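(* Let $p,q\in\mathbb{Z}_{\ge 0}$, $f\in\Lambda_p$ and $g\in\Lambda_q$. Then $$J_p(f)\,J_q(g)=\sum_{r=0}^{\min(p,q)} r!\binom{p}{r}\binom{q}{r}\,J_{p+q-2r}\big(f\,\hat{\wedge}_r\, g\big),$$ where $f\hat\wedge_r g\in\Lambda_{p+q-2r}$ denotes the anti-symmetrization of $$(f\wedge_r g)(t_1,\dots,t_{p+q-2r})=\int_{\mathbb{R}_+^r} f(t_1,\dots,t_{p-r},s_r,s_{r-1},\dots,s_1)\,g(s_1,\dots,s_r,t_{p-r+1},\dots,t_{p+q-2r})\,ds_1\cdots ds_r .$$
   Context: $L^2(\mathbb{R}_+)$ is the complex $L^2$ space for Lebesgue measure (inner products linear in the second variable), with complex conjugation $J$. For $h\in L^2(\mathbb{R}_+^n)$ its anti-symmetrization is $\hat h(t_1,\dots,t_n)=\frac1{n!}\sum_{\sigma\in S_n}\mathrm{sgn}(\sigma)h(t_{\sigma(1)},\dots,t_{\sigma(n)})$. $\Lambda_n$ is the space of anti-symmetric functions in $L^2(\mathbb{R}_+^n)$ with inner product $\langle f,g\rangle_{\Lambda_n}=n!\int\overline{f}g\,d\mathbf{x}$, and $\Lambda_0=\mathbb{C}$. $\Gamma_a=\bigoplus_{n\ge0}\Lambda_n$ is the anti-symmetric Fock space (Hilbert direct sum) with vacuum vector $\Omega=1\in\Lambda_0$. For $z\in L^2(\mathbb{R}_+)$, $b^*(z)$ is the bounded operator with $b^*(z)w=\widehat{z\otimes w}$ for $w\in\Lambda_n$, $b(z)$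 is its adjoint, and $\Psi(z)=b^*(z)+b(Jz)$. $\mathcal{C}$ is the von Neumann algebra generated by $\{\Psi(z)\}$, and $m(u)=\langle\Omega,u\Omega\rangle$ is a faithful normal tracial state on it. $L^p(\mathcal{C})$ is the associated noncommutative $L^p$ space (norm $m(|u|^p)^{1/p}$); products of its elements are taken as $m$-measurable operators affiliated with $\mathcal{C}$. The map $u\mapsto u\Omega$ extends to a unitary $L^2(\mathcal{C})\to\Gamma_a$, and for $f\in\Lambda_n$, $J_n(f)\in L^2(\mathcal{C})$ denotes the element mapped to $f$ by this unitary. *)

(* Defs.v *)
From HB Require Import structures.
From mathcomp Require Import all_boot all_order all_algebra all_fingroup.
From mathcomp Require Import generic_quotient ring_quotient.
From mathcomp Require Import all_classical all_reals all_analysis measurable_realfun.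
From mathcomp Require Import complex ring lra.

Set Implicit Arguments.
Unset Strict Implicit.
Unset Printing Implicit Defensive.
Import Order.TTheory GRing.Theory Num.Theory.
Import numFieldNormedType.Exports.
Local Open Scope classical_set_scope.
Local Open Scope ring_scope.

(* Lebesgue measure on R_+^n, realized as a measure on all n-tuples of reals
   that does not charge the complement of R_+^n; hence functions on R_+^n up
   to null sets are functions on n-tuples up to [muplus n]-null sets. *)

Section muplus.
Variable R : realType.

Definition mu1 : set R -> \bar R :=
  fun A => lebesgue_measure (A `&` `[0, +oo[).

Let mR := mrestr (@lebesgue_measure R) (measurable_itv `[0, +oo[).

Let mu1_0 : mu1 set0 = 0%E. Proof. exact: (measure0 mR). Qed.

Let mu1_ge0 A : (0 <= mu1 A)%E. Proof. exact: (measure_ge0 mR). Qed.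

Let mu1_sigma_additive : semi_sigma_additive mu1.
Proof. exact: (@measure_semi_sigma_additive _ _ _ mR). Qed.

HB.instance Definition _ :=
  isMeasure.Build _ _ _ mu1 mu1_0 mu1_ge0 mu1_sigma_additive.

Let mu1_sigma_finite : sigma_finite setT mu1.
Proof.
have [F FT Foo] := sigma_finiteT (@lebesgue_measure R).
exists F => // k; have [mF lF] := Foo k; split => //.
apply: le_lt_trans lF; apply: le_measure; rewrite ?inE//.
by apply: measurableI => //; exact: measurable_itv.
Qed.

HB.instance Definition _ :=
  Measure_isSigmaFinite.Build _ _ _ mu1 mu1_sigma_finite.

Definition cons_pair n (u : R * n.-tuple R) : n.+1.-tuple R :=
  [tuple of u.1 :: u.2].

Lemma measurable_cons_pair n : measurable_fun setT (@cons_pair n).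
Proof. exact: measurable_cons measurable_fst measurable_snd. Qed.

Definition muS n (m : {sigma_finite_measure set (n.-tuple R) -> \bar R}) :
  set (n.+1.-tuple R) -> \bar R := pushforward (mu1 \x m)%E (@cons_pair n).

Section muS.
Variables (n : nat) (m : {sigma_finite_measure set (n.-tuple R) -> \bar R}).

Let muS0 : muS m set0 = 0%E.
Proof. by rewrite /muS /pushforward preimage_set0 measure0. Qed.

Let muS_ge0 A : (0 <= muS m A)%E.
Proof. by rewrite /muS /pushforward; exact: measure_ge0. Qed.

Let muS_sigma_additive : semi_sigma_additive (muS m).
Proof.
move=> F mF tF mUF; rewrite /muS /pushforward preimage_bigcup.
have mc := @measurable_cons_pair n.
apply: measure_semi_sigma_additive.
- by move=> k; rewrite -[X in measurable X]setTI; exact: mc.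
- apply/trivIsetP => /= i j _ _ ij; rewrite -preimage_setI.
  by move/trivIsetP : tF => /(_ _ _ _ _ ij) ->//; rewrite preimage_set0.
- by rewrite -preimage_bigcup -[X in measurable X]setTI; exact: mc.
Qed.

HB.instance Definition _ :=
  isMeasure.Build _ _ _ (muS m) muS0 muS_ge0 muS_sigma_additive.

Let muS_sigma_finite : sigma_finite setT (muS m).
Proof.
have /sigma_finiteP[F [TF ndF Foo]] := sigma_finiteT mu1.
have /sigma_finiteP[G [TG ndG Goo]] := sigma_finiteT m.
pose h (t : n.+1.-tuple R) : R * n.-tuple R := (thead t, [tuple of behead t]).
have Kh : h \o @cons_pair n = id.
  by apply/funext => -[x t]; congr pair; apply: val_inj.
have mh : measurable_fun setT h.
  apply/measurable_fun_pairP; split; first exact: measurable_tnth.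
  exact: measurable_behead.
exists (fun k => h @^-1` (F k `*` G k)).
  apply/esym/seteqP; split=> // t _.
  have : (\bigcup_k F k) (h t).1 by rewrite -TF.
  have : (\bigcup_k G k) (h t).2 by rewrite -TG.
  move=> [j _ Gj] [i _ Fi]; exists (maxn i j) => //; split.
    by move: Fi; exact/subsetPset/ndF/leq_maxl.
  by move: Gj; exact/subsetPset/ndG/leq_maxr.
move=> k; have [mF lF] := Foo k; have [mG lG] := Goo k; split.
  rewrite -[X in measurable X]setTI; apply: mh => //; exact: measurableX.
rewrite /muS /pushforward -comp_preimage Kh preimage_id.
by rewrite product_measure1E// lte_mul_pinfty// ge0_fin_numE.
Qed.

HB.instance Definition _ :=
  Measure_isSigmaFinite.Build _ _ _ (muS m) muS_sigma_finite.
End muS.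

Fixpoint muplus n : {sigma_finite_measure set (n.-tuple R) -> \bar R} :=
  if n is k.+1 then muS (muplus k) else \d_([tuple] : 0.-tuple R).

End muplus.

Section L2.
Variable R : realType.
Local Notation C := R[i].

Definition normsq (z : C) : R := complex.Re z ^+ 2 + complex.Im z ^+ 2.

Definition cintegral n (f : n.-tuple R -> C) : C :=
  Complex (\int[muplus R n]_t complex.Re (f t)) (\int[muplus R n]_t complex.Im (f t)).

Definition L2norm2 n (f : n.-tuple R -> C) : \bar R :=
  (\int[muplus R n]_t (normsq (f t))%:E)%E.

Definition L2 n (f : n.-tuple R -> C) : Prop :=
  [/\ measurable_fun setT (fun t => complex.Re (f t)),
      measurable_fun setT (fun t => complex.Im (f t)) & (L2norm2 f < +oo)%E].

Definition permute_tuple n (s : 'S_n) (t : n.-tuple R) : n.-tuple R :=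
  [tuple tnth t (s i) | i < n].

Definition antisymmetric n (f : n.-tuple R -> C) : Prop :=
  forall s : 'S_n,
    {ae muplus R n, forall t, f (permute_tuple s t) = (-1) ^+ s * f t}.

(* representatives of the elements of Lambda_n *)
Definition Lambda n (f : n.-tuple R -> C) : Prop := L2 f /\ antisymmetric f.

Definition antisymmetrize n (h : n.-tuple R -> C) : n.-tuple R -> C :=
  fun t => (n`!%:R)^-1 * \sum_(s : 'S_n) (-1) ^+ s * h (permute_tuple s t).

(* the n-tuple with the same entries as s, for s of size n *)
Definition tuple_of_seq n (s : seq R) : n.-tuple R :=
  [tuple nth 0 s i | i < n].

Definition tensor p q (f : p.-tuple R -> C) (g : q.-tuple R -> C) :
    (p + q).-tuple R -> C :=
  fun t => f (tuple_of_seq p (take p t)) * g (tuple_of_seq q (drop p t)).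

(* meaningful for r <= minn p q *)
Definition contraction p q r (f : p.-tuple R -> C) (g : q.-tuple R -> C) :
    (p + q - r.*2).-tuple R -> C :=
  fun t => cintegral (fun s : r.-tuple R =>
    f (tuple_of_seq p (take (p - r) t ++ rev s)) *
    g (tuple_of_seq q (s ++ drop (p - r) t))).

End L2.
Arguments contraction {R p q} r f g.

(* The Fock space. A family (x_n)_n of functions is one function on the
   disjoint union of the R^n; vectors are square-summable families modulo
   equality almost everywhere. *)

Section fock.
Local Open Scope quotient_scope.
Variable R : realType.
Local Notation C := R[i].
Local Notation family := ({n : nat & n.-tuple R} -> C).

Definition component (x : family) n : n.-tuple R -> C :=
  fun t => x (existT _ n t).
Arguments component : clear implicits.

Definition in_fock (x : family) : Prop :=
  (forall n, Lambda (component x n)) /\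
  (\sum_(0 <= n <oo) (n`!%:R)%:E * L2norm2 (component x n) < +oo)%E.

Definition fock_pred : {pred family} := [pred x | `[< in_fock x >]].

Let normsqD (z w : C) : normsq (z + w) <= 2 * normsq z + 2 * normsq w.
Proof.
case: z w => [a b] [c d]; rewrite /normsq /=.
by have := sqr_ge0 (a - c); have := sqr_ge0 (b - d); lra.
Qed.

Let normsqM (z w : C) : normsq (z * w) = normsq z * normsq w.
Proof. by case: z w => [a b] [c d]; rewrite /normsq /=; ring. Qed.

Let componentE a (x y : family) n t :
  component (a *: x + y) n t = a * component x n t + component y n t.
Proof. by []. Qed.

Let ReE (a z w : C) : complex.Re (a * z + w) =
  complex.Re a * complex.Re z - complex.Im a * complex.Im z + complex.Re w.
Proof. by case: a z w => [? ?] [? ?] [? ?]. Qed.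

Let ImE (a z w : C) : complex.Im (a * z + w) =
  complex.Re a * complex.Im z + complex.Im a * complex.Re z + complex.Im w.
Proof. by case: a z w => [? ?] [? ?] [? ?]. Qed.

Let normsq_ge0 z : (0 <= (normsq z)%:E :> \bar R)%E.
Proof. by rewrite lee_fin addr_ge0 ?sqr_ge0. Qed.

Let measurable_normsq n (f : n.-tuple R -> C) :
  measurable_fun setT (fun t => complex.Re (f t)) ->
  measurable_fun setT (fun t => complex.Im (f t)) ->
  measurable_fun setT (EFin \o (fun t => normsq (f t))).
Proof.
move=> mr mi; apply/measurable_EFinP.
by apply: measurable_funD; exact: measurable_funX.
Qed.

Let measurable_lin n a (f g : n.-tuple R -> C) : L2 f -> L2 g ->
  measurable_fun setT (fun t => complex.Re (a * f t + g t)) /\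
  measurable_fun setT (fun t => complex.Im (a * f t + g t)).
Proof.
move=> [fr fi _] [gr gi _]; split.
  under eq_fun do rewrite ReE.
  apply: measurable_funD => //; apply: measurable_funB => //;
    exact: measurable_funM.
under eq_fun do rewrite ImE.
apply: measurable_funD => //; apply: measurable_funD => //;
  exact: measurable_funM.
Qed.

Let L2norm2D n a (f g : n.-tuple R -> C) : L2 f -> L2 g ->
  (L2norm2 (fun t => a * f t + g t)%R
   <= (2 * normsq a)%:E * L2norm2 f + 2%:E * L2norm2 g)%E.
Proof.
move=> Lf Lg; have [mr mi] := measurable_lin a Lf Lg.
have mfg := measurable_normsq mr mi.
have [fr fi _] := Lf; have mf := measurable_normsq fr fi.
have [gr gi _] := Lg; have mg := measurable_normsq gr gi.
have ca : (0 <= (2 * normsq a)%:E :> \bar R)%E.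
  by rewrite lee_fin mulr_ge0 ?addr_ge0 ?sqr_ge0.
rewrite /L2norm2 -ge0_integralZl// -ge0_integralZl//.
have hf t : setT t -> (0 <= (2 * normsq a)%:E * (normsq (f t))%:E)%E.
  by move=> _; exact: mule_ge0.
have hg t : setT t -> (0 <= 2%:E * (normsq (g t))%:E)%E.
  by move=> _; exact: mule_ge0.
have mf' := measurable_funeM (2 * normsq a)%:E mf.
have mg' := measurable_funeM 2%:E mg.
rewrite -ge0_integralD//.
apply: ge0_le_integral.
- exact: measurableT.
- by move=> t _; exact: normsq_ge0.
- exact: mfg.
- by apply: emeasurable_funD; [exact: mf' | exact: mg'].
- move=> t _; rewrite -!EFinM -EFinD lee_fin.
  by rewrite (le_trans (normsqD _ _))// normsqM mulrA.
Qed.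

Let L2norm2_ge0 n (f : n.-tuple R -> C) : (0 <= L2norm2 f)%E.
Proof. exact: integral_ge0. Qed.

Let L2norm2_0 n : L2norm2 (component 0 n) = 0%E.
Proof.
rewrite /L2norm2; under eq_integral => t _ do
  rewrite /component /normsq /= expr0n /= addr0.
exact: integral0.
Qed.

Let fock_submod : submod_closed fock_pred.
Proof.
split.
  apply/asboolP; split=> [n|].
    split; first by split; rewrite ?L2norm2_0//; exact: measurable_cst.
    by move=> s; apply: nearW => t; rewrite /component /= mulr0.
  by rewrite eseries0// => n _ _; rewrite L2norm2_0 mule0.
move=> a x y /asboolP[Lx sx] /asboolP[Ly sy].
apply/asboolP; split=> [n|].
  have [L2x xa] := Lx n; have [L2y ya] := Ly n.
  have [mr mi] := measurable_lin a L2x L2y.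
  split; last first.
    move=> s; move: (xa s) (ya s); apply: filterS2 => t xE yE.
    by rewrite !componentE xE yE mulrDr mulrCA.
  split => //.
  apply: (le_lt_trans (L2norm2D a L2x L2y)).
  have [_ _ xf] := L2x; have [_ _ yf] := L2y.
  by rewrite lte_add_pinfty// lte_mul_pinfty// lee_fin mulr_ge0 ?addr_ge0 ?sqr_ge0.
pose S z : \bar R := (\sum_(0 <= n <oo) (n`!%:R)%:E * L2norm2 (component z n))%E.
have ge0 z n : (0 <= (n`!%:R)%:E * L2norm2 (component z n))%E.
  by rewrite mule_ge0// lee_fin.
have ca : (0 <= (2 * normsq a)%:E :> \bar R)%E.
  by rewrite lee_fin mulr_ge0 ?addr_ge0 ?sqr_ge0.
apply: (@le_lt_trans _ _ ((2 * normsq a)%:E * S x + 2%:E * S y)%E).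
  rewrite /S -nneseriesZl// -nneseriesZl// -nneseriesD//; last 2 first.
  - by move=> n _ _; rewrite mule_ge0.
  - by move=> n _ _; rewrite mule_ge0.
  apply: lee_nneseries => [n _ _|n _].
    by rewrite mule_ge0// lee_fin.
  have [L2x _] := Lx n; have [L2y _] := Ly n.
  apply: (le_trans (lee_wpmul2l _ (L2norm2D a L2x L2y))); first by rewrite lee_fin.
  rewrite ge0_muleDr ?mule_ge0//.
  by rewrite !muleA (muleC _ (2 * _)%:E) (muleC _ 2%:E).
by rewrite lte_add_pinfty// lte_mul_pinfty.
Qed.

HB.instance Definition _ :=
  GRing.isSubmodClosed.Build _ _ fock_pred fock_submod.

Record prefock :=
  Prefock { prefock_val :> family ; _ : prefock_val \in fock_pred }.
HB.instance Definition _ := [isSub for prefock_val].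
HB.instance Definition _ := [Choice of prefock by <:].
HB.instance Definition _ := [SubChoice_isSubLmodule of prefock by <:].

Definition null_prefock : {pred prefock} :=
  [pred x : prefock |
    `[< forall n, {ae muplus R n, forall t, component x n t = 0} >]].

Let null_submod : submod_closed null_prefock.
Proof.
split; first by apply/asboolP => n; apply: nearW.
move=> a x y /asboolP x0 /asboolP y0; apply/asboolP => n.
move: (x0 n) (y0 n); apply: filterS2 => t xE yE.
by rewrite componentE xE yE mulr0 addr0.
Qed.

HB.instance Definition _ :=
  GRing.isSubmodClosed.Build _ _ null_prefock null_submod.

Definition fock : Type := Quotient.quot null_prefock.
HB.instance Definition _ := GRing.Zmodule.on fock.
HB.instance Definition _ := EqQuotient.on fock.

Definition to_fock (x : prefock) : fock := \pi x.
Definition fock_rep (u : fock) : prefock := repr u.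

Lemma fock_repK u : to_fock (fock_rep u) = u.
Proof. exact: reprK. Qed.

Lemma to_fockP (x y : prefock) :
  to_fock x = to_fock y <-> x - y \in null_prefock.
Proof.
split=> [/eqP|xy]; first by rewrite -Quotient.idealrBE.
by apply/eqP; rewrite -Quotient.idealrBE.
Qed.

Lemma to_fockD (x y : prefock) : to_fock (x + y) = to_fock x + to_fock y.
Proof. exact: (Quotient.pi_add null_prefock). Qed.

Definition fock_scale (a : C) (u : fock) : fock := to_fock (a *: fock_rep u).

Lemma fock_scaleE a x : fock_scale a (to_fock x) = to_fock (a *: x).
Proof.
apply/to_fockP; rewrite -scalerBr rpredZ//.
by apply/to_fockP; rewrite fock_repK.
Qed.

Let fock_scaleA a b u : fock_scale a (fock_scale b u) = fock_scale (a * b) u.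
Proof. by rewrite -[u]fock_repK (fock_scaleE b) !fock_scaleE scalerA. Qed.

Let fock_scale1 : left_id 1 fock_scale.
Proof. by move=> u; rewrite -[u]fock_repK fock_scaleE scale1r. Qed.

Let fock_scaleDr : right_distributive fock_scale +%R.
Proof.
move=> a u v; rewrite -[u]fock_repK -[v]fock_repK -to_fockD !fock_scaleE.
by rewrite scalerDr to_fockD.
Qed.

Let fock_scaleDl u : {morph fock_scale^~ u : a b / a + b}.
Proof.
by move=> a b; rewrite -[u]fock_repK !fock_scaleE -to_fockD scalerDl.
Qed.

HB.instance Definition _ := GRing.Zmodule_isLmodule.Build C fock
  fock_scaleA fock_scale1 fock_scaleDr fock_scaleDl.

End fock.
Arguments component {R} x n t.

Section fock_structure.
Variable R : realType.
Local Notation C := R[i].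

(* <u, v> = \sum_n n! \int conj(u_n) v_n, summed in real and imaginary parts *)
Definition fock_ip (u v : fock R) : C :=
  let F n := n`!%:R * cintegral (fun t : n.-tuple R =>
    (component (fock_rep u) n t)^*%C * component (fock_rep v) n t) in
  Complex (limn (series (fun n => complex.Re (F n))))
          (limn (series (fun n => complex.Im (F n)))).

(* the family with f in degree n and 0 in the other degrees *)
Definition single n (f : n.-tuple R -> C) : {k : nat & k.-tuple R} -> C :=
  fun u => if insub (val (tagged u)) is Some t then f t else 0.

(* the inclusion of Lambda_n into the Fock space; only used for f satisfying
   [Lambda] (it sends every other f to 0) *)
Definition embed n (f : n.-tuple R -> C) : fock R :=
  to_fock (insubd 0 (single f)).

Definition vacuum : fock R := embed (fun _ : 0.-tuple R => 1).

End fock_structure.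

Section operators.
Variables (R : realType) (H : lmodType R[i]) (ip : H -> H -> R[i]).
Local Notation C := R[i].
Implicit Types (A B : H -> H) (S : set (H -> H)).

Definition hnorm (x : H) : R := Num.sqrt (complex.Re (ip x x)).

Definition bounded_op B : Prop :=
  (forall (a : C) (x y : H), B (a *: x + y) = a *: B x + B y) /\
  exists M : R, forall x, hnorm (B x) <= M * hnorm x.

Definition is_adjoint B B' : Prop := forall x y, ip x (B y) = ip (B' x) y.

Definition commutant S : set (H -> H) :=
  [set B | bounded_op B /\ forall A, S A -> A \o B = B \o A].

(* the von Neumann algebra generated by S, by the bicommutant theorem *)
Definition vN_algebra S : set (H -> H) :=
  commutant (commutant
    (S `|` [set A' | bounded_op A' /\ exists2 A, S A & is_adjoint A A'])).

(* Unbounded operators are identified with their graphs. *)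
Implicit Types T U : set (H * H).

Definition graph B : set (H * H) := [set p | p.2 = B p.1].

Definition dom T : set H := [set x | exists y, T (x, y)].

Definition linear_graph T : Prop :=
  [/\ T (0, 0),
      forall (a : C) x x' y y',
        T (x, y) -> T (x', y') -> T (a *: x + x', a *: y + y') &
      forall y, T (0, y) -> y = 0].

Definition graph_closure T : set (H * H) :=
  [set p | forall e : R, 0 < e ->
    exists2 q, T q & hnorm (p.1 - q.1) < e /\ hnorm (p.2 - q.2) < e].

Definition closed_graph T : Prop := graph_closure T `<=` T.

Definition densely_defined T : Prop :=
  forall x (e : R), 0 < e -> exists2 y, dom T y & hnorm (x - y) < e.

Definition graph_add T U : set (H * H) :=
  [set p | exists y z, [/\ T (p.1, y), U (p.1, z) & p.2 = y + z]].

Definition graph_comp T U : set (H * H) :=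
  [set p | exists2 y, U (p.1, y) & T (y, p.2)].

Definition graph_scale (c : C) T : set (H * H) :=
  [set p | exists2 y, T (p.1, y) & p.2 = c *: y].

Definition graph_adjoint T : set (H * H) :=
  [set p | forall x y, T (x, y) -> ip p.1 y = ip p.2 x].

(* sum and product in the *-algebra of measurable operators: closures of the
   algebraic sum and of the composition *)
Definition strong_add T U := graph_closure (graph_add T U).
Definition strong_mul T U := graph_closure (graph_comp T U).

(* N is a von Neumann algebra and Om the vector defining its trace
   m(u) = <Om, u Om>. *)
Variables (N : set (H -> H)) (Om : H).

Definition trace B : C := ip Om (B Om).

Definition projection B : Prop := [/\ N B, B \o B = B & is_adjoint B B].

Definition affiliated T : Prop :=
  forall B, commutant N B -> forall x y, T (x, y) -> T (B x, B y).

Definition measurable_op T : Prop :=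
  [/\ linear_graph T, closed_graph T, densely_defined T, affiliated T &
      forall e : R, 0 < e -> exists E, [/\ projection E, range E `<=` dom T &
        complex.Re (trace (fun x => x - E x)) <= e]].

(* the extension of the trace to positive operators affiliated with N:
   m(T) = sup { m(a) | a in N, 0 <= a <= T } *)
Definition trace_ext T : \bar R :=
  ereal_sup [set (complex.Re (trace a))%:E | a in
    [set a | [/\ N a, forall x, 0 <= ip x (a x) &
                 forall x y, T (x, y) -> ip x (a x) <= ip x y]]].

(* m(|T|^2), where |T|^2 = T^* T *)
Definition L2_norm2 T : \bar R :=
  trace_ext (graph_comp (graph_adjoint T) T).

Definition in_L2 T : Prop := measurable_op T /\ (L2_norm2 T < +oo)%E.

(* the graph of the continuous extension to L^2(N) of u |-> u Om, u in N *)
Definition L2_image T (x : H) : Prop :=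
  in_L2 T /\ exists u : nat -> H -> H,
    [/\ forall k, N (u k),
        L2_norm2 (strong_add T (graph (fun x => - u k x)))
          @[k --> \oo] --> (0 : \bar R) &
        hnorm (u k Om - x) @[k --> \oo] --> (0 : R)].

End operators.

Section clifford.
Variable R : realType.
Local Notation C := R[i].
Local Notation ip := (@fock_ip R).

(* B = b^*(z); elements of L^2(R_+) are functions of 1-tuples. B is determined
   by its values on the Lambda_n, whose span is dense. *)
Definition creation (z : 1.-tuple R -> C) (B : fock R -> fock R) : Prop :=
  bounded_op ip B /\ forall n (w : n.-tuple R -> C), Lambda w ->
    B (embed w) = embed (antisymmetrize (tensor z w)).

(* B = Psi(z) = b^*(z) + b(J z) *)
Definition field_op (z : 1.-tuple R -> C) (B : fock R -> fock R) : Prop :=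
  exists B1 B2 B2', [/\ creation z B1, creation (fun t => (z t)^*%C) B2,
    bounded_op ip B2', is_adjoint ip B2 B2' & B = (fun x => B1 x + B2' x)].

Definition clifford : set (fock R -> fock R) :=
  vN_algebra ip [set B | exists2 z, L2 z & field_op z B].

(* J_n(f), the element of L^2(clifford) with image f in the Fock space; it
   exists and is unique, by unitarity of L^2(clifford) -> fock R, so the
   default value set0 (the graph of no operator) is never used *)
Definition chaos n (f : n.-tuple R -> C) : set (fock R * fock R) :=
  xget set0 [set T | L2_image ip clifford (vacuum R) T (embed f)].

(* f hat-wedge_r g *)
Definition hat_contraction p q r (f : p.-tuple R -> C) (g : q.-tuple R -> C) :
    (p + q - r.*2).-tuple R -> C :=
  antisymmetrize (contraction r f g).
Arguments hat_contraction {p q} r f g.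

Definition clifford_add := @strong_add R (fock R) ip.
Definition clifford_mul := @strong_mul R (fock R) ip.
Definition clifford_zero : set (fock R * fock R) := graph (fun _ => 0).

End clifford.
Arguments hat_contraction {R p q} r f g.

(* Main.v *)
(* The formula is turned into an identity between vectors of the Fock space H.
   Let N be the Clifford algebra, N' its commutant, Omega the vacuum, and let J
   be the modular conjugation, given on degree n by (-1)^(n(n-1)/2) times
   complex conjugation. For x in H let T_x be the set of the pairs (y, h) such that
   <h, w Omega> = <y, w (J x)> for all w in N'. Since the trace is finite, a closed
   densely defined operator affiliated with N has no proper extension of the same
   kind; hence J_p(f) = T_f, the closure of T_x + T_y is T_(x + y), and the closure
   of T_x T_y is T_h as soon as (y, h) is in T_x and (J x, k) is in T_(J y) for some k.
   It remains to see that (g, Phi(f, g)) is in T_f, where Phi(f, g) is the sum of the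
   r! C(p, r) C(q, r) times f hat-wedge_r g. For bounded f and g with bounded support
   this follows by induction on the degree of g from
   Phi(f, Psi(z) g) = Phi(f Psi(z), g), where f Psi(z) = J Psi(conj z) J f; splitting
   off one variable of each contraction proves this identity by induction on r.
   Boundedness of the bilinear map Phi gives the general case. *)
Require Import Defs.
From HB Require Import structures.
From mathcomp Require Import all_boot all_order all_algebra all_fingroup.
From mathcomp Require Import all_classical all_reals all_analysis measurable_realfun.
From mathcomp Require Import complex zify ring lra.
Set Implicit Arguments.
Unset Strict Implicit.
Unset Printing Implicit Defensive.
Import Order.TTheory GRing.Theory Num.Theory.
Import numFieldNormedType.Exports.
Local Open Scope classical_set_scope.
Local Open Scope ring_scope.

(** * Hilbert spaces and bounded operators *)

(** No spectral theorem is used. A closed densely defined affiliated operator is studied through the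
    orthogonal projection onto its graph, a 2 by 2 matrix over N: the traces of the two diagonal
    corners always add up to the trace of 1, which is why proper extensions are impossible. The
    corner (1 + c^2 T^* T)^-1 of the projection for c T replaces functional calculus: it computes
    the L^2 norm and yields the small projections asked for by measurability. The commutant is not
    computed. Right multiplication by a field is the left one with its creator twisted by (-1)^n in
    degree n; the two kinds commute, J exchanges them, and words of either kind applied to the
    vacuum are total. This suffices for the trace property. The reversed kernel s_r, ..., s_1 lets
    the pair (last variable of f, first variable of g) be removed without sign. In a contraction of
    order r with z wedge g, g of degree q, the factor z is contracted with weight r/(q+1) and free
    with weight (q+1-r)/(q+1); r! C(p,r) C(q,r) is what turns these weights into p times the
    coefficient for (p-1, q, r-1) and into the one for (p, q, r). *)

Section complex_facts.
Variable R : realType.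
Implicit Types z w : R[i].
Local Notation Re := complex.Re.
Local Notation Im := complex.Im.

Lemma ReD z w : Re (z + w) = Re z + Re w. Proof. by case: z w => [? ?] [? ?]. Qed.
Lemma ImD z w : Im (z + w) = Im z + Im w. Proof. by case: z w => [? ?] [? ?]. Qed.
Lemma ReN z : Re (- z) = - Re z. Proof. by case: z. Qed.
Lemma ImN z : Im (- z) = - Im z. Proof. by case: z. Qed.
Lemma ReB z w : Re (z - w) = Re z - Re w. Proof. by rewrite ReD ReN. Qed.
Lemma ImB z w : Im (z - w) = Im z - Im w. Proof. by rewrite ImD ImN. Qed.
Lemma ReM z w : Re (z * w) = Re z * Re w - Im z * Im w.
Proof. by case: z w => [? ?] [? ?]. Qed.
Lemma ImM z w : Im (z * w) = Re z * Im w + Im z * Re w.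
Proof. by case: z w => [? ?] [? ?]. Qed.
Lemma ReJ z : Re z^*%C = Re z. Proof. by case: z. Qed.
Lemma ImJ z : Im z^*%C = - Im z. Proof. by case: z. Qed.
Lemma eqC z w : Re z = Re w -> Im z = Im w -> z = w.
Proof. by case: z w => [? ?] [? ?] /= -> ->. Qed.
Lemma conjc1 : (1 : R[i])^*%C = 1.
Proof. by apply: eqC => //=; rewrite oppr0. Qed.
Lemma conjcD z w : (z + w)^*%C = z^*%C + w^*%C.
Proof. by apply: eqC; rewrite ?(ReD, ImD, ReJ, ImJ)// opprD. Qed.
Lemma conjcN z : (- z)^*%C = - z^*%C.
Proof. by apply: eqC; rewrite ?(ReN, ImN, ReJ, ImJ). Qed.
Lemma conjcM z w : (z * w)^*%C = z^*%C * w^*%C.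
Proof. by apply: eqC; rewrite ?(ReM, ImM, ReJ, ImJ); ring. Qed.
Lemma ReMr (a : R) z : Re (a%:C%C * z) = a * Re z.
Proof. by rewrite ReM /= mul0r subr0. Qed.
Lemma normsq_ge0 z : 0 <= normsq z.
Proof. by rewrite /normsq addr_ge0 ?sqr_ge0. Qed.
Lemma normsqM z w : normsq (z * w) = normsq z * normsq w.
Proof. by case: z w => [a b] [c d]; rewrite /normsq /=; ring. Qed.
Lemma normsqJ z : normsq z^*%C = normsq z.
Proof. by rewrite /normsq ReJ ImJ sqrrN. Qed.
Lemma normsqN z : normsq (- z) = normsq z.
Proof. by rewrite /normsq ReN ImN !sqrrN. Qed.
Lemma normsq_real (a : R) : normsq a%:C%C = a ^+ 2.
Proof. by rewrite /normsq /= expr0n /= addr0. Qed.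
Lemma normsq_eq0 z : normsq z = 0 -> z = 0.
Proof.
move/eqP; rewrite /normsq paddr_eq0 ?sqr_ge0// !sqrf_eq0 => /andP[/eqP a /eqP b].
by apply: eqC.
Qed.
Lemma conjc_normsq z : z^*%C * z = (normsq z)%:C%C.
Proof. by apply: eqC; rewrite ?(ReM, ImM, ReJ, ImJ) /normsq /=; ring. Qed.
Lemma natrC (n : nat) : n%:R = ((n%:R : R)%:C)%C :> R[i].
Proof. by rewrite rmorph_nat. Qed.

End complex_facts.

Section hilbert_space.
Variables (R : realType) (H : lmodType R[i]) (ip : H -> H -> R[i]).
Local Notation C := R[i].
Local Notation Re := complex.Re.
Local Notation Im := complex.Im.
Local Notation nrm := (hnorm ip).
Implicit Types (x y z : H) (u v : nat -> H) (a : C) (K : set H).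

Definition tends u x : Prop := nrm (u n - x) @[n --> \oo] --> (0 : R).

Definition cauchy_seq u : Prop := forall e : R, 0 < e ->
  exists N, forall m n, (N <= m)%N -> (N <= n)%N -> nrm (u m - u n) < e.

(** Positivity and definiteness are stated for the real part because [hnorm] is defined through it;
    that [ip x x] is real follows from the symmetry, see [ipxx]. *)
Record hilbert : Prop := Hilbert {
  hilbert_lin : forall x a y z, ip x (a *: y + z) = a * ip x y + ip x z;
  hilbert_sym : forall x y, ip y x = (ip x y)^*%C;
  hilbert_ge0 : forall x, 0 <= Re (ip x x);
  hilbert_eq0 : forall x, Re (ip x x) = 0 -> x = 0;
  hilbert_complete : forall u, cauchy_seq u -> exists x, tends u x }.

Variable hH : hilbert.
Let ipP := hilbert_lin hH.
Let ipC := hilbert_sym hH.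

Definition nsq x : R := Re (ip x x).

Lemma nsqE x : nsq x = Re (ip x x). Proof. by []. Qed.
Lemma ip0r x : ip x 0 = 0.
Proof. by have := ipP x (-1) 0 0; rewrite scaler0 addr0 mulN1r addNr. Qed.
Lemma ipZr x a y : ip x (a *: y) = a * ip x y.
Proof. by have := ipP x a y 0; rewrite addr0 ip0r addr0. Qed.
Lemma ipDr x y z : ip x (y + z) = ip x y + ip x z.
Proof. by have := ipP x 1 y z; rewrite scale1r mul1r. Qed.
Lemma ipNr x y : ip x (- y) = - ip x y.
Proof. by rewrite -scaleN1r ipZr mulN1r. Qed.
Lemma ipBr x y z : ip x (y - z) = ip x y - ip x z.
Proof. by rewrite ipDr ipNr. Qed.
Lemma ip0l x : ip 0 x = 0. Proof. by rewrite ipC ip0r conjc0. Qed.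
Lemma ipZl x a y : ip (a *: x) y = a^*%C * ip x y.
Proof. by rewrite ipC ipZr conjcM -ipC. Qed.
Lemma ipDl x y z : ip (x + y) z = ip x z + ip y z.
Proof. by rewrite ipC ipDr conjcD -!ipC. Qed.
Lemma ipNl x y : ip (- x) y = - ip x y.
Proof. by rewrite ipC ipNr conjcN -ipC. Qed.
Lemma ipBl x y z : ip (x - y) z = ip x z - ip y z.
Proof. by rewrite ipDl ipNl. Qed.
Lemma ReipC x y : Re (ip x y) = Re (ip y x).
Proof. by rewrite ipC ReJ. Qed.
Lemma ipxx x : ip x x = (nsq x)%:C%C.
Proof.
apply: eqC => //=; have := congr1 (@complex.Im _) (ipC x x); rewrite ImJ => h.
by move: h; lra.
Qed.
Lemma nsq_ge0 x : 0 <= nsq x. Proof. exact: hilbert_ge0. Qed.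
Lemma nsq0 : nsq 0 = 0. Proof. by rewrite /nsq ip0r. Qed.
Lemma nsq_eq0 x : nsq x = 0 -> x = 0. Proof. exact: hilbert_eq0. Qed.
Lemma nsqD x y : nsq (x + y) = nsq x + nsq y + 2 * Re (ip x y).
Proof. by rewrite /nsq ipDl !ipDr !ReD (ReipC y x); ring. Qed.
Lemma nsqN x : nsq (- x) = nsq x.
Proof. by rewrite /nsq ipNl ipNr opprK. Qed.
Lemma nsqB x y : nsq (x - y) = nsq x + nsq y - 2 * Re (ip x y).
Proof. by rewrite nsqD nsqN ipNr ReN; ring. Qed.
Lemma nsqZ a x : nsq (a *: x) = normsq a * nsq x.
Proof. by rewrite /nsq ipZl ipZr mulrA conjc_normsq ReMr. Qed.
Lemma nrmE x : nrm x ^+ 2 = nsq x.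
Proof. by rewrite /hnorm sqr_sqrtr// nsq_ge0. Qed.
Lemma nrm_ge0 x : 0 <= nrm x. Proof. exact: sqrtr_ge0. Qed.
Lemma nrm0 : nrm 0 = 0. Proof. by rewrite /hnorm -/(nsq 0) nsq0 sqrtr0. Qed.
Lemma nrm_eq0 x : nrm x = 0 -> x = 0.
Proof. by move=> h; apply: nsq_eq0; rewrite -nrmE h expr0n. Qed.
Lemma nrmN x : nrm (- x) = nrm x.
Proof. by rewrite /hnorm -!/(nsq _) nsqN. Qed.
Lemma nrmBC x y : nrm (x - y) = nrm (y - x).
Proof. by rewrite -nrmN opprB. Qed.
Lemma nrmZ a x : nrm (a *: x) = Num.sqrt (normsq a) * nrm x.
Proof. by rewrite /hnorm -!/(nsq _) nsqZ sqrtrM// normsq_ge0. Qed.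
Lemma ler_nrm x y : (nrm x <= nrm y) = (nsq x <= nsq y).
Proof. by rewrite -!nrmE ler_sqr// nnegrE nrm_ge0. Qed.
Lemma nrm_le (M : R) x : 0 <= M -> nsq x <= M ^+ 2 -> nrm x <= M.
Proof. by move=> M0; rewrite -nrmE ler_sqr// nnegrE ?nrm_ge0. Qed.

Lemma cauchy_schwarz x y : normsq (ip x y) <= nsq x * nsq y.
Proof.
have [x0|nx0] := eqVneq (nsq x) 0.
  by rewrite (nsq_eq0 x0) ip0l nsq0 mul0r /normsq /= expr0n addr0.
have x0 : 0 < nsq x by rewrite lt_neqAle eq_sym nx0 nsq_ge0.
(* This vector is [nsq x] times the component of [y] orthogonal to [x]; the scaling avoids a
   division. *)
have := nsq_ge0 ((nsq x)%:C%C *: y - ip x y *: x).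
rewrite nsqB !nsqZ ipZl ipZr normsq_real.
have -> : Re (((nsq x)%:C)^*%C * (ip x y * ip y x)) = nsq x * normsq (ip x y).
  rewrite (ipC x y) (mulrC (ip x y)) conjc_normsq.
  by rewrite ReM /= oppr0 mul0r subr0.
set N := normsq _; have N0 : 0 <= N by exact: normsq_ge0.
move=> h; rewrite -(ler_pM2l x0); nra.
Qed.

Lemma normsq_Re (z : C) : Re z ^+ 2 <= normsq z.
Proof. by rewrite /normsq lerDl sqr_ge0. Qed.

Lemma Reip_le x y : `|Re (ip x y)| <= nrm x * nrm y.
Proof.
rewrite -(@ler_sqr _ `|_|) ?nnegrE ?mulr_ge0 ?nrm_ge0// exprMn !nrmE.
by rewrite real_normK ?num_real// (le_trans (normsq_Re _))// cauchy_schwarz.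
Qed.

Lemma Reip_ler x y : Re (ip x y) <= nrm x * nrm y.
Proof. exact: le_trans (ler_norm _) (Reip_le _ _). Qed.

Lemma ler_nrmD x y : nrm (x + y) <= nrm x + nrm y.
Proof.
apply: nrm_le; first by rewrite addr_ge0 ?nrm_ge0.
by rewrite nsqD sqrrD !nrmE mulr2n; have := Reip_ler x y; lra.
Qed.

Lemma ler_nrmB x y z : nrm (x - z) <= nrm (x - y) + nrm (y - z).
Proof. by rewrite -[x - z](subrKA y); exact: ler_nrmD. Qed.

Lemma ler_distn x y : `|nrm x - nrm y| <= nrm (x - y).
Proof.
have h1 := ler_nrmD (x - y) y; rewrite subrK in h1.
have h2 := ler_nrmD (y - x) x; rewrite subrK nrmBC in h2.
by rewrite ler_norml; apply/andP; split; lra.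
Qed.

Lemma tendsP u x : tends u x <-> forall e, 0 < e -> exists N, forall n, (N <= n)%N -> nrm (u n - x) < e.
Proof.
split.
  move=> /cvgrPdist_lt h e /h[N _ hN]; exists N => n /hN.
  by rewrite sub0r normrN ger0_norm// nrm_ge0.
move=> h; apply/cvgrPdist_lt => e /h[N hN]; exists N => // n /hN.
by rewrite sub0r normrN ger0_norm// nrm_ge0.
Qed.

Lemma tends_squeeze (f : nat -> R) u x : f n @[n --> \oo] --> (0 : R) ->
  (forall n, nrm (u n - x) <= f n) -> tends u x.
Proof.
move=> f0 uf; apply: (@squeeze_cvgr _ _ _ _ (fun=> 0) f) => //; last exact: cvg_cst.
by apply: nearW => n; rewrite nrm_ge0 uf.
Qed.

Lemma tends_cst x : tends (fun=> x) x.
Proof. by rewrite /tends; under eq_fun do rewrite subrr nrm0; exact: cvg_cst. Qed.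

Lemma tends_lip (M : R) u x v y : tends u x ->
  (forall n, nrm (v n - y) <= M * nrm (u n - x)) -> tends v y.
Proof.
move=> ux; apply: tends_squeeze.
by rewrite -[X in _ --> X](mulr0 M); apply: cvgMr.
Qed.

Lemma tendsD u x v y : tends u x -> tends v y -> tends (fun n => u n + v n) (x + y).
Proof.
move=> ux vy; apply: (@tends_squeeze (fun n => nrm (u n - x) + nrm (v n - y))).
  by rewrite -[X in _ --> X](addr0 0); exact: cvgD ux vy.
by move=> n; rewrite opprD addrACA; exact: ler_nrmD.
Qed.

Lemma tendsZ a u x : tends u x -> tends (fun n => a *: u n) (a *: x).
Proof. by move=> ux; apply: tends_lip ux _ => n; rewrite -scalerBr nrmZ. Qed.

Lemma tendsN u x : tends u x -> tends (fun n => - u n) (- x).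
Proof.
move=> /(tendsZ (-1)); rewrite scaleN1r.
by under [fun n => _ *: _]eq_fun do rewrite scaleN1r.
Qed.

Lemma tendsB u x v y : tends u x -> tends v y -> tends (fun n => u n - v n) (x - y).
Proof. by move=> ux /tendsN; exact: tendsD. Qed.

Lemma tends_unique u x y : tends u x -> tends u y -> x = y.
Proof.
move=> ux uy; have := tendsB ux uy.
rewrite /tends; under eq_fun do rewrite subrr sub0r nrmN.
move=> h; apply/eqP; rewrite -subr_eq0; apply/eqP/nrm_eq0.
exact: cvg_unique (cvg_cst _) h.
Qed.

Lemma tends_shift k u x : tends u x -> tends (fun n => u (n + k)%N) x.
Proof.
by move=> h; rewrite /tends (cvg_shiftn k (fun n => nrm (u n - x))).
Qed.

Lemma cvg_nrm u x : tends u x -> nrm (u n) @[n --> \oo] --> nrm x.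
Proof.
move=> /tendsP h; apply/cvgrPdist_lt => e /h[N hN]; exists N => // n /hN.
by apply: le_lt_trans; rewrite distrC ler_distn.
Qed.

Lemma cvg_nsq u x : tends u x -> nsq (u n) @[n --> \oo] --> nsq x.
Proof.
move=> /cvg_nrm h; under eq_fun do rewrite -nrmE expr2.
by rewrite -nrmE expr2; exact: cvgM.
Qed.

Lemma cvg_Reip u x v y : tends u x -> tends v y ->
  Re (ip (u n) (v n)) @[n --> \oo] --> Re (ip x y).
Proof.
(* Polarization reduces the limit to those of squared norms. *)
have E s t : Re (ip s t) = (nsq (s + t) - nsq s - nsq t) / 2.
  by rewrite nsqD; field.
move=> ux vy; rewrite E; under eq_fun do rewrite E.
apply: cvgMl; apply: cvgB; last exact: cvg_nsq.
by apply: cvgB; apply: cvg_nsq => //; exact: tendsD.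
Qed.

Lemma ImipE x y : Im (ip x y) = Re (ip x (-'i%C *: y)).
Proof. by rewrite ipZr; case: (ip x y) => a b /=; ring. Qed.

(** Tool for carrying identities from a graph to its closure; imaginary parts reduce to real ones by
    [ImipE]. *)
Lemma ip_lim u x v y u' x' v' y' : tends u x -> tends v y -> tends u' x' ->
  tends v' y' -> (forall n, ip (u n) (v n) = ip (u' n) (v' n)) -> ip x y = ip x' y'.
Proof.
move=> ux vy ux' vy' h; apply: eqC.
  have := cvg_Reip ux' vy'; under eq_fun do rewrite -h.
  by apply: cvg_unique; [|exact: cvg_Reip].
rewrite !ImipE; have := cvg_Reip ux' (tendsZ (-'i%C) vy').
under eq_fun do rewrite -ImipE -h ImipE.
by apply: cvg_unique; [|exact: cvg_Reip ux (tendsZ _ vy)].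
Qed.

Lemma tends_cauchy u x : tends u x -> cauchy_seq u.
Proof.
move=> /tendsP h e e0; have [N hN] := h (e / 2) ltac:(lra).
exists N => m n /hN hm /hN hn; apply: le_lt_trans (ler_nrmB _ x _) _.
by rewrite (nrmBC x); lra.
Qed.

Lemma ip_ext x x' : (forall y, ip y x = ip y x') -> x = x'.
Proof.
move=> h; apply/eqP; rewrite -subr_eq0; apply/eqP/nsq_eq0.
by rewrite /nsq ipBr h subrr.
Qed.

Definition subspace K : Prop := K 0 /\ forall a x y, K x -> K y -> K (a *: x + y).
Definition closed_under_limits K : Prop := forall u x, (forall n, K (u n)) -> tends u x -> K x.

(** A minimizing sequence is Cauchy by the parallelogram law, and its limit [p] is orthogonal to [K]
    because moving [p] inside [K] cannot lower the distance to [x]. *)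
Lemma projection_exists K : subspace K -> closed_under_limits K ->
  forall x, exists2 p, K p & forall k, K k -> ip k (x - p) = 0.
Proof.
move=> [K0 Klin] Kcl x.
pose S := [set nsq (x - k) | k in K].
have Sinf : has_inf S.
  by split; [exists (nsq (x - 0)), 0 | exists 0 => _ [k _ <-]; exact: nsq_ge0].
pose d := inf S.
have dle k : K k -> d <= nsq (x - k).
  by move=> Kk; apply: ge_inf; [case: Sinf | exists k].
have /choice[k hk] n : exists k, K k /\ nsq (x - k) < d + n.+1%:R^-1.
  have [_ [k Kk <-] h] := inf_adherent (ltac:(by rewrite invr_gt0) : 0 < n.+1%:R^-1 :> R) Sinf.
  by exists k.
have Kd a y z : K y -> K z -> K (a *: (y + z)).
  move=> Ky Kz; have := Klin a _ 0 (Klin 1 _ _ Ky Kz) K0.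
  by rewrite scale1r addr0.
have kk m n : nsq (k m - k n) <= 2 * m.+1%:R^-1 + 2 * n.+1%:R^-1.
  have [Km hm] := hk m; have [Kn hn] := hk n.
  have := dle _ (Kd (2^-1)%:C%C _ _ Km Kn).
  (* Parallelogram law: the midpoint of [k m] and [k n] lies in [K], so its squared distance to [x]
     is at least [d]. *)
  have -> : x - (2^-1)%:C%C *: (k m + k n) = (2^-1)%:C%C *: ((x - k m) + (x - k n)).
    rewrite addrACA -opprD scalerBr; congr (_ - _).
    rewrite -[x + x](_ : (2 : C) *: x = _); last by rewrite scalerDl scale1r.
    rewrite scalerA (_ : _ * _ = 1) ?scale1r//.
    by rewrite natrC -rmorphM /= mulVf.
  rewrite nsqZ normsq_real => h.
  have -> : k m - k n = (x - k n) - (x - k m) by rewrite opprB [RHS]addrC addrA subrK.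
  have h4 : (2^-1 : R) ^+ 2 = 4^-1 by field.
  move: h; rewrite nsqB nsqD (ReipC (x - k n)) h4; move: hm hn.
  set A := nsq _; set B := nsq _; set e := Re _; set i := m.+1%:R^-1.
  by set j := n.+1%:R^-1 => h1 h2 h3; lra.
have [p kp] : exists p, tends k p.
  apply: (hilbert_complete hH) => e e0.
  have [N hN] : exists N : nat, forall n, (N <= n)%N -> n.+1%:R^-1 < e ^+ 2 / 4.
    have e40 : 0 < e ^+ 2 / 4 by rewrite divr_gt0// exprn_gt0.
    exists (Num.bound ((e ^+ 2 / 4)^-1)) => n Nn.
    rewrite invf_plt ?posrE//.
    have := archi_boundP (ltac:(by rewrite invr_ge0 ltW) : 0 <= (e ^+ 2 / 4)^-1).
    by move/lt_trans; apply; rewrite ltr_nat.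
  exists N => m n /hN hm /hN hn.
  rewrite -(@ltr_sqr _ _ e) ?nnegrE ?nrm_ge0 ?(ltW e0)// nrmE.
  apply: le_lt_trans (kk m n) _; move: hm hn.
  by set i := m.+1%:R^-1; set j := n.+1%:R^-1; lra.
have Kp : K p by apply: Kcl kp => n; case: (hk n).
exists p => // q Kq.
have dp : nsq (x - p) <= d.
  have h1 := cvg_nsq (tendsB (tends_cst x) kp).
  have h2 : (d + n.+1%:R^-1) @[n --> \oo] --> d.
    by rewrite -[X in _ --> X]addr0; apply: cvgD; [exact: cvg_cst | exact: cvg_harmonic].
  by apply: ler_cvg_to h1 h2 _; apply: nearW => n; apply: ltW; case: (hk n).
set c := ip q (x - p); apply: normsq_eq0.
pose M := nsq q.
(* The variation goes in the direction [c *: q], which makes the linear term real and equal to a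
   multiple of [normsq c]. *)
have key (t : R) : 2 * t * normsq c <= t ^+ 2 * normsq c * M.
  have Kt : K ((t%:C%C * c) *: q + p) by exact: Klin.
  have := le_trans dp (dle _ Kt).
  rewrite [_ *: q + p]addrC opprD addrA (nsqB (x - p)) nsqZ normsqM normsq_real -/M ipZr.
  have -> : Re (t%:C%C * c * ip (x - p) q) = t * normsq c.
    by rewrite (ipC q) -/c -mulrA (mulrC c) conjc_normsq -rmorphM.
  by lra.
have M0 : 0 <= M by exact: nsq_ge0.
have c0 := normsq_ge0 c.
(* With t = 1/(M + 1) one has t M < 1, and the case M = 0 needs no separate treatment. *)
have := key (M + 1)^-1; have i0 : 0 < (M + 1)^-1 by rewrite invr_gt0; lra.
set i := _^-1 in i0 *; have iE : i * (M + 1) = 1 by rewrite mulVf//; lra.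
have -> : i ^+ 2 * normsq c * M = i * normsq c * (i * (M + 1)) - i ^+ 2 * normsq c.
  by ring.
rewrite iE mulr1 => h; have iN : i * normsq c <= 0.
  by have : 0 <= i ^+ 2 * normsq c by [rewrite mulr_ge0// sqr_ge0]; lra.
by apply/eqP; rewrite eq_le c0 andbT -(pmulr_rle0 _ i0).
Qed.

End hilbert_space.

Ltac hring h := apply: (ip_ext h) => ?;
  rewrite ?(ipBr h, ipDr h, ipNr h, ipZr h, ip0r h); ring.

Lemma ler_cvg0 (R : realType) (c : R) (f : nat -> R) :
  f n @[n --> \oo] --> (0 : R) -> (forall n, c <= f n) -> c <= 0.
Proof.
move=> f0 h; apply: (@ler_cvg_to _ _ _ _ (fun=> c) f _ _ _ f0) => //.
  exact: cvg_cst.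
exact: nearW.
Qed.

Section bounded_operators.
Variables (R : realType) (H : lmodType R[i]) (ip : H -> H -> R[i]).
Variable hH : hilbert ip.
Local Notation C := R[i].
Local Notation Re := complex.Re.
Local Notation nrm := (hnorm ip).
Local Notation nsq := (nsq ip).
Implicit Types (x y z : H) (u v : nat -> H) (a : C) (K : set H) (A B : H -> H).

Lemma linD A : (forall a x y, A (a *: x + y) = a *: A x + A y) ->
  forall x y, A (x + y) = A x + A y.
Proof. by move=> l x y; rewrite -[x]scale1r l !scale1r. Qed.

Lemma lin0 A : (forall a x y, A (a *: x + y) = a *: A x + A y) -> A 0 = 0.
Proof. by move=> l; have := l (-1) 0 0; rewrite scaler0 addr0 scaleN1r addNr. Qed.

Lemma linZ A : (forall a x y, A (a *: x + y) = a *: A x + A y) ->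
  forall a x, A (a *: x) = a *: A x.
Proof. by move=> l a x; rewrite -[a *: x]addr0 l lin0// addr0. Qed.

Lemma linB A : (forall a x y, A (a *: x + y) = a *: A x + A y) ->
  forall x y, A (x - y) = A x - A y.
Proof. by move=> l x y; rewrite linD// -scaleN1r linZ// scaleN1r. Qed.

Lemma bop_lin A : bounded_op ip A -> forall a x y, A (a *: x + y) = a *: A x + A y.
Proof. by case. Qed.

Lemma bop_bound A : bounded_op ip A ->
  exists2 M : R, 0 < M & forall x, nrm (A x) <= M * nrm x.
Proof.
move=> [_ [M hM]]; exists (`|M| + 1) => [|x]; first by rewrite ltr_wpDl.
apply: le_trans (hM x) _; rewrite ler_wpM2r ?nrm_ge0//.
by rewrite (le_trans (ler_norm _))// lerDl.
Qed.

Lemma bop_tends A u x : bounded_op ip A -> tends ip u x -> tends ip (A \o u) (A x).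
Proof.
move=> bA; have [M _ hM] := bop_bound bA; move=> /tends_lip; apply => n /=.
by rewrite -(linB (bop_lin bA)).
Qed.

Lemma bop_id : bounded_op ip id.
Proof. by split=> //; exists 1 => x; rewrite mul1r. Qed.

Lemma bop_comp A B : bounded_op ip A -> bounded_op ip B -> bounded_op ip (A \o B).
Proof.
move=> bA bB; split=> [a x y /=|]; first by rewrite (bop_lin bB) (bop_lin bA).
have [M M0 hM] := bop_bound bA; have [L _ hL] := bop_bound bB.
exists (M * L) => x /=; apply: le_trans (hM _) _.
by rewrite -mulrA ler_pM2l.
Qed.

Lemma bop_lc b A B : bounded_op ip A -> bounded_op ip B ->
  bounded_op ip (fun x => b *: A x + B x).
Proof.
move=> bA bB; split=> [a x y /=|].
  rewrite (bop_lin bB) (bop_lin bA) !scalerDr !scalerA (mulrC b).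
  by rewrite addrACA.
have [M M0 hM] := bop_bound bA; have [L _ hL] := bop_bound bB.
exists (Num.sqrt (normsq b) * M + L) => x /=.
apply: le_trans (ler_nrmD hH _ _) _; rewrite mulrDl lerD// nrmZ//.
by rewrite -mulrA ler_wpM2l ?sqrtr_ge0.
Qed.

(** Unless f is 0, a vector [t] orthogonal to the closed kernel exists outside it;
    [x - (f x / f t) *: t] lies in the kernel, hence is orthogonal to [t], and this computes
    [f x]. *)
Lemma riesz (f : H -> C) : (forall a x y, f (a *: x + y) = a * f x + f y) ->
  (exists M : R, forall x, normsq (f x) <= M * nsq x) -> exists z, forall x, f x = ip z x.
Proof.
move=> fl [M fM].
have fB x y : f (x - y) = f x - f y.
  by rewrite addrC -scaleN1r fl mulN1r addrC.
have f0 : f 0 = 0 by rewrite -[X in f X](subrr 0) fB subrr.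
pose K : set H := [set x | f x = 0].
have Ks : subspace K by split=> //= a x y; rewrite /K /= fl => -> ->; rewrite mulr0 addr0.
have Kc : closed_under_limits ip K.
  move=> u x Ku ux; apply: normsq_eq0; apply/eqP; rewrite eq_le normsq_ge0 andbT.
  apply: (@ler_cvg0 _ _ (fun n => M * nsq (u n - x))).
    rewrite -[X in _ --> X](mulr0 M) -(nsq0 hH); apply: cvgMr.
    have := tendsB hH ux (tends_cst hH x); rewrite subrr; exact: cvg_nsq.
  by move=> n; have := fM (u n - x); rewrite fB (Ku n) sub0r normsqN.
have [[w fw]|/forallNP nf] := pselect (exists w, f w <> 0); last first.
  by exists 0 => x; rewrite ip0l//; have := nf x; rewrite notK.
have [p Kp hp] := projection_exists hH Ks Kc w.
pose t := w - p; have ft : f t != 0 by rewrite fB Kp subr0; exact/eqP.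
have tt : (nsq t)%:C%C != 0 :> C.
  apply: contra_neq ft => /(congr1 (@complex.Re _)) /= /(nsq_eq0 hH) ->.
  exact: f0.
exists ((f t / (nsq t)%:C%C)^*%C *: t) => x.
have := hp (x - (f x / f t) *: t).
have Kx : K (x - (f x / f t) *: t).
  by rewrite /K /= fB -[_ *: t]addr0 fl f0 addr0 mulfVK// subrr.
move=> /(_ Kx); rewrite -/t ipBl// ipZl// ipxx// => /eqP.
rewrite subr_eq0 => /eqP h.
rewrite ipZl// conjcK (hilbert_sym hH x) h conjcM conjcK.
have -> : ((nsq t)%:C)^*%C = (nsq t)%:C%C :> C by apply: eqC => //=; rewrite oppr0.
by field; rewrite ft.
Qed.

Lemma adjoint_sym A B : is_adjoint ip A B -> is_adjoint ip B A.
Proof. by move=> h x y; rewrite (hilbert_sym hH) -h -(hilbert_sym hH). Qed.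

Lemma adjoint_exists A : bounded_op ip A ->
  exists2 B, bounded_op ip B & is_adjoint ip A B.
Proof.
move=> bA; have [M M0 hM] := bop_bound bA.
have /choice[B hB] x : exists z, forall y, ip x (A y) = ip z y.
  apply: riesz => [a y z|]; first by rewrite (bop_lin bA) (hilbert_lin hH).
  exists (nsq x * M ^+ 2) => y; apply: le_trans (cauchy_schwarz hH _ _) _.
  rewrite -mulrA ler_wpM2l ?nsq_ge0// -!(nrmE hH) -exprMn.
  by rewrite ler_sqr ?nnegrE ?mulr_ge0 ?nrm_ge0// ltW.
exists B => //; split=> [a x y|].
  apply: (ip_ext hH) => z; rewrite (hilbert_lin hH) !(hilbert_sym hH _ z) -!hB.
  by rewrite ipDl// ipZl// conjcD conjcM conjcK.
(* The bound is |B x|^2 = <x, A (B x)> <= M |x| |B x|, divided by |B x| when that is nonzero. *)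
exists M => x; have := nrm_ge0 ip (B x); rewrite le_eqVlt => /predU1P[<-|B0].
  by rewrite mulr_ge0 ?nrm_ge0// ltW.
rewrite -(ler_pM2r B0) -expr2 nrmE// nsqE -hB.
by apply: le_trans (Reip_ler hH _ _) _; rewrite (mulrC (nrm x)) mulrAC ler_wpM2r ?nrm_ge0// hM.
Qed.

Lemma projection_operator K : subspace K -> closed_under_limits ip K ->
  exists P, [/\ bounded_op ip P, forall x, K (P x), forall x, K x -> P x = x,
    forall k x, K k -> ip k (x - P x) = 0 & is_adjoint ip P P].
Proof.
move=> Ks Kc; have [K0 Kl] := Ks.
have /choice[P hP] x : exists p, K p /\ forall k, K k -> ip k (x - p) = 0.
  by have [p] := projection_exists hH Ks Kc x; exists p.
have PK x : K (P x) by case: (hP x).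
have Po k x : K k -> ip k (x - P x) = 0 by case: (hP x) => _; exact.
have Pu x p : K p -> (forall k, K k -> ip k (x - p) = 0) -> P x = p.
  move=> Kp hp; apply/eqP; rewrite -subr_eq0; apply/eqP/(nsq_eq0 hH).
  have Kd : K (P x - p) by rewrite addrC -scaleN1r; exact: Kl.
  rewrite nsqE.
  have -> : ip (P x - p) (P x - p) = ip (P x - p) (x - p) - ip (P x - p) (x - P x).
    by rewrite -ipBr// opprB [_ + (P x - x)]addrC addrA subrK.
  by rewrite hp// Po// subrr.
have Pl a x y : P (a *: x + y) = a *: P x + P y.
  apply: Pu => [|k Kk]; first exact: Kl.
  by rewrite opprD addrACA -scalerBr (hilbert_lin hH) !Po// mulr0 addr0.
exists P; split=> //.
- split=> //; exists 1 => x; rewrite mul1r ler_nrm//.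
  have -> : nsq x = nsq (P x) + nsq (x - P x).
    by rewrite -{1}[x](subrK (P x)) (nsqD hH (x - P x)) ReipC// Po//= mulr0 addr0 addrC.
  by rewrite lerDl nsq_ge0.
- by move=> x Kx; apply: Pu => // k _; rewrite subrr ip0r.
- have Pe x y : ip (P x) y = ip (P x) (P y).
    by apply/eqP; rewrite -subr_eq0 -ipBr// Po.
  by move=> x y; rewrite Pe (hilbert_sym hH) Pe -(hilbert_sym hH).
Qed.

Implicit Types (S : set (H -> H)).

Lemma commutant_comp S A B : commutant ip S A -> commutant ip S B ->
  commutant ip S (A \o B).
Proof.
move=> [bA hA] [bB hB]; split; first exact: bop_comp.
by move=> D SD; rewrite compA hA// -compA hB// compA.
Qed.

Lemma commutant_lc S b A B : (forall D, S D -> bounded_op ip D) ->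
  commutant ip S A -> commutant ip S B -> commutant ip S (fun x => b *: A x + B x).
Proof.
move=> bS [bA hA] [bB hB]; split; first exact: bop_lc.
move=> D SD; apply/funext => x /=; rewrite (bop_lin (bS _ SD)).
by congr (_ *: _ + _); [exact: (congr1 (@^~ x) (hA _ SD)) | exact: (congr1 (@^~ x) (hB _ SD))].
Qed.

Lemma commutant_id S : commutant ip S id.
Proof. by split=> //; exact: bop_id. Qed.

Lemma commutantE S A B : commutant ip S A -> S B -> forall x, B (A x) = A (B x).
Proof. by move=> [_ h] /h e x; exact: (congr1 (@^~ x) e). Qed.

Lemma commutant_adjoint S A A' :
  (forall B, S B -> exists2 B', S B' & is_adjoint ip B B') ->
  bounded_op ip A' -> is_adjoint ip A A' -> commutant ip S A -> commutant ip S A'.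
Proof.
move=> hS bA' AA' cA; split=> // B /hS[B' SB' BB'].
apply/funext => x /=; apply: (ip_ext hH) => y.
by rewrite BB' !(adjoint_sym AA') BB' (commutantE cA SB').
Qed.

(** A subspace invariant under a family closed under adjoints reduces it: [B (P x) - P (B x)] is
    [P (B (P x - x))], and [B] keeps [P x - x] orthogonal to [K]. *)
Lemma commutant_projection S K P :
  (forall B, S B -> bounded_op ip B /\ exists2 B', S B' & is_adjoint ip B B') ->
  (forall B x, S B -> K x -> K (B x)) ->
  bounded_op ip P -> (forall x, K (P x)) -> (forall x, K x -> P x = x) ->
  (forall k x, K k -> ip k (x - P x) = 0) -> commutant ip S P.
Proof.
move=> hS KS bP PK Pid Po; split=> // B SB; apply/funext => x /=.
have [bB [B' SB' BB']] := hS _ SB.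
apply/eqP; rewrite -subr_eq0; apply/eqP.
have E : B (P x) - P (B x) = P (B (P x - x)).
  by rewrite (linB (bop_lin bB)) (linB (bop_lin bP)) (Pid _ (KS _ _ SB (PK x))).
rewrite E; apply: (nsq_eq0 hH); rewrite nsqE.
set q := P _; have Kq : K q by exact: PK.
have -> : ip q q = ip q (B (P x - x)).
  by apply/esym/eqP; rewrite -subr_eq0 -ipBr// Po.
by rewrite BB' -[P x - x]opprB ipNr// Po ?oppr0//; exact: KS.
Qed.

End bounded_operators.

Section product.
Variables (R : realType) (H : lmodType R[i]) (ip : H -> H -> R[i]).
Variable hH : hilbert ip.
Local Notation Re := complex.Re.

Definition prod_ip (p q : H * H) : R[i] := ip p.1 q.1 + ip p.2 q.2.

Lemma nsq2E p : nsq prod_ip p = nsq ip p.1 + nsq ip p.2.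
Proof. by rewrite nsqE ReD. Qed.

Lemma nrm2_ge1 p : hnorm ip p.1 <= hnorm prod_ip p.
Proof. by rewrite ler_sqrt -/(nsq _ _) -?/(nsq prod_ip _) ?nsq2E ?addr_ge0 ?nsq_ge0// lerDl nsq_ge0. Qed.

Lemma nrm2_ge2 p : hnorm ip p.2 <= hnorm prod_ip p.
Proof. by rewrite ler_sqrt -/(nsq _ _) -?/(nsq prod_ip _) ?nsq2E ?addr_ge0 ?nsq_ge0// lerDr nsq_ge0. Qed.

Lemma nrm2_le p : hnorm prod_ip p <= hnorm ip p.1 + hnorm ip p.2.
Proof.
rewrite -[leRHS]ger0_norm ?addr_ge0 ?nrm_ge0// -sqrtr_sqr ler_wsqrtr//.
rewrite -/(nsq _ _) nsq2E sqrrD !nrmE// -addrA [X in _ <= _ + X]addrC addrA lerDl.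
by rewrite mulrn_wge0// mulr_ge0 ?nrm_ge0.
Qed.

Lemma tends2P (u : nat -> H * H) x :
  tends prod_ip u x <-> tends ip (fun n => (u n).1) x.1 /\ tends ip (fun n => (u n).2) x.2.
Proof.
split=> [h|[h1 h2]].
  split; apply: (tends_squeeze h) => n; first exact: (nrm2_ge1 (u n - x)).
  exact: (nrm2_ge2 (u n - x)).
apply: (@tends_squeeze _ _ _ (fun n => hnorm ip ((u n).1 - x.1) + hnorm ip ((u n).2 - x.2))).
  by rewrite -[X in _ --> X](addr0 0); exact: cvgD h1 h2.
by move=> n; exact: nrm2_le.
Qed.

Lemma hilbert_prod : hilbert prod_ip.
Proof.
split.
- move=> x a y z; rewrite /prod_ip /= !(hilbert_lin hH); ring.
- by move=> x y; rewrite /prod_ip conjcD -!(hilbert_sym hH).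
- by move=> x; rewrite -/(nsq prod_ip x) nsq2E addr_ge0 ?nsq_ge0.
- move=> x /eqP; rewrite -/(nsq prod_ip x) nsq2E paddr_eq0 ?nsq_ge0//.
  by case: x => x y /andP[/eqP/(nsq_eq0 hH)/= -> /eqP/(nsq_eq0 hH)/= ->].
- move=> u cu.
  have [x ux] : exists x, tends ip (fun n => (u n).1) x.
    apply: (hilbert_complete hH) => e /cu[N hN]; exists N => m n mN nN.
    exact: le_lt_trans (nrm2_ge1 (u m - u n)) (hN _ _ mN nN).
  have [y uy] : exists y, tends ip (fun n => (u n).2) y.
    apply: (hilbert_complete hH) => e /cu[N hN]; exists N => m n mN nN.
    exact: le_lt_trans (nrm2_ge2 (u m - u n)) (hN _ _ mN nN).
  by exists (x, y); apply/tends2P.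
Qed.

Lemma closed_graphP (T : set (H * H)) : closed_graph ip T <-> closed_under_limits prod_ip T.
Proof.
split=> [cT u x Tu /tends2P[/tendsP u1 /tendsP u2]|cT p hp].
  apply: cT => e e0; have [N1 h1] := u1 _ e0; have [N2 h2] := u2 _ e0.
  exists (u (maxn N1 N2)) => //; split; rewrite nrmBC//.
    by rewrite h1// leq_maxl.
  by rewrite h2// leq_maxr.
have /choice[u hu] n : exists q, T q /\
    (hnorm ip (p.1 - q.1) < n.+1%:R^-1 /\ hnorm ip (p.2 - q.2) < n.+1%:R^-1).
  by have [|q] := hp n.+1%:R^-1; [rewrite invr_gt0 | exists q].
apply: (cT u) => [n|]; first by case: (hu n).
by apply/tends2P; split; apply: (tends_squeeze cvg_harmonic) => n;
   rewrite nrmBC// ltW//; case: (hu n) => _ [].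
Qed.

End product.

(** * Square roots and spectral subspaces of bounded symmetric operators *)

Section symmetric_operators.
Variables (R : realType) (H : lmodType R[i]) (ip : H -> H -> R[i]).
Variable hH : hilbert ip.
Local Notation C := R[i].
Local Notation Re := complex.Re.
Local Notation nrm := (hnorm ip).
Local Notation nsq := (nsq ip).
Implicit Types (x y z : H) (u : nat -> H) (D A B : H -> H).

Lemma iter_adjoint D : is_adjoint ip D D ->
  forall n x y, ip (iter n D x) y = ip x (iter n D y).
Proof. by move=> sD; elim=> //= n IH x y; rewrite -sD IH -iterS iterSr. Qed.

Lemma tends_nsq u x : nsq (u n - x) @[n --> \oo] --> (0 : R) -> tends ip u x.
Proof.
move=> /cvgrPdist_lt h; apply/tendsP => e e0.
have [M _ hM] := h _ (exprn_gt0 2 e0); exists M => n /hM.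
rewrite sub0r normrN ger0_norm ?nsq_ge0// -nrmE//.
by rewrite ltr_sqr ?nnegrE ?nrm_ge0// ltW.
Qed.

(** The increments are dominated by those of a bounded monotone real sequence, so [u] has finite
    total variation. Serves the square root iteration and a Neumann series. *)
Lemma cvg_of_increments u (s : nat -> R) (M : R) : 0 <= M ->
  (forall n, s n <= s n.+1) -> (exists b, forall n, s n <= b) ->
  (forall n, nrm (u n.+1 - u n) <= (s n.+1 - s n) * M) -> exists x, tends ip u x.
Proof.
move=> M0 sS [b sb] du; apply: (hilbert_complete hH) => e e0.
have dist n k : nrm (u (n + k)%N - u n) <= (s (n + k)%N - s n) * M.
  elim: k => [|k IH]; first by rewrite addn0 !subrr nrm0// mul0r.
  apply: le_trans (ler_nrmB hH _ (u (n + k)%N) _) _.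
  rewrite addnS -[s _ - s n](subrKA (s (n + k)%N)) mulrDl.
  by apply: lerD => //; exact: du.
have scvg : cvgn s.
  apply: nondecreasing_is_cvgn; first exact/nondecreasing_seqP.
  by exists b => _ [n _ <-].
have e4 : 0 < e / (4 * (M + 1)) by rewrite divr_gt0// mulr_gt0// ltr_wpDl.
have sl : s n @[n --> \oo] --> limn s by [].
have /cvgrPdist_lt/(_ _ e4)[K _ hK] := sl.
have key m n : (K <= n <= m)%N -> nrm (u m - u n) < e.
  move=> /andP[Kn nm]; rewrite -(subnKC nm); apply: le_lt_trans (dist _ _) _.
  rewrite subnKC//.
  have := hK m (leq_trans Kn nm); have := hK n Kn => /=.
  rewrite !ltr_norml => /andP[h1 h2] /andP[h3 h4].
  apply: (@le_lt_trans _ _ (2 * (e / (4 * (M + 1))) * (M + 1))).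
    by apply: ler_pM; rewrite ?subr_ge0 ?lerDl//; [exact/(nondecreasing_seqP s).1 | lra].
  by rewrite (_ : _ * _ = e / 2); [lra | field; lra].
exists K => m n Km Kn; have [nm|/ltnW mn] := leqP n m.
  by apply: key; rewrite Kn.
by rewrite nrmBC//; apply: key; rewrite Km.
Qed.

(** The numbers |D^n x|^2 decrease, and the squared distance between two even powers applied to x is
    a combination of them, so the even powers converge. Their limit is fixed by D^2; positivity
    excludes the eigenvalue -1, so it is fixed by [D], hence 0. *)
Lemma iter_contraction_cvg0 D : bounded_op ip D -> is_adjoint ip D D ->
  (forall x, 0 <= Re (ip x (D x))) -> (forall x, nrm (D x) <= nrm x) ->
  (forall y, D y = y -> y = 0) ->
  forall x, tends ip (fun n => iter n D x) 0.
Proof.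
move=> bD sD pD cD D1 x; pose b n := nsq (iter n D x).
have bS n : b n.+1 <= b n by rewrite /b /= -ler_nrm.
have bcvg : cvgn b.
  apply: nonincreasing_is_cvgn; first exact/nonincreasing_seqP.
  by exists 0 => _ [n _ <-]; exact: nsq_ge0.
have bl : b n @[n --> \oo] --> limn b by [].
set l := limn b in bl *.
pose v k := iter k.*2 D x.
have vv k j : nsq (v k - v j) = b k.*2 + b j.*2 - 2 * b (k + j)%N.
  rewrite nsqB//; congr (_ - 2 * _); rewrite /b nsqE !iter_adjoint// -!iterD.
  by rewrite -!addnn addnACA.
have cv : cauchy_seq ip v.
  move=> e e0; have e4 : 0 < e ^+ 2 / 4 by rewrite divr_gt0// exprn_gt0.
  have /cvgrPdist_lt/(_ _ e4)[M _ hM] := bl.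
  exists M => m n Mm Mn; rewrite -(@ltr_sqr _ _ e) ?nnegrE ?nrm_ge0 ?(ltW e0)//.
  rewrite nrmE// vv.
  have := hM m.*2 (leq_trans Mm _); rewrite -addnn leq_addr => /(_ isT).
  have := hM n.*2 (leq_trans Mn _); rewrite -addnn leq_addr => /(_ isT).
  have := hM (m + n)%N (leq_trans Mm (leq_addr _ _)) => /=.
  by rewrite !addnn !ltr_norml => /andP[? ?] /andP[? ?] /andP[? ?]; lra.
have [y vy] := hilbert_complete hH cv.
have DDy : D (D y) = y.
  apply: (tends_unique hH) (_ : tends ip (fun n => v (n + 1)%N) y); last exact: tends_shift.
  have := bop_tends bD (bop_tends bD vy).
  by congr (tends _ _ _); apply/funext => n; rewrite /v addn1 doubleS.
(* [D] acts as -1 on [y - D y], which positivity allows only for the zero vector. *)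
have w0 : y - D y = 0.
  have e : D (y - D y) = - (y - D y) by rewrite (linB (bop_lin bD)) DDy opprB.
  have := pD (y - D y); rewrite e ipNr// ReN oppr_ge0 => h.
  by apply: (nsq_eq0 hH); apply/eqP; rewrite eq_le nsq_ge0// andbT.
have y0 : y = 0 by apply: D1; apply/esym/eqP; rewrite -subr_eq0 w0.
apply: tends_nsq; under eq_fun do rewrite subr0.
suff <- : l = 0 by [].
have h1 : b k.*2 @[k --> \oo] --> (0 : R).
  by have := cvg_nsq hH vy; rewrite y0 nsq0.
apply: cvg_unique h1 => //; apply: cvg_comp bl.
apply/cvgnyPge => n; exists n => // m /= nm.
by rewrite (leq_trans nm)// -addnn leq_addr.
Qed.

Section square_root.
Variable D : H -> H.
Variables (bD : bounded_op ip D) (sD : is_adjoint ip D D).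
Variable cD : forall x, nrm (D x) <= nrm x.

(** Fixed point iteration for X = (D + X^2)/2, that is (1 - X)^2 = 1 - D: the limit is 1 minus the
    square root of 1 - D. For D = 1 - A^2 it is 1 - |A|. *)
Fixpoint root_iter n : H -> H :=
  if n is k.+1 then fun x => (2^-1)%:C%C *: (D x + root_iter k (root_iter k x))
  else fun=> 0.
(** The same iteration with [D] replaced by the number 1. It increases, stays below 1 and dominates
    the increments of [root_iter]. *)
Fixpoint root_major n : R :=
  if n is k.+1 then (1 + root_major k ^+ 2) / 2 else 0.
Local Notation X := root_iter.
Local Notation s := root_major.

Let sE n : s n.+1 = (1 + s n ^+ 2) / 2. Proof. by []. Qed.

Let s_ge0 n : 0 <= s n.
Proof. by case: n => //= n; rewrite divr_ge0// addr_ge0// sqr_ge0. Qed.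

Let s_le1 n : s n <= 1.
Proof. by elim: n => //= n IH; have := s_ge0 n; nra. Qed.

Let sS n : s n <= s n.+1.
Proof. by rewrite sE; have := sqr_ge0 (1 - s n); lra. Qed.

Let XE n x : X n.+1 x = (2^-1)%:C%C *: (D x + X n (X n x)).
Proof. by []. Qed.

Let nrm_half x : nrm ((2^-1)%:C%C *: x) = nrm x / 2.
Proof.
by rewrite nrmZ// normsq_real sqrtr_sqr ger0_norm ?invr_ge0// mulrC.
Qed.

Let Xlin n a x y : X n (a *: x + y) = a *: X n x + X n y.
Proof.
elim: n x y => [|n IH] x y /=; first by rewrite scaler0 addr0.
rewrite (bop_lin bD) !IH scalerA mulrC -scalerA -scalerDr; congr (_ *: _).
by rewrite scalerDr addrACA.
Qed.

Let Xbd n x : nrm (X n x) <= s n * nrm x.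
Proof.
elim: n x => [|n IH] x /=; first by rewrite nrm0// mul0r.
rewrite nrm_half mulrAC ler_wpM2r ?invr_ge0//.
apply: le_trans (ler_nrmD hH _ _) _; rewrite mulrDl mul1r lerD//.
apply: le_trans (IH _) _; rewrite expr2 -mulrA ler_wpM2l//.
Qed.

(** The difference of two squares factors as X_(n+1) (X_(n+1) - X_n) + (X_(n+1) - X_n) X_n, and the
    scalar iteration factors in the same way. *)
Let Xdiff n x : nrm (X n.+1 x - X n x) <= (s n.+1 - s n) * nrm x.
Proof.
elim: n x => [|n IH] x.
  have -> : X 0 x = 0 by [].
  by have := Xbd 1 x; rewrite /= !subr0.
rewrite [X n.+2 x]XE [in X in _ - X]XE -scalerBr nrm_half opprD addrACA subrr add0r.
have -> : s n.+2 - s n.+1 = (s n.+1 + s n) * (s n.+1 - s n) / 2.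
  by rewrite [s n.+2]sE [in X in _ - X]sE; field.
rewrite mulrAC ler_wpM2r ?invr_ge0//.
rewrite -[X in nrm X](subrKA (X n.+1 (X n x))).
apply: le_trans (ler_nrmD hH _ _) _; rewrite !mulrDl lerD//.
  rewrite -(linB (Xlin n.+1)); apply: le_trans (Xbd _ _) _.
  by rewrite -[leRHS]mulrA ler_wpM2l.
apply: le_trans (IH _) _; by rewrite [leRHS]mulrAC [leRHS]mulrC ler_wpM2l ?subr_ge0.
Qed.

Let Xcvg x : exists y, tends ip (X ^~ x) y.
Proof.
apply: (cvg_of_increments (nrm_ge0 ip x) sS) => //; by exists 1.
Qed.

(** The equation says that 1 - X is a square root of 1 - D; the commutation clause is what later
    places spectral projections in the algebra. *)
Lemma square_root_exists : exists X : H -> H,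
  [/\ bounded_op ip X, is_adjoint ip X X, forall x, nrm (X x) <= nrm x,
      forall x, X x + X x = D x + X (X x) &
      forall B, bounded_op ip B -> (forall x, B (D x) = D (B x)) ->
        forall x, B (X x) = X (B x)].
Proof.
have /choice[Y XY] := Xcvg.
have Xsym n x y : ip x (X n y) = ip (X n x) y.
  elim: n x y => [|n IH] x y /=; first by rewrite ip0r// ip0l.
  rewrite ipZr// ipZl// ipDr// ipDl// sD !IH.
  by congr (_ * _); apply: eqC => //=; rewrite oppr0.
have bY : bounded_op ip Y.
  split=> [a x y|].
    apply: (tends_unique hH (XY _)); under eq_fun do rewrite Xlin.
    by apply: tendsD => //; exact: tendsZ.
  exists 1 => x; apply: ler_cvg_to (cvg_nrm hH (XY x)) (cvg_cst _) _.
  by apply: nearW => n; apply: le_trans (Xbd _ _) _; rewrite ler_wpM2r ?nrm_ge0.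
have Y1 x : nrm (Y x) <= nrm x.
  apply: ler_cvg_to (cvg_nrm hH (XY x)) (cvg_cst _) _; apply: nearW => n.
  by apply: le_trans (Xbd _ _) _; rewrite ler_piMl ?nrm_ge0.
exists Y; split=> //.
- move=> x y; apply: (ip_lim hH (tends_cst hH x) (XY y) (XY x) (tends_cst hH y)) => n.
  exact: Xsym.
- move=> x.
  have h1 : tends ip (fun n => X n (X n x)) (Y (Y x)).
    apply: (@tends_squeeze _ _ _ (fun n => nrm (X n x - Y x) + nrm (X n (Y x) - Y (Y x)))).
      by rewrite -[X in _ --> X](addr0 0); exact: cvgD (XY x) (XY (Y x)).
    move=> n; apply: le_trans (ler_nrmB hH _ (X n (Y x)) _) _.
    rewrite lerD2r -(linB (Xlin n)); apply: le_trans (Xbd _ _) _.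
    by rewrite ler_piMl ?nrm_ge0.
  have h2 := tends_shift 1 (XY x).
  have h3 : tends ip (fun n => X (n + 1) x) ((2^-1)%:C%C *: (D x + Y (Y x))).
    under eq_fun do rewrite addn1 /=.
    by apply: tendsZ => //; apply: tendsD => //; exact: tends_cst.
  rewrite [in LHS](tends_unique hH h2 h3) -scalerDl (_ : _ + _ = 1) ?scale1r//.
  by apply: eqC => /=; [field | rewrite addr0].
- move=> B bB BD x.
  have BX n z : B (X n z) = X n (B z).
    elim: n z => [|n IH] z /=; first by rewrite (lin0 (bop_lin bB)).
    by rewrite (linZ (bop_lin bB)) (linD (bop_lin bB)) BD !IH.
  apply: (tends_unique hH (bop_tends bB (XY x))).
  by rewrite /comp; under eq_fun do rewrite BX; exact: XY.
Qed.

End square_root.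

(** [K] consists of the x with |A| x = A x, where |A| = 1 - X. Every vector (A + |A|) w lies in [K],
    so a vector orthogonal to [K] satisfies A y = -|A| y. *)
Lemma positive_subspace A : bounded_op ip A -> is_adjoint ip A A ->
  (forall x, nrm (A x) <= nrm x) ->
  exists K : set H, [/\ subspace K, closed_under_limits ip K,
    forall B, bounded_op ip B -> (forall x, B (A x) = A (B x)) ->
      forall x, K x -> K (B x),
    forall x, K x -> 0 <= Re (ip x (A x)) &
    forall y, (forall x, K x -> ip x y = 0) -> Re (ip y (A y)) <= 0].
Proof.
move=> bA sA cA; have lA := bop_lin bA.
pose D x := x - A (A x).
have bD : bounded_op ip D.
  have := bop_lc hH (-1) (bop_comp bA bA) (bop_id ip).
  congr (bounded_op _ _); apply/funext => x /=.
  by rewrite /D scaleN1r addrC.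
have sD : is_adjoint ip D D.
  by move=> x y; rewrite /D ipBr// ipBl// !sA.
have cD x : nrm (D x) <= nrm x.
  rewrite ler_nrm// /D nsqB// sA -nsqE.
  have : nsq (A (A x)) <= nsq (A x) by rewrite -ler_nrm.
  by have := nsq_ge0 hH (A x); lra.
have [X [bX sX cX XX XB]] := square_root_exists bD sD cD.
have lX := bop_lin bX.
have XA x : A (X x) = X (A x).
  by apply: XB => // z; rewrite /D (linB lA).
have pX x : 0 <= Re (ip x (x - X x)).
  rewrite ipBr// ReB -nsqE -nrmE// expr2 subr_ge0.
  by apply: le_trans (Reip_ler hH _ _) _; rewrite ler_wpM2l ?nrm_ge0.
exists [set x | x - X x = A x]; split.
- split=> /= [|a x y hx hy]; first by rewrite (lin0 lA) (lin0 lX) subr0.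
  by rewrite lA lX -hx -hy scalerBr opprD addrACA.
- move=> u x hu ux /=.
  apply: (tends_unique hH (tendsB hH ux (bop_tends bX ux))).
  have := bop_tends bA ux; congr (tends _ _ _).
  by apply/funext => n /=; rewrite -hu.
- move=> B bB BA x /= hx.
  have BX : B (X x) = X (B x).
    by apply: XB => // z; rewrite /D (linB (bop_lin bB)) !BA.
  by rewrite -BX -(linB (bop_lin bB)) hx BA.
- by move=> x /= <-.
- move=> y hy; suff -> : A y = - (y - X y) by rewrite ipNr// ReN oppr_le0.
  apply/eqP; rewrite -addr_eq0; apply/eqP/(ip_ext hH) => w; rewrite ip0r//.
  have -> : ip w (A y + (y - X y)) = ip (A w + (w - X w)) y.
    by rewrite ipDr// ipDl// ipBr// ipBl// sA sX.
  apply: hy => /=; rewrite (linD lX) (linB lX) (linD lA) (linB lA) XA.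
  have -> : X (X w) = X w + X w - w + A (A w).
    by rewrite XX /D; hring hH.
  by hring hH.
Qed.

End symmetric_operators.

(** * Finite von Neumann algebras *)

Section finite_von_neumann_algebra.
Variables (R : realType) (H : lmodType R[i]) (ip : H -> H -> R[i]).
Variable hH : hilbert ip.
Local Notation C := R[i].
Local Notation Re := complex.Re.
Local Notation nrm := (hnorm ip).
Local Notation ip2 := (prod_ip ip).
Implicit Types (x y z : H) (T U : set (H * H)).

(* N' is the commutant of N; J is the modular conjugation of the trace vector *)
Record standard_form (N N' : set (H -> H)) (Om : H) (J : H -> H) : Prop := StandardForm {
  sf_N : N = commutant ip N';
  sf_N' : commutant ip N = N';
  sf_adjN : forall B, N B -> exists2 B', N B' & is_adjoint ip B B';
  sf_adjN' : forall B, N' B -> exists2 B', N' B' & is_adjoint ip B B';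
  sf_sep : forall y, (forall w, N' w -> ip (w Om) y = 0) -> y = 0;
  sf_cyc : forall x (e : R), 0 < e -> exists2 u, N u & nrm (u Om - x) < e;
  sf_trace : forall a b, N a -> N b -> ip Om (a (b Om)) = ip Om (b (a Om));
  sf_J : forall w w' x, N' w -> N' w' -> is_adjoint ip w w' ->
    ip (w Om) x = ip (J x) (w' Om);
  sf_JK : forall x, J (J x) = x }.

Variables (N N' : set (H -> H)) (Om : H) (J : H -> H).
Variable hN : standard_form N N' Om J.

(** This is [measurable_op] without its trace condition, which [small_projection] supplies as soon
    as [Om] is in the domain. *)
Definition affiliated_op T : Prop :=
  [/\ linear_graph T, closed_graph ip T, densely_defined ip T & affiliated ip N T].

Lemma N_bounded B : N B -> bounded_op ip B.
Proof. by rewrite (sf_N hN) => -[]. Qed.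

Lemma N'_bounded B : N' B -> bounded_op ip B.
Proof. by rewrite -(sf_N' hN) => -[]. Qed.

Lemma N_commute B B' x : N B -> N' B' -> B (B' x) = B' (B x).
Proof. by rewrite (sf_N hN) => hB hB'; rewrite (commutantE hB hB'). Qed.

Lemma N_id : N id. Proof. by rewrite (sf_N hN); exact: commutant_id. Qed.

Lemma N_comp A B : N A -> N B -> N (A \o B).
Proof. by rewrite (sf_N hN); exact: commutant_comp. Qed.

Lemma N_lc a A B : N A -> N B -> N (fun x => a *: A x + B x).
Proof. by rewrite (sf_N hN); apply: commutant_lc => //; exact: N'_bounded. Qed.

Lemma N_iter n A : N A -> N (iter n A).
Proof. by move=> NA; elim: n => [|n IH]; [exact: N_id | exact: N_comp]. Qed.

Lemma N'_comp A B : N' A -> N' B -> N' (A \o B).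
Proof. by rewrite -(sf_N' hN); exact: commutant_comp. Qed.

Lemma N'_lc a A B : N' A -> N' B -> N' (fun x => a *: A x + B x).
Proof. by rewrite -(sf_N' hN); apply: commutant_lc => //; exact: N_bounded. Qed.

Lemma N'_id : N' id. Proof. by rewrite -(sf_N' hN); exact: commutant_id. Qed.

(** By [sf_sep] no nonzero vector is orthogonal to all w Om, so the projection onto the closure of
    these vectors moves nothing. *)
Lemma N'_cyclic x : exists u : nat -> H -> H,
  (forall n, N' (u n)) /\ tends ip (fun n => u n Om) x.
Proof.
pose K : set H := [set x | forall e : R, 0 < e -> exists2 w, N' w & nrm (w Om - x) < e].
have Ks : subspace K.
  split=> [e e0|a y z Ky Kz e e0].
    exists (fun x => (-1) *: id x + id x); first by apply: N'_lc; exact: N'_id.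
    by rewrite /= scaleN1r addNr subrr nrm0.
  have s0 := sqrtr_ge0 (normsq a); set s := Num.sqrt _ in s0.
  have [w Nw hw] := Ky (e / (2 * (s + 1))) ltac:(rewrite divr_gt0// mulr_gt0//; lra).
  have [v Nv hv] := Kz (e / 2) ltac:(lra).
  exists (fun x => a *: w x + v x); first exact: N'_lc.
  rewrite opprD addrACA -scalerBr; apply: le_lt_trans (ler_nrmD hH _ _) _.
  rewrite nrmZ// -/s; suff : s * nrm (w Om - y) <= e / 2 by lra.
  apply: le_trans (ler_wpM2l s0 (ltW hw)) _.
  rewrite invfM mulrA mulrA [s * _]mulrC -!mulrA ler_pM2l// mulrC -mulrA.
  by rewrite ler_piMr// mulrC ler_pdivrMr ?mul1r; lra.
have Kc : closed_under_limits ip K.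
  move=> v y Kv /tendsP vy e e0; have [n hn] := vy (e / 2) ltac:(lra).
  have [w Nw hw] := Kv n (e / 2) ltac:(lra).
  exists w => //; apply: le_lt_trans (ler_nrmB hH _ (v n) _) _.
  by have := hn n (leqnn _); lra.
have [p Kp hp] := projection_exists hH Ks Kc x.
have Kx : K x.
  have -> // : x = p.
  apply/eqP; rewrite -subr_eq0; apply/eqP/(sf_sep hN) => w Nw.
  by apply: hp => e e0; exists w => //; rewrite subrr nrm0.
have /choice[u hu] n : exists w, N' w /\ nrm (w Om - x) < n.+1%:R^-1.
  by have [|w] := Kx n.+1%:R^-1; [rewrite invr_gt0 | exists w].
exists u; split=> [n|]; first by case: (hu n).
by apply: (tends_squeeze cvg_harmonic) => n; apply: ltW; case: (hu n).
Qed.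

Lemma graph_subspace T : linear_graph T -> @subspace _ (H * H)%type T.
Proof. by move=> [T0 Tl _]; split=> // a [x y] [x' y'] /= h h'; exact: Tl. Qed.

(** Stone's characteristic matrix of [T]: the corners of the projection onto the graph are bounded
    and lie in [N], so questions about the unbounded [T] become questions in [N]. *)
Record graph_projection T (P : H * H -> H * H) : Prop := GraphProjection {
  gp_bounded : bounded_op ip2 P;
  gp_range : forall p, T (P p);
  gp_id : forall p, T p -> P p = p;
  gp_orth : forall k p, T k -> ip2 k (p - P p) = 0;
  gp_sym : is_adjoint ip2 P P;
  gp_N11 : N (fun x => (P (x, 0)).1);
  gp_N12 : N (fun x => (P (0, x)).1);
  gp_N21 : N (fun x => (P (x, 0)).2);
  gp_N22 : N (fun x => (P (0, x)).2) }.

(** The graph is invariant under the diagonal operators (B, B) with [B] in [N'], so [P] commutes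
    with them and each corner commutes with [B]; since [N] is the commutant of [N'], the corners are
    in [N]. *)
Lemma graph_projection_exists T : affiliated_op T -> exists P, graph_projection T P.
Proof.
move=> [lT cT dT aT].
have Ts := graph_subspace lT; have Tc := (closed_graphP hH T).1 cT.
have [P [bP PT Pid Po Ps]] := projection_operator (hilbert_prod hH) Ts Tc.
pose S2 : set (H * H -> H * H) := [set B2 | exists2 B, N' B & B2 = fun p => (B p.1, B p.2)].
have cP : commutant ip2 S2 P.
  apply: (commutant_projection (hilbert_prod hH) (K := T)) => //.
  - move=> _ [B NB ->]; split.
      have bB := N'_bounded NB; have [M M0 hM] := bop_bound bB.
      split=> [a x y|]; first by rewrite /= !(bop_lin bB).
      exists M => p; apply: (nrm_le (hilbert_prod hH)).
        by rewrite mulr_ge0 ?nrm_ge0// ltW.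
      rewrite exprMn nrmE; last exact: hilbert_prod.
      rewrite !nsq2E mulrDr -!(nrmE hH) -!exprMn lerD// ler_sqr ?hM// nnegrE ?nrm_ge0//.
        by rewrite mulr_ge0 ?nrm_ge0// ltW.
      by rewrite mulr_ge0 ?nrm_ge0// ltW.
    have [B' NB' BB'] := sf_adjN' hN NB.
    exists (fun p => (B' p.1, B' p.2)); first by exists B'.
    by move=> x y; rewrite /prod_ip /= !BB'.
  - by move=> _ [x y] [B NB ->] /=; apply: aT; rewrite (sf_N' hN).
have PE B p : N' B -> P (B p.1, B p.2) = (B (P p).1, B (P p).2).
  move=> NB; have SB : S2 (fun p => (B p.1, B p.2)) by exists B.
  by rewrite -(commutantE cP SB p).
have entry (e : H -> H * H) (pr : H * H -> H) :
    (forall (a : C) x y, e (a *: x + y) = a *: e x + e y) ->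
    (forall (a : C) (x y : H * H), pr (a *: x + y) = a *: pr x + pr y) ->
    (forall x, hnorm ip2 (e x) <= nrm x) -> (forall p, nrm (pr p) <= hnorm ip2 p) ->
    (forall B x, N' B -> e (B x) = (B (e x).1, B (e x).2)) ->
    (forall B p, pr (B p.1, B p.2) = B (pr p)) -> N (fun x => pr (P (e x))).
  move=> le lp ne np eB pB; rewrite (sf_N hN); split.
    split=> [a x y|]; first by rewrite le (bop_lin bP) lp.
    have [M M0 hM] := bop_bound bP; exists M => x.
    apply: le_trans (np _) _; apply: le_trans (hM _) _.
    by rewrite ler_pM2l.
  by move=> B NB; apply/funext => x /=; rewrite eB// PE// pB.
have l1 (a : C) x y : (a *: x + y, 0) = a *: (x, 0) + (y, 0) :> H * H.
  by rewrite [RHS]surjective_pairing /= scaler0 addr0.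
have l2 (a : C) x y : (0, a *: x + y) = a *: (0, x) + (0, y) :> H * H.
  by rewrite [RHS]surjective_pairing /= scaler0 addr0.
have n1 x : hnorm ip2 (x, 0) <= nrm x.
  by apply: le_trans (nrm2_le hH _) _; rewrite nrm0 ?addr0.
have n2 x : hnorm ip2 (0, x) <= nrm x.
  by apply: le_trans (nrm2_le hH _) _; rewrite nrm0 ?add0r.
have B0 B : N' B -> B 0 = 0 by move=> /N'_bounded bB; rewrite (lin0 (bop_lin bB)).
exists P; split=> //.
- by apply: (entry (fun x => (x, 0)) fst) => //; [exact: nrm2_ge1 | move=> B x /B0 /= ->].
- by apply: (entry (fun x => (0, x)) fst) => //; [exact: nrm2_ge1 | move=> B x /B0 /= ->].
- by apply: (entry (fun x => (x, 0)) snd) => //; [exact: nrm2_ge2 | move=> B x /B0 /= ->].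
- by apply: (entry (fun x => (0, x)) snd) => //; [exact: nrm2_ge2 | move=> B x /B0 /= ->].
Qed.

Section projection_entries.
Variables (T : set (H * H)) (P : H * H -> H * H).
Variables (aT : affiliated_op T) (hP : graph_projection T P).
Let p11 x := (P (x, 0)).1.
Let p12 x := (P (0, x)).1.
Let p21 x := (P (x, 0)).2.
Let p22 x := (P (0, x)).2.

Lemma gp_nsq p : nsq ip2 p = nsq ip2 (P p) + nsq ip2 (p - P p).
Proof.
rewrite -{1}[p](subrK (P p)) (nsqD (hilbert_prod hH) (p - P p)) addrAC addrC addrA.
rewrite (ReipC (hilbert_prod hH)) (gp_orth hP) ?mulr0 ?add0r//.
  by rewrite addr0.
exact: (gp_range hP).
Qed.

Lemma gp_Re p : Re (ip2 p (P p)) = nsq ip2 (P p).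
Proof. by rewrite nsqE -(gp_sym hP) (gp_id hP (gp_range hP p)). Qed.

Lemma gp_ReB p : Re (ip2 p (p - P p)) = nsq ip2 (p - P p).
Proof.
rewrite (ipBr (hilbert_prod hH)) ReB gp_Re -nsqE gp_nsq; ring.
Qed.

Lemma gp_le p : hnorm ip2 (P p) <= hnorm ip2 p.
Proof.
rewrite (ler_nrm (hilbert_prod hH)) [leRHS]gp_nsq lerDl.
exact/nsq_ge0/hilbert_prod.
Qed.

Lemma gp_le' p : hnorm ip2 (p - P p) <= hnorm ip2 p.
Proof.
rewrite (ler_nrm (hilbert_prod hH)) [leRHS]gp_nsq lerDr.
exact/nsq_ge0/hilbert_prod.
Qed.

Lemma gp_min p q : T q -> nsq ip2 (p - P p) <= nsq ip2 (p - q).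
Proof.
move=> Tq; have -> : p - q = (p - P p) + (P p - q) by rewrite addrA subrK.
have TPq : T (P p - q).
  have [_ Tl] := graph_subspace (let: And4 l _ _ _ := aT in l).
  by rewrite addrC -scaleN1r; apply: Tl => //; exact: (gp_range hP).
rewrite (nsqD (hilbert_prod hH) (p - P p)) (ReipC (hilbert_prod hH)).
rewrite (gp_orth hP)// mulr0 addr0 lerDl; exact/nsq_ge0/hilbert_prod.
Qed.

Lemma gpE a b : P (a, b) = (p11 a + p12 b, p21 a + p22 b).
Proof.
have -> : (a, b) = (a, 0) + (0, b) by congr (_, _); rewrite ?addr0 ?add0r.
rewrite (linD (bop_lin (gp_bounded hP))) /p11 /p12 /p21 /p22.
by case: (P (a, 0)) (P (0, b)) => [? ?] [? ?].
Qed.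

Lemma gp_adj11 : is_adjoint ip p11 p11.
Proof.
move=> x y; have := gp_sym hP (x, 0) (y, 0).
by rewrite /prod_ip /= ip0l// ip0r// !addr0.
Qed.

Lemma gp_adj22 : is_adjoint ip p22 p22.
Proof.
move=> x y; have := gp_sym hP (0, x) (0, y).
by rewrite /prod_ip /= ip0l// ip0r// !add0r.
Qed.

Lemma gp_nrm1 x : hnorm ip2 (x, 0) = nrm x.
Proof. by rewrite /hnorm -!/(nsq _ _) nsq2E /= nsq0// addr0. Qed.

Lemma gp_nrm2 x : hnorm ip2 (0, x) = nrm x.
Proof. by rewrite /hnorm -!/(nsq _ _) nsq2E /= nsq0// add0r. Qed.

Lemma gp_idem x : [/\ p11 (p11 x) + p12 (p21 x) = p11 x,
  p21 (p11 x) + p22 (p21 x) = p21 x & p21 (p12 x) + p22 (p22 x) = p22 x].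
Proof.
have h1 : P (p11 x, p21 x) = (p11 x, p21 x).
  by rewrite /p11 /p21 -surjective_pairing (gp_id hP)//; exact: (gp_range hP).
have h2 : P (p12 x, p22 x) = (p12 x, p22 x).
  by rewrite /p12 /p22 -surjective_pairing (gp_id hP)//; exact: (gp_range hP).
by move: h1 h2; rewrite !gpE => -[-> ->] [_ ->].
Qed.

Lemma gp_pos11 x : Re (ip x (x - p11 x)) = nsq ip2 ((x, 0) - P (x, 0)).
Proof. by rewrite -gp_ReB /prod_ip /= ip0l// addr0. Qed.

(** A vector y fixed by 1 - p11 has [P (y, 0) = 0], so it is orthogonal to the dense domain of [T]
    and vanishes; [iter_contraction_cvg0] applies. *)
Lemma gp_decay11 : tends ip (fun n => iter n (fun x => x - p11 x) Om) 0.
Proof.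
have N11 := gp_N11 hP; have b11 := N_bounded N11.
apply: (iter_contraction_cvg0 hH).
- have := bop_lc hH (-1) b11 (bop_id ip).
  by congr (bounded_op _ _); apply/funext => x; rewrite scaleN1r addrC.
- by move=> x y; rewrite ipBr// ipBl// gp_adj11.
- by move=> x; rewrite gp_pos11; exact/nsq_ge0/hilbert_prod.
- move=> x; apply: le_trans (_ : hnorm ip2 ((x, 0) - P (x, 0)) <= _).
    exact: (nrm2_ge1 hH ((x, 0) - P (x, 0))).
  by apply: le_trans (gp_le' _) _; rewrite gp_nrm1.
- move=> y yD; have y0 : p11 y = 0 by rewrite -[p11 y](subKr y) yD subrr.
  have : nsq ip2 (P (y, 0)) = 0.
    rewrite -gp_Re /prod_ip /= ip0l// addr0 -[(P (y, 0)).1]/(p11 y).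
    by rewrite y0 ip0r.
  move=> /(nsq_eq0 (hilbert_prod hH)) P0.
  have [_ _ dT _] := aT.
  apply: (nsq_eq0 hH); apply/eqP; rewrite eq_le nsq_ge0// andbT.
  apply/ler_addgt0Pr => e e0; rewrite add0r.
  have [a [b Tab] ya] := dT y (e / (nrm y + 1)) ltac:(by rewrite divr_gt0// ltr_wpDl ?nrm_ge0).
  have h0 : ip a y = 0.
    have := gp_orth hP (y, 0) Tab; rewrite P0 subr0 /prod_ip /= ip0r//.
    by rewrite addr0.
  have -> : nsq ip y = Re (ip (y - a) y) by rewrite ipBl// h0 subr0.
  apply: le_trans (Reip_ler hH _ _) _.
  have y1 := nrm_ge0 ip y; apply: le_trans (ler_wpM2r y1 (ltW ya)) _.
  by rewrite mulrAC ler_pdivrMr ?ltr_wpDl// ler_wpM2l ?(ltW e0)// lerDl.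
Qed.

(** A vector y fixed by p22 gives a pair (0, y) in the graph of [T], hence is 0;
    [iter_contraction_cvg0] applies. *)
Lemma gp_decay22 : tends ip (fun n => iter n p22 Om) 0.
Proof.
have b22 := N_bounded (gp_N22 hP).
have Re22 x : Re (ip x (p22 x)) = nsq ip2 (P (0, x)).
  by rewrite -gp_Re /prod_ip /= ip0l// add0r.
apply: (iter_contraction_cvg0 hH b22 gp_adj22).
- by move=> x; rewrite Re22; exact/nsq_ge0/hilbert_prod.
- move=> x; apply: le_trans (nrm2_ge2 hH (P (0, x))) _.
  by apply: le_trans (gp_le _) _; rewrite gp_nrm2.
- move=> y y22'; have {y22'}y22 : p22 y = y := y22'; have := gp_nsq (0, y).
  rewrite -Re22 y22 -nsqE nsq2E /= nsq0// add0r -[X in X = _ -> _]addr0.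
  move=> /addrI /esym /(nsq_eq0 (hilbert_prod hH)) /eqP.
  rewrite subr_eq0 => /eqP e; have [[_ _ Ts] _ _ _] := aT.
  by apply: Ts; rewrite e; exact: (gp_range hP).
Qed.

(** The diagonal corners have the same total trace as for the projection onto the first summand.
    With D = 1 - p11, the trace property applied to p12 and p22^k p21 shows that the traces of
    D^(k+1) and p22^(k+1) differ by a constant independent of k; both tend to 0, so the constant is
    0. *)
Lemma gp_trace : nsq ip2 (P (Om, 0)) + nsq ip2 (P (0, Om)) = nsq ip Om.
Proof.
pose D x := x - p11 x.
have ND : N D.
  have := N_lc (-1) (gp_N11 hP) N_id.
  by congr (N _); apply/funext => x; rewrite scaleN1r addrC.
have l21 a x y : p21 (a *: x + y) = a *: p21 x + p21 y.
  exact: (bop_lin (N_bounded (gp_N21 hP))).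
have l11 a x y : p11 (a *: x + y) = a *: p11 x + p11 y.
  exact: (bop_lin (N_bounded (gp_N11 hP))).
have D21 x : p22 (p21 x) = p21 (D x).
  have [_ h _] := gp_idem x; rewrite /D (linB l21).
  by rewrite -[X in X - _]h addrAC subrr add0r.
have D21k k x : iter k p22 (p21 x) = p21 (iter k D x).
  by elim: k => //= k ->; rewrite D21.
(* Idempotence of [P] gives p22 p21 = p21 D, p12 p21 = D - D^2 and p21 p12 = p22 - p22^2. *)
have step k : ip Om (iter k.+1 D Om) - ip Om (iter k.+2 D Om) =
    ip Om (iter k.+1 p22 Om) - ip Om (iter k.+2 p22 Om).
  have := sf_trace hN (gp_N12 hP) (N_comp (N_iter k (gp_N22 hP)) (gp_N21 hP)).
  rewrite /= -/(p21 Om) -/(p12 Om) D21k -/(p21 _) -/(p12 _) -!ipBr//.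
  set z := iter k D Om.
  have [h _ _] := gp_idem z; have [_ _ h'] := gp_idem Om.
  have -> : p12 (p21 z) = D z - D (D z).
    have -> : D (D z) = D z - p11 (D z) by [].
    rewrite subKr /D (linB l11); apply: (addrI (p11 (p11 z))).
    by rewrite h addrC subrK.
  move=> ->; have -> : p21 (p12 Om) = p22 Om - p22 (p22 Om).
    by apply: (addIr (p22 (p22 Om))); rewrite h' subrK.
  have l22k := bop_lin (N_bounded (N_iter k (gp_N22 hP))).
  by rewrite (linB l22k) -!iterSr.
have cst k : ip Om (iter k.+1 D Om) - ip Om (iter k.+1 p22 Om) = ip Om (D Om) - ip Om (p22 Om).
  elim: k => // k <-; have := step k.
  set A := ip _ _; set B := ip _ _; set A' := ip _ _; set B' := ip _ _ => e.
  by have -> : A = A' - B' + B by [rewrite -e subrK]; ring.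
have eD : ip Om (D Om) = ip Om (p22 Om).
  apply/eqP; rewrite -subr_eq0 -ipBr//; apply/eqP.
  have h1 := tendsB hH (tends_shift 1 gp_decay11) (tends_shift 1 gp_decay22).
  rewrite subrr in h1.
  have := ip_lim hH (tends_cst hH Om) h1 (tends_cst hH Om) (tends_cst hH (D Om - p22 Om)).
  rewrite ip0r// => <-// n; rewrite addn1; have := cst n.
  by rewrite -[X in X = _](ipBr hH) -[X in _ = X](ipBr hH).
rewrite -!gp_Re /prod_ip /= !(ip0l hH) addr0 add0r -/(p11 Om) -/(p22 Om) -eD.
by rewrite /D ipBr// ReB nsqE; ring.
Qed.

End projection_entries.

(** The graph projections satisfy P <= Q and have equal traces by [gp_trace], so Q - P kills (Om, 0)
    and (0, Om). Its corners commute with [N'], so it also kills the pairs (w Om, 0) and (0, w Om),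
    which are total. *)
Lemma affiliated_op_maximal T U : affiliated_op T -> affiliated_op U ->
  T `<=` U -> T = U.
Proof.
move=> aT aU TU; apply/seteqP; split=> // p Up.
have [P hP] := graph_projection_exists aT; have [Q hQ] := graph_projection_exists aU.
have h2 := hilbert_prod hH.
have PQ p' : nsq ip2 (Q p' - P p') = nsq ip2 (Q p') - nsq ip2 (P p').
  rewrite nsqB//.
  have -> : Re (ip2 (Q p') (P p')) = nsq ip2 (P p').
    rewrite -(gp_Re hP) (ReipC h2) [RHS](ReipC h2); apply/eqP.
    rewrite -subr_eq0 -ReB -ipBr// -opprB ipNr// (gp_orth hQ) ?oppr0//.
    by apply: TU; exact: (gp_range hP).
  ring.
have := gp_trace aT hP; rewrite -(gp_trace aU hQ) => e.
have q1 := PQ (Om, 0); have q2 := PQ (0, Om).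
have [z1 z2] : Q (Om, 0) = P (Om, 0) /\ Q (0, Om) = P (0, Om).
  have := nsq_ge0 h2 (Q (Om, 0) - P (Om, 0)).
  have := nsq_ge0 h2 (Q (0, Om) - P (0, Om)).
  by rewrite q1 q2 => h h'; split; apply/eqP; rewrite -subr_eq0; apply/eqP/(nsq_eq0 h2);
    rewrite ?q1 ?q2; lra.
have z w : N' w -> Q (w Om, 0) = P (w Om, 0) /\ Q (0, w Om) = P (0, w Om).
  move=> Nw.
  have c11 := N_commute Om (gp_N11 hP) Nw; have c21 := N_commute Om (gp_N21 hP) Nw.
  have c12 := N_commute Om (gp_N12 hP) Nw; have c22 := N_commute Om (gp_N22 hP) Nw.
  have d11 := N_commute Om (gp_N11 hQ) Nw; have d21 := N_commute Om (gp_N21 hQ) Nw.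
  have d12 := N_commute Om (gp_N12 hQ) Nw; have d22 := N_commute Om (gp_N22 hQ) Nw.
  rewrite [Q (w Om, 0)]surjective_pairing [P (w Om, 0)]surjective_pairing.
  rewrite [Q (0, w Om)]surjective_pairing [P (0, w Om)]surjective_pairing.
  by rewrite c11 c21 c12 c22 d11 d21 d12 d22 z1 z2.
suff <- : P p = p by exact: (gp_range hP).
rewrite -{2}(gp_id hQ Up); apply/eqP; rewrite eq_sym -subr_eq0; apply/eqP.
have sQP p' p'' : ip2 p' (Q p'' - P p'') = ip2 (Q p' - P p') p''.
  by rewrite ipBr// ipBl// (gp_sym hP) (gp_sym hQ).
case E : (Q p - P p) => [a b]; congr (_, _).
  apply: (sf_sep hN) => w Nw; have := sQP (w Om, 0) p.
  by rewrite (z w Nw).1 subrr E ip0l// {1}/prod_ip /= ip0l// addr0.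
apply: (sf_sep hN) => w Nw; have := sQP (0, w Om) p.
by rewrite (z w Nw).2 subrr E ip0l// {1}/prod_ip /= ip0l// add0r.
Qed.

Lemma conjc_real (a : R) : (a%:C%C)^*%C = a%:C%C :> C.
Proof. by apply: eqC => //=; rewrite oppr0. Qed.

(* y = (1 + c^2 T* T)^-1 xi and t = T y *)
Lemma resolvent_exists T (c : R) : 0 < c -> affiliated_op T ->
  exists2 B, N B & forall xi, exists t, [/\ T (B xi, t),
    forall a b, T (a, b) -> ip a (xi - B xi) = (c ^+ 2)%:C%C * ip b t &
    forall x, T (xi, x) -> nsq ip (xi - B xi) + c ^+ 2 * nsq ip t <= c ^+ 2 * nsq ip x].
Proof.
move=> c0 aT; have [lT cT dT affT] := aT.
have c1 : c%:C%C != 0 :> C by apply/eqP => -[/eqP]; rewrite gt_eqF.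
have [T0 Tl Ts] := lT.
(* The resolvent of [T] is the upper left corner of the graph projection of c T: P (xi, 0) is the
   pair of B xi and c T (B xi). *)
pose U := graph_scale c%:C%C T.
have UE a b : T (a, b) -> U (a, c%:C%C *: b) by exists b.
have aU : affiliated_op U.
  split.
  - split=> [|a x x' y y' [z /= Tz ->] [z' /= Tz' ->]|y [z /= Tz ->]].
    + by exists 0 => //; rewrite scaler0.
    + exists (a *: z + z') => /=; first exact: Tl.
      by rewrite scalerDr !scalerA mulrC.
    + by rewrite (Ts _ Tz) scaler0.
  - apply/(closed_graphP hH) => u [x y] Uu /(tends2P hH)[/= u1 u2].
    exists (c%:C%C^-1 *: y) => /=; last by rewrite scalerA divff// scale1r.
    apply: ((closed_graphP hH T).1 cT (fun n => ((u n).1, c%:C%C^-1 *: (u n).2))).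
      move=> n; have [z /= Tz ->] := Uu n.
      by rewrite scalerA mulVf// scale1r.
    by apply/(tends2P hH) => //; split => //=; exact: tendsZ.
  - move=> x e /(dT x)[y [z Tz] xy]; exists y => //.
    by exists (c%:C%C *: z); exact: UE.
  - move=> B NB x y [z /= Tz ->]; exists (B z); first exact: affT.
    by case: NB => bB _; rewrite (linZ (bop_lin bB)).
have [P hP] := graph_projection_exists aU.
exists (fun x => (P (x, 0)).1); first exact: gp_N11 hP.
move=> xi; have [t /= Tt Pt] := gp_range hP (xi, 0); exists t; split=> //.
(* Orthogonality of (xi, 0) - P (xi, 0) to the graph is the weak form of xi - B xi = c^2 T^* T (B
   xi). *)
- move=> a b Tab; have := gp_orth hP (xi, 0) (UE _ _ Tab).
  rewrite /prod_ip /= Pt sub0r ipNr// ipZl// ipZr// conjc_real => /eqP.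
  rewrite addr_eq0 opprK => /eqP ->.
  by rewrite mulrA expr2 rmorphM.
(* The projection of (xi, 0) is at least as close to it as the graph point (xi, c x). *)
- move=> x Tx; have := gp_min aU hP (xi, 0) (UE _ _ Tx).
  rewrite !nsq2E /= Pt !sub0r subrr nsq0// add0r !nsqN// !nsqZ// normsq_real.
  by [].
Qed.

Lemma cvg_geom0 (k : nat) (M : R) :
  (n.+1%:R^-1 : R) ^+ k.+1 * M @[n --> \oo] --> (0 : R).
Proof.
rewrite -[X in _ --> X](mul0r M); apply: cvgMl.
have -> : (0 : R) = 0 ^+ k.+1 by rewrite expr0n.
apply: (@cvg_comp _ _ _ (fun n : nat => n.+1%:R^-1 : R) (fun x : R => x ^+ k.+1)).
  exact: cvg_harmonic.
exact: exprn_continuous.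
Qed.

(** A competitor a <= T^* T can only be compared where T^* T is defined, so [Om] is replaced by y =
    (1 + c^2 T^* T)^-1 Om. There <y, a y> <= |T y|^2 <= |x|^2, and y tends to [Om] as c tends to
    0. *)
Lemma L2_norm2_le T x : affiliated_op T -> T (Om, x) ->
  (L2_norm2 ip N Om T <= (nsq ip x)%:E)%E.
Proof.
move=> aT TOm; apply: ge_ereal_sup => _ [a [Na a0 aTT] <-]; rewrite lee_fin.
have c0 n : 0 < n.+1%:R^-1 :> R by rewrite invr_gt0.
have /choice[Y hY] n : exists y, nsq ip (Om - y) <= (n.+1%:R^-1) ^+ 2 * nsq ip x /\
    Re (ip y (a y)) <= nsq ip x.
  have [B NB hB] := resolvent_exists (c0 n) aT; have [t [Tt h1 h2]] := hB Om.
  exists (B Om); have := h2 _ TOm; have t0 := nsq_ge0 hH t.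
  set c := n.+1%:R^-1; have c2 : 0 < c ^+ 2 by rewrite exprn_gt0// c0.
  have y0 := nsq_ge0 hH (Om - B Om) => h; split; first by nra.
  have cc : (c ^+ 2)%:C%C != 0 :> C by apply/eqP => -[/eqP]; rewrite gt_eqF.
  have TT : graph_comp (graph_adjoint ip T) T (B Om, (c ^+ 2)%:C%C^-1 *: (Om - B Om)).
    exists t => // x' y' T' /=; rewrite ipZl// (hilbert_sym hH x') (h1 _ _ T').
    rewrite conjcM conjc_real -(hilbert_sym hH) -[_%:C%C^-1]fmorphV conjc_real fmorphV.
    by rewrite mulrA mulVf// mul1r.
  have := aTT _ _ TT; rewrite lecE => /andP[_ /le_trans]; apply.
  rewrite ipZr// (h1 _ _ Tt) mulrA mulVf// mul1r -nsqE.
  by rewrite -(ler_pM2l c2); lra.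
have YOm : tends ip Y Om.
  apply: (tends_nsq hH); apply: (@squeeze_cvgr _ _ _ _ (fun=> 0)
      (fun n => (n.+1%:R^-1) ^+ 2 * nsq ip x)); last 2 first.
  - exact: cvg_cst.
  - exact: cvg_geom0.
  apply: nearW => n; rewrite nsq_ge0//= -nsqN// opprB.
  by case: (hY n).
have := cvg_Reip hH YOm (bop_tends (N_bounded Na) YOm).
by move=> /(ler_cvg_to)/(_ (cvg_cst (nsq ip x))); apply; apply: nearW => n; case: (hY n).
Qed.

(** The operators T^* T (1 + c^2 T^* T)^-1 are admissible in the supremum, which bounds |T y| for y
    = (1 + c^2 T^* T)^-1 Om. As c decreases to 0 the vectors T y form a Cauchy sequence, and
    closedness puts [Om] into the domain. *)
Lemma L2_norm2_ge T : affiliated_op T -> (L2_norm2 ip N Om T < +oo)%E ->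
  exists2 x, T (Om, x) & ((nsq ip x)%:E <= L2_norm2 ip N Om T)%E.
Proof.
move=> aT fT.
have N0 : N (fun=> 0).
  have := N_lc (-1) N_id N_id; congr (N _).
  by apply/funext => x; rewrite scaleN1r addNr.
have L0 : (0 <= L2_norm2 ip N Om T)%E.
  apply: ereal_sup_ubound; exists (fun=> 0); last by rewrite /trace ip0r.
  split=> // [x|x y [t /= Tt adj]]; first by rewrite ip0r.
  rewrite ip0r// (hilbert_sym hH) -(adj _ _ Tt) ipxx// conjc_real lecE /= eqxx.
  exact: nsq_ge0.
have [M ME] : exists M : R, L2_norm2 ip N Om T = M%:E.
  by exists (fine (L2_norm2 ip N Om T)); rewrite fineK// ge0_fin_numE.
rewrite ME; have [lT cT dT affT] := aT.
have c0 n : 0 < n.+1%:R^-1 :> R by rewrite invr_gt0.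
have res n := resolvent_exists (c0 n) aT.
have /choice[y] n : exists y, exists t, [/\ T (y, t),
    forall a b, T (a, b) -> ip a (Om - y) = ((n.+1%:R^-1) ^+ 2)%:C%C * ip b t &
    nsq ip (Om - y) <= (n.+1%:R^-1) ^+ 2 * M /\ nsq ip t <= M].
  have [B NB hB] := res n; have [t [Tt h1 _]] := hB Om.
  exists (B Om), t; split=> //.
  set c := n.+1%:R^-1; have c2 : 0 < c ^+ 2 by rewrite exprn_gt0// c0.
  (* (1 - B)/c^2 equals T^* T B: a bounded element of [N] lying between 0 and T^* T. *)
  pose a x := (c ^+ 2)%:C%C^-1 *: (x - B x).
  have Na : N a.
    have NB' : N (fun x => (-1) *: B x + x) by apply: N_lc => //; exact: N_id.
    have := N_lc ((c ^+ 2)%:C%C^-1) NB' N0; congr (N _).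
    by apply/funext => x; rewrite addr0 scaleN1r addrC.
  have cc : (c ^+ 2)%:C%C != 0 :> C by apply/eqP => -[/eqP]; rewrite gt_eqF.
  have cV : (c ^+ 2)%:C%C^-1 = ((c ^+ 2)^-1)%:C%C :> C by rewrite fmorphV.
  have aE x : exists2 r : R, ip x (a x) = r%:C%C & 0 <= r /\
     forall t', T (x, t') -> r <= nsq ip t'.
    have [t' [Tt' h1' h2']] := hB x.
    exists ((c ^+ 2)^-1 * (nsq ip (x - B x) + c ^+ 2 * nsq ip t')).
      rewrite /a ipZr// cV rmorphM /=; congr (_ * _).
      have -> : ip x (x - B x) = ip (x - B x) (x - B x) + ip (B x) (x - B x).
        by rewrite -ipDl// subrK.
      by rewrite (h1' _ _ Tt') !ipxx// -/c; apply: eqC => /=; ring.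
    split=> [|s Ts].
      apply: mulr_ge0; first by rewrite invr_ge0 ltW.
      by apply: addr_ge0; [|apply: mulr_ge0; first exact: ltW]; exact: nsq_ge0.
    by rewrite mulrC ler_pdivrMr// [leRHS]mulrC; exact: h2'.
  have : ((Re (trace ip Om a))%:E <= M%:E)%E.
    rewrite -ME; apply: ereal_sup_ubound; exists a => //; split=> //.
      by move=> x; have [r -> [r0 _]] := aE x; rewrite lecE /= eqxx.
    move=> x z [s /= Ts adj]; have [r -> [_ r1]] := aE x.
    rewrite (hilbert_sym hH) -(adj _ _ Ts) ipxx// conjc_real lecE /= eqxx.
    exact: r1.
  rewrite lee_fin /trace /a ipZr// cV ReMr mulrC ler_pdivrMr//.
  have -> : ip Om (Om - B Om) = ip (Om - B Om) (Om - B Om) + ip (B Om) (Om - B Om).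
    by rewrite -ipDl// subrK.
  rewrite ReD -nsqE (h1 _ _ Tt) ReMr -nsqE => h.
  rewrite -/c in h; have := nsq_ge0 hH (Om - B Om).
  have t0 : 0 <= c ^+ 2 * nsq ip t by rewrite mulr_ge0 ?(ltW c2)//; exact: nsq_ge0.
  by split; [lra | rewrite -(ler_pM2l c2); lra].
move=> /choice[t hyt].
have yOm : tends ip y Om.
  apply: (tends_nsq hH); apply: (@squeeze_cvgr _ _ _ _ (fun=> 0)
      (fun n => (n.+1%:R^-1) ^+ 2 * M)); last 2 first.
  - exact: cvg_cst.
  - exact: cvg_geom0.
  by apply: nearW => n; rewrite nsq_ge0//= -nsqN// opprB; case: (hyt n) => _ _ [].
(* Subtracting the two resolvent equations shows that <t m - t n, t n> has nonnegative real part,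
   because the parameters satisfy c' < c; so the squared norm grows by at least |t m - t n|^2. *)
have mono m n : (n <= m)%N -> nsq ip (t m - t n) <= nsq ip (t m) - nsq ip (t n).
  rewrite leq_eqVlt => /predU1P[->|nm]; first by rewrite !subrr nsq0.
  have [Tm hm _] := hyt m; have [Tn hn _] := hyt n.
  have c2 k : 0 < (k.+1%:R^-1 : R) ^+ 2 by rewrite exprn_gt0// c0.
  pose c : R := (n.+1%:R^-1) ^+ 2; pose c' : R := (m.+1%:R^-1) ^+ 2.
  have cc : c' < c.
    by rewrite /c /c' ltr_sqr ?nnegrE ?ltW// ltf_pV2 ?posrE// ltr_nat.
  have e1 : ip (y m - y n) (Om - y n) = c%:C%C * ip (t m - t n) (t n).
    by rewrite !ipBl// (hn _ _ Tm) (hn _ _ Tn) mulrBr.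
  have e2 : ip (y m - y n) (Om - y m) = c'%:C%C * ip (t m - t n) (t m).
    by rewrite !ipBl// (hm _ _ Tm) (hm _ _ Tn) mulrBr.
  have e3 : nsq ip (y m - y n) = c * Re (ip (t m - t n) (t n)) - c' * Re (ip (t m - t n) (t m)).
    rewrite -!ReMr -e1 -e2 -ReB -ipBr// nsqE; congr (Re (ip _ _)).
    by hring hH.
  have e4 : Re (ip (t m - t n) (t m)) = nsq ip (t m - t n) + Re (ip (t m - t n) (t n)).
    by rewrite nsqE -ReD -ipDr// subrK.
  have e5 : nsq ip (t m) = nsq ip (t m - t n) + nsq ip (t n) + 2 * Re (ip (t m - t n) (t n)).
    by rewrite -nsqD// subrK.
  have p1 := nsq_ge0 hH (y m - y n); have p2 := nsq_ge0 hH (t m - t n).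
  have c'0 : 0 < c' by exact: c2.
  move: e3; rewrite e4 => e3.
  have : 0 <= (c - c') * Re (ip (t m - t n) (t n)) by nra.
  by rewrite pmulr_rge0 ?subr_gt0// => ?; lra.
have [z tz] : exists z, tends ip t z.
  apply: (hilbert_complete hH) => e e0.
  pose s n := nsq ip (t n).
  have scvg : cvgn s.
    apply: nondecreasing_is_cvgn.
      apply/nondecreasing_seqP => n; have := mono n.+1 n (leqnSn _).
      by have := nsq_ge0 hH (t n.+1 - t n); rewrite /s; lra.
    by exists M => _ [n _ <-]; case: (hyt n) => _ _ [].
  have sl : s n @[n --> \oo] --> limn s by [].
  have e4 : 0 < e ^+ 2 / 2 by rewrite divr_gt0// exprn_gt0.
  have /cvgrPdist_lt/(_ _ e4)[K _ hK] := sl.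
  have key m n : (K <= n <= m)%N -> nrm (t m - t n) < e.
    move=> /andP[Kn nm]; rewrite -(@ltr_sqr _ _ e) ?nnegrE ?nrm_ge0 ?(ltW e0)// nrmE//.
    apply: le_lt_trans (mono _ _ nm) _; rewrite -/(s m) -/(s n).
    have := hK m (leq_trans Kn nm); have := hK n Kn => /=.
    by rewrite !ltr_norml => /andP[? ?] /andP[? ?]; lra.
  exists K => m n Km Kn; have [nm|/ltnW mn] := leqP n m.
    by apply: key; rewrite Kn.
  by rewrite nrmBC//; apply: key; rewrite Km.
exists z.
  apply: ((closed_graphP hH T).1 cT (fun n => (y n, t n))).
    by move=> n; case: (hyt n).
  by apply/(tends2P hH).
rewrite lee_fin; apply: ler_cvg_to (cvg_nsq hH tz) (cvg_cst _) _.
by apply: nearW => n; case: (hyt n) => _ _ [].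
Qed.

(** [E] is the spectral projection of B = (1 + c^2 T^* T)^-1 for B >= 1/2. On its range B is
    invertible, so that range lies in the range of B, hence in the domain of T. Off it 1 - B >= 1/2,
    so the trace of 1 - E is at most twice that of 1 - B, which is at most c^2 |x|^2. *)
Lemma small_projection T x (e : R) : affiliated_op T -> T (Om, x) -> 0 < e ->
  exists E, [/\ projection ip N E, range E `<=` Defs.dom T &
    Re (trace ip Om (fun x => x - E x)) <= e].
Proof.
move=> aT TOm e0.
(* Chosen so that 2 c^2 |x|^2 <= e; the added 1 keeps the denominator positive. *)
pose c := Num.sqrt (e / (2 * (nsq ip x + 1))).
have x0 := nsq_ge0 hH x.
have c20 : 0 < e / (2 * (nsq ip x + 1)) by rewrite divr_gt0// mulr_gt0//; lra.
have c0 : 0 < c by rewrite sqrtr_gt0.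
have cE : c ^+ 2 = e / (2 * (nsq ip x + 1)) by rewrite sqr_sqrtr// ltW.
have c2x : 2 * (c ^+ 2 * nsq ip x) <= e.
  have : c ^+ 2 * (2 * (nsq ip x + 1)) = e by rewrite cE mulfVK//; apply: lt0r_neq0; lra.
  have : 0 <= c ^+ 2 by exact: sqr_ge0.
  by lra.
have [B NB hB] := resolvent_exists c0 aT.
have bB := N_bounded NB; have lB := bop_lin bB.
have c2C : (c ^+ 2)%:C%C != 0 :> C.
  by apply/eqP => -[/eqP]; rewrite gt_eqF// exprn_gt0.
have ReB' y : exists2 t, T (B y, t) & ip y (B y) = (nsq ip (B y) + c ^+ 2 * nsq ip t)%:C%C
     /\ forall z, ip y (B z) = ip (B y) z.
  have [t [Tt h1 _]] := hB y; exists t => //; split.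
    rewrite -{1}[y](subrK (B y)) ipDl// (hilbert_sym hH) (h1 _ _ Tt).
    by rewrite conjcM conjc_real -(hilbert_sym hH) !ipxx// -rmorphM -rmorphD addrC.
  move=> z; have [s [Ts h2 _]] := hB z.
  rewrite -{1}[y](subrK (B y)) ipDl// (hilbert_sym hH (B z)) (h1 _ _ Ts).
  rewrite conjcM conjc_real -(hilbert_sym hH) -{2}[z](subrK (B z)) [in RHS]ipDr//.
  by rewrite (h2 _ _ Tt).
have sB : is_adjoint ip B B by move=> y z; have [t _ [_]] := ReB' y; exact.
have pB y : nsq ip (B y) <= Re (ip y (B y)).
  have [t _ [-> _]] := ReB' y; rewrite /= lerDl mulr_ge0 ?nsq_ge0//.
  exact: sqr_ge0.
pose D y := y - B y.
have lD a y z : D (a *: y + z) = a *: D y + D z by rewrite /D lB; hring hH.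
have pD y : nsq ip (D y) <= Re (ip y (D y)).
  rewrite /D nsqB// ipBr// ReB -nsqE; have := pB y; lra.
pose A y := B y - D y.
have AE y : A y = B y + B y - y by rewrite /A /D; hring hH.
have bA : bounded_op ip A.
  have := bop_lc hH 1 bB (bop_lc hH (-1) (bop_id ip) bB).
  congr (bounded_op _ _); apply/funext => y.
  by rewrite AE scale1r scaleN1r; hring hH.
have sA : is_adjoint ip A A.
  by move=> y z; rewrite !AE ipBr// ipBl// ipDr// ipDl// sB.
have cA y : nrm (A y) <= nrm y.
  rewrite ler_nrm// AE -[B y + B y]scale1r scalerDr !scale1r.
  have -> : B y + B y = 2 *: B y by rewrite scalerDl scale1r.
  rewrite nsqB// nsqZ// ipZl// (_ : normsq 2 = 4); last first.
    by rewrite /normsq /=; ring.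
  rewrite (_ : 2^*%C = 2%:C%C :> C); last by rewrite natrC conjc_real.
  by rewrite ReMr ReipC//; have := pB y; lra.
have [K [Ks Kc KB Kpos Kneg]] := positive_subspace hH bA sA cA.
have [E [bE EK Eid Eo Es]] := projection_operator hH Ks Kc.
have BA y : B (A y) = A (B y) by rewrite !AE (linB lB) (linD lB).
have KBK y : K y -> K (B y) by apply: KB.
have KDK y : K y -> K (D y).
  move=> Ky; have [_ Kl] := Ks; rewrite /D addrC -scaleN1r; apply: Kl => //.
  exact: KBK.
have NE : N E.
  rewrite (sf_N hN); apply: (commutant_projection hH (K := K)) => //.
    by move=> w Nw; split; [exact: N'_bounded | exact: sf_adjN' hN _ Nw].
  move=> w y Nw Ky; apply: KB => //; first exact: N'_bounded.
  move=> z; have lw := bop_lin (N'_bounded Nw).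
  by rewrite !AE (linB lw) (linD lw) (N_commute z NB Nw).
have EE : E \o E = E by apply/funext => y /=; exact/Eid/EK.
exists E; split=> //.
- move=> _ [y0 _ <-]; set z := E y0; have Kz : K z by exact: EK.
  (* On [K] positivity of A = 1 - 2 D means D <= 1/2. The norm bound also uses positivity of A at D
     y, which is available because [D] preserves [K]. *)
  have half y : K y -> nrm (D y) <= 2^-1 * nrm y.
    move=> Ky; have h1 := Kpos _ Ky; have h2 := Kpos _ (KDK _ Ky).
    have sD y' z' : ip y' (D z') = ip (D y') z' by rewrite /D ipBr// ipBl// sB.
    have AD y' : A y' = y' - (D y' + D y') by rewrite /A /D; hring hH.
    have h3 : 0 <= Re (ip (A y) (D (A y))).
      by apply: le_trans (pD (A y)); exact: nsq_ge0.
    have DA : D (A y) = A (D y) by rewrite !AD (linB lD) (linD lD).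
    (* D A (2 D + A) = D A, where 2 D + A = 1 *)
    have e1 : Re (ip y (D (A y))) = 2 * Re (ip (D y) (A (D y))) + Re (ip (A y) (D (A y))).
      have {1}-> : y = D y + D y + A y by rewrite AD addrC subrK.
      by rewrite (ipDl hH (D y + D y)) (ipDl hH (D y)) !ReD -DA; ring.
    have e2 : Re (ip y (D (A y))) = Re (ip y (D y)) - 2 * nsq ip (D y).
      rewrite AD (linB lD) (linD lD) (ipBr hH y) (ipDr hH y) ReB ReD (sD y (D y)).
      by rewrite -nsqE; ring.
    have ey : Re (ip y (A y)) = nsq ip y - 2 * Re (ip y (D y)).
      by rewrite AD (ipBr hH y) (ipDr hH y) ReB ReD -nsqE; ring.
    apply: nrm_le => //; first by rewrite mulr_ge0 ?invr_ge0 ?nrm_ge0.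
    rewrite exprMn nrmE// (_ : 2^-1 ^+ 2 = 4^-1); last by field.
    by lra.
  (* Partial sums of the Neumann series for the inverse of B = 1 - D on [K], applied to [z]. *)
  pose v := fix v n := if n is k.+1 then z + D (v k) else 0.
  have vD n : v n.+2 - v n.+1 = D (v n.+1 - v n).
    by rewrite /= -/(v n) (linB lD) (linD lD); hring hH.
  have Kv n : K (v n.+1 - v n).
    by elim: n => [|n IH]; [rewrite /= (lin0 lD) addr0 subr0 | rewrite vD; exact: KDK].
  have vd n : nrm (v n.+1 - v n) <= (2^-1) ^+ n * nrm z.
    elim: n => [|n IH]; first by rewrite /= (lin0 lD) addr0 subr0 expr0 mul1r.
    rewrite vD; apply: le_trans (half _ (Kv n)) _.
    by rewrite exprS -mulrA ler_wpM2l// invr_ge0.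
  have [y vy] : exists y, tends ip v y.
    apply: (@cvg_of_increments _ _ _ hH v (fun n => - (2^-1) ^+ n) (2 * nrm z)).
    - by rewrite mulr_ge0 ?nrm_ge0.
    - by move=> n; rewrite lerN2 exprS ler_piMl ?exprn_ge0 ?invr_ge0// invf_le1// ler1n.
    - by exists 0 => n; rewrite oppr_le0 exprn_ge0 ?invr_ge0.
    - move=> n; apply: le_trans (vd n) _; rewrite exprS; set q := _ ^+ n.
      by have := nrm_ge0 ip z; lra.
  have bD : bounded_op ip D.
    have := bop_lc hH (-1) bB (bop_id ip); congr (bounded_op _ _).
    by apply/funext => y'; rewrite scaleN1r addrC.
  have zE : B y = z.
    have h1 := tends_shift 1 vy.
    have h2 : tends ip (fun n => v (n + 1)%N) (z + D y).
      have -> : (fun n => v (n + 1)%N) = fun n => z + (D \o v) n.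
        by apply/funext => n; rewrite addn1.
      by apply: tendsD => //; [exact: tends_cst | exact: bop_tends].
    have h := tends_unique hH h1 h2.
    by apply: (addIr (D y)); rewrite -h /D addrC subrK.
  by have [t [Tt _ _]] := hB y; exists t; rewrite -zE.
- rewrite /trace; set y := Om - E Om.
  have yK k : K k -> ip k y = 0 by move=> Kk; exact: Eo.
  have e1 : ip Om y = ip y y.
    have -> : ip y y = ip (Om - E Om) y by [].
    by rewrite ipBl// (yK _ (EK Om)) subr0.
  (* Om = E Om + y, and the cross terms vanish since [D] preserves [K] while [y] is orthogonal to
     it. *)
  have e2 : Re (ip Om (D Om)) = Re (ip (E Om) (D (E Om))) + Re (ip y (D y)).
    have -> : D Om = D (E Om) + D y by rewrite -(linD lD) addrC subrK.
    have -> : ip Om (D (E Om) + D y) = ip (E Om + y) (D (E Om) + D y).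
      by congr (ip _ _); rewrite /y addrC subrK.
    rewrite (ipDl hH (E Om) y) (ipDr hH (E Om)) (ipDr hH y (D (E Om))) !ReD.
    rewrite (ReipC hH y (D (E Om))).
    have sD y' z' : ip y' (D z') = ip (D y') z' by rewrite /D ipBr// ipBl// sB.
    rewrite (sD _ y) !yK /= ?addr0 ?add0r//; exact/KDK/EK.
  have := Kneg y yK; have [t [Tt h1 h2]] := hB Om.
  have := h2 _ TOm; rewrite e1 -nsqE.
  have := pD (E Om); have := nsq_ge0 hH (D (E Om)).
  have : Re (ip Om (D Om)) = nsq ip (Om - B Om) + c ^+ 2 * nsq ip t.
    rewrite -{1}[Om](subrK (B Om)) ipDl// ReD -nsqE (h1 _ _ Tt) ReMr.
    by rewrite -nsqE.
  rewrite e2 /A ipBr// ReB {1}[B y](_ : _ = y - D y); last by rewrite /D subKr.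
  rewrite ipBr// ReB -(nsqE ip y).
  by lra.
Qed.

(* left multiplication by x, as the adjoint of the densely defined w Om |-> w (J x), w in N' *)
Definition left_mul x : set (H * H) :=
  [set p | forall w, N' w -> ip p.2 (w Om) = ip p.1 (w (J x))].

(** Antilinearity is not part of [standard_form]: it follows from [sf_J], since the vectors w Om
    separate. *)
Lemma JD a x y : J (a *: x + y) = a^*%C *: J x + J y.
Proof.
apply/eqP; rewrite -subr_eq0; apply/eqP/(sf_sep hN) => w Nw.
have [w' Nw' ww'] := sf_adjN' hN Nw.
have w'w := adjoint_sym hH ww'.
rewrite ipBr// (hilbert_sym hH) -(sf_J hN _ Nw' Nw w'w).
rewrite !(ipDr hH) !(ipZr hH) !(sf_J hN _ Nw' Nw w'w).
by rewrite conjcD conjcM -!(hilbert_sym hH) subrr.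
Qed.

Lemma sf_J2 w w' x : N' w -> N' w' -> is_adjoint ip w w' ->
  ip x (w Om) = ip (w' Om) (J x).
Proof. by move=> Nw Nw' ww'; rewrite (hilbert_sym hH) (sf_J hN _ Nw Nw' ww') -(hilbert_sym hH). Qed.

(** This makes [left_mul x] densely defined. It is [sf_J2] for the operator w^* v, whose adjoint is
    v^* w. *)
Lemma left_mul_dom w x : N' w -> left_mul x (w Om, w x).
Proof.
move=> Nw v Nv /=.
have [w' Nw' ww'] := sf_adjN' hN Nw; have [v' Nv' vv'] := sf_adjN' hN Nv.
have w'w := adjoint_sym hH ww'.
rewrite -[LHS]w'w -[w' (v Om)]/((w' \o v) Om).
rewrite (@sf_J2 _ (v' \o w)) ?vv' //; [exact: N'_comp | exact: N'_comp|].
by move=> y z /=; rewrite w'w vv'.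
Qed.

Lemma left_mul_closed x : closed_graph ip (left_mul x).
Proof.
apply/(closed_graphP hH) => u p up /(tends2P hH)[u1 u2] w Nw.
by apply: (ip_lim hH u2 (tends_cst hH _) u1 (tends_cst hH _)) => n; exact: up.
Qed.

Lemma left_mul_affiliated x : affiliated_op (left_mul x).
Proof.
split; last first.
- move=> B; rewrite (sf_N' hN) => NB y z yz w Nw /=.
  have [B' NB' BB'] := sf_adjN' hN NB; have B'B := adjoint_sym hH BB'.
  by rewrite -!B'B; exact: (yz (B' \o w) (N'_comp NB' Nw)).
- move=> y e e0; have [u [Nu uy]] := N'_cyclic y.
  have /tendsP/(_ _ e0)[n hn] := uy.
  exists (u n Om); last by rewrite nrmBC// hn.
  by exists (u n x); exact: left_mul_dom.
- exact: left_mul_closed.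
- split=> [w Nw|a y y' z z' h h' w Nw|y h] /=; first by rewrite !ip0l.
    by rewrite !(ipDl hH) !(ipZl hH) (h _ Nw) (h' _ Nw).
  apply: (sf_sep hN) => w Nw; rewrite (hilbert_sym hH) (h _ Nw) /= ip0l//.
  exact: conjc0.
Qed.

Lemma left_mul_Om x : left_mul x (Om, x).
Proof. exact: (left_mul_dom x N'_id). Qed.

Lemma affiliated_op_dom T x w : affiliated_op T -> T (Om, x) -> N' w -> T (w Om, w x).
Proof. by move=> [_ _ _ aT] TOm Nw; apply: aT => //; rewrite (sf_N' hN). Qed.

(** [T] and [left_mul x] are not comparable a priori, but both extend their intersection. This is
    again closed and affiliated, and densely defined since it contains all pairs (w Om, w x);
    maximality applies to each of the two extensions. *)
Lemma affiliated_opE T x : affiliated_op T -> T (Om, x) -> T = left_mul x.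
Proof.
move=> aT TOm; have aL := left_mul_affiliated x.
have aI : affiliated_op (T `&` left_mul x).
  have [[T0 Tl Ts] cT dT fT] := aT; have [[L0 Ll Ls] cL dL fL] := aL.
  split.
  - split=> //; last by move=> y [h _]; exact: Ts.
    by move=> a y y' z z' [h1 h2] [h3 h4]; split; [exact: Tl | exact: Ll].
  - move=> p hp; split; [apply: cT => e e0 | apply: cL => e e0];
    by have [q [Tq Lq] pq] := hp e e0; exists q.
  - move=> y e e0; have [u [Nu uy]] := N'_cyclic y.
    have /tendsP/(_ _ e0)[n hn] := uy.
    exists (u n Om); last by rewrite nrmBC// hn.
    by exists (u n x); split; [exact: (affiliated_op_dom aT) | exact: left_mul_dom].
  - by move=> B NB y z [h1 h2]; split; [exact: fT | exact: fL].
by rewrite -(affiliated_op_maximal aI aT)//; apply: affiliated_op_maximal.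
Qed.

Lemma graph_closureP (G : set (H * H)) p : graph_closure ip G p <->
  exists u, (forall n, G (u n)) /\ tends ip2 u p.
Proof.
split=> [hp|[u [Gu /(tends2P hH)[/tendsP u1 /tendsP u2]]] e e0].
  have /choice[u hu] n : exists q, G q /\
      (nrm (p.1 - q.1) < n.+1%:R^-1 /\ nrm (p.2 - q.2) < n.+1%:R^-1).
    by have [|q] := hp n.+1%:R^-1; [rewrite invr_gt0 | exists q].
  exists u; split=> [n|]; first by case: (hu n).
  by apply/(tends2P hH); split; apply: (tends_squeeze cvg_harmonic) => n;
     rewrite nrmBC// ltW//; case: (hu n) => _ [].
have [N1 h1] := u1 _ e0; have [N2 h2] := u2 _ e0.
exists (u (maxn N1 N2)) => //; split; rewrite nrmBC//.
  by rewrite h1// leq_maxl.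
by rewrite h2// leq_maxr.
Qed.

Lemma graph_closure_sub (G U : set (H * H)) : G `<=` U -> closed_graph ip U ->
  graph_closure ip G `<=` U.
Proof.
move=> GU cU p hp; apply: cU => e e0; have [q Gq pq] := hp e e0.
by exists q => //; exact: GU.
Qed.

(** Invariance under [N'] makes the closure affiliated, and together with (Om, x) it gives the dense
    domain of the w Om; so only closability has to be checked before [affiliated_opE] identifies the
    closure. *)
Lemma graph_closureE (G : set (H * H)) x : G (0, 0) ->
  (forall a y y' z z', G (y, z) -> G (y', z') -> G (a *: y + y', a *: z + z')) ->
  (forall B y z, N' B -> G (y, z) -> G (B y, B z)) ->
  (forall y, graph_closure ip G (0, y) -> y = 0) -> G (Om, x) ->
  graph_closure ip G = left_mul x.
Proof.
move=> G0 Gl Ga Gs GOm.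
have sub : G `<=` graph_closure ip G.
  by move=> p Gp e e0; exists p => //; rewrite !subrr nrm0.
apply: affiliated_opE; last exact: sub.
split.
- split=> //; first exact: sub.
  move=> a y y' z z' /graph_closureP[u [Gu up]] /graph_closureP[v [Gv vp]].
  apply/graph_closureP; exists (fun n => a *: u n + v n); split=> [n|].
    by case: (u n) (v n) (Gu n) (Gv n) => [? ?] [? ?]; exact: Gl.
  have := tendsD (hilbert_prod hH) (tendsZ (hilbert_prod hH) a up) vp.
  by rewrite [_ + _ in X in X -> _]surjective_pairing.
- move=> p hp e e0; have e2 : 0 < e / 2 by rewrite divr_gt0.
  have [q /(_ _ e2)[r Gr [r1 r2]] [q1 q2]] := hp _ e2; exists r => //.
  split; first by apply: le_lt_trans (ler_nrmB hH _ q.1 _) _; lra.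
  by apply: le_lt_trans (ler_nrmB hH _ q.2 _) _; lra.
- move=> y e e0; have [u [Nu uy]] := N'_cyclic y.
  have /tendsP/(_ _ e0)[n hn] := uy.
  exists (u n Om); last by rewrite nrmBC// hn.
  by exists (u n x); apply: sub; exact: Ga.
- move=> B; rewrite (sf_N' hN) => NB y z /graph_closureP[u [Gu /(tends2P hH)[u1 u2]]].
  apply/graph_closureP; exists (fun n => (B (u n).1, B (u n).2)); split=> [n|].
    by apply: Ga => //; rewrite -surjective_pairing.
  have bB := N'_bounded NB.
  by apply/(tends2P hH); split; [exact: (bop_tends bB u1) | exact: (bop_tends bB u2)].
Qed.

Lemma JDx x y : J (x + y) = J x + J y.
Proof. by have := JD 1 x y; rewrite conjc1 !scale1r. Qed.

Lemma JZx a x : J (a *: x) = a^*%C *: J x.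
Proof.
have J0 : J 0 = 0.
  have := JD (-1) 0 0; rewrite scaler0 addr0 => {1}->.
  by rewrite conjcN conjc1 scaleN1r addNr.
by rewrite -[a *: x]addr0 JD J0 addr0.
Qed.

Lemma left_mul_add x y p z z' : left_mul x (p, z) -> left_mul y (p, z') ->
  left_mul (x + y) (p, z + z').
Proof.
move=> h h' w Nw /=; rewrite ipDl// (h _ Nw) (h' _ Nw) JDx.
by rewrite (linD (bop_lin (N'_bounded Nw))) ipDr.
Qed.

(** The algebraic sum is closable because it is contained in the closed operator
    [left_mul (x + y)]. *)
Lemma strong_add_left_mul x y :
  strong_add ip (left_mul x) (left_mul y) = left_mul (x + y).
Proof.
have [[x0 xl xs] cx _ fx] := left_mul_affiliated x.
have [[y0 yl ys] cy _ fy] := left_mul_affiliated y.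
have [[_ _ xys] cxy _ _] := left_mul_affiliated (x + y).
have sub : graph_add (left_mul x) (left_mul y) `<=` left_mul (x + y).
  by move=> [p q] /= [z [z' [h h' /= ->]]]; exact: left_mul_add.
apply: graph_closureE.
- by exists 0, 0; rewrite addr0.
- move=> a z z' t t' [u [v /= [h1 h2 ->]]] [u' [v' /= [h3 h4 ->]]].
  exists (a *: u + u'), (a *: v + v'); split=> //=; [exact: xl | exact: yl |].
  by rewrite scalerDr addrACA.
- move=> B z t NB [u [v /= [h1 h2 ->]]]; exists (B u), (B v); split=> /=.
  + by apply: fx => //; rewrite (sf_N' hN).
  + by apply: fy => //; rewrite (sf_N' hN).
  + by rewrite (linD (bop_lin (N'_bounded NB))).
- by move=> z /(graph_closure_sub sub cxy) /xys.
- by exists x, y; split=> //; exact: left_mul_Om.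
Qed.

(* the hypothesis on k provides a densely defined adjoint of the composition *)
Lemma strong_mul_left_mul x y h k : left_mul x (y, h) -> left_mul (J y) (J x, k) ->
  strong_mul ip (left_mul x) (left_mul y) = left_mul h.
Proof.
move=> xyh yxk.
have [[x0 xl xs] cx _ fx] := left_mul_affiliated x.
have [[y0 yl ys] cy _ fy] := left_mul_affiliated y.
(* [left_mul (J y)] is contained in the adjoint of [left_mul y]: it is the closure of w Om |-> w (J
   y), for which the relation is the definition of [left_mul y]. *)
have dual p q p' q' : left_mul y (p, q) -> left_mul (J y) (p', q') -> ip q p' = ip p q'.
  move=> ypq.
  pose G : set (H * H) := [set r | exists2 w, N' w & r = (w Om, w (J y))].
  have [[_ _ Js] cJ _ _] := left_mul_affiliated (J y).
  have -> : left_mul (J y) = graph_closure ip G.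
    apply/esym/graph_closureE.
    - have N0 : N' (fun z => (-1) *: id z + id z) by apply: N'_lc; exact: N'_id.
      by exists (fun z => (-1) *: id z + id z); rewrite //= !scaleN1r !addNr.
    - move=> a _ _ _ _ [w Nw [-> ->]] [v Nv [-> ->]].
      by exists (fun z => a *: w z + v z) => //; exact: N'_lc.
    - by move=> B _ _ NB [w Nw [-> ->]]; exists (B \o w) => //; exact: N'_comp.
    - move=> z hz; apply: Js; apply: graph_closure_sub hz => // _ [w Nw ->].
      exact: left_mul_dom.
    - by exists id => //; exact: N'_id.
  move=> /graph_closureP[u [Gu /(tends2P hH)[/= u1 u2]]].
  apply: (ip_lim hH (tends_cst hH q) u1 (tends_cst hH p) u2) => n.
  by have [w Nw ->] := Gu n; exact: ypq.
apply: graph_closureE.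
- by exists 0.
- move=> a z z' t t' [u /= h1 h2] [u' /= h3 h4].
  by exists (a *: u + u'); [exact: yl | exact: xl].
- move=> B z t NB [u /= h1 h2]; exists (B u); [apply: fy|apply: fx] => //;
  by rewrite (sf_N' hN).
(* Closability: paired with w Om, the second components give the inner products of the first
   components with w k, and these tend to 0. *)
- move=> z /graph_closureP[u [hu /(tends2P hH)[/= u1 u2]]].
  apply: (sf_sep hN) => w Nw; rewrite (hilbert_sym hH).
  have -> : ip z (w Om) = ip 0 (w k).
    apply: (ip_lim hH u2 (tends_cst hH _) u1 (tends_cst hH _)) => n.
    have [c yc xc] := hu n; rewrite (xc _ Nw) /=.
    apply: (dual _ _ _ _ yc); have [_ _ _ fJ] := left_mul_affiliated (J y).
    by apply: fJ => //; rewrite (sf_N' hN).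
  by rewrite ip0l// conjc0.
- by exists y => //; exact: left_mul_Om.
Qed.

(** For a = 0 the left side would be zero on the domain of [left_mul x] only, whereas [left_mul 0]
    is defined everywhere. *)
Lemma graph_scale_left_mul a x : a != 0 -> graph_scale a (left_mul x) = left_mul (a *: x).
Proof.
move=> a0; have lw w : N' w -> forall b y, w (b *: y) = b *: w y.
  by move=> Nw; exact: (linZ (bop_lin (N'_bounded Nw))).
apply/seteqP; split=> [[p q] [y /= h ->] w Nw /=|[p q] h].
  by rewrite ipZl// (h _ Nw) JZx lw// ipZr.
exists (a^-1 *: q) => /= [w Nw /=|]; last by rewrite scalerA divff// scale1r.
rewrite ipZl// (h _ Nw) /= JZx lw// ipZr// mulrA -conjcM mulVf//.
by rewrite conjc1 mul1r.
Qed.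

Lemma graph_bounded_left_mul B : N B -> graph B = left_mul (B Om).
Proof.
move=> NB; have bB := N_bounded NB; apply: affiliated_opE => //.
split.
- split; rewrite /graph /=.
  + by rewrite (lin0 (bop_lin bB)).
  + by move=> a x x' y y' -> ->; rewrite (bop_lin bB).
  + by move=> y ->; rewrite (lin0 (bop_lin bB)).
- apply/(closed_graphP hH) => u p up /(tends2P hH)[u1 u2].
  apply: (tends_unique hH u2); have := bop_tends bB u1.
  by congr (tends _ _ _); apply/funext => n; rewrite /= (up n).
- by move=> x e e0; exists x; [exists (B x) | rewrite subrr nrm0].
- move=> w; rewrite (sf_N' hN) => Nw x z; rewrite /graph /= => ->.
  by rewrite (N_commute x NB Nw).
Qed.

Lemma N0 : N (fun=> 0).
Proof.
have := N_lc (-1) N_id N_id; congr (N _).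
by apply/funext => x; rewrite scaleN1r addNr.
Qed.

Lemma graph_zero_left_mul : graph (fun=> 0) = left_mul 0.
Proof. exact: (graph_bounded_left_mul N0). Qed.

Lemma L2_norm2_ge0 T : (0 <= L2_norm2 ip N Om T)%E.
Proof.
apply: ereal_sup_ubound; exists (fun=> 0); last by rewrite /trace ip0r.
split=> // [|x|x y [t /= Tt adj]]; [exact: N0 | by rewrite ip0r|].
rewrite ip0r// (hilbert_sym hH) -(adj _ _ Tt) ipxx// conjc_real lecE /= eqxx.
exact: nsq_ge0.
Qed.

(** By [L2_norm2_le] and [L2_norm2_ge], the norm of [left_mul z] is |z|^2. So L^2 convergence of u_k
    to [left_mul y] is convergence of u_k Om to y, and y is the only possible image. *)
Lemma L2_imageP T x : L2_image ip N Om T x <-> T = left_mul x.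
Proof.
have sub u y : N u -> strong_add ip (left_mul y) (graph (fun x => - u x)) = left_mul (y - u Om).
  move=> Nu; rewrite -strong_add_left_mul; congr (strong_add _ _ _).
  apply: (@graph_bounded_left_mul (fun x => - u x)).
  have := N_lc (-1) Nu N0; congr (N _).
  by apply/funext => z; rewrite scaleN1r addr0.
split.
  move=> [[[lT cT dT fT _] LT] [u [Nu uT ux]]].
  have aT : affiliated_op T by [].
  have [y Ty _] := L2_norm2_ge aT LT; have TE := affiliated_opE aT Ty.
  move: uT; rewrite TE; under eq_fun do rewrite sub//.
  move=> uT; congr left_mul; apply: (tends_unique hH (u := fun k => u k Om)) => //.
  apply: (tends_nsq hH); apply/cvgrPdist_lt => e e0.
  have /fine_cvgP[fu] := uT.
  move=> /cvgrPdist_lt/(_ _ e0); apply: filterS2 fu => n fn /=.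
  rewrite !sub0r !normrN !ger0_norm ?nsq_ge0// ?fine_ge0 ?L2_norm2_ge0//.
  apply: le_lt_trans; rewrite -lee_fin fineK// -nsqN// opprB.
  have aL := left_mul_affiliated (y - u n Om).
  have [|z hz zle] := L2_norm2_ge aL; first by rewrite -ge0_fin_numE ?L2_norm2_ge0.
  suff <- : nsq ip z = nsq ip (y - u n Om) by [].
  congr (nsq ip _).
  have [[_ l s] _ _ _] := aL; apply/eqP; rewrite -subr_eq0; apply/eqP/s.
  have := l (-1) _ _ _ _ (left_mul_Om (y - u n Om)) hz.
  by rewrite !scaleN1r addNr [_ + z]addrC.
move=> ->; have aL := left_mul_affiliated x; have lOm := left_mul_Om x.
split.
  split; last by apply: le_lt_trans (L2_norm2_le aL lOm) _; rewrite ltry.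
  by have [? ? ? ?] := aL; split=> // e e0; exact: small_projection lOm _.
have /choice[u hu] n : exists u, N u /\ nrm (u Om - x) < n.+1%:R^-1.
  have [|u] := sf_cyc hN x (e := n.+1%:R^-1); first by rewrite invr_gt0.
  by exists u.
have ux : tends ip (fun n => u n Om) x.
  by apply: (tends_squeeze cvg_harmonic) => n; apply: ltW; case: (hu n).
exists u; split=> // [n|]; first by case: (hu n).
have Nu n : N (u n) by case: (hu n).
under eq_fun => n do rewrite (sub _ _ (Nu n)).
have sq n : (0 <= L2_norm2 ip N Om (left_mul (x - u n Om)) <= (nsq ip (x - u n Om))%:E)%E.
  rewrite L2_norm2_ge0/=; apply: L2_norm2_le; first exact: left_mul_affiliated.
  exact: left_mul_Om.
have fsq : \forall n \near \oo, (0 <= L2_norm2 ip N Om (left_mul (x - u n Om)) <=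
    (nsq ip (x - u n Om))%:E)%E by exact: nearW.
apply: (squeeze_cvge fsq); first exact: cvg_cst.
apply/fine_cvgP; split; first exact: nearW.
have := cvg_nsq hH (tendsB hH (tends_cst hH x) ux).
by rewrite subrr nsq0.
Qed.

End finite_von_neumann_algebra.

(** * Integration over tuples *)

Section complex_integral.
Context d (T : measurableType d) (R : realType).
Variable mu : {measure set T -> \bar R}.
Local Notation C := R[i].
Local Notation Re := complex.Re.
Local Notation Im := complex.Im.
Implicit Types (f g h : T -> C) (a : C).

Definition cmeas f : Prop :=
  measurable_fun setT (fun t => Re (f t)) /\ measurable_fun setT (fun t => Im (f t)).

Lemma cmeas_cst a : cmeas (fun=> a).
Proof. by split; exact: measurable_cst. Qed.

Lemma cmeasD f g : cmeas f -> cmeas g -> cmeas (fun t => f t + g t).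
Proof.
move=> [f1 f2] [g1 g2]; split; under eq_fun do rewrite ?(ReD, ImD); exact: measurable_funD.
Qed.

Lemma cmeasM f g : cmeas f -> cmeas g -> cmeas (fun t => f t * g t).
Proof.
move=> [f1 f2] [g1 g2]; split.
  by under eq_fun do rewrite ReM; apply: measurable_funB; exact: measurable_funM.
by under eq_fun do rewrite ImM; apply: measurable_funD; exact: measurable_funM.
Qed.

Lemma cmeasZ a f : cmeas f -> cmeas (fun t => a * f t).
Proof. by apply: cmeasM; exact: cmeas_cst. Qed.

Lemma cmeasB f g : cmeas f -> cmeas g -> cmeas (fun t => f t - g t).
Proof.
move=> mf mg; under eq_fun do rewrite -mulN1r; apply: cmeasD => //; exact: cmeasZ.
Qed.

Lemma cmeasJ f : cmeas f -> cmeas (fun t => (f t)^*%C).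
Proof.
move=> [f1 f2]; split; first by under eq_fun do rewrite ReJ.
under eq_fun do rewrite ImJ -[- _]sub0r.
exact: (measurable_funB (measurable_cst _)).
Qed.

Lemma sum_fun_cons (I : Type) (i : I) (s : seq I) (P : pred I) (F : I -> T -> C) :
  (fun t => \sum_(j <- i :: s | P j) F j t) =
  if P i then fun t => F i t + \sum_(j <- s | P j) F j t
  else fun t => \sum_(j <- s | P j) F j t.
Proof. by apply/funext => t; rewrite big_cons; case: ifP. Qed.

Lemma cmeas_sum (I : Type) (s : seq I) (P : pred I) (F : I -> T -> C) :
  (forall i, P i -> cmeas (F i)) -> cmeas (fun t => \sum_(i <- s | P i) F i t).
Proof.
move=> mF; elim: s => [|i s IH].
  by under eq_fun do rewrite big_nil; exact: cmeas_cst.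
rewrite sum_fun_cons; case: ifPn => // Pi.
by apply: cmeasD => //; exact: mF.
Qed.

Lemma measurable_normsq f : cmeas f -> measurable_fun setT (fun t => normsq (f t)).
Proof. by move=> [f1 f2]; apply: measurable_funD; exact: measurable_funX. Qed.

Lemma measurable_EFin_normsq f : cmeas f -> measurable_fun setT (fun t => (normsq (f t))%:E).
Proof. by move=> /measurable_normsq mf; exact/measurable_EFinP. Qed.

Definition cint f : C := Complex (\int[mu]_t Re (f t)) (\int[mu]_t Im (f t)).

Definition cintegrable f : Prop :=
  mu.-integrable setT (EFin \o (fun t => Re (f t))) /\
  mu.-integrable setT (EFin \o (fun t => Im (f t))).

Lemma cintegrableD f g : cintegrable f -> cintegrable g -> cintegrable (fun t => f t + g t).
Proof.
move=> [f1 f2] [g1 g2]; split.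
  rewrite (_ : _ \o _ = (EFin \o fun t => Re (f t)) \+ (EFin \o fun t => Re (g t)))%E.
    exact: integrableD.
  by apply/funext => t /=; rewrite ReD EFinD.
rewrite (_ : _ \o _ = (EFin \o fun t => Im (f t)) \+ (EFin \o fun t => Im (g t)))%E.
  exact: integrableD.
by apply/funext => t /=; rewrite ImD EFinD.
Qed.

Lemma cintegrableZ a f : cintegrable f -> cintegrable (fun t => a * f t).
Proof.
move=> [f1 f2]; split.
  rewrite (_ : _ \o _ = (fun t => (Re a)%:E * (EFin \o (fun t => Re (f t))) t) \+
    (fun t => (- Im a)%:E * (EFin \o (fun t => Im (f t))) t))%E.
    by apply: integrableD => //; exact: integrableZl.
  by apply/funext => t /=; rewrite -!EFinM -EFinD ReM mulNr.
rewrite (_ : _ \o _ = (fun t => (Re a)%:E * (EFin \o (fun t => Im (f t))) t) \+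
    (fun t => (Im a)%:E * (EFin \o (fun t => Re (f t))) t))%E.
  by apply: integrableD => //; exact: integrableZl.
by apply/funext => t /=; rewrite -!EFinM -EFinD ImM.
Qed.

Lemma cintegrable0 : cintegrable (fun=> 0).
Proof. by split; exact: integrable0. Qed.

Lemma cintegrable_sum (I : Type) (s : seq I) (P : pred I) (F : I -> T -> C) :
  (forall i, P i -> cintegrable (F i)) -> cintegrable (fun t => \sum_(i <- s | P i) F i t).
Proof.
move=> mF; elim: s => [|i s IH].
  by under eq_fun do rewrite big_nil; exact: cintegrable0.
rewrite sum_fun_cons; case: ifPn => // Pi.
by apply: cintegrableD => //; exact: mF.
Qed.

Lemma cintD f g : cintegrable f -> cintegrable g ->
  cint (fun t => f t + g t) = cint f + cint g.
Proof.
move=> [f1 f2] [g1 g2]; apply: eqC; rewrite ?(ReD, ImD) /= -RintegralD//;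
by apply: eq_Rintegral => t _; rewrite ?(ReD, ImD).
Qed.

Lemma cintZ a f : cintegrable f -> cint (fun t => a * f t) = a * cint f.
Proof.
move=> [f1 f2]; apply: eqC; rewrite ?(ReM, ImM) /= -!RintegralZl//.
  rewrite -RintegralB//.
  - by apply: eq_Rintegral => t _; rewrite ReM.
  - by have := integrableZl measurableT (Re a) f1.
  - by have := integrableZl measurableT (Im a) f2.
rewrite -RintegralD//.
- by apply: eq_Rintegral => t _; rewrite ImM.
- by have := integrableZl measurableT (Re a) f2.
- by have := integrableZl measurableT (Im a) f1.
Qed.

Lemma eq_cint f g : (forall t, f t = g t) -> cint f = cint g.
Proof. by move=> h; congr cint; exact/funext. Qed.

Lemma cint0 : cint (fun=> 0) = 0.
Proof. by apply: eqC; rewrite /= Rintegral_cst// mul0r. Qed.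

Lemma cint_sum (I : Type) (s : seq I) (P : pred I) (F : I -> T -> C) :
  (forall i, P i -> cintegrable (F i)) ->
  cint (fun t => \sum_(i <- s | P i) F i t) = \sum_(i <- s | P i) cint (F i).
Proof.
move=> mF; elim: s => [|i s IH].
  by rewrite big_nil -[RHS]cint0; apply: eq_cint => t; rewrite big_nil.
rewrite big_cons; case: ifPn => Pi; last first.
  by rewrite -IH; apply: eq_cint => t; rewrite big_cons (negbTE Pi).
rewrite -IH -cintD//; [|exact: mF|exact: cintegrable_sum].
by apply: eq_cint => t; rewrite big_cons Pi.
Qed.

Lemma cintB f g : cintegrable f -> cintegrable g ->
  cint (fun t => f t - g t) = cint f - cint g.
Proof.
move=> If Ig; rewrite -mulN1r -cintZ// -cintD//; last exact: cintegrableZ.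
by apply: eq_cint => t; rewrite mulN1r.
Qed.

Lemma cintJ f : cintegrable f -> cint (fun t => (f t)^*%C) = (cint f)^*%C.
Proof.
move=> [f1 f2]; apply: eqC; rewrite ?(ReJ, ImJ) /=.
  by apply: eq_Rintegral => t _; rewrite ReJ.
rewrite -mulN1r -RintegralZl//; apply: eq_Rintegral => t _; by rewrite ImJ mulN1r.
Qed.

Lemma cint_ae_eq f g : cmeas f -> cmeas g -> {ae mu, forall t, f t = g t} ->
  cint f = cint g.
Proof.
move=> [f1 f2] [g1 g2] fg; apply: eqC; rewrite /= /Rintegral; congr fine;
  apply: ae_eq_integral => //; try exact/measurable_EFinP;
  by move: fg; apply: filterS => t -> _.
Qed.

Lemma cintegrable_ae_eq f g : cmeas g -> {ae mu, forall t, f t = g t} ->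
  cintegrable f -> cintegrable g.
Proof.
move=> [g1 g2] fg [/integrableP[f1 f1i] /integrableP[f2 f2i]]; split; apply/integrableP.
  split; first exact/measurable_EFinP.
  move: f1i; rewrite (ae_eq_integral (fun t => `|(Re (g t))%:E|)%E)//.
  - exact: measurableT_comp.
  - by apply: measurableT_comp => //; exact/measurable_EFinP.
  - by move: fg; apply: filterS => t /= -> _.
split; first exact/measurable_EFinP.
move: f2i; rewrite (ae_eq_integral (fun t => `|(Im (g t))%:E|)%E)//.
- exact: measurableT_comp.
- by apply: measurableT_comp => //; exact/measurable_EFinP.
- by move: fg; apply: filterS => t /= -> _.
Qed.

Definition sqn f : \bar R := (\int[mu]_t (normsq (f t))%:E)%E.

Lemma sqn_ge0 f : (0 <= sqn f)%E.
Proof. by apply: integral_ge0 => t _; rewrite lee_fin normsq_ge0. Qed.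

Lemma eq_sqn f g : (forall t, f t = g t) -> sqn f = sqn g.
Proof. by move=> h; congr sqn; exact/funext. Qed.

Lemma sqn_ae_eq f g : cmeas f -> cmeas g -> {ae mu, forall t, f t = g t} -> sqn f = sqn g.
Proof.
move=> mf mg fg; apply: ae_eq_integral => //; try exact: measurable_EFin_normsq.
by move: fg; apply: filterS => t -> _.
Qed.

Lemma sqn_eq0 f : cmeas f -> sqn f = 0%E -> {ae mu, forall t, f t = 0}.
Proof.
move=> mf f0; have := (ae_eq_integral_abs mu measurableT (measurable_EFin_normsq mf)).1.
rewrite -[X in (X = _ -> _) -> _](_ : sqn f = _); last first.
  by apply: eq_integral => t _; rewrite /= ger0_norm ?normsq_ge0.
move=> /(_ f0); apply: filterS => t /(_ I) /= [] /normsq_eq0.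
exact.
Qed.

Lemma sqn_ae0 f : cmeas f -> {ae mu, forall t, f t = 0} -> sqn f = 0%E.
Proof.
move=> mf f0; have -> : sqn f = sqn (fun=> 0).
  by apply: sqn_ae_eq => //; exact: cmeas_cst.
by rewrite /sqn /normsq /= expr0n /= addr0 integral0.
Qed.

Lemma sqnZ a f : cmeas f -> sqn (fun t => a * f t) = ((normsq a)%:E * sqn f)%E.
Proof.
move=> mf; rewrite /sqn -ge0_integralZl//.
- by apply: eq_integral => t _; rewrite normsqM EFinM.
- exact: measurable_EFin_normsq.
- by move=> t _; rewrite lee_fin normsq_ge0.
- by rewrite lee_fin normsq_ge0.
Qed.

Lemma normsqD_le (z w : C) : normsq (z + w) <= 2 * normsq z + 2 * normsq w.
Proof.
case: z w => [x y] [x' y']; rewrite /normsq /=.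
by have := sqr_ge0 (x - x'); have := sqr_ge0 (y - y'); lra.
Qed.

Lemma sqnD f g : cmeas f -> cmeas g ->
  (sqn (fun t => f t + g t)%R <= 2%:E * sqn f + 2%:E * sqn g)%E.
Proof.
move=> mf mg; have mf' := measurable_EFin_normsq mf; have mg' := measurable_EFin_normsq mg.
have f0 h t : setT t -> (0 <= (normsq (h t : C))%:E :> \bar R)%E.
  by move=> _; rewrite lee_fin normsq_ge0.
have f2 h t : setT t -> (0 <= 2%:E * (normsq (h t : C))%:E :> \bar R)%E.
  by move=> _; rewrite -EFinM lee_fin mulr_ge0// normsq_ge0.
rewrite /sqn -(ge0_integralZl _ _ mf')// -?(ge0_integralZl _ _ mg')//; try exact: f0.
rewrite -ge0_integralD//; try exact: f2; try exact: measurable_funeM.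
apply: ge0_le_integral => //; try exact: f0.
- exact: (measurable_EFin_normsq (cmeasD mf mg)).
- by apply: emeasurable_funD; exact: measurable_funeM.
- by move=> t _; rewrite -!EFinM -EFinD lee_fin normsqD_le.
Qed.

Lemma sqnB f g : cmeas f -> cmeas g ->
  (sqn (fun t => f t - g t)%R <= 2%:E * sqn f + 2%:E * sqn g)%E.
Proof.
move=> mf mg; have mN := cmeasZ (-1) mg; have := sqnD mf mN.
rewrite sqnZ// normsqN (_ : normsq 1 = 1) ?mul1e; last by rewrite /normsq /=; ring.
by under [X in sqn X]eq_fun do rewrite mulN1r.
Qed.

Definition sqint f : Prop := cmeas f /\ (sqn f < +oo)%E.

Lemma sqint_fin f : sqint f -> sqn f \is a fin_num.
Proof. by move=> [_ h]; rewrite ge0_fin_numE// sqn_ge0. Qed.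

Lemma sqintZ a f : sqint f -> sqint (fun t => a * f t).
Proof.
move=> [mf ff]; split; first exact: cmeasZ.
by rewrite sqnZ// lte_mul_pinfty// lee_fin normsq_ge0.
Qed.

Lemma sqintD f g : sqint f -> sqint g -> sqint (fun t => f t + g t).
Proof.
move=> [mf ff] [mg fg]; split; first exact: cmeasD.
by apply: le_lt_trans (sqnD mf mg) _; rewrite lte_add_pinfty// lte_mul_pinfty.
Qed.

Lemma sqint0 : sqint (fun=> 0).
Proof.
split; first exact: cmeas_cst.
by rewrite /sqn /normsq /= expr0n /= addr0 integral0.
Qed.

Lemma sqintB f g : sqint f -> sqint g -> sqint (fun t => f t - g t).
Proof.
move=> Lf Lg; have := sqintD Lf (sqintZ (-1) Lg).
by under eq_fun do rewrite mulN1r.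
Qed.

Lemma sqint_integrable f : sqint f -> mu.-integrable setT (EFin \o (fun t => normsq (f t))).
Proof.
move=> [mf ff]; apply/integrableP; split; first exact: measurable_EFin_normsq.
by under eq_integral do rewrite /= ger0_norm ?normsq_ge0//.
Qed.

Lemma normsqJ_sqint f : sqint f -> sqint (fun t => (f t)^*%C).
Proof.
move=> [mf ff]; split; first exact: cmeasJ.
by rewrite /sqn; under eq_integral do rewrite normsqJ.
Qed.

Lemma sqint_mul f g : sqint f -> sqint g -> cintegrable (fun t => f t * g t).
Proof.
move=> Lf Lg; have [mf _] := Lf; have [mg _] := Lg.
have [h1 h2] := cmeasM mf mg.
have Ifg : mu.-integrable setT (EFin \o (fun t => normsq (f t) + normsq (g t))).
  have := integrableD measurableT (sqint_integrable Lf) (sqint_integrable Lg).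
  by congr (_.-integrable _ _); apply/funext => t /=; rewrite EFinD.
have le (z w : C) : `|Re (z * w)| <= normsq z + normsq w /\ `|Im (z * w)| <= normsq z + normsq w.
  case: z w => [x y] [x' y']; rewrite /normsq /= !ler_norml.
  have := (sqr_ge0 (x + x'), sqr_ge0 (x - x'), sqr_ge0 (y + y'), sqr_ge0 (y - y')).
  have := (sqr_ge0 (x + y'), sqr_ge0 (x - y'), sqr_ge0 (y + x'), sqr_ge0 (y - x')).
  by move=> [[[? ?] ?] ?] [[[? ?] ?] ?]; split; apply/andP; split; lra.
split; apply: le_integrable Ifg => //; try exact/measurable_EFinP.
  move=> t _ /=; have [h _] := le (f t) (g t); rewrite lee_fin.
  by apply: le_trans h _; exact: ler_norm.
move=> t _ /=; have [_ h] := le (f t) (g t); rewrite lee_fin.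
by apply: le_trans h _; exact: ler_norm.
Qed.

Lemma sqint_ip f g : sqint f -> sqint g -> cintegrable (fun t => (f t)^*%C * g t).
Proof. by move=> /normsqJ_sqint; exact: sqint_mul. Qed.

Lemma cint_sqn f : sqint f -> cint (fun t => (f t)^*%C * f t) = (fine (sqn f))%:C%C.
Proof.
move=> Lf; apply: eqC => /=.
  by rewrite /sqn /Rintegral; congr fine; apply: eq_integral => t _; rewrite conjc_normsq.
rewrite (_ : (fun t => Im _) = fun=> 0) ?Rintegral_cst ?mul0r//.
by apply/funext => t; rewrite conjc_normsq.
Qed.

(** Stated in the extended reals without integrability: if one norm is 0 the product vanishes almost
    everywhere, and if one is infinite and the other nonzero the bound is infinite. *)
Lemma cint_cauchy_schwarz f g : cmeas f -> cmeas g ->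
  ((normsq (cint (fun t => f t * g t)))%:E <= sqn f * sqn g)%E.
Proof.
move=> mf mg.
have zero h k : cmeas h -> cmeas k -> sqn h = 0%E -> cint (fun t => h t * k t) = 0.
  move=> mh mk h0; rewrite (@cint_ae_eq _ (fun=> 0)) ?cint0//.
    exact: cmeasM.
  by have := sqn_eq0 mh h0; apply: filterS => t ->; rewrite mul0r.
have n0 : normsq (0 : C) = 0 by rewrite /normsq /= expr0n /= addr0.
have [f0|nf0] := eqVneq (sqn f) 0%E; first by rewrite zero// n0 f0 mul0e.
have [g0|ng0] := eqVneq (sqn g) 0%E.
  under [fun t => f t * g t]eq_fun do rewrite mulrC.
  by rewrite zero// n0 g0 mule0.
have [ff|] := boolP (sqn f < +oo)%E; last first.
  rewrite -leNgt leye_eq => /eqP ->.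
  by rewrite gt0_mulye ?leey// lt_neqAle eq_sym ng0 sqn_ge0.
have [fg|] := boolP (sqn g < +oo)%E; last first.
  rewrite -leNgt leye_eq => /eqP ->.
  by rewrite gt0_muley ?leey// lt_neqAle eq_sym nf0 sqn_ge0.
have Lf : sqint f by []; have Lg : sqint g by [].
have Ifg := sqint_mul Lf Lg.
rewrite -(fineK (sqint_fin Lf)) -(fineK (sqint_fin Lg)) -EFinM lee_fin.
set c := cint _; set A := fine (sqn f); set B := fine (sqn g).
have A0 : 0 < A by rewrite fine_gt0// ff andbT lt_neqAle eq_sym nf0 sqn_ge0.
(* Obtained by integrating |l conj(c) f - conj(g)|^2 >= 0, where c is the integral of f g; l = 1/A
   is the best choice. *)
have key (l : R) : 0 < l -> 2 * l * normsq c <= l ^+ 2 * normsq c * A + B.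
  move=> l0; have IcZ := cintegrableZ c^*%C Ifg.
  have -> : normsq c = \int[mu]_t Re (c^*%C * (f t * g t)).
    by have := congr1 (@complex.Re _) (cintZ c^*%C Ifg); rewrite -/c conjc_normsq /= => ->.
  have I1 := IcZ.1; have If := sqint_integrable Lf; have Ig := sqint_integrable Lg.
  have -> : l ^+ 2 * (\int[mu]_t Re (c^*%C * (f t * g t))) = l ^+ 2 * normsq c.
    by have := congr1 (@complex.Re _) (cintZ c^*%C Ifg); rewrite -/c conjc_normsq /= => ->.
  rewrite /A /B /sqn -!/(Rintegral _ _ _) -RintegralZl// -RintegralZl//.
  have I2 := integrableZl measurableT (l ^+ 2 * normsq c) If.
  rewrite -RintegralD//.
  have I3 : mu.-integrable setT (EFin \o (fun t => 2 * l * Re (c^*%C * (f t * g t)))).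
    by have := integrableZl measurableT (2 * l) I1.
  have I4 : mu.-integrable setT (EFin \o (fun t => l ^+ 2 * normsq c * normsq (f t) + normsq (g t))).
    by have := integrableD measurableT I2 Ig; congr (_.-integrable _ _).
  apply: le_Rintegral => // t _.
  have := normsq_ge0 (l%:C%C * (c^*%C * f t) - (g t)^*%C).
  by case: (c) (f t) (g t) => [x y] [x' y'] [x2 y2]; rewrite /normsq /=; lra.
have := key A^-1 ltac:(by rewrite invr_gt0).
have -> : A^-1 ^+ 2 * normsq c * A = A^-1 * normsq c by field; exact: lt0r_neq0.
by move=> h; rewrite -ler_pdivrMl//; lra.
Qed.

End complex_integral.

(** * The measure on tuples: uniqueness, permutations, iterated integrals *)

Section tuple_measure.
Variable R : realType.
Local Notation C := R[i].
Local Notation mu n := (muplus R n).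
Local Notation m1 := (@mu1 R).

Definition box n (A : nat -> set R) : set (n.-tuple R) :=
  [set t | forall i : 'I_n, A i (tnth t i)].

Arguments box n A : clear implicits.

Lemma measurable_tnth_set n (i : 'I_n) (A : set R) : measurable A ->
  measurable [set t : n.-tuple R | A (tnth t i)].
Proof.
move=> mA; rewrite -[X in measurable X]setTI.
exact: (measurable_tnth i measurableT mA).
Qed.

Lemma measurable_box n (A : nat -> set R) : (forall i, measurable (A i)) -> measurable (box n A).
Proof.
move=> mA; rewrite (_ : box n A = \bigcap_(i in [set: 'I_n]) [set t | A i (tnth t i)]).
  apply: fin_bigcap_measurable => // i _; exact: measurable_tnth_set.
by apply/seteqP; split=> [t h i _|t h i]; [exact: h | exact: (h i)].
Qed.

Lemma muplus_box n (A : nat -> set R) : (forall i, measurable (A i)) ->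
  mu n (box n A) = \big[*%E/1%E]_(i < n) m1 (A i).
Proof.
elim: n A => [|n IH] A mA.
  by rewrite big_ord0 /= diracE mem_set// => -[].
rewrite big_ord_recl /= -(IH (A \o S)); last by move=> i; exact: mA.
rewrite -product_measure1E//; last by apply: measurable_box => i; exact: mA.
rewrite /muS /pushforward; congr (_ _); apply/seteqP; split=> [[x t] h|[x t] [/= h1 h2] i].
  split; first exact: (h ord0).
  by move=> i; have := h (lift ord0 i); rewrite /cons_pair tnthS.
by case: (unliftP ord0 i) => [j ->|->]; [rewrite /cons_pair tnthS; exact: h2|].
Qed.

Lemma tuple_measurableE n : @measurable _ (n.-tuple R) =
  <<s [set X | exists2 A : nat -> set R, (forall i, measurable (A i)) & X = box n A] >>.
Proof.
apply/seteqP; split.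
  apply: smallest_sub; first exact: smallest_sigma_algebra.
  move=> X; rewrite -bigcup_seq => -[i _ [B mB <-]]; apply: sub_sigma_algebra.
  exists (fun j => if j == i :> nat then B else setT).
    by move=> j; case: ifP.
  apply/seteqP; split=> [t /= [_ h] j|t h].
    by case: eqP => // /val_inj ->.
  by split=> //; have := h i; rewrite eqxx.
apply: smallest_sub; first exact: sigma_algebra_measurable.
by move=> _ [A mA ->]; exact: measurable_box.
Qed.

(** Boxes are stable under intersection and generate the sigma-algebra; cubes over an exhaustion of
    the line by sets of finite measure exhaust the space. *)
Lemma muplus_unique n (m : {measure set (n.-tuple R) -> \bar R}) :
  (forall A : nat -> set R, (forall i, measurable (A i)) -> m (box n A) = mu n (box n A)) ->
  forall X, measurable X -> m X = mu n X.
Proof.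
move=> mE X mX; have /sigma_finiteP[F [TF ndF Foo]] := sigma_finiteT m1.
apply: (measure_unique _ (fun k => box n (fun=> F k)) (tuple_measurableE n)) => //.
- move=> _ _ [A mA ->] [B mB ->]; exists (fun i => A i `&` B i).
    by move=> i; exact: measurableI.
  apply/seteqP; split=> [t [h1 h2] i|t h]; first by split; [exact: h1 | exact: h2].
  by split=> i; have [] := h i.
- by move=> k; exists (fun=> F k) => // i; have [] := Foo k.
- apply/seteqP; split=> // t _.
  have /choice[k hk] (i : 'I_n) : exists k, F k (tnth t i).
    by have : setT (tnth t i) by []; rewrite TF => -[k _ ?]; exists k.
  exists (\max_(i < n) k i)%N => // i.
  by move: (hk i); apply/subsetPset/ndF; exact: leq_bigmax.
- by move=> _ [A mA ->]; exact: mE.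
- move=> k; rewrite mE; last by move=> i; have [] := Foo k.
  rewrite muplus_box; last by move=> i; have [] := Foo k.
  have [_ Fk] := Foo k.
  elim: n {m mE X mX} => [|n IH]; first by rewrite big_ord0 ltry.
  by rewrite big_ord_recl lte_mul_pinfty// ge0_fin_numE.
Qed.

Lemma measurable_permute n (s : 'S_n) : measurable_fun setT (@permute_tuple R n s).
Proof.
apply/measurable_fun_tnthP => i.
rewrite (_ : _ \o _ = (fun t => tnth t (s i))); first exact: measurable_tnth.
by apply/funext => t /=; rewrite tnth_mktuple.
Qed.

Lemma permute_tupleM n (s u : 'S_n) (t : n.-tuple R) :
  permute_tuple s (permute_tuple u t) = permute_tuple (s * u)%g t.
Proof. by apply: eq_from_tnth => i; rewrite !tnth_mktuple permM. Qed.

Lemma permute_tuple1 n (t : n.-tuple R) : permute_tuple 1%g t = t.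
Proof. by apply: eq_from_tnth => i; rewrite !tnth_mktuple perm1. Qed.

(** The preimage of a box is the box with permuted sides, and the product of the measures of the
    sides does not change. *)
Lemma muplus_permute n (s : 'S_n) X : measurable X ->
  pushforward (mu n) (permute_tuple s) X = mu n X.
Proof.
move=> mX; have mP := measurable_permute s.
pose mP_mixin := isMeasurableFun.Build _ _ _ _ _ mP.
pose mP_pack : {mfun _ >-> _} := HB.pack (@permute_tuple R n s) mP_mixin.
apply: (muplus_unique (m := pushforward (mu n) mP_pack)) => // A mA.
pose B i := if insub i is Some j then A ((s^-1)%g j) else setT.
have mB i : measurable (B i) by rewrite /B; case: insub.
have e : @permute_tuple R n s @^-1` box n A = box n B.
  apply/seteqP; split=> t h i.
    rewrite /B valK; have := h ((s^-1)%g i).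
    by rewrite /= tnth_mktuple permKV.
  have := h (s i); rewrite /B valK /= permK.
  by rewrite tnth_mktuple.
transitivity (mu n (box n B)); first exact: (congr1 (mu n) e).
rewrite !muplus_box// (reindex_inj (@perm_inj _ s)) /=.
by apply: eq_bigr => i _; rewrite /B valK permK.
Qed.

Lemma ge0_integral_permute n (s : 'S_n) (f : n.-tuple R -> \bar R) :
  measurable_fun setT f -> (forall t, 0 <= f t)%E ->
  (\int[mu n]_t f (permute_tuple s t) = \int[mu n]_t f t)%E.
Proof.
move=> mf f0; have mP := measurable_permute s.
pose mP_mixin := isMeasurableFun.Build _ _ _ _ _ mP.
pose mP_pack : {mfun _ >-> _} := HB.pack (@permute_tuple R n s) mP_mixin.
have f0' : {in setT, forall t, 0 <= f t}%E by move=> t _; exact: f0.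
have := ge0_integral_pushforward mP (mu n) measurableT mf f0'.
rewrite preimage_setT => <-.
by apply: eq_measure_integral => A mA _; exact: muplus_permute.
Qed.

Lemma cintegrable_permute n (s : 'S_n) (f : n.-tuple R -> C) :
  cintegrable (mu n) f -> cintegrable (mu n) (fun t => f (permute_tuple s t)).
Proof.
move=> [/integrableP[f1 f1i] /integrableP[f2 f2i]].
have mP := measurable_permute s.
split; apply/integrableP; split.
- exact: (measurableT_comp f1).
- rewrite (ge0_integral_permute s (f := fun t => `|(complex.Re (f t))%:E|)%E)//.
  exact: measurableT_comp.
- exact: (measurableT_comp f2).
- rewrite (ge0_integral_permute s (f := fun t => `|(complex.Im (f t))%:E|)%E)//.
  exact: measurableT_comp.
Qed.

Lemma cmeas_permute n (s : 'S_n) (f : n.-tuple R -> C) :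
  cmeas f -> cmeas (fun t => f (permute_tuple s t)).
Proof.
by move=> [f1 f2]; have mP := measurable_permute s; split; [exact: (measurableT_comp f1 mP) | exact: (measurableT_comp f2 mP)].
Qed.

Lemma cint_permute n (s : 'S_n) (f : n.-tuple R -> C) : cmeas f ->
  cint (mu n) (fun t => f (permute_tuple s t)) = cint (mu n) f.
Proof.
move=> [/measurable_EFinP f1 /measurable_EFinP f2].
have E (g : n.-tuple R -> R) : measurable_fun setT (EFin \o g) ->
    (\int[mu n]_t (g (permute_tuple s t))%:E = \int[mu n]_t (g t)%:E)%E.
  move=> mg; rewrite [LHS]integralE [RHS]integralE; congr (_ - _)%E.
    rewrite -(ge0_integral_permute s (measurable_funepos mg))//.
    by apply: eq_integral => t _; rewrite -[RHS]/(((EFin \o g)^\+ \o permute_tuple s) t)%E -funepos_comp.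
  rewrite -(ge0_integral_permute s (measurable_funeneg mg))//.
  by apply: eq_integral => t _; rewrite -[RHS]/(((EFin \o g)^\- \o permute_tuple s) t)%E -funeneg_comp.
by apply: eqC; rewrite /= /Rintegral (E (fun t => _ (f t))).
Qed.

Lemma ae_permute n (s : 'S_n) (P : n.-tuple R -> Prop) :
  {ae mu n, forall t, P t} -> {ae mu n, forall t, P (permute_tuple s t)}.
Proof.
move=> [N [mN N0 sub]]; exists (permute_tuple s @^-1` N); split.
- by rewrite -[X in measurable X]setTI; exact: measurable_permute.
- by rewrite -[LHS]/(pushforward (mu n) (permute_tuple s) N) muplus_permute.
- by move=> t /= h; exact: (sub (permute_tuple s t)).
Qed.

Lemma sqn_permute n (s : 'S_n) (f : n.-tuple R -> C) : cmeas f ->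
  sqn (mu n) (fun t => f (permute_tuple s t)) = sqn (mu n) f.
Proof.
move=> mf; apply: (ge0_integral_permute s (f := fun t => (normsq (f t))%:E)).
  exact: measurable_EFin_normsq.
by move=> t; rewrite lee_fin normsq_ge0.
Qed.

Lemma ge0_integral_cons n (f : n.+1.-tuple R -> \bar R) :
  measurable_fun setT f -> (forall t, 0 <= f t)%E ->
  (\int[mu n.+1]_t f t = \int[m1]_x \int[mu n]_t f (cons_pair (x, t)))%E.
Proof.
move=> mf f0; have mc := @measurable_cons_pair R n.
have f0' : {in setT, forall t, 0 <= f t}%E by move=> t _; exact: f0.
have := ge0_integral_pushforward mc (m1 \x mu n)%E measurableT mf f0'.
rewrite preimage_setT => ->; have mfc := measurableT_comp mf mc.
by rewrite (fubini_tonelli1 _ mfc) => // u; exact: f0.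
Qed.

Lemma integral_tuple0 (f : 0.-tuple R -> \bar R) : measurable_fun setT f ->
  (\int[mu 0]_t f t = f [tuple])%E.
Proof. by move=> mf; rewrite integral_dirac// diracT mul1e. Qed.

End tuple_measure.

(** * Completeness of L^2 *)

Section L2_complete.
Context d (T : measurableType d) (R : realType).
Variable mu : {measure set T -> \bar R}.
Local Notation C := R[i].
Local Notation Re := complex.Re.
Local Notation Im := complex.Im.

Lemma geometric_increments_cvg (u : nat -> R) (c : R) :
  (forall n, `|u n.+1 - u n| <= c * (2^-1) ^+ n) -> cvgn u.
Proof.
move=> h; pose a n := u n.+1 - u n.
have uE : u = (fun n => series a n + u 0%N).
  by apply/funext => n; rewrite /series /= telescope_sumr// subrK.
have ca : cvgn (series a).
  apply: normed_cvg; apply: (series_le_cvg (v_ := geometric c (2^-1))) => [n|n|n|].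
  - exact: normr_ge0.
  - exact: le_trans (normr_ge0 _) (h n).
  - exact: h.
  - by apply: is_cvg_geometric_series; rewrite ger0_norm ?invr_ge0// invf_lt1// ltr1n.
by rewrite uE; apply: is_cvgD => //; exact: is_cvg_cst.
Qed.

Lemma limn_einf_le (u : (\bar R)^nat) (e : \bar R) : (forall n, u n <= e)%E ->
  (limn_einf u <= e)%E.
Proof.
move=> h; rewrite limn_einf_lim; apply: lime_le; first exact: is_cvg_einfs.
apply: nearW => n; apply: le_trans (h n).
by apply: ereal_inf_lbound; exists n => //=.
Qed.

(** Along a subsequence whose increments have squared norm at most 8^-i, the series of 4^i |dif_i|^2
    has finite integral. It is therefore finite almost everywhere, which forces |dif_i| <= c 2^-i
    and pointwise convergence; Fatou's lemma bounds the distance to the limit. *)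
Lemma sqint_complete (f : nat -> T -> C) : (forall k, sqint mu (f k)) ->
  (forall e : R, 0 < e -> exists K, forall j k, (K <= j)%N -> (K <= k)%N ->
    (sqn mu (fun t => f j t - f k t)%R <= e%:E)%E) ->
  exists2 g, cmeas g & forall e : R, 0 < e -> exists K, forall k, (K <= k)%N ->
    (sqn mu (fun t => g t - f k t)%R <= e%:E)%E.
Proof.
move=> Lf cf; have mf k : cmeas (f k) by case: (Lf k).
have /choice[K0 hK0] i : exists K, forall j k, (K <= j)%N -> (K <= k)%N ->
    (sqn mu (fun t => f j t - f k t)%R <= ((8^-1) ^+ i)%:E)%E.
  by apply: cf; rewrite exprn_gt0// invr_gt0.
pose k i := maxn i (\max_(j < i.+1) K0 j)%N.
have kK i j : (i <= j)%N -> (K0 i <= k j)%N.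
  move=> ij; rewrite leq_max; apply/orP; right.
  exact: (@leq_bigmax _ (fun m : 'I_j.+1 => K0 m) (Ordinal (ij : (i < j.+1)%N))).
pose dif i t := f (k i.+1) t - f (k i) t.
have mdif i : cmeas (dif i) by exact: cmeasB.
have sdif i : (sqn mu (dif i) <= ((8^-1) ^+ i)%:E)%E.
  by apply: hK0; apply: kK.
pose s i t := ((4 ^+ i)%:E * (normsq (dif i t))%:E)%E : \bar R.
have s0 i t : (0 <= s i t)%E by rewrite mule_ge0// lee_fin ?exprn_ge0// normsq_ge0.
have ms i : measurable_fun setT (s i).
  by apply: measurable_funeM; exact: measurable_EFin_normsq.
pose S t := (\sum_(i <oo) s i t)%E.
have mS : measurable_fun setT S.
  by apply: ge0_emeasurable_sum => // i t _ _; exact: s0.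
have IS : (\int[mu]_t S t < +oo)%E.
  rewrite integral_nneseries//.
  apply: (@le_lt_trans _ _ (\sum_(i <oo) ((2^-1 : R) ^+ i)%:E)%E).
    apply: lee_nneseries => [i _ _|i _]; first exact: integral_ge0.
    rewrite ge0_integralZl//; try exact: measurable_EFin_normsq.
    2: by move=> t _; rewrite lee_fin normsq_ge0.
    have -> : (2^-1 : R) ^+ i = 4 ^+ i * 8^-1 ^+ i.
      by rewrite -exprMn; congr (_ ^+ _); field.
    by rewrite EFinM; apply: lee_wpmul2l (sdif i); rewrite lee_fin exprn_ge0.
  have h : (\sum_(0 <= i < n) ((2^-1 : R) ^+ i)%:E)%E @[n --> \oo] --> ((1 - 2^-1)^-1 : R)%:E.
    under eq_fun do rewrite sumEFin.
    apply: cvg_EFin; first exact: nearW.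
    have := @cvg_geometric_series R 1 (2^-1) ltac:(by rewrite ger0_norm ?invr_ge0// invf_lt1// ltr1n).
    rewrite div1r => h; apply: cvg_trans h; apply: near_eq_cvg; apply: nearW => n /=.
    by apply: eq_bigr => i _; rewrite /geometric /= mul1r.
  by rewrite (cvg_lim _ h)// ltry.
have aeS : {ae mu, forall t, S t \is a fin_num}.
  have iS : mu.-integrable setT S.
    apply/integrableP; split => //; under eq_integral => t _ do rewrite gee0_abs ?nneseries_ge0//.
    exact: IS.
  by have := integrable_ae measurableT iS; apply: filterS => t; exact.
(* An upper limit, so that the candidate is measurable everywhere, including where the sequence
   diverges. *)
pose gR t := fine (limn_esup (fun i => (Re (f (k i) t))%:E)).
pose gI t := fine (limn_esup (fun i => (Im (f (k i) t))%:E)).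
have cvgf t : S t \is a fin_num ->
    Re (f (k i) t) @[i --> \oo] --> gR t /\ Im (f (k i) t) @[i --> \oo] --> gI t.
  move=> St; pose c := Num.sqrt (fine (S t)).
  have S0 : (0 <= S t)%E by apply: nneseries_ge0.
  have nd i : normsq (dif i t) <= (c * (2^-1) ^+ i) ^+ 2.
    rewrite exprMn sqr_sqrtr ?fine_ge0// -exprM mulnC exprM.
    have : (s i t <= S t)%E.
      rewrite /S (nneseries_split 0 i.+1)//= big_mkord big_ord_recr /= -[leLHS]add0e -[leLHS]adde0 .
      apply: leeD; last by apply: nneseries_ge0.
      by rewrite add0e leeDr// sume_ge0.
    rewrite -(fineK St) /s -EFinM lee_fin => h.
    rewrite (_ : (2^-1 ^+ 2) ^+ i = (4 ^+ i)^-1); last first.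
      by rewrite -exprVn; congr (_ ^+ _); field.
    by rewrite ler_pdivlMr ?exprn_gt0// mulrC.
  have c0 i : 0 <= c * (2^-1) ^+ i by rewrite mulr_ge0 ?sqrtr_ge0// exprn_ge0.
  have cR : cvgn (fun i => Re (f (k i) t)).
    apply: (@geometric_increments_cvg _ c) => i.
    rewrite -ReB -(@ler_sqr _ `|_|) ?nnegrE// real_normK ?num_real//.
    by apply: le_trans (nd i); rewrite /normsq lerDl sqr_ge0.
  have cI : cvgn (fun i => Im (f (k i) t)).
    apply: (@geometric_increments_cvg _ c) => i.
    rewrite -ImB -(@ler_sqr _ `|_|) ?nnegrE// real_normK ?num_real//.
    by apply: le_trans (nd i); rewrite /normsq lerDr sqr_ge0.
  have lim (u : nat -> R) : cvgn u -> u i @[i --> \oo] --> fine (limn_esup (fun i => (u i)%:E)).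
    move=> cu; have cE : (u i)%:E @[i --> \oo] --> (limn u)%:E.
      by apply: cvg_EFin => //; exact: nearW.
    rewrite is_cvg_limn_esupE; last by apply/cvg_ex; eexists; exact: cE.
    by rewrite (cvg_lim _ cE).
  by split; exact: lim.
have mfine (u : nat -> T -> R) : (forall i, measurable_fun setT (u i)) ->
    measurable_fun setT (fun t => fine (limn_esup (fun i => (u i t)%:E))).
  move=> mu'; apply: (measurableT_comp (fine_measurable measurableT)) => //.
  by apply: measurable_fun_limn_esup => i; exact/measurable_EFinP.
pose g t := Complex (gR t) (gI t).
have mg : cmeas g by split; apply: mfine => i; case: (mf (k i)).
exists g => // e e0; have [K hK] := cf e e0; exists K => j Kj.
have kK' i : (K <= k (i + K))%N by rewrite leq_max leq_addl.
pose F i t : \bar R := (normsq (f (k (i + K)%N) t - f j t))%:E.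
have mF i : measurable_fun setT (F i) by apply: measurable_EFin_normsq; exact: cmeasB.
have F0 i t : setT t -> (0 <= F i t)%E by rewrite lee_fin normsq_ge0.
apply: (@le_trans _ _ (\int[mu]_t limn_einf (F ^~ t))%E); last first.
  apply: le_trans (fatou mu measurableT mF F0) _.
  by apply: limn_einf_le => i; exact: hK.
rewrite le_eqVlt; apply/orP; left; apply/eqP; apply: ge0_ae_eq_integral => //.
- by apply: measurable_EFin_normsq; exact: cmeasB.
- rewrite (_ : (fun t => _) = (fun t => - limn_esup (fun i => - F i t)))%E.
    by apply: measurableT_comp => //; apply: measurable_fun_limn_esup => i; exact: measurableT_comp.
  by apply/funext => t; rewrite (limn_esupN (F ^~ t)) oppeK.
- by move=> t _; rewrite lee_fin normsq_ge0.
- move=> t _; rewrite limn_einf_lim; apply: lime_ge; first exact: is_cvg_einfs.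
  by apply: nearW => n; apply: le_ereal_inf_tmp => _ [m _ <-]; exact: F0.
apply: filterS aeS => t /cvgf[cR cI] _.
have cF : F i t @[i --> \oo] --> (normsq (g t - f j t))%:E.
  apply: cvg_EFin; first exact: nearW.
  have cR' : Re (f (k (i + K)%N) t) @[i --> \oo] --> gR t.
    by rewrite (cvg_shiftn K (fun i => Re (f (k i) t))).
  have cI' : Im (f (k (i + K)%N) t) @[i --> \oo] --> gI t.
    by rewrite (cvg_shiftn K (fun i => Im (f (k i) t))).
  rewrite /normsq; apply: cvgD.
    rewrite ReB [X in _ --> X]expr2; under eq_fun do rewrite ReB expr2.
    by apply: cvgM; apply: cvgB => //; exact: cvg_cst.
  rewrite ImB [X in _ --> X]expr2; under eq_fun do rewrite ImB expr2.
  by apply: cvgM; apply: cvgB => //; exact: cvg_cst.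
by rewrite (cvg_limn_einf_sup cF).
Qed.

End L2_complete.

Section measurable_sequences.
Context d (T : measurableType d) (R : realType).
Local Notation C := R[i].
Implicit Types (h : T -> seq R) (F : seq R -> C).

(** Measurability of a map into lists, taken coordinatewise; the length is fixed because a function
    on lists is only controlled at one length. *)
Definition mseq n h : Prop :=
  (forall t, size (h t) = n) /\ forall i, measurable_fun setT (fun t => nth 0 (h t) i).

Lemma mseq_cons n h (x : T -> R) : measurable_fun setT x -> mseq n h ->
  mseq n.+1 (fun t => x t :: h t).
Proof. by move=> mx [sh mh]; split=> [t|[|i]] //=; rewrite ?sh. Qed.

Lemma mseq_cat n m h k : mseq n h -> mseq m k -> mseq (n + m) (fun t => h t ++ k t).
Proof.
move=> [sh mh] [sk mk]; split=> [t|i]; first by rewrite size_cat sh sk.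
rewrite (_ : (fun t => _) =
    if (i < n)%N then fun t => nth 0 (h t) i else fun t => nth 0 (k t) (i - n)).
  by case: ifP.
by apply/funext => t; rewrite nth_cat sh; case: ifP.
Qed.

Lemma mseq_rev n h : mseq n h -> mseq n (fun t => rev (h t)).
Proof.
move=> [sh mh]; split=> [t|i]; first by rewrite size_rev.
have [lin|nli] := ltnP i n; first by under eq_fun do rewrite nth_rev ?sh//; exact: mh.
by under eq_fun do rewrite nth_default ?size_rev ?sh//; exact: measurable_cst.
Qed.

Lemma mseq_take n k h : mseq n h -> (k <= n)%N -> mseq k (fun t => take k (h t)).
Proof.
move=> [sh mh] kn; split=> [t|i]; first by rewrite size_takel ?sh.
have [ik|ki] := ltnP i k; first by under eq_fun do rewrite nth_take//; exact: mh.
by under eq_fun do rewrite nth_default ?size_takel ?sh//; exact: measurable_cst.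
Qed.

Lemma mseq_drop n k h : mseq n h -> mseq (n - k) (fun t => drop k (h t)).
Proof.
move=> [sh mh]; split=> [t|i]; first by rewrite size_drop sh.
by under eq_fun do rewrite nth_drop; exact: mh.
Qed.

Lemma mseq_cst s : mseq (size s) (fun=> s).
Proof. by split=> // i; exact: measurable_cst. Qed.

Lemma mseq_rcons n h (x : R) : mseq n h -> mseq n.+1 (fun t => rcons (h t) x).
Proof.
by move=> mh; rewrite -addn1; under eq_fun do rewrite -cats1; apply: mseq_cat mh _; exact: (mseq_cst [:: x]).
Qed.

Lemma mseq_tuple_of n h : mseq n h -> measurable_fun setT (fun t => tuple_of_seq n (h t)).
Proof.
move=> [sh mh]; apply/measurable_fun_tnthP => i.
rewrite (_ : _ \o _ = (fun t => nth 0 (h t) i)); first exact: mh.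
by apply/funext => t /=; rewrite tnth_mktuple.
Qed.

End measurable_sequences.

Section measurable_sequence_functions.
Variable R : realType.
Local Notation C := R[i].
Local Notation mu n := (muplus R n).
Local Notation m1 := (@mu1 R).
Implicit Types (F G : seq R -> C).

Lemma tuple_of_seqK n (s : seq R) : size s = n -> tuple_of_seq n s = s :> seq R.
Proof.
move=> sn; apply: (@eq_from_nth _ 0); first by rewrite size_tuple.
move=> i; rewrite size_tuple => lin.
by rewrite -[LHS](tnth_nth _ _ (Ordinal lin)) tnth_mktuple.
Qed.

Lemma tuple_of_seq_id n (t : n.-tuple R) : tuple_of_seq n t = t.
Proof. by apply: val_inj; rewrite [LHS]tuple_of_seqK// size_tuple. Qed.

Lemma mseq_tuple n : mseq n (fun t : n.-tuple R => t : seq R).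
Proof.
split=> [t|i]; first by rewrite size_tuple.
have [lin|nli] := ltnP i n.
  rewrite (_ : (fun _ => _) = (fun t => tnth t (Ordinal lin))); first exact: measurable_tnth.
  by apply/funext => t; rewrite (tnth_nth 0).
by under eq_fun do rewrite nth_default ?size_tuple//; exact: measurable_cst.
Qed.

Lemma mseq_comp d d' (T : measurableType d) (T' : measurableType d') n (h : T -> seq R) (g : T' -> T) :
  mseq n h -> measurable_fun setT g -> mseq n (fun t => h (g t)).
Proof.
by move=> [sh mh] mg; split=> [t|i] //; exact: (measurableT_comp (mh i) mg).
Qed.

Lemma measurable_mseq d (T : measurableType d) d' (U : measurableType d')
  n (h : T -> seq R) (f : seq R -> U) :
  measurable_fun setT (fun t : n.-tuple R => f t) -> mseq n h -> measurable_fun setT (fun t => f (h t)).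
Proof.
move=> mf mh; have [sh _] := mh.
rewrite (_ : (fun t => _) = (fun t => f (tuple_of_seq n (h t)))).
  exact: (measurableT_comp mf (mseq_tuple_of mh)).
by apply/funext => t; rewrite tuple_of_seqK.
Qed.

Lemma cmeas_mseq d (T : measurableType d) n (h : T -> seq R) F :
  cmeas (fun t : n.-tuple R => F t) -> mseq n h -> cmeas (fun t => F (h t)).
Proof.
move=> [f1 f2] mh; split.
  exact: (measurable_mseq (f := fun s => complex.Re (F s)) f1 mh).
exact: (measurable_mseq (f := fun s => complex.Im (F s)) f2 mh).
Qed.

Lemma ge0_integral_cat a b (f : seq R -> \bar R) :
  measurable_fun setT (fun t : (a + b).-tuple R => f t) -> (forall t, 0 <= f t)%E ->
  (\int[mu (a + b)]_t f t = \int[mu a]_s \int[mu b]_t f (s ++ t))%E.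
Proof.
elim: a f => [|a IH] f mf f0.
  rewrite (@integral_tuple0 R (fun s : 0.-tuple R => \int[mu b]_t f (s ++ t))%E)//.
  rewrite (_ : (fun s => _) = fun=> (\int[mu b]_t f ([tuple] ++ t))%E); first exact: measurable_cst.
  by apply/funext => s; rewrite tuple0.
have mf' : measurable_fun setT (fun u : (a.+1).-tuple R * b.-tuple R => f (u.1 ++ u.2)).
  apply: (measurable_mseq mf); apply: mseq_cat.
    exact: mseq_comp (@mseq_tuple _) measurable_fst.
  exact: mseq_comp (@mseq_tuple _) measurable_snd.
rewrite (ge0_integral_cons (n := (a + b)%N) mf)//.
have mF := measurable_fun_fubini_tonelli_F (T1 := a.+1.-tuple R) (T2 := b.-tuple R) (m2 := mu b) _ mf' (fun u => f0 (u.1 ++ u.2)).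
rewrite (ge0_integral_cons (n := a) mF); last by move=> s; exact: integral_ge0.
apply: eq_integral => x _; apply: (IH (fun s => f (x :: s))) => //.
apply: (@measurable_mseq _ _ _ _ (a.+1 + b)%N (fun t : (a + b).-tuple R => x :: (t : seq R)) f mf).
by apply: mseq_cons; [exact: measurable_cst | exact: mseq_tuple].
Qed.

Lemma measurable_cint d1 d2 (T1 : measurableType d1) (T2 : measurableType d2)
  (m2 : {sigma_finite_measure set T2 -> \bar R}) (f : T1 * T2 -> R) :
  measurable_fun setT f -> measurable_fun setT (fun x => \int[m2]_y f (x, y)).
Proof.
move=> /measurable_EFinP mf.
apply: (measurableT_comp (fine_measurable measurableT)) => //.
rewrite (_ : (fun x => _) = (fun x => \int[m2]_y ((EFin \o f)^\+ (x, y)) -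
    \int[m2]_y ((EFin \o f)^\- (x, y))))%E.
  apply: emeasurable_funB.
    have h := measurable_fun_fubini_tonelli_F (m2 := m2) _ (measurable_funepos mf).
    by apply: h => u; exact: funepos_ge0.
  have h := measurable_fun_fubini_tonelli_F (m2 := m2) _ (measurable_funeneg mf).
  by apply: h => u; exact: funeneg_ge0.
apply/funext => x; rewrite [LHS]integralE.
congr (_ - _)%E; apply: eq_integral => y _.
  by rewrite -[RHS]/(((EFin \o f)^\+ \o pair x) y)%E -funepos_comp.
by rewrite -[RHS]/(((EFin \o f)^\- \o pair x) y)%E -funeneg_comp.
Qed.

Lemma cmeas_cint d1 d2 (T1 : measurableType d1) (T2 : measurableType d2)
  (m2 : {sigma_finite_measure set T2 -> \bar R}) (f : T1 * T2 -> C) :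
  cmeas f -> cmeas (fun x => cint m2 (fun y => f (x, y))).
Proof.
by move=> [f1 f2]; split; [exact: (measurable_cint m2 f1) | exact: (measurable_cint m2 f2)].
Qed.

End measurable_sequence_functions.

(** * Contractions are bounded in L^2 *)

Section contraction_bound.
Variable R : realType.
Local Notation C := R[i].
Local Notation mu n := (muplus R n).
Local Notation m1 := (@mu1 R).
Local Notation tf n F := (fun t : n.-tuple R => F (tval t) : C).
Implicit Types (F G : seq R -> C).

Lemma measurable_sqn_sections d1 d2 (T1 : measurableType d1) (T2 : measurableType d2)
  (m2 : {sigma_finite_measure set T2 -> \bar R}) n (h : T1 * T2 -> seq R) F :
  cmeas (tf n F) -> mseq n h -> measurable_fun setT (fun x => sqn m2 (fun y => F (h (x, y)))).
Proof.
move=> mF mh; have mFh := measurable_EFin_normsq (cmeas_mseq mF mh).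
have := measurable_fun_fubini_tonelli_F (m2 := m2) _ mFh; apply => u.
by rewrite lee_fin normsq_ge0.
Qed.

Lemma mseq_cat_fst d1 d2 (T1 : measurableType d1) (T2 : measurableType d2) a b
  (h : T1 -> seq R) (k : T2 -> seq R) : mseq a h -> mseq b k ->
  mseq (a + b) (fun u : T1 * T2 => h u.1 ++ k u.2).
Proof.
move=> mh mk; apply: mseq_cat; first exact: (mseq_comp mh measurable_fst).
exact: (mseq_comp mk measurable_snd).
Qed.

Lemma mseq_cat_snd d1 d2 (T1 : measurableType d1) (T2 : measurableType d2) a b
  (h : T2 -> seq R) (k : T1 -> seq R) : mseq a h -> mseq b k ->
  mseq (a + b) (fun u : T1 * T2 => h u.2 ++ k u.1).
Proof.
move=> mh mk; apply: mseq_cat; first exact: (mseq_comp mh measurable_snd).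
exact: (mseq_comp mk measurable_fst).
Qed.

Lemma rev_permute n : exists s : 'S_n, forall u : n.-tuple R,
  rev u = permute_tuple s u :> seq R.
Proof.
exists (perm (@rev_ord_inj n)) => u; apply: (@eq_from_nth _ 0).
  by rewrite size_rev !size_tuple.
move=> i; rewrite size_rev size_tuple => lin.
rewrite -[RHS](tnth_nth _ _ (Ordinal lin)) tnth_mktuple permE (tnth_nth 0).
by rewrite nth_rev ?size_tuple.
Qed.

Lemma sqn_rev n F : cmeas (tf n F) -> sqn (mu n) (tf n (F \o rev)) = sqn (mu n) (tf n F).
Proof.
move=> mF; have [s hs] := rev_permute n; rewrite -(sqn_permute s mF).
by apply: eq_sqn => t /=; rewrite hs.
Qed.

(* f wedge_r g, for f of degree a + r *)
Definition contr a r F G (t : seq R) : C :=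
  cint (mu r) (fun u => F (take a t ++ rev u) * G (u ++ drop a t)).

Section bound.
Variables (a b r : nat) (F G : seq R -> C).
Hypotheses (mF : cmeas (tf (a + r) F)) (mG : cmeas (tf (r + b) G)).

Let mtake : mseq a (fun t : (a + b).-tuple R => take a t).
Proof. by apply: mseq_take; [exact: mseq_tuple | exact: leq_addr]. Qed.

Let mdrop : mseq b (fun t : (a + b).-tuple R => drop a t).
Proof. by have := mseq_drop a (@mseq_tuple R (a + b)); rewrite addKn. Qed.

Let mrev : mseq r (fun u : r.-tuple R => rev u).
Proof. exact: mseq_rev (@mseq_tuple R r). Qed.

Lemma contr_meas : cmeas (tf (a + b) (contr a r F G)).
Proof.
have := @cmeas_cint R _ _ ((a + b).-tuple R) (r.-tuple R) (mu r)
  (fun v => F (take a v.1 ++ rev v.2) * G (v.2 ++ drop a v.1)).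
apply; apply: cmeasM.
  exact: (cmeas_mseq mF (mseq_cat_fst mtake mrev)).
exact: (cmeas_mseq mG (mseq_cat_snd (@mseq_tuple R r) mdrop)).
Qed.

Lemma sections_meas t : size t = (a + b)%N ->
  cmeas (fun u : r.-tuple R => F (take a t ++ rev u)) /\
  cmeas (fun u : r.-tuple R => G (u ++ drop a t)).
Proof.
move=> st; split.
  apply: (cmeas_mseq mF); apply: mseq_cat mrev.
  by have := @mseq_cst _ (r.-tuple R) R (take a t); rewrite size_takel// st leq_addr.
apply: (cmeas_mseq mG); apply: mseq_cat; first exact: mseq_tuple.
by have := @mseq_cst _ (r.-tuple R) R (drop a t); rewrite size_drop st addKn.
Qed.

Local Notation SF t := (sqn (mu r) (fun u : r.-tuple R => F (take a t ++ rev u))).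
Local Notation SG t := (sqn (mu r) (fun u : r.-tuple R => G (u ++ drop a t))).

Lemma measurable_sections : measurable_fun setT (fun t : (a + b).-tuple R => SF t * SG t)%E.
Proof.
apply: emeasurable_funM.
  exact: (measurable_sqn_sections (mu r) mF (mseq_cat_fst mtake mrev)).
exact: (measurable_sqn_sections (mu r) mG (mseq_cat_snd (@mseq_tuple R r) mdrop)).
Qed.

(** The section norm of [F] depends only on the first [a] variables and that of [G] only on the last
    [b], so the integral factors. Each factor is an iterated integral, after the reversal is undone
    by a permutation. *)
Lemma integral_sections :
  (\int[mu (a + b)]_t (SF t * SG t) = sqn (mu (a + r)) (tf (a + r) F) * sqn (mu (r + b)) (tf (r + b) G))%E.
Proof.
have f0 t : (0 <= SF t * SG t)%E by rewrite mule_ge0// sqn_ge0.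
rewrite (ge0_integral_cat (f := fun t => SF t * SG t)%E measurable_sections f0).
pose phi (s : seq R) := sqn (mu r) (fun u : r.-tuple R => F (s ++ rev u)).
pose psi (t : seq R) := sqn (mu r) (fun u : r.-tuple R => G (u ++ t)).
transitivity (\int[mu a]_s \int[mu b]_t (phi s * psi t))%E.
  apply: eq_integral => s _; apply: eq_integral => t _.
  by rewrite take_size_cat ?size_tuple// drop_size_cat ?size_tuple.
have mpsi : measurable_fun setT (fun t : b.-tuple R => psi t).
  exact: (measurable_sqn_sections (mu r) mG (mseq_cat_snd (@mseq_tuple R r) (@mseq_tuple R b))).
have mphi : measurable_fun setT (fun t : a.-tuple R => phi t).
  exact: (measurable_sqn_sections (mu r) mF (mseq_cat_fst (@mseq_tuple R a) mrev)).
have nF (t : seq R) : (0 <= (normsq (F t))%:E :> \bar R)%E by rewrite lee_fin normsq_ge0.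
have nG (t : seq R) : (0 <= (normsq (G t))%:E :> \bar R)%E by rewrite lee_fin normsq_ge0.
under eq_integral => s _.
  rewrite ge0_integralZl//; last 2 first.
  - by move=> t _; exact: sqn_ge0.
  - exact: sqn_ge0.
  over.
rewrite ge0_integralZr//; last 2 first.
- by move=> s _; exact: sqn_ge0.
- by apply: integral_ge0 => t _; exact: sqn_ge0.
congr (_ * _)%E.
  rewrite /sqn (ge0_integral_cat (f := fun t => (normsq (F t))%:E) (measurable_EFin_normsq mF) nF).
  apply: eq_integral => s _.
  have mFs : cmeas (tf r (fun u => F (s ++ u))).
    apply: (cmeas_mseq mF); apply: mseq_cat; last exact: mseq_tuple.
    by have := @mseq_cst _ (r.-tuple R) R s; rewrite size_tuple.
  exact: (sqn_rev (F := fun u => F (s ++ u)) mFs).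
rewrite /sqn (ge0_integral_cat (f := fun t => (normsq (G t))%:E) (measurable_EFin_normsq mG) nG).
have mGn : measurable_fun setT (fun u : b.-tuple R * r.-tuple R => (normsq (G (u.2 ++ u.1)))%:E).
  exact: (measurable_EFin_normsq (cmeas_mseq mG (mseq_cat_snd (@mseq_tuple R r) (@mseq_tuple R b)))).
have := fubini_tonelli (m1 := mu b) (m2 := mu r) _ mGn; apply => u; exact: nG.
Qed.

(** Cauchy-Schwarz in the contracted variables for each [t], integrated by [integral_sections]. *)
Lemma contr_bound : (sqn (mu (a + b)) (tf (a + b) (contr a r F G)) <=
  sqn (mu (a + r)) (tf (a + r) F) * sqn (mu (r + b)) (tf (r + b) G))%E.
Proof.
rewrite -integral_sections; apply: ge0_le_integral => //.
- by move=> t _; rewrite lee_fin normsq_ge0.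
- exact: measurable_EFin_normsq contr_meas.
- exact: measurable_sections.
- move=> t _; have [h1 h2] := sections_meas (size_tuple t).
  exact: cint_cauchy_schwarz.
Qed.

(** The product of the section norms is finite for almost every [t]; a section of infinite norm can
    then only face one of norm 0, and the integrand vanishes almost everywhere. *)
Lemma contr_integrable : sqint (mu (a + r)) (tf (a + r) F) -> sqint (mu (r + b)) (tf (r + b) G) ->
  {ae mu (a + b), forall t : (a + b).-tuple R, cintegrable (mu r)
    (fun u : r.-tuple R => F (take a t ++ rev u) * G (u ++ drop a t))}.
Proof.
move=> LF LG.
have fin : (mu (a + b)).-integrable setT (fun t => SF t * SG t)%E.
  apply/integrableP; split; first exact: measurable_sections.
  under eq_integral => t _ do rewrite gee0_abs ?mule_ge0 ?sqn_ge0//.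
  rewrite integral_sections -(fineK (sqint_fin LF)) -(fineK (sqint_fin LG)).
  by rewrite -EFinM ltry.
have := integrable_ae measurableT fin; apply: filterS => t /(_ I) h.
have [hF hG] := sections_meas (size_tuple t).
have zero (f g : r.-tuple R -> C) : cmeas f -> cmeas g -> sqn (mu r) f = 0%E ->
    cintegrable (mu r) (fun u => f u * g u).
  move=> mf mg /(sqn_eq0 mf) f0; apply: (@cintegrable_ae_eq _ _ _ _ (fun=> 0)).
  - exact: cmeasM.
  - by apply: filterS f0 => u ->; rewrite mul0r.
  - exact: cintegrable0.
have [F0|F0] := eqVneq (SF t) 0%E; first exact: zero.
have [G0|G0] := eqVneq (SG t) 0%E.
  by under eq_fun do rewrite mulrC; exact: zero.
have pos (x : \bar R) : (0 <= x)%E -> x != 0%E -> (0 < x)%E by move=> ? ?; rewrite lt_def; apply/andP.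
have hFp := pos _ (sqn_ge0 _ _) F0; have hGp := pos _ (sqn_ge0 _ _) G0.
apply: sqint_mul; split => //.
  by rewrite ltey; apply: contraTneq h => ->; rewrite gt0_mulye.
by rewrite ltey; apply: contraTneq h => ->; rewrite gt0_muley.
Qed.

End bound.

(** FG - F'G' = (F - F') G + F' (G - G'), at the points where the integrals of FG, F'G' and F'G
    converge. *)
Lemma contrB a b r F F' G G' : sqint (mu (a + r)) (tf (a + r) F) -> sqint (mu (a + r)) (tf (a + r) F') ->
  sqint (mu (r + b)) (tf (r + b) G) -> sqint (mu (r + b)) (tf (r + b) G') ->
  {ae mu (a + b), forall t : (a + b).-tuple R, contr a r F G t - contr a r F' G' t =
    contr a r (fun s => F s - F' s) G t + contr a r F' (fun s => G s - G' s) t}.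
Proof.
move=> LF LF' LG LG'; have [mF _] := LF; have [mF' _] := LF'; have [mG _] := LG; have [mG' _] := LG'.
have h1 := contr_integrable mF mG LF LG; have h2 := contr_integrable mF' mG' LF' LG'.
have h3 := contr_integrable mF' mG LF' LG.
move: h1 h2 h3; apply: filterS3 => t i1 i2 i3.
have N1 f g : cintegrable (mu r) f -> cintegrable (mu r) g -> cintegrable (mu r) (fun u => f u - g u).
  by move=> If /(cintegrableZ (-1)) Ig; under eq_fun do rewrite -mulN1r; exact: cintegrableD.
rewrite /contr -(cintB i1 i2); under [X in X + _]eq_cint => u do rewrite mulrBl.
under [X in _ + X]eq_cint => u do rewrite mulrBr.
by rewrite -(cintD (N1 _ _ i1 i3) (N1 _ _ i3 i2)); apply: eq_cint => u; rewrite addrA subrK.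
Qed.

End contraction_bound.

(** * Functions whose integrals over boxes vanish *)

Section box_integrals.
Variable R : realType.
Local Notation C := R[i].
Local Notation mu n := (muplus R n).
Local Notation m1 := (@mu1 R).
Local Notation bx n A := (@box R n A).

Fixpoint tens (zs : seq (R -> C)) (t : seq R) : C :=
  match zs, t with z :: zs', x :: t' => z x * tens zs' t' | _, _ => 1 end.

Definition ind (A : set R) (x : R) : C := (\1_A x)%:C%C.

Definition bounded_set1 (A : set R) : Prop :=
  measurable A /\ exists K : R, forall x, A x -> `|x| <= K.

Lemma tens_ind n (A : nat -> set R) (t : n.-tuple R) :
  tens [seq ind (A i) | i <- iota 0 n] t = (\1_(bx n A) t)%:C%C.
Proof.
suff h m : tens [seq ind (A i) | i <- iota m n] t = (\1_(bx n (fun i => A (m + i)%N)) t)%:C%C.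
  exact: h.
elim: n m t => [|n IH] m.
  by move=> t; rewrite tuple0 /= indicE mem_set// => -[].
case/tupleP => x t /=; rewrite IH /ind -rmorphM /=; congr (_%:C)%C.
rewrite !indicE -natrM mulnb; congr (nat_of_bool _)%:R.
apply/andP/idP; rewrite ?inE.
  move=> [Ax At] i; have [j ->|->] := unliftP ord0 i; last by rewrite tnth0 addn0; exact: Ax.
  by rewrite tnthS lift0 addnS -addSn; exact: At.
move=> At; split; first by have := At ord0; rewrite tnth0 addn0.
by move=> i; have := At (lift ord0 i); rewrite tnthS lift0 addnS -addSn.
Qed.

Variables (n : nat) (h : n.-tuple R -> C).
Hypothesis Lh : sqint (mu n) h.

Lemma finite_box (A : nat -> set R) : (forall i, bounded_set1 (A i)) ->
  (mu n (bx n A) < +oo)%E.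
Proof.
move=> bA; rewrite muplus_box; last by move=> i; case: (bA i).
have fA i : (m1 (A i) < +oo)%E.
  have [mA [K AK]] := bA i; apply: (@le_lt_trans _ _ (lebesgue_measure `[- K, K])).
    apply: le_measure; rewrite ?inE.
    - by apply: measurableI; [case: (bA i) | exact: measurable_itv].
    - exact: measurable_itv.
    - by move=> x [/AK Kx _]; move: Kx; rewrite ler_norml /= in_itv.
  by rewrite lebesgue_measure_itv; case: ifP => // _; rewrite -EFinB ltry.
elim: n => [|k IH]; first by rewrite big_ord0 ltry.
rewrite big_ord_recr /=; apply: lte_mul_pinfty => //.
  by apply: prode_ge0 => i _; exact: measure_ge0.
by rewrite ge0_fin_numE//; apply: prode_ge0 => i _; exact: measure_ge0.
Qed.

Hypothesis h0 : forall A : nat -> set R, (forall i, bounded_set1 (A i)) ->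
  cint (mu n) (fun t => (\1_(bx n A) t)%:C%C * h t) = 0.

(** Inside each cube, the sets over which [u] integrates to 0 form a Dynkin class containing the
    boxes, hence comprise all measurable sets, and [u] vanishes almost everywhere on the cube. *)
Let part_ae0 (u : n.-tuple R -> R) : measurable_fun setT u ->
  (forall A : nat -> set R, (forall i, bounded_set1 (A i)) ->
    (mu n).-integrable setT (fun t => (\1_(bx n A) t * u t)%:E) /\
    \int[mu n]_t (\1_(bx n A) t * u t) = 0) ->
  {ae mu n, forall t, u t = 0}.
Proof.
move=> mu0 hu.
pose B (K : nat) := bx n (fun=> [set x : R | `|x| <= K%:R]).
have bset K : bounded_set1 [set x : R | `|x| <= K%:R].
  split; last by exists K%:R.
  rewrite (_ : mkset _ = `[- K%:R, K%:R]%classic); first exact: measurable_itv.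
  by apply/seteqP; split=> x /=; rewrite in_itv /= ler_norml.
have mB K : measurable (B K) by apply: measurable_box => _; case: (bset K).
have restE X : (fun t => (\1_X t * u t)%:E) = (EFin \o u) \_ X :> (_ -> \bar R).
  by apply/funext => t; rewrite patchE indicE; case: (t \in X); rewrite ?mul1r ?mul0r.
have iB K : (mu n).-integrable (B K) (EFin \o u).
  apply/(integrable_mkcond _ (mB K)); rewrite -restE.
  by have [] := hu (fun=> [set x : R | `|x| <= K%:R]) (fun=> bset K).
have zero K X : measurable X -> (\int[mu n]_(t in B K `&` X) (u t)%:E = 0)%E.
  pose P X := (\int[mu n]_(t in B K `&` X) (u t)%:E = 0)%E.
  have intI Y : measurable Y -> (mu n).-integrable (B K `&` Y) (EFin \o u).
    move=> mY; apply: (@integrableS _ _ _ _ (B K)) => //; exact: measurableI.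
  have PT : P setT.
    rewrite /P setIT integral_mkcond; have [iu u0] := hu _ (fun=> bset K).
    rewrite -[LHS]fineK; last by rewrite -(restE (B K)) integrable_fin_num.
    by rewrite -(restE (B K)) -[fine _]/(\int[mu n]_t _) u0.
  rewrite tuple_measurableE -/(P X); apply: (dynkin_induction (tuple_measurableE R n)) => //.
  - move=> _ _ [A1 mA1 ->] [A2 mA2 ->]; exists (fun i => A1 i `&` A2 i).
      by move=> i; exact: measurableI.
    apply/seteqP; split=> [t [g1 g2] i|t g]; first by split; [exact: g1 | exact: g2].
    by split=> i; have [] := g i.
  - move=> _ [A mA ->]; rewrite /P.
    pose A' i := [set x : R | `|x| <= K%:R] `&` A i.
    have -> : B K `&` bx n A = bx n A'.
      apply/seteqP; split=> [t [g1 g2] i|t g]; first by split; [exact: g1 | exact: g2].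
      by split=> i; have [] := g i.
    have bA' i : bounded_set1 (A' i).
      have [mK [k hk]] := bset K; split; first exact: measurableI.
      by exists k => x [/hk].
    rewrite integral_mkcond; have [iu u0] := hu _ bA'.
    rewrite -[LHS]fineK; last by rewrite -(restE (bx n A')) integrable_fin_num.
    by rewrite -(restE (bx n A')) -[fine _]/(\int[mu n]_t _) u0.
  - move=> Y mY PY; move: PT; rewrite /P setIT -{1}(setIT (B K)) -(setUv Y) setIUr.
    rewrite integral_setU//; last 4 first.
    + exact: measurableI.
    + by apply: measurableI => //; exact: measurableC.
    + exact/measurable_EFinP/(measurable_funS measurableT).
    + by apply/disj_setPLR => t [_ Yt] [_ nYt]; exact: nYt.
    by rewrite PY add0e.
  - move=> F mF tF PF; rewrite /P setI_bigcupr integral_bigcup.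
    + by apply: eseries0 => i _ _; exact: PF.
    + exact: trivIset_setIl.
    + by move=> k; exact: measurableI.
    + by rewrite -setI_bigcupr; apply: intI; exact: bigcup_measurable.
have /ae_foralln : forall K, {ae mu n, forall t, B K t -> u t = 0}.
  move=> K; have := @integral_ae_eq _ _ _ (mu n) (B K) (mB K) (cst 0%E) _ (iB K) (measurable_cst _).
  have sub E : E `<=` B K -> measurable E ->
      (\int[mu n]_(x in E) (EFin \o u) x = \int[mu n]_(x in E) cst 0 x)%E.
    move=> EB mE; rewrite integral0 -[RHS](zero K E mE).
    by rewrite setIidr.
  by move=> /(_ sub); apply: filterS => t g /g [].
apply: filterS => t g; apply: (g (\max_(i < n) Num.bound `|tnth t i|)%N) => i /=.
apply: (@le_trans _ _ (Num.bound `|tnth t i|)%:R).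
  by rewrite ltW// archi_boundP.
by rewrite ler_nat; exact: (leq_bigmax (F := fun i => Num.bound `|tnth t i|)).
Qed.

Lemma box_integrals_ae0 : {ae mu n, forall t, h t = 0}.
Proof.
have [[mr mi] _] := Lh.
have L1 A : (forall i, bounded_set1 (A i)) -> sqint (mu n) (fun t => (\1_(bx n A) t)%:C%C).
  move=> bA; have mb : measurable (bx n A) by apply: measurable_box => i; case: (bA i).
  split; first by split; [exact: measurable_indic | exact: measurable_cst].
  rewrite /sqn (eq_integral (fun t => (\1_(bx n A) t)%:E)); last first.
    by move=> t _; rewrite normsq_real indicE; case: (_ \in _); rewrite ?expr1n ?expr0n.
  by rewrite integral_indic// setIT finite_box.
have iA A : (forall i, bounded_set1 (A i)) ->
  cintegrable (mu n) (fun t => (\1_(bx n A) t)%:C%C * h t) 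
    by move=> bA; exact: sqint_mul (L1 A bA) Lh.
have r0 : {ae mu n, forall t, complex.Re (h t) = 0}.
  apply: part_ae0 => // A bA; have [] := iA A bA; have := congr1 (@complex.Re _) (h0 bA).
  rewrite /=; under eq_fun do rewrite ReMr.
  by move=> ? ? _.
have i0 : {ae mu n, forall t, complex.Im (h t) = 0}.
  apply: part_ae0 => // A bA; have [] := iA A bA; have := congr1 (@complex.Im _) (h0 bA).
  have E t : complex.Im ((\1_(bx n A) t)%:C%C * h t) = \1_(bx n A) t * complex.Im (h t).
    by rewrite ImM /= mul0r addr0.
  rewrite /=; under eq_fun do rewrite E.
  by move=> ? _ ?.
by move: r0 i0; apply: filterS2 => t a b; exact: eqC.
Qed.

End box_integrals.

(** * Antisymmetrization and contractions *)

Section antisymmetrization.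
Variable R : realType.
Local Notation C := R[i].
Implicit Types (F G H : seq R -> C) (z : R -> C).

(* Functions of n variables are functions on lists, of which only the values on
   lists of size n matter: no casts between n + m and m + n are needed *)
Definition asym n F (t : seq R) : C :=
  (n`!%:R)^-1 * \sum_(s : 'S_n) (-1) ^+ s * F (permute_tuple s (tuple_of_seq n t)).

(** Required at every tuple and not almost everywhere, so that one variable can be fixed; classes
    modulo null sets are reached at the end by continuity. *)
Definition alt n F : Prop := forall (s : 'S_n) (t : n.-tuple R),
  F (permute_tuple s t) = (-1) ^+ s * F t.

Definition ten z F (t : seq R) : C := if t is x :: t' then z x * F t' else 0.

Definition catf p F G (t : seq R) : C := F (take p t) * G (drop p t).

Lemma asymE n F (t : n.-tuple R) :
  asym n F t = (n`!%:R)^-1 * \sum_(s : 'S_n) (-1) ^+ s * F (permute_tuple s t).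
Proof. by rewrite /asym tuple_of_seq_id. Qed.

Lemma asym_tuple n F (t : seq R) : asym n F (tuple_of_seq n t) = asym n F t.
Proof. by rewrite asymE. Qed.

Lemma eq_asym n F G : (forall t, size t = n -> F t = G t) -> asym n F =1 asym n G.
Proof.
by move=> FG t; congr (_ * _); apply: eq_bigr => s _; rewrite FG ?size_tuple.
Qed.

Lemma asymD n F G t : asym n (fun t => F t + G t) t = asym n F t + asym n G t.
Proof.
rewrite /asym -mulrDr -big_split; congr (_ * _).
by apply: eq_bigr => s _; rewrite mulrDr.
Qed.

Lemma asymZ n a F t : asym n (fun t => a * F t) t = a * asym n F t.
Proof.
rewrite /asym [RHS]mulrCA; congr (_ * _); rewrite mulr_sumr.
by apply: eq_bigr => s _; rewrite mulrCA.
Qed.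

Lemma asym0 n t : asym n (fun=> 0) t = 0.
Proof. by rewrite /asym big1 ?mulr0// => s _; rewrite mulr0. Qed.

Lemma asym_sum n (I : Type) (r : seq I) (P : pred I) (F : I -> seq R -> C) t :
  asym n (fun t => \sum_(i <- r | P i) F i t) t = \sum_(i <- r | P i) asym n (F i) t.
Proof.
elim: r => [|i r IH].
  by rewrite big_nil -[RHS](asym0 n t); apply: eq_asym => u _; rewrite big_nil.
rewrite big_cons (eq_asym (G := fun t => (if P i then F i t else 0) +
    \sum_(j <- r | P j) F j t)); last first.
  by move=> u _; rewrite big_cons; case: ifP; rewrite ?add0r.
rewrite asymD IH; case: ifP => //= _.
by rewrite asym0 add0r.
Qed.

Lemma signM (n : nat) (s u : 'S_n) : (-1) ^+ (s * u)%g = (-1) ^+ s * (-1) ^+ u :> C.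
Proof. by rewrite odd_permM signr_addb. Qed.

Lemma sign_sq (b : bool) : (-1) ^+ b * (-1) ^+ b = 1 :> C.
Proof. by rewrite -expr2 -exprM mulnC exprM sqrrN !expr1n. Qed.

Lemma fact_neq0 n : n`!%:R != 0 :> C.
Proof. by rewrite pnatr_eq0 -lt0n fact_gt0. Qed.

Lemma asym_permute n F (s : 'S_n) t :
  asym n (fun u => F (permute_tuple s (tuple_of_seq n u))) t = (-1) ^+ s * asym n F t.
Proof.
rewrite /asym [RHS]mulrCA; congr (_ * _); rewrite mulr_sumr.
rewrite [RHS](reindex_inj (mulgI s)); apply: eq_bigr => u _.
by rewrite tuple_of_seq_id permute_tupleM signM mulrA mulrA sign_sq mul1r.
Qed.

Lemma asym_alt n F : alt n (asym n F).
Proof.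
move=> s t; rewrite !asymE [RHS]mulrCA; congr (_ * _); rewrite mulr_sumr.
rewrite [RHS](reindex_inj (mulIg s)); apply: eq_bigr => u _.
by rewrite permute_tupleM signM [(-1) ^+ u * (-1) ^+ s]mulrC !mulrA sign_sq mul1r.
Qed.

Lemma alt_asym n F t : alt n F -> size t = n -> asym n F t = F t.
Proof.
move=> aF st; rewrite /asym (eq_bigr (fun=> F t)) => [|s _].
  by rewrite sumr_const card_Sn -[X in _ * X]mulr_natl mulKf// fact_neq0.
by rewrite aF mulrA sign_sq mul1r tuple_of_seqK.
Qed.

Lemma asym_asym n F t : asym n (asym n F) t = asym n F t.
Proof. by rewrite -[RHS]asym_tuple -[LHS]asym_tuple alt_asym ?size_tuple//; exact: asym_alt. Qed.

Lemma alt_eq n F G : (forall t, size t = n -> F t = G t) -> alt n F -> alt n G.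
Proof. by move=> FG aF s t; rewrite -!FG ?size_tuple. Qed.

Lemma altZ n a F : alt n F -> alt n (fun t => a * F t).
Proof. by move=> aF s t; rewrite aF mulrCA. Qed.

Lemma altD n F G : alt n F -> alt n G -> alt n (fun t => F t + G t).
Proof. by move=> aF aG s t; rewrite aF aG mulrDr. Qed.

Definition del n (k : 'I_n.+1) (t : n.+1.-tuple R) : n.-tuple R :=
  [tuple tnth t (lift k i) | i < n].

Lemma permute_lift n (k : 'I_n.+1) (s : 'S_n) (t : n.+1.-tuple R) :
  permute_tuple (lift_perm ord0 k s) t = tnth t k :: permute_tuple s (del k t) :> seq R.
Proof.
rewrite -[RHS]/(tval [tuple of tnth t k :: permute_tuple s (del k t)]); congr tval.
apply: eq_from_tnth => i; rewrite tnth_mktuple.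
have [j ->|->] := unliftP ord0 i; first by rewrite lift_perm_lift tnthS !tnth_mktuple.
by rewrite lift_perm_id tnth0.
Qed.

(** Expansion along the argument of [z], as for a determinant: [lift_perm ord0 k s] runs through all
    permutations exactly once and contributes the extra sign (-1)^k. *)
Lemma asym_ten n z F (t : n.+1.-tuple R) :
  asym n.+1 (ten z F) t =
    (n.+1%:R)^-1 * \sum_(k < n.+1) (-1) ^+ k * (z (tnth t k) * asym n F (del k t)).
Proof.
rewrite asymE factS natrM invfM -mulrA; congr (_ * _).
pose h (u : 'I_n.+1 * 'S_n) : 'S_n.+1 := lift_perm ord0 u.1 u.2.
have bh : bijective h.
  apply: inj_card_bij; last by rewrite card_prod card_ord !card_Sn.
  move=> [k s] [k' s'] /= e.
  have kk' : k = k' by have := congr1 (fun u : 'S_n.+1 => u ord0) e; rewrite /h /= !lift_perm_id.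
  move: e; rewrite /h kk' /= => e; congr pair; apply/permP => i.
  have := congr1 (fun u : 'S_n.+1 => u (lift ord0 i)) e.
  by rewrite !lift_perm_lift => /lift_inj.
pose E (s : 'S_n.+1) := (n`!%:R)^-1 * ((-1) ^+ s * ten z F (permute_tuple s t)).
transitivity (\sum_(u : 'I_n.+1 * 'S_n) E (h u)).
  by rewrite mulr_sumr; exact: (reindex h (onW_bij _ bh)).
rewrite -(pair_big xpredT xpredT (fun k s => E (lift_perm ord0 k s))).
apply: eq_bigr => k _; rewrite asymE mulrCA !mulr_sumr /E.
apply: eq_bigr => s _; rewrite permute_lift odd_lift_perm /= signr_addb signr_odd.
set a := _^-1; set b := z _; set c := F _; set e := _ ^+ k; set e' := _ ^+ s; ring.
Qed.

Lemma asym_ten_asym n z F t : asym n.+1 (ten z (asym n F)) t = asym n.+1 (ten z F) t.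
Proof.
rewrite -[RHS]asym_tuple -[LHS]asym_tuple !asym_ten; congr (_ * _).
by apply: eq_bigr => k _; rewrite asym_asym.
Qed.

Lemma del0 n (x : R) (t : n.-tuple R) : del ord0 [tuple of x :: t] = t.
Proof. by apply: eq_from_tnth => i; rewrite tnth_mktuple tnthS. Qed.

Lemma del_lift n (x : R) (t : n.+1.-tuple R) (k : 'I_n.+1) :
  del (lift ord0 k) [tuple of x :: t] = x :: del k t :> seq R.
Proof.
rewrite -[RHS]/(tval [tuple of x :: del k t]); congr tval.
apply: eq_from_tnth => i; rewrite tnth_mktuple.
have [j ->|->] := unliftP ord0 i; last first.
  by rewrite (_ : lift _ _ = ord0) ?tnth0//; exact: val_inj.
rewrite (_ : lift _ _ = lift ord0 (lift k j)) ?tnthS ?tnth_mktuple//.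
by apply: val_inj => /=; rewrite /bump /= !add1n ltnS; case: leqP.
Qed.

Lemma alt_cons n F x : alt n.+1 F -> alt n (fun s => F (x :: s)).
Proof.
move=> aF s t; have := aF (lift_perm ord0 ord0 s) [tuple of x :: t].
by rewrite permute_lift tnth0 del0 odd_lift_perm.
Qed.

(** In [asym_ten] the term k = 0 feeds x to [z]; in the others x stays the first argument of [F],
    and the shift of k gives the sign -1. This drives the recursions for contractions and the
    anticommutation relation [car]. *)
Lemma asym_cons n z F x t : alt n F -> size t = n ->
  n.+1%:R * asym n.+1 (ten z F) (x :: t) =
  z x * F t - n%:R * asym n (ten z (fun s => F (x :: s))) t.
Proof.
move=> aF st; pose u : n.-tuple R := Tuple (introT eqP st).
rewrite -[x :: t]/(tval [tuple of x :: u]) -[t]/(tval u) asym_ten mulVKf ?pnatr_eq0//.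
rewrite big_ord_recl del0 tnth0 expr0 mul1r alt_asym ?size_tuple//; congr (_ + _).
case: n aF st u => [|n] aF st u; first by rewrite big_ord0 mul0r oppr0.
rewrite asym_ten mulVKf ?pnatr_eq0// -sumrN; apply: eq_bigr => k _.
rewrite tnthS lift0 exprS mulN1r mulNr; congr (- (_ * (_ * _))).
rewrite alt_asym ?size_tuple// del_lift [RHS]alt_asym ?size_tuple//.
exact: alt_cons.
Qed.

Lemma alt_swap n F x y t : alt n.+2 F -> size t = n -> F (x :: y :: t) = - F (y :: x :: t).
Proof.
move=> aF st; pose u : n.-tuple R := Tuple (introT eqP st).
have := aF (lift_perm ord0 (lift ord0 ord0) 1%g) [tuple of x :: [tuple of y :: u]].
rewrite permute_lift permute_tuple1 tnthS tnth0 del_lift del0 odd_lift_perm odd_perm1 /= expr1 mulN1r.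
by move=> ->; rewrite opprK.
Qed.

Lemma alt_rcons n F x t : alt n.+1 F -> size t = n -> F (rcons t x) = (-1) ^+ n * F (x :: t).
Proof.
elim: n F t => [|n IH] F [|y t] //= aF; first by rewrite mul1r.
move=> [st]; rewrite (IH (fun s => F (y :: s))) ?(alt_swap x y aF)//; last exact: alt_cons.
by rewrite exprS; ring.
Qed.

Lemma alt_rcons_slice n F x : alt n.+1 F -> alt n (fun s => F (rcons s x)).
Proof.
move=> aF; apply: (alt_eq (F := fun s => (-1) ^+ n * F (x :: s))).
  by move=> t st; rewrite (alt_rcons x aF).
by apply: altZ; exact: alt_cons.
Qed.

(** The extension of a block permutation is built with [lift_perm], one fixed point at a time, which
    keeps the sign. *)
Lemma permute_right p m n (s : 'S_m) : n = (p + m)%N -> exists u : 'S_n,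
  odd_perm u = odd_perm s /\ forall t, size t = n ->
  permute_tuple u (tuple_of_seq n t) =
    take p t ++ permute_tuple s (tuple_of_seq m (drop p t)) :> seq R.
Proof.
move=> ->; elim: p => [|p [u [ou hu]]].
  by exists s; split=> // t st; rewrite take0 drop0.
exists (lift_perm ord0 ord0 u); rewrite odd_lift_perm ou; split=> // -[//|x t] /= [st].
rewrite -(hu t st) permute_lift.
have -> : tuple_of_seq (p + m).+1 (x :: t) = [tuple of x :: tuple_of_seq (p + m) t].
  by apply: val_inj; rewrite /= !tuple_of_seqK//= st.
by rewrite tnth0 del0.
Qed.

Lemma permute_left p m n (s : 'S_p) : n = (p + m)%N -> exists u : 'S_n,
  odd_perm u = odd_perm s /\ forall t, size t = n ->
  permute_tuple u (tuple_of_seq n t) =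
    permute_tuple s (tuple_of_seq p (take p t)) ++ drop p t :> seq R.
Proof.
elim: m n => [|m IH] n.
  rewrite addn0 => ->; exists s; split=> // t st.
  by rewrite take_oversize ?drop_oversize ?st// cats0.
rewrite addnS => ->; have [u [ou hu]] := IH _ erefl.
exists (lift_perm ord_max ord_max u); rewrite odd_lift_perm ou addbb; split=> // t.
case/lastP: t => // t x; rewrite size_rcons => -[st].
have lp : (p <= size t)%N by rewrite st leq_addr.
rewrite -cats1 takel_cat// drop_cat.
have -> : (if (p < size t)%N then drop p t ++ [:: x] else drop (p - size t) [:: x]) = drop p t ++ [:: x].
  case: ltnP => // h; have -> : p = size t by apply/eqP; rewrite eqn_leq lp.
  by rewrite subnn drop_size.
rewrite catA -(hu t st); apply: (@eq_from_nth _ 0).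
  by rewrite size_cat !size_tuple addn1.
move=> i; rewrite size_tuple => il.
rewrite -[LHS](tnth_nth _ _ (Ordinal il)) tnth_mktuple.
have [j ej|ej] := unliftP ord_max (Ordinal il).
  rewrite ej lift_perm_lift tnth_mktuple nth_cat.
  have -> : i = j by have := congr1 (@nat_of_ord _) ej; rewrite lift_max.
  have ju : (u j < p + m)%N by exact: ltn_ord (u j).
  have jl : (j < p + m)%N by exact: ltn_ord j.
  rewrite !lift_max st ju nth_cat size_tuple jl -[RHS](tnth_nth _ _ j) tnth_mktuple.
  by rewrite tnth_mktuple.
rewrite ej lift_perm_id tnth_mktuple; have -> : i = (p + m)%N by have := congr1 val ej.
by rewrite !nth_cat size_tuple st /= !ltnn subnn.
Qed.

(** Each inner permutation is absorbed by the outer antisymmetrization: its sign occurs twice, and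
    the m! resulting terms coincide. *)
Lemma asym_catf_right p m n F H t : n = (p + m)%N ->
  asym n (catf p F (asym m H)) t = asym n (catf p F H) t.
Proof.
move=> nE; transitivity (asym n (fun t => (m`!%:R)^-1 * \sum_(s : 'S_m) (-1) ^+ s *
    catf p F (fun v => H (permute_tuple s (tuple_of_seq m v))) t) t).
  apply: eq_asym => u su; rewrite /catf /asym mulrCA mulr_sumr; congr (_ * _).
  by apply: eq_bigr => s _; rewrite mulrCA.
rewrite asymZ asym_sum (eq_bigr (fun=> asym n (catf p F H) t)) => [|s _].
  by rewrite sumr_const card_Sn -[X in _ * X]mulr_natl mulKf// fact_neq0.
rewrite asymZ; have [u [ou hu]] := permute_right s nE.
transitivity ((-1) ^+ s * ((-1) ^+ u * asym n (catf p F H) t) : C); last first.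
  by rewrite ou mulrA sign_sq mul1r.
rewrite -asym_permute; congr (_ * _).
apply: eq_asym => v sv; rewrite hu// /catf.
by rewrite take_size_cat ?drop_size_cat// size_takel// sv nE leq_addr.
Qed.

Lemma asym_catf_left p m n F H t : n = (p + m)%N ->
  asym n (catf p (asym p F) H) t = asym n (catf p F H) t.
Proof.
move=> nE; transitivity (asym n (fun t => (p`!%:R)^-1 * \sum_(s : 'S_p) (-1) ^+ s *
    catf p (fun v => F (permute_tuple s (tuple_of_seq p v))) H t) t).
  apply: eq_asym => u su; rewrite /catf /asym -mulrA mulr_suml; congr (_ * _).
  by apply: eq_bigr => s _; rewrite mulrA.
rewrite asymZ asym_sum (eq_bigr (fun=> asym n (catf p F H) t)) => [|s _].
  by rewrite sumr_const card_Sn -[X in _ * X]mulr_natl mulKf// fact_neq0.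
rewrite asymZ; have [u [ou hu]] := permute_left s nE.
transitivity ((-1) ^+ s * ((-1) ^+ u * asym n (catf p F H) t) : C); last first.
  by rewrite ou mulrA sign_sq mul1r.
rewrite -asym_permute; congr (_ * _).
apply: eq_asym => v sv; rewrite hu// /catf.
by rewrite take_size_cat ?drop_size_cat// size_tuple.
Qed.

Lemma permute_front n a (t : n.+1.-tuple R) (ha : (a < n.+1)%N) :
  permute_tuple (lift_perm ord0 (Ordinal ha) 1%g) t =
    nth 0 t a :: (take a t ++ drop a.+1 t) :> seq R.
Proof.
rewrite permute_lift permute_tuple1 (tnth_nth 0); congr (_ :: _).
have st : size (take a t) = a by rewrite size_takel// size_tuple ltnW.
apply: (@eq_from_nth _ 0).
  by rewrite size_tuple size_cat st size_drop size_tuple subSS subnKC.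
move=> i; rewrite size_tuple => il.
rewrite -[LHS](tnth_nth _ _ (Ordinal il)) tnth_mktuple (tnth_nth 0) nth_cat st /= /bump.
case: ltnP => ia; rewrite ?leqNgt ?ia ?nth_take//= .
by rewrite nth_drop add1n addSn subnKC// ltnNge ia.
Qed.

(** Moving the variable at position [a] to the front is a cycle of sign (-1)^a. *)
Lemma asym_insert n a z F t : (a <= n)%N ->
  asym n.+1 (fun s => z (nth 0 s a) * F (take a s ++ drop a.+1 s)) t =
  (-1) ^+ a * asym n.+1 (ten z F) t.
Proof.
move=> an; have ha : (a < n.+1)%N by [].
have := asym_permute (ten z F) (lift_perm ord0 (Ordinal ha) 1%g) t.
rewrite odd_lift_perm odd_perm1 addbF /= signr_odd => <-.
by apply: eq_asym => s ss; rewrite permute_front tuple_of_seqK.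
Qed.

End antisymmetrization.

(** * Bounded functions supported on sets of finite measure *)

Section finite_support.
Context d (T : measurableType d) (R : realType).
Variable m : {measure set T -> \bar R}.
Local Notation C := R[i].
Variables (f : T -> C) (M : R) (B : set T).
Hypotheses (mf : cmeas f) (fM : forall t, normsq (f t) <= M).
Hypotheses (mB : measurable B) (fB : (m B < +oo)%E) (supp : forall t, f t <> 0 -> B t).

Let M0 (t : T) : 0 <= M. Proof. exact: le_trans (normsq_ge0 _) (fM t). Qed.

Let cind : T -> C := fun t => (\1_B t)%:C%C.

Let cindE t : normsq (cind t) = \1_B t.
Proof. by rewrite normsq_real indicE; case: (_ \in _); rewrite ?expr1n ?expr0n. Qed.

Let sqn_ind : sqn m cind = m B.
Proof.
rewrite /sqn (eq_integral (fun t => (\1_B t)%:E)) => [|t _]; last by rewrite cindE.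
by rewrite integral_indic// setIT.
Qed.

Let f_ind t : f t = f t * cind t.
Proof.
have [->|/eqP/supp Bt] := eqVneq (f t) 0; first by rewrite mul0r.
by rewrite /cind indicE mem_set// mulr1.
Qed.

Lemma sqn_finite_support : (sqn m f <= M%:E * m B)%E.
Proof.
case: (pselect (exists t : T, True)) => [[t0 _]|T0]; last first.
  have e : B = set0 by apply/seteqP; split=> // t _; apply: T0; exists t.
  rewrite e measure0 mule0 /sqn (_ : setT = set0) ?integral_set0//.
  by apply/seteqP; split=> // t _; apply: T0; exists t.
have := @ge0_le_integral _ _ _ m setT measurableT (fun t => (normsq (f t))%:E) (fun t => M%:E * (\1_B t)%:E)%E.
rewrite ge0_integralZl//; last 2 first.
- exact/measurable_EFinP.
- by [move=> t _; rewrite lee_fin | exact: M0 t0].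
rewrite integral_indic// setIT; apply.
- by move=> t _; rewrite lee_fin normsq_ge0.
- exact: measurable_EFin_normsq.
- by apply: measurable_funeM; exact/measurable_EFinP.
- move=> t _; rewrite -EFinM lee_fin f_ind normsqM cindE ler_wpM2r//.
Qed.

Lemma sqint_finite_support : sqint m f.
Proof.
split=> //; apply: le_lt_trans sqn_finite_support _.
case: (pselect (exists t : T, True)) => [[t0 _]|T0].
  by apply: lte_mul_pinfty => //; rewrite ?lee_fin ?(M0 t0)// ge0_fin_numE.
have e : B = set0 by apply/seteqP; split=> // t _; apply: T0; exists t.
by rewrite e measure0 mule0.
Qed.

Let sqint_ind : sqint m cind.
Proof. by split; [split; [exact: measurable_indic | exact: measurable_cst] | rewrite sqn_ind]. Qed.

Lemma cintegrable_finite_support : cintegrable m f.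
Proof.
by have := sqint_mul sqint_finite_support sqint_ind; under eq_fun do rewrite -f_ind.
Qed.

Lemma cint_finite_support : normsq (cint m f) <= M * fine (m B) * fine (m B).
Proof.
have [mi _] := sqint_ind; have := cint_cauchy_schwarz m mf mi.
under eq_cint do rewrite -f_ind.
have Bf : m B \is a fin_num by rewrite ge0_fin_numE.
rewrite sqn_ind => /le_trans h; rewrite -lee_fin; apply: h.
by rewrite !EFinM fineK// lee_wpmul2r// sqn_finite_support.
Qed.

End finite_support.

Section nice_functions.
Variable R : realType.
Local Notation C := R[i].
Local Notation mu n := (muplus R n).
Local Notation m1 := (@mu1 R).
Local Notation tf n F := (fun t : n.-tuple R => F (tval t) : C).
Implicit Types (F G : seq R -> C) (z : R -> C).

Definition bmeas n F : Prop :=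
  cmeas (tf n F) /\ exists M : R, forall t : n.-tuple R, normsq (F t) <= M.

(** Boundedness and bounded support pass to slices and make the integrals below converge at every
    point, so the recursions for contractions are pointwise identities without exceptional null
    sets. *)
Definition nice n F : Prop := bmeas n F /\
  exists K : R, forall t : n.-tuple R, F t <> 0 -> forall y, y \in tval t -> `|y| <= K.

Definition nice1 z : Prop := [/\ cmeas z, exists M : R, forall x, normsq (z x) <= M &
  exists K : R, forall x, z x <> 0 -> `|x| <= K].

Lemma bmeas_eq n F G : (forall t, size t = n -> F t = G t) -> bmeas n F -> bmeas n G.
Proof.
move=> FG [mF [M hM]]; split; last by exists M => t; rewrite -FG ?size_tuple.
by rewrite -(_ : tf n F = tf n G)//; apply/funext => t; rewrite FG ?size_tuple.
Qed.

Lemma nice_eq n F G : (forall t, size t = n -> F t = G t) -> nice n F -> nice n G.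
Proof.
move=> FG [bF [K hK]]; split; first exact: bmeas_eq bF.
by exists K => t; rewrite -FG ?size_tuple//; exact: hK.
Qed.

Lemma bmeas_cst n a : bmeas n (fun=> a).
Proof. by split; [exact: cmeas_cst | exists (normsq a)]. Qed.

Lemma bmeas_comp m n (h : seq R -> seq R) F : bmeas n F ->
  mseq n (fun t : m.-tuple R => h t) -> bmeas m (F \o h).
Proof.
move=> [mF [M hM]] mh; split; first exact: cmeas_mseq mF mh.
by exists M => t; have := hM (tuple_of_seq n (h t)); rewrite tuple_of_seqK; case: mh.
Qed.

Lemma nice_comp m n (h : seq R -> seq R) F : nice n F -> mseq n (fun t : m.-tuple R => h t) ->
  (forall t, size t = m -> {subset t <= h t}) -> nice m (F \o h).
Proof.
move=> [bF [K hK]] mh sub; split; first exact: bmeas_comp bF mh.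
exists K => t /= ht y yt; have := hK (tuple_of_seq n (h t)).
rewrite tuple_of_seqK; last by case: mh.
by move=> /(_ ht y); apply; apply: sub; rewrite ?size_tuple.
Qed.

Lemma bmeasM n F G : bmeas n F -> bmeas n G -> bmeas n (fun t => F t * G t).
Proof.
move=> [mF [M hM]] [mG [M' hM']]; split; first exact: cmeasM.
by exists (M * M') => t; rewrite normsqM ler_pM ?normsq_ge0.
Qed.

Lemma bmeasD n F G : bmeas n F -> bmeas n G -> bmeas n (fun t => F t + G t).
Proof.
move=> [mF [M hM]] [mG [M' hM']]; split; first exact: cmeasD.
exists (2 * M + 2 * M') => t; apply: le_trans (normsqD_le _ _) _.
by rewrite lerD// ler_pM2l.
Qed.

Lemma niceM n F G : nice n F -> bmeas n G -> nice n (fun t => F t * G t).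
Proof.
move=> [bF [K hK]] bG; split; first exact: bmeasM.
by exists K => t FG; apply: hK => F0; apply: FG; rewrite F0 mul0r.
Qed.

Lemma niceZ n a F : nice n F -> nice n (fun t => a * F t).
Proof.
move=> nF; apply: (nice_eq (F := fun t => F t * a)) => [t _|]; first by rewrite mulrC.
by apply: niceM => //; exact: bmeas_cst.
Qed.

Lemma niceD n F G : nice n F -> nice n G -> nice n (fun t => F t + G t).
Proof.
move=> [bF [K hK]] [bG [K' hK']]; split; first exact: bmeasD.
exists (Num.max K K') => t FG y yt; rewrite le_max.
have [F0|/eqP F0] := eqVneq (F t) 0; last by rewrite (hK _ F0 _ yt).
by rewrite (hK' t _ _ yt) ?orbT// => G0; apply: FG; rewrite F0 G0 addr0.
Qed.

Lemma nice0 n : nice n (fun=> 0).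
Proof. by split; [exact: bmeas_cst | exists 0]. Qed.

Lemma nice_sum n (I : Type) (r : seq I) (P : pred I) (F : I -> seq R -> C) :
  (forall i, P i -> nice n (F i)) -> nice n (fun t => \sum_(i <- r | P i) F i t).
Proof.
move=> nF; elim: r => [|i r IH].
  by apply: nice_eq (nice0 n) => t _; rewrite big_nil.
have [Pi|Pi] := boolP (P i); last first.
  by apply: nice_eq IH => t _; rewrite big_cons (negbTE Pi).
apply: (nice_eq (F := fun t => F i t + \sum_(i <- r | P i) F i t)) => [t _|].
  by rewrite big_cons Pi.
by apply: niceD => //; exact: nF.
Qed.

Lemma mseq_permute n (s : 'S_n) :
  mseq n (fun t : n.-tuple R => permute_tuple s (tuple_of_seq n t) : seq R).
Proof.
rewrite (_ : (fun t => _) = (fun t : n.-tuple R => permute_tuple s t : seq R)).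
  exact: (mseq_comp (@mseq_tuple R n) (measurable_permute s)).
by apply/funext => t; rewrite tuple_of_seq_id.
Qed.

Lemma nice_asym n F : nice n F -> nice n (asym n F).
Proof.
move=> nF; apply: niceZ; apply: nice_sum => s _; apply: niceZ.
apply: (nice_comp (h := fun t => permute_tuple s (tuple_of_seq n t) : seq R) nF (mseq_permute s)).
move=> t st y; rewrite -{1}(tuple_of_seqK st) => /tnthP[i ->].
have -> : tnth (tuple_of_seq n t) i = tnth (permute_tuple s (tuple_of_seq n t)) ((s^-1)%g i).
  by rewrite [RHS]tnth_mktuple permKV.
exact: mem_tnth.
Qed.

Lemma nice1_nice z : nice1 z -> nice 1 (fun t => z (head 0 t)).
Proof.
move=> [mz [M hM] [K hK]]; have mh : measurable_fun setT (fun t : 1.-tuple R => head 0 t).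
  have [_ /(_ 0%N)] := @mseq_tuple R 1; apply: eq_measurable_fun => t _.
  by case/tupleP: t => x t.
split; last first.
  exists K; case/tupleP => x t; rewrite tuple0 /= => h y; rewrite inE => /eqP ->; exact: hK.
split; last by exists M => t; exact: hM.
by case: mz => m1' m2'; split; [exact: (measurableT_comp m1' mh) | exact: (measurableT_comp m2' mh)].
Qed.

Lemma measurable_tuple_cst (a : R) : measurable [set x : R | `|x| <= a].
Proof.
rewrite (_ : mkset _ = `[- a, a]%classic); first exact: measurable_itv.
by apply/seteqP; split=> x /=; rewrite in_itv /= ler_norml.
Qed.

Lemma bounded_set1_ball (a : R) : bounded_set1 [set x : R | `|x| <= a].
Proof. by split; [exact: measurable_tuple_cst | exists a]. Qed.

Lemma finite_mu1 (A : set R) : bounded_set1 A -> (m1 A < +oo)%E.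
Proof.
move=> bA; have := @finite_box R 1 (fun=> A) (fun=> bA).
by rewrite muplus_box ?big_ord1// => _; case: bA.
Qed.

Lemma nice_finite_support n F : nice n F -> exists2 B, measurable B /\ (mu n B < +oo)%E &
  forall t, tf n F t <> 0 -> B t.
Proof.
move=> [_ [K hK]]; exists (@box R n (fun=> [set x | `|x| <= K])).
  split; first by apply: measurable_box => _; exact: measurable_tuple_cst.
  by apply: finite_box => _; exact: bounded_set1_ball.
by move=> t Ft i; apply: hK Ft _ _; exact: mem_tnth.
Qed.

Lemma nice_sqint n F : nice n F -> sqint (mu n) (tf n F).
Proof.
move=> nF; have [B [mB fB] hB] := nice_finite_support nF; have [[mF [M hM]] _] := nF.
exact: (sqint_finite_support mF hM mB fB hB).
Qed.

Lemma nice_integrable n F : nice n F -> cintegrable (mu n) (tf n F).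
Proof.
move=> nF; have [B [mB fB] hB] := nice_finite_support nF; have [[mF [M hM]] _] := nF.
exact: (cintegrable_finite_support mF hM mB fB hB).
Qed.

Lemma nice1_integrable z (f : R -> C) : nice1 z -> cmeas f ->
  (exists M : R, forall x, normsq (f x) <= M) -> cintegrable m1 (fun x => z x * f x).
Proof.
move=> [mz [M hM] [K hK]] mf [M' hM'].
refine (cintegrable_finite_support (M := M * M') (B := [set x : R | `|x| <= K]) _ _ _ _ _).
- exact: cmeasM.
- by move=> x; rewrite normsqM ler_pM ?normsq_ge0.
- exact: measurable_tuple_cst.
- exact/finite_mu1/bounded_set1_ball.
- by move=> x zf; apply: hK => z0; apply: zf; rewrite z0 mul0r.
Qed.

Lemma nice_ten n z F : nice1 z -> nice n F -> nice n.+1 (ten z F).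
Proof.
move=> nz nF; have [[mz [M hM]] [K hK]] := nice1_nice nz.
have mhead : mseq 1 (fun t : n.+1.-tuple R => take 1 t) 
    by apply: (mseq_take (n := n.+1)) => //; exact: mseq_tuple.
have mbeh : mseq n (fun t : n.+1.-tuple R => drop 1 t).
  by have := mseq_drop 1 (@mseq_tuple R n.+1); rewrite subSS subn0.
have e t : size t = n.+1 -> z (head 0 (take 1 t)) * F (drop 1 t) = ten z F t.
  by case: t => [//|x t] _ /=; rewrite ?take0 ?drop0.
have [bF [K' hK']] := nF; split.
  apply: (bmeas_eq e); apply: bmeasM.
    by apply: (bmeas_comp (h := take 1) (F := fun t => z (head 0 t)) _ mhead); case: (nice1_nice nz).
  exact: (bmeas_comp (h := drop 1) bF mbeh).
have [_ _ [k hk]] := nz.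
exists (Num.max k K'); case/tupleP => x t /= h y; rewrite inE le_max => /predU1P[->|yt].
  by rewrite hk// => z0; apply: h; rewrite z0 mul0r.
by rewrite (hK' t _ _ yt) ?orbT// => F0; apply: h; rewrite F0 mulr0.
Qed.

(** Linear in [z], without conjugation: the annihilator b(z) acts on degree n + 1 as n + 1 times
    [sl (conjf z)]. *)
Definition sl z F (s : seq R) : C := cint m1 (fun x => z x * F (x :: s)).

Lemma mseq_cons_cst n x : mseq n.+1 (fun t : n.-tuple R => x :: t).
Proof. by apply: mseq_cons; [exact: measurable_cst | exact: mseq_tuple]. Qed.

Lemma nice_cons n F x : nice n.+1 F -> nice n (fun s => F (x :: s)).
Proof.
move=> nF; apply: (nice_comp (h := cons x) nF (mseq_cons_cst n x)) => t _ y yt.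
by rewrite inE yt orbT.
Qed.

Lemma nice_rcons n F x : nice n.+1 F -> nice n (fun s => F (rcons s x)).
Proof.
move=> nF; apply: (nice_comp (h := fun s => rcons s x) nF) => [|t _ y yt].
  exact: mseq_rcons (@mseq_tuple R n).
by rewrite mem_rcons inE yt orbT.
Qed.

Lemma mseq_cons_var n (t : seq R) : size t = n -> mseq n.+1 (fun x : R => x :: t).
Proof. by move=> st; apply: mseq_cons => //; rewrite -st; exact: mseq_cst. Qed.

Lemma sl_integrable n z F t : nice1 z -> bmeas n.+1 F -> size t = n ->
  cintegrable m1 (fun x => z x * F (x :: t)).
Proof.
move=> nz [mF [M hM]] st; apply: nice1_integrable => //.
  exact: cmeas_mseq mF (mseq_cons_var st).
exists M => x; have := hM (tuple_of_seq n.+1 (x :: t)).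
by rewrite tuple_of_seqK//= st.
Qed.

Lemma nice_sl n z F : nice1 z -> nice n.+1 F -> nice n (sl z F).
Proof.
move=> nz [bF [K hK]]; have [mF [M hM]] := bF; have [mz [M' hM'] [K' hK']] := nz.
have supp (t : n.-tuple R) : sl z F t <> 0 -> exists x, F (x :: t) <> 0.
  apply: contra_notP => /forallNP h; rewrite /sl -[RHS](cint0 m1).
  by apply: eq_cint => x; have := h x; rewrite notK => ->; rewrite mulr0.
split; last first.
  exists K => t /supp[x Fx] y yt; apply: (hK [tuple of x :: t] Fx).
  by rewrite inE yt orbT.
split.
  have := @cmeas_cint R _ _ (n.-tuple R) R m1 (fun v => z v.2 * F (v.2 :: v.1)); apply.
  apply: cmeasM.
    case: mz => z1 z2; have m2 := @measurable_snd _ _ (n.-tuple R) R.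
    by split; [exact: (measurableT_comp z1 m2) | exact: (measurableT_comp z2 m2)].
  apply: (cmeas_mseq mF); apply: mseq_cons; first exact: measurable_snd.
  exact: (mseq_comp (@mseq_tuple R n) measurable_fst).
exists (M' * M * fine (m1 [set x | `|x| <= K']) * fine (m1 [set x | `|x| <= K'])) => t.
apply: cint_finite_support.
- apply: cmeasM => //; apply: (cmeas_mseq mF); apply: mseq_cons_var; exact: size_tuple.
- move=> x; rewrite normsqM; have := hM [tuple of x :: t].
  by move=> h; apply: ler_pM; rewrite ?normsq_ge0.
- exact: measurable_tuple_cst.
- exact/finite_mu1/bounded_set1_ball.
- by move=> x zf; apply: hK' => z0; apply: zf; rewrite z0 mul0r.
Qed.

(** Fubini in both orders; every inner integral is finite because slices of a [nice] function are
    again bounded with bounded support. *)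
Lemma cint_cons n F : nice n.+1 F ->
  [/\ cintegrable m1 (fun x => cint (mu n) (fun t : n.-tuple R => F (x :: t))),
      cint (mu n.+1) (tf n.+1 F) = cint m1 (fun x => cint (mu n) (fun t : n.-tuple R => F (x :: t))) &
      cint (mu n.+1) (tf n.+1 F) = cint (mu n) (fun t : n.-tuple R => cint m1 (fun x => F (x :: t)))].
Proof.
move=> nF; have [[[mr mi] bF] [K hK]] := nF.
have mc := @measurable_cons_pair R n.
have key (u : seq R -> R) : measurable_fun setT (fun t : n.+1.-tuple R => u t) ->
    (mu n.+1).-integrable setT (fun t : n.+1.-tuple R => (u t)%:E) ->
    (forall x, (mu n).-integrable setT (fun t : n.-tuple R => (u (x :: t))%:E)) ->
    (forall t : n.-tuple R, m1.-integrable setT (fun x => (u (x :: t))%:E)) ->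
    [/\ m1.-integrable setT (fun x => (\int[mu n]_t u (x :: t))%:E),
      \int[mu n.+1]_t u t = \int[m1]_x \int[mu n]_t u (x :: t) &
      \int[mu n.+1]_t u t = \int[mu n]_t \int[m1]_x u (x :: t)].
  move=> mu' iu i1 i2; have mE : measurable_fun setT (fun t : n.+1.-tuple R => (u t)%:E).
    exact/measurable_EFinP.
  pose v (w : R * n.-tuple R) := (u (w.1 :: w.2))%:E.
  have iv : (m1 \x mu n)%E.-integrable setT v.
    apply/integrableP; split; first exact: (measurableT_comp mE mc).
    have /integrableP[_] := iu; congr (_ < _)%E.
    have f0 : {in setT, forall t : n.+1.-tuple R, (0 <= `|(u t)%:E|)%E} by [].
    have mA : measurable_fun setT (fun t : n.+1.-tuple R => `|(u t)%:E|%E) by exact: measurableT_comp.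
    have := ge0_integral_pushforward mc (m1 \x mu n)%E measurableT mA f0.
    by rewrite preimage_setT.
  have E : (\int[mu n.+1]_t (u t)%:E = \int[m1 \x mu n]_w v w)%E.
    by have := integral_pushforward mc (mu := (m1 \x mu n)%E) (D := setT) mE; rewrite preimage_setT; apply.
  have e1 x : ((\int[mu n]_t u (x :: t))%:E = fubini_F (mu n) v x)%E.
    by rewrite fineK// integrable_fin_num.
  have e2 t : ((\int[m1]_x u (x :: tval t))%:E = fubini_G m1 v t)%E.
    by rewrite fineK// integrable_fin_num.
  split.
  - by under eq_fun do rewrite e1; exact: integrable_fubini_F.
  - by rewrite /Rintegral E -(fubini1 iv); congr fine; apply: eq_integral => x _; rewrite e1.
  - by rewrite /Rintegral E -(fubini2 iv); congr fine; apply: eq_integral => t _; rewrite e2.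
have i1 x : cintegrable (mu n) (fun t : n.-tuple R => F (x :: t)) by exact: nice_integrable (nice_cons x nF).
have i2 (t : n.-tuple R) : cintegrable m1 (fun x => F (x :: t)).
  have [M hM] := bF; refine (cintegrable_finite_support (M := M) (B := [set x : R | `|x| <= K]) _ _ _ _ _).
  - exact: (cmeas_mseq (conj mr mi) (mseq_cons_var (size_tuple t))).
  - by move=> x; exact: (hM [tuple of x :: t]).
  - exact: measurable_tuple_cst.
  - exact/finite_mu1/bounded_set1_ball.
  - by move=> x Fx; apply: (hK [tuple of x :: t] Fx); rewrite inE eqxx.
have [iR iI] := nice_integrable nF.
have [r1 r2 r3] := key (fun t => complex.Re (F t)) mr iR (fun x => (i1 x).1) (fun t => (i2 t).1).
have [s1 s2 s3] := key (fun t => complex.Im (F t)) mi iI (fun x => (i1 x).2) (fun t => (i2 t).2).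
by split; [split | apply: eqC | apply: eqC].
Qed.

End nice_functions.

(** * Peeling one variable off a contraction *)

Section contraction_recursion.
Variable R : realType.
Local Notation C := R[i].
Local Notation mu n := (muplus R n).
Local Notation m1 := (@mu1 R).
Local Notation tf n F := (fun t : n.-tuple R => F (tval t) : C).
Implicit Types (F G f v : seq R -> C) (z : R -> C).

Lemma cint_tuple0 (f : 0.-tuple R -> C) : cint (mu 0) f = f [tuple].
Proof.
have m (g : 0.-tuple R -> R) : measurable_fun setT (fun t => (g t)%:E).
  rewrite (_ : (fun t => _) = fun=> (g [tuple])%:E); first exact: measurable_cst.
  by apply/funext => t; rewrite tuple0.
by apply: eqC; rewrite /= /Rintegral integral_tuple0.
Qed.

Lemma contr0 a F G t : contr a 0 F G t = F (take a t) * G (drop a t).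
Proof. by rewrite /contr cint_tuple0 /= cats0. Qed.

(** Mirror of [sl]: a contraction uses the last variables of its left factor and the first ones of
    its right factor. *)
Definition slr z F (s : seq R) : C := cint m1 (fun x => z x * F (rcons s x)).

Lemma slr_sl n z F s : alt n.+1 F -> nice1 z -> nice n.+1 F -> size s = n ->
  slr z F s = (-1) ^+ n * sl z F s.
Proof.
move=> aF nz [bF _] ss; rewrite /slr /sl -cintZ; last exact: sl_integrable bF ss.
by apply: eq_cint => x; rewrite (alt_rcons x aF)// mulrCA.
Qed.

Lemma nice_slr n z F : alt n.+1 F -> nice1 z -> nice n.+1 F -> nice n (slr z F).
Proof.
move=> aF nz nF; apply: (nice_eq (F := fun s => (-1) ^+ n * sl z F s)).
  by move=> s ss; rewrite (slr_sl aF).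
by apply: niceZ; exact: nice_sl.
Qed.

Section slices.
Variables (a b r : nat) (t : seq R).
Hypothesis st : size t = (a + b)%N.

Let ta : size (take a t) = a. Proof. by rewrite size_takel// st leq_addr. Qed.
Let tb : size (drop a t) = b. Proof. by rewrite size_drop st addKn. Qed.

Lemma mseq_take_rev k : mseq (a + k) (fun u : k.-tuple R => take a t ++ rev u).
Proof.
apply: mseq_cat; last exact: mseq_rev (@mseq_tuple R k).
by rewrite -{1}ta; exact: mseq_cst.
Qed.

Lemma mseq_drop_cat k : mseq (k + b) (fun u : k.-tuple R => u ++ drop a t).
Proof. by apply: mseq_cat; [exact: mseq_tuple | rewrite -{1}tb; exact: mseq_cst]. Qed.

Lemma nice_take_rev k F : nice (a + k) F -> nice k (fun u => F (take a t ++ rev u)).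
Proof.
move=> nF; apply: (nice_comp (h := fun u => take a t ++ rev u) nF (mseq_take_rev k)).
by move=> u _ y yu; rewrite mem_cat mem_rev yu orbT.
Qed.

Lemma nice_drop_cat k G : nice (k + b) G -> nice k (fun u => G (u ++ drop a t)).
Proof.
move=> nG; apply: (nice_comp (h := fun u => u ++ drop a t) nG (mseq_drop_cat k)).
by move=> u _ y yu; rewrite mem_cat yu.
Qed.

Lemma contr_integrand k F G : nice (a + k) F -> nice (k + b) G ->
  cintegrable (mu k) (fun u : k.-tuple R => F (take a t ++ rev u) * G (u ++ drop a t)).
Proof.
move=> nF [bG _]; apply: (nice_integrable (F := fun u => F (take a t ++ rev u) * G (u ++ drop a t))).
apply: niceM; first exact: nice_take_rev.
exact: (bmeas_comp (h := fun u => u ++ drop a t) bG (mseq_drop_cat k)).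
Qed.

Lemma contr_linr F G G' c c' : nice (a + r) F -> nice (r + b) G -> nice (r + b) G' ->
  contr a r F (fun s => c * G s + c' * G' s) t = c * contr a r F G t + c' * contr a r F G' t.
Proof.
move=> nF nG nG'; rewrite /contr -!cintZ; [|exact: contr_integrand..].
rewrite -cintD; [|exact: cintegrableZ (contr_integrand _ _)..].
by apply: eq_cint => u; ring.
Qed.

Lemma contr_linl F F' G c c' : nice (a + r) F -> nice (a + r) F' -> nice (r + b) G ->
  contr a r (fun s => c * F s + c' * F' s) G t = c * contr a r F G t + c' * contr a r F' G t.
Proof.
move=> nF nF' nG; rewrite /contr -!cintZ; [|exact: contr_integrand..].
rewrite -cintD; [|exact: cintegrableZ (contr_integrand _ _)..].
by apply: eq_cint => u; ring.
Qed.

(** Thanks to the reversed kernel, s_1 is the last argument of [F] and the first of [G]; fixing it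
    leaves a contraction of order [r] of two slices, without sign. *)
Lemma contr_slice F G : nice (a + r.+1) F -> nice (r.+1 + b) G ->
  cintegrable m1 (fun x => contr a r (fun s => F (rcons s x)) (fun s => G (x :: s)) t) /\
  contr a r.+1 F G t = cint m1 (fun x => contr a r (fun s => F (rcons s x)) (fun s => G (x :: s)) t).
Proof.
move=> nF [bG _].
have nI : nice r.+1 (fun u => F (take a t ++ rev u) * G (u ++ drop a t)).
  apply: niceM; first exact: nice_take_rev.
  exact: (bmeas_comp (h := fun u => u ++ drop a t) bG (mseq_drop_cat _)).
have [i1 e1 _] := cint_cons nI.
have e x : contr a r (fun s => F (rcons s x)) (fun s => G (x :: s)) t =
    cint (mu r) (fun u : r.-tuple R => F (take a t ++ rev (x :: u)) * G ((x :: u) ++ drop a t)).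
  by apply: eq_cint => u; rewrite rev_cons -rcons_cat.
have {}e := funext e; split; first by rewrite e.
by rewrite e [LHS]e1.
Qed.

Lemma contr_slr z F G : nice1 z -> nice (a + r).+1 F -> nice (r + b) G ->
  cintegrable m1 (fun x => z x * contr a r (fun s => F (rcons s x)) G t) /\
  contr a r (slr z F) G t = cint m1 (fun x => z x * contr a r (fun s => F (rcons s x)) G t).
Proof.
rewrite -addnS => nz nF nG; have [bF _] := nF.
have nI : nice r.+1 (fun u => ten z (fun u => G (u ++ drop a t)) u * F (take a t ++ rev u)).
  apply: niceM; first by apply: nice_ten => //; exact: nice_drop_cat.
  exact: (bmeas_comp (h := fun u => take a t ++ rev u) bF (mseq_take_rev _)).
have [i1 e1 e2] := cint_cons nI.
have e x : z x * contr a r (fun s => F (rcons s x)) G t =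
    cint (mu r) (fun u : r.-tuple R => ten z (fun u => G (u ++ drop a t)) (x :: u) * F (take a t ++ rev (x :: u))).
  rewrite /contr -cintZ; last first.
    by apply: (contr_integrand (F := fun s => F (rcons s x))) => //; apply: nice_rcons; rewrite -addnS.
  by apply: eq_cint => u; rewrite rev_cons -rcons_cat /=; ring.
split; first by under eq_fun do rewrite e.
rewrite (eq_cint _ (fun x => e x)) -e1 e2; apply: eq_cint => u; rewrite /slr mulrC -cintZ.
  by apply: eq_cint => x; rewrite rev_cons -rcons_cat /=; ring.
apply: nice1_integrable => //.
  apply: (cmeas_mseq (h := fun x : R => rcons (take a t ++ rev u) x) bF.1).
  rewrite (_ : (fun x : R => _) = (fun x : R => (take a t ++ rev u) ++ [:: x])); last first.
    by apply/funext => x; rewrite cats1.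
  rewrite addnS -addn1; apply: mseq_cat; last by split=> // -[|i]//=; exact: measurable_cst.
  by have := @mseq_cst _ R R (take a t ++ rev u); rewrite size_cat ta size_rev size_tuple.
have [M hM] := bF.2; exists M => x; have := hM (tuple_of_seq (a + r.+1) (rcons (take a t ++ rev u) x)).
by rewrite tuple_of_seqK// size_rcons size_cat ta size_rev size_tuple addnS.
Qed.

Lemma contr_sl z F G : nice1 z -> nice (a + r) F -> nice (r.+1 + b) G ->
  cintegrable m1 (fun x => z x * contr a r F (fun s => G (x :: s)) t) /\
  contr a r F (sl z G) t = cint m1 (fun x => z x * contr a r F (fun s => G (x :: s)) t).
Proof.
move=> nz nF nG; have [bG _] := nG.
have nI : nice r.+1 (fun u => ten z (fun u => F (take a t ++ rev u)) u * G (u ++ drop a t)).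
  apply: niceM; first by apply: nice_ten => //; exact: nice_take_rev.
  exact: (bmeas_comp (h := fun u => u ++ drop a t) bG (mseq_drop_cat _)).
have [i1 e1 e2] := cint_cons nI.
have e x : z x * contr a r F (fun s => G (x :: s)) t =
    cint (mu r) (fun u : r.-tuple R => ten z (fun u => F (take a t ++ rev u)) (x :: u) * G ((x :: u) ++ drop a t)).
  rewrite /contr -cintZ; last first.
    by apply: (contr_integrand (G := fun s => G (x :: s))) => //; exact: nice_cons.
  by apply: eq_cint => u /=; ring.
split; first by under eq_fun do rewrite e.
rewrite (eq_cint _ (fun x => e x)) -e1 e2; apply: eq_cint => u; rewrite /sl -cintZ.
  by apply: eq_cint => x /=; ring.
by apply: sl_integrable => //; rewrite size_cat size_tuple tb.
Qed.

End slices.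

Lemma asym_cint n (Phi : R -> seq R -> C) t :
  (forall s, size s = n -> cintegrable m1 (fun x => Phi x s)) ->
  cintegrable m1 (fun x => asym n (Phi x) t) /\
  asym n (fun s => cint m1 (fun x => Phi x s)) t = cint m1 (fun x => asym n (Phi x) t).
Proof.
move=> iP; have i s : cintegrable m1 (fun x => (-1) ^+ odd_perm s *
    Phi x (permute_tuple s (tuple_of_seq n t))).
  by apply: cintegrableZ; apply: iP; exact: size_tuple.
have iS : cintegrable m1 (fun x => \sum_(s : 'S_n) (-1) ^+ s * Phi x (permute_tuple s (tuple_of_seq n t))).
  by apply: cintegrable_sum => s _; exact: i.
split; first exact: cintegrableZ.
rewrite /asym cintZ// cint_sum => [|s _]; last exact: i.
congr (_ * _); apply: eq_bigr => s _; rewrite cintZ//.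
by apply: iP; exact: size_tuple.
Qed.

Lemma asym_ten_cint n z (Phi : R -> seq R -> C) t :
  (forall s, size s = n -> cintegrable m1 (fun x => Phi x s)) ->
  cintegrable m1 (fun x => asym n.+1 (ten z (Phi x)) t) /\
  asym n.+1 (ten z (fun s => cint m1 (fun x => Phi x s))) t =
    cint m1 (fun x => asym n.+1 (ten z (Phi x)) t).
Proof.
move=> iP; have iT s : size s = n.+1 -> cintegrable m1 (fun x => ten z (Phi x) s).
  by case: s => [//|y s] [ss] /=; apply: cintegrableZ; exact: iP.
have [h1 h2] := asym_cint t iT; split=> //; rewrite -h2; apply: eq_asym => -[//|y s] [ss] /=.
by rewrite cintZ//; exact: iP.
Qed.

(** The degree [n] is a separate parameter, tied to a + b by hypotheses where needed, so that no
    cast between equal degrees occurs. *)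
Definition acontr n a r F G : seq R -> C := asym n (contr a r F G).

Lemma acontr_slice n a b r F G t : n = (a + b)%N -> nice (a + r.+1) F -> nice (r.+1 + b) G ->
  cintegrable m1 (fun x => acontr n a r (fun s => F (rcons s x)) (fun s => G (x :: s)) t) /\
  acontr n a r.+1 F G t = cint m1 (fun x => acontr n a r (fun s => F (rcons s x)) (fun s => G (x :: s)) t).
Proof.
move=> -> nF nG; have h s (ss : size s = (a + b)%N) := contr_slice ss nF nG.
have [i e] := asym_cint t (fun s ss => (h s ss).1); split=> //.
by rewrite -e; apply: eq_asym => s ss; rewrite (h s ss).2.
Qed.

Lemma acontr_slr n a b r z F G t : n = (a + b)%N -> nice1 z -> nice (a + r).+1 F -> nice (r + b) G ->
  cintegrable m1 (fun x => z x * acontr n a r (fun s => F (rcons s x)) G t) /\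
  acontr n a r (slr z F) G t = cint m1 (fun x => z x * acontr n a r (fun s => F (rcons s x)) G t).
Proof.
move=> -> nz nF nG; have h s (ss : size s = (a + b)%N) := contr_slr ss nz nF nG.
have [i e] := asym_cint t (fun s ss => (h s ss).1).
have E x : asym (a + b) (fun s => z x * contr a r (fun s0 => F (rcons s0 x)) G s) t =
  z x * acontr (a + b) a r (fun s => F (rcons s x)) G t by rewrite asymZ.
split; first by move: i; under eq_fun do rewrite E.
rewrite -(eq_cint _ (fun x => E x)) -e; apply: eq_asym => s ss; exact: (h s ss).2.
Qed.

Lemma acontr_sl n a b r z F G t : n = (a + b)%N -> nice1 z -> nice (a + r) F -> nice (r.+1 + b) G ->
  cintegrable m1 (fun x => z x * acontr n a r F (fun s => G (x :: s)) t) /\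
  acontr n a r F (sl z G) t = cint m1 (fun x => z x * acontr n a r F (fun s => G (x :: s)) t).
Proof.
move=> -> nz nF nG; have h s (ss : size s = (a + b)%N) := contr_sl ss nz nF nG.
have [i e] := asym_cint t (fun s ss => (h s ss).1).
have E x : asym (a + b) (fun s => z x * contr a r F (fun s => G (x :: s)) s) t =
  z x * acontr (a + b) a r F (fun s => G (x :: s)) t by rewrite asymZ.
split; first by move: i; under eq_fun do rewrite E.
rewrite -(eq_cint _ (fun x => E x)) -e; apply: eq_asym => s ss; exact: (h s ss).2.
Qed.

Lemma acontr_linr n a b r F G G' c c' t : n = (a + b)%N -> nice (a + r) F -> nice (r + b) G -> nice (r + b) G' ->
  acontr n a r F (fun s => c * G s + c' * G' s) t = c * acontr n a r F G t + c' * acontr n a r F G' t.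
Proof.
move=> -> nF nG nG'; rewrite /acontr -!asymZ -asymD; apply: eq_asym => s ss.
have := contr_linr ss c c' nF nG nG'; apply.
Qed.

Lemma acontr_linl n a b r F F' G c c' t : n = (a + b)%N -> nice (a + r) F -> nice (a + r) F' -> nice (r + b) G ->
  acontr n a r (fun s => c * F s + c' * F' s) G t = c * acontr n a r F G t + c' * acontr n a r F' G t.
Proof.
move=> -> nF nF' nG; rewrite /acontr -!asymZ -asymD; apply: eq_asym => s ss.
have := contr_linl ss c c' nF nF' nG; apply.
Qed.

Lemma eq_acontr n a b r F F' G G' : n = (a + b)%N ->
  (forall s, size s = (a + r)%N -> F s = F' s) -> (forall s, size s = (r + b)%N -> G s = G' s) ->
  acontr n a r F G =1 acontr n a r F' G'.
Proof.
move=> -> FF GG; apply: eq_asym => s ss; apply: eq_cint => u; rewrite FF ?GG//.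
  by rewrite size_cat size_tuple size_drop ss addKn.
by rewrite size_cat size_rev size_tuple size_takel// ss leq_addr.
Qed.

End contraction_recursion.

(** * Contractions with a wedge product *)

Section creation_recursion.
Variable R : realType.
Local Notation C := R[i].
Local Notation mu n := (muplus R n).
Local Notation m1 := (@mu1 R).
Implicit Types (F G f v : seq R -> C) (z : R -> C).

(** The creation operator b^*(z) in degree [n]. *)
Definition wedge n z F : seq R -> C := asym n.+1 (ten z F).

Definition nalt n F : Prop := nice n F /\ alt n F.

Lemma nalt_wedge n z F : nice1 z -> nice n F -> nalt n.+1 (wedge n z F).
Proof. by move=> nz nF; split; [apply: nice_asym; exact: nice_ten | exact: asym_alt]. Qed.

Lemma nalt_cons n F x : nalt n.+1 F -> nalt n (fun s => F (x :: s)).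
Proof. by move=> [nF aF]; split; [exact: nice_cons | exact: alt_cons]. Qed.

Lemma nalt_rcons n F x : nalt n.+1 F -> nalt n (fun s => F (rcons s x)).
Proof. by move=> [nF aF]; split; [exact: nice_rcons | exact: alt_rcons_slice]. Qed.

Lemma alt_sl n z F : nice1 z -> nalt n.+1 F -> alt n (sl z F).
Proof.
move=> nz [[bF _] aF] s t; rewrite /sl -cintZ; last exact: (sl_integrable nz bF (size_tuple t)).
apply: eq_cint => x; rewrite mulrCA; congr (_ * _).
exact: (alt_cons x aF).
Qed.

Lemma nalt_sl n z F : nice1 z -> nalt n.+1 F -> nalt n (sl z F).
Proof. by move=> nz nF; split; [apply: nice_sl; case: nF | exact: alt_sl]. Qed.

Lemma slr_rcons n z F x s : nice1 z -> nalt n.+2 F -> size s = n ->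
  slr z (fun s => F (rcons s x)) s = - slr z F (rcons s x).
Proof.
move=> nz [nF aF] ss; have [bF _] := nF.
rewrite (slr_sl (alt_rcons_slice x aF))//; last exact: nice_rcons.
rewrite (slr_sl aF)//; last by rewrite size_rcons ss.
by rewrite exprS mulN1r mulNr opprK; congr (_ * _); apply: eq_cint => y; rewrite rcons_cons.
Qed.

Lemma sl_cons n z F x s : nice1 z -> nalt n.+2 F -> size s = n ->
  sl z (fun s => F (x :: s)) s = - sl z F (x :: s).
Proof.
move=> nz [nF aF] ss; rewrite -mulN1r /sl -cintZ; last first.
  by have [bF _] := nF; apply: (sl_integrable nz bF); rewrite /= ss.
by apply: eq_cint => y; rewrite (alt_swap x y aF)//; ring.
Qed.

Lemma acontrZr n a b r F G c t : n = (a + b)%N -> nice (a + r) F -> nice (r + b) G ->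
  acontr n a r F (fun s => c * G s) t = c * acontr n a r F G t.
Proof.
move=> nE nF nG; have := acontr_linr c 0 t nE nF nG nG; rewrite mul0r addr0 => <-.
by apply: (eq_acontr nE) => // s _; rewrite mul0r addr0.
Qed.

Lemma acontrZl n a b r F G c t : n = (a + b)%N -> nice (a + r) F -> nice (r + b) G ->
  acontr n a r (fun s => c * F s) G t = c * acontr n a r F G t.
Proof.
move=> nE nF nG; have := acontr_linl c 0 t nE nF nF nG; rewrite mul0r addr0 => <-.
by apply: (eq_acontr nE) => // s _; rewrite mul0r addr0.
Qed.

(** In [wedge q z v] the factor [z] occupies each of q + 1 positions with equal weight. In r of them
    it is contracted, giving [slr z f]; in the others it stays free, and (-1)^(r + a) is the cost of
    moving it to the front past r contracted variables and the a free variables of [f]. The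
    induction peels off s_1. *)
Lemma acontr_wedge_r r : forall a b q n f v z t, n = (a + b)%N -> q.+1 = (r + b)%N ->
  nice1 z -> nalt (a + r) f -> nalt q v ->
  q.+1%:R * acontr n a r f (wedge q z v) t =
    r%:R * acontr n a r.-1 (slr z f) v t +
    (q.+1%:R - r%:R) * ((-1) ^+ (r + a) * wedge n.-1 z (acontr n.-1 a r f v) t).
Proof.
elim: r => [|r IH] a b q n f v z t nE qE nz nf nv.
  move: qE; rewrite add0n => qE.
  rewrite mul0r add0r subr0; congr (_ * _); rewrite nE -qE addnS /= /wedge /acontr asym_ten_asym.
  rewrite -asym_insert ?leq_addr//.
  transitivity (asym (a + q).+1 (catf a f (asym q.+1 (ten z v))) t).
    by apply: eq_asym => s _; rewrite contr0.
  rewrite asym_catf_right ?addnS//; apply: eq_asym => s ss.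
  have la : (a < size s)%N by rewrite ss ltnS leq_addr.
  rewrite /catf contr0 (drop_nth 0 la) /=.
  rewrite take_size_cat ?drop_size_cat ?size_takel// ?(ltnW la)//.
  by rewrite mulrCA.
have qE' : q = (r + b)%N by case: qE.
have nfS := nf.1; have [nf' af'] := nf; rewrite addnS in nf nf' af'.
have nW : nice (r.+1 + b) (wedge q z v) by rewrite -qE; case: (nalt_wedge nz nv.1).
have [iA eA] := acontr_slice t nE nfS nW.
have nv' : nice (r + b) v by rewrite -qE'; case: nv.
have [iB eB] := acontr_slr t nE nz nf.1 nv'.
pose Y x := q%:R * acontr n a r (fun s => f (rcons s x)) (asym q (ten z (fun s => v (x :: s)))) t.
(* [asym_cons] at the sliced variable x: either [z] takes x, which integrates to the contraction of
   [slr z f], or x is left to [v], which is the case of the induction hypothesis. *)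
have key x : q.+1%:R * acontr n a r (fun s => f (rcons s x)) (fun s => wedge q z v (x :: s)) t =
    z x * acontr n a r (fun s => f (rcons s x)) v t - Y x.
  have nfx : nice (a + r) (fun s => f (rcons s x)) by exact: nice_rcons.
  have nT : nice (r + b) (asym q (ten z (fun s => v (x :: s)))).
    (* For q = 0 there is no predecessor degree; the function only matters on the empty tuple, and
       its coefficient is 0. *)
    rewrite -qE'; case: (q) nv => [|q'] nv2; last by apply: nice_asym; apply: nice_ten => //; apply: nice_cons; case: nv2.
    by split; [apply: (bmeas_eq (F := fun=> asym 0 (ten z (fun s => v (x :: s))) [::])) (bmeas_cst _ _) => -[] | exists 0 => t'; rewrite tuple0].
  rewrite -(acontrZr _ t nE nfx); last by rewrite -qE'; apply: nice_cons; case: (nalt_wedge nz nv.1).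
  rewrite /Y; have := acontr_linr (z x) (- q%:R) t nE nfx nv' nT; rewrite mulNr => <-.
  apply: (eq_acontr nE) => // s; rewrite -qE' => sq; rewrite mulNr.
  by apply: asym_cons sq; case: nv.
have iY : cintegrable m1 Y.
  have -> : Y = fun x => z x * acontr n a r (fun s => f (rcons s x)) v t +
      - q.+1%:R * acontr n a r (fun s => f (rcons s x)) (fun s => wedge q z v (x :: s)) t.
    by apply/funext => x; rewrite mulNr key; ring.
  by apply: cintegrableD => //; exact: cintegrableZ.
rewrite eA -(cintZ _ iA) (eq_cint _ key) (cintB iB iY) -eB.
suff -> : cint m1 Y = - r%:R * acontr n a r (slr z f) v t +
    (q%:R - r%:R) * ((-1) ^+ (r + a) * wedge n.-1 z (acontr n.-1 a r.+1 f v) t).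
  rewrite -[q.+1%:R]natr1 -[r.+1%:R]natr1 addSn exprS mulNr.
  move: (acontr n a r (slr z f) v t) (wedge _ _ _ _) ((-1) ^+ (r + a)) (q%:R : C) (r%:R : C).
  by move=> A B e x y; ring.
(* For q = 0 also r = 0, and both sides vanish. *)
clear iA eA iB eB key iY; case: q qE qE' nv nW @Y => [|q] qE qE' nv nW Y.
  have r0 : r = 0%N by move: qE'; case: (r).
  rewrite r0 !(oppr0, addr0, mul0r) -[RHS](cint0 m1).
  by apply: eq_cint => x; rewrite /Y mul0r.
have YE x : Y x = r%:R * acontr n a r.-1 (slr z (fun s => f (rcons s x))) (fun s => v (x :: s)) t +
    (q.+1%:R - r%:R) * ((-1) ^+ (r + a) *
      wedge n.-1 z (acontr n.-1 a r (fun s => f (rcons s x)) (fun s => v (x :: s))) t).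
  by apply: (IH a b) => //; [exact: nalt_rcons | exact: nalt_cons].
have [i1 e1] : cintegrable m1 (fun x => r%:R * acontr n a r.-1 (slr z (fun s => f (rcons s x))) (fun s => v (x :: s)) t) /\
    cint m1 (fun x => r%:R * acontr n a r.-1 (slr z (fun s => f (rcons s x))) (fun s => v (x :: s)) t) =
    - r%:R * acontr n a r (slr z f) v t.
  clear IH YE Y nfS; case: r qE qE' nf nf' af' nW nv' => [|r] qE qE' nf nf' af' nW nv'.
    split; first by under eq_fun do rewrite mul0r; exact: cintegrable0.
    transitivity (0 : C); last by rewrite oppr0 mul0r.
    by rewrite -(cint0 m1); apply: eq_cint => x; rewrite mul0r.
  have nS : nice (a + r.+1) (slr z f) by apply: nice_slr.
  have [i e] := acontr_slice t nE nS nv'.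
  have E x : r.+1%:R * acontr n a r.+1.-1 (slr z (fun s => f (rcons s x))) (fun s => v (x :: s)) t =
      - r.+1%:R * acontr n a r (fun s => slr z f (rcons s x)) (fun s => v (x :: s)) t.
    rewrite mulNr -mulrN; congr (_ * _); rewrite -mulN1r -(acontrZl _ _ nE).
    - apply: (eq_acontr nE) => // s ss; rewrite mulN1r; apply: (slr_rcons x nz _ ss).
      by rewrite -addnS.
    - by apply: nice_rcons; rewrite -addnS.
    - exact: nice_cons.
  split; first by under eq_fun do rewrite E; exact: cintegrableZ.
  by rewrite (eq_cint _ E) cintZ// e.
have [i2 e2] : cintegrable m1 (fun x => (q.+1%:R - r%:R) * ((-1) ^+ (r + a) * wedge n.-1 z (acontr n.-1 a r (fun s => f (rcons s x)) (fun s => v (x :: s))) t)) /\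
    cint m1 (fun x => (q.+1%:R - r%:R) * ((-1) ^+ (r + a) * wedge n.-1 z (acontr n.-1 a r (fun s => f (rcons s x)) (fun s => v (x :: s))) t)) =
    (q.+1%:R - r%:R) * ((-1) ^+ (r + a) * wedge n.-1 z (acontr n.-1 a r.+1 f v) t).
  (* For b = 0 the coefficient q + 1 - r is 0, whatever the truncated degree [n.-1] means there. *)
  clear IH YE Y i1 e1; case: b nE qE qE' nv' nW => [|b] nE qE qE' nv' nW.
    have -> : q.+1 = r by rewrite qE' addn0.
    rewrite subrr mul0r; split; first by under eq_fun do rewrite mul0r; exact: cintegrable0.
    by rewrite -[RHS](cint0 m1); apply: eq_cint => x; rewrite mul0r.
  have nE' : n.-1 = (a + b)%N by rewrite nE addnS.
  have nv2 : nice (r.+1 + b) v by rewrite addSn -addnS.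
  have nf2 : nice (a + r.+1) f by rewrite addnS.
  have h s := acontr_slice s nE' nf2 nv2.
  have [i e] := asym_ten_cint z t (n := n.-1) (fun s _ => (h s).1).
  split; first by do 2 apply: cintegrableZ.
  rewrite cintZ; last exact: cintegrableZ.
  rewrite cintZ//; congr (_ * (_ * _)); rewrite [LHS](esym e); apply: eq_asym => -[//|y s] /= _.
  by rewrite (h s).2.
by rewrite (eq_cint _ YE) cintD// e1 e2.
Qed.

(** [asym_cons] at the last variable, where the left factor enters a contraction; carrying x to the
    front produces the powers of -1. *)
Lemma wedge_rcons p z f x s : nice1 z -> nalt p f -> size s = p ->
  p.+1%:R * ((-1) ^+ p * wedge p z f (rcons s x)) =
  z x * f s - p%:R * ((-1) ^+ p.-1 * wedge p.-1 z (fun s => f (rcons s x)) s).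
Proof.
move=> nz nf ss; have [nW aW] := nalt_wedge nz nf.1.
rewrite (alt_rcons x aW ss) signrMK asym_cons//; last by case: nf.
congr (_ - _); case: p nf ss {nW aW} => [|p] nf ss; first by rewrite !mul0r.
congr (_ * _); rewrite -asymZ; apply: eq_asym => -[//|y u] /= [su].
by rewrite (alt_rcons x (nf.2)) // mulrCA signrMK.
Qed.

(** Mirror of [acontr_wedge_r]. The factor [z] is created at the front of [f] while contractions use
    its last variables; (-1)^p is the cost of carrying [z] to the end. *)
Lemma acontr_wedge_l r : forall a b p n f v z t, n = (a + b)%N -> p.+1 = (a + r)%N ->
  nice1 z -> nalt p f -> nalt (r + b) v ->
  p.+1%:R * ((-1) ^+ p * acontr n a r (wedge p z f) v t) =
    r%:R * acontr n a r.-1 f (sl z v) t +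
    (p.+1%:R - r%:R) * ((-1) ^+ (r + a.-1) * wedge n.-1 z (acontr n.-1 a.-1 r f v) t).
Proof.
elim: r => [|r IH] a b p n f v z t nE pE nz nf nv.
  rewrite addn0 in pE; rewrite mul0r add0r subr0 nE -pE addSn /=; congr (_ * (_ * _)).
  rewrite /wedge /acontr asym_ten_asym.
  transitivity (asym (p + b).+1 (catf p.+1 (asym p.+1 (ten z f)) v) t).
    by apply: eq_asym => s _; rewrite contr0.
  rewrite (asym_catf_left (m := b))//; apply: eq_asym => -[//|x s] [ss].
  by rewrite /catf /= contr0 mulrA.
have pE' : p = (a + r)%N by move: pE; rewrite addnS => -[].
pose W := fun s => (-1) ^+ p * wedge p z f s.
have nW : nice (a + r.+1) W by rewrite -pE; apply: niceZ; case: (nalt_wedge nz nf.1).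
have nf' : nice (a + r) f by rewrite -pE'; case: nf.
have -> : (-1) ^+ p * acontr n a r.+1 (wedge p z f) v t = acontr n a r.+1 W v t.
  rewrite /W (acontrZl (F := wedge p z f) ((-1) ^+ p) t nE _ nv.1)//.
  by rewrite -pE; case: (nalt_wedge nz nf.1).
have [iA eA] := acontr_slice t nE nW nv.1.
have [iB eB] := acontr_sl t nE nz nf' nv.1.
pose Y x := p%:R * ((-1) ^+ p.-1 * acontr n a r (wedge p.-1 z (fun s => f (rcons s x))) (fun s => v (x :: s)) t).
have nvx x : nice (r + b) (fun s => v (x :: s)) by apply: nice_cons; case: nv.
have key x : p.+1%:R * acontr n a r (fun s => W (rcons s x)) (fun s => v (x :: s)) t =
    z x * acontr n a r f (fun s => v (x :: s)) t - Y x.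
  have nWx : nice (a + r) (fun s => W (rcons s x)).
    by apply: nice_rcons; rewrite -addnS.
  rewrite -(acontrZl _ t nE nWx (nvx x)) /Y.
  clear iA eA iB eB Y; case: p pE pE' nf @W nW nWx => [|p'] pE pE' nf W nW nWx.
    rewrite mul0r subr0 -(acontrZl _ t nE nf' (nvx x)).
    by apply: (eq_acontr nE) => // s; rewrite -pE' => sp; rewrite (wedge_rcons x nz nf sp) mul0r subr0.
  have nT : nice (a + r) (wedge p' z (fun s => f (rcons s x))).
    rewrite -pE'; have [h _] := @nalt_wedge p' z (fun s => f (rcons s x)) nz (nice_rcons x nf.1); exact: h.
  have := acontr_linl (z x) (- (p'.+1%:R * (-1) ^+ p')) t nE nf' nT (nvx x).
  rewrite mulNr -mulrA /= => <-.
  apply: (eq_acontr nE) => // s; rewrite -pE' => sp.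
  by rewrite (wedge_rcons x nz nf sp) mulNr -mulrA.
have iY : cintegrable m1 Y.
  have -> : Y = fun x => z x * acontr n a r f (fun s => v (x :: s)) t +
      - p.+1%:R * acontr n a r (fun s => W (rcons s x)) (fun s => v (x :: s)) t.
    by apply/funext => x; rewrite mulNr key; ring.
  by apply: cintegrableD => //; exact: cintegrableZ.
rewrite eA -(cintZ _ iA) (eq_cint _ key) (cintB iB iY) -eB.
suff -> : cint m1 Y = - r%:R * acontr n a r f (sl z v) t +
    (p%:R - r%:R) * ((-1) ^+ (r + a.-1) * wedge n.-1 z (acontr n.-1 a.-1 r.+1 f v) t).
  rewrite -[p.+1%:R]natr1 -[r.+1%:R]natr1 addSn exprS mulNr.
  move: (acontr n a r f (sl z v) t) (wedge _ _ _ _) ((-1) ^+ (r + a.-1)) (p%:R : C) (r%:R : C).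
  by move=> A B e x y; ring.
clear iA eA iB eB key iY nW W; case: p pE pE' nf @Y => [|p] pE pE' nf Y.
  have r0 : r = 0%N by move: pE'; case: (r) => // k; rewrite addnS.
  rewrite r0 !(oppr0, addr0, mul0r) -[RHS](cint0 m1).
  by apply: eq_cint => x; rewrite /Y mul0r.
have YE x : Y x = r%:R * acontr n a r.-1 (fun s => f (rcons s x)) (sl z (fun s => v (x :: s))) t +
    (p.+1%:R - r%:R) * ((-1) ^+ (r + a.-1) *
      wedge n.-1 z (acontr n.-1 a.-1 r (fun s => f (rcons s x)) (fun s => v (x :: s))) t).
  by apply: (IH a b) => //; [exact: nalt_rcons | exact: nalt_cons].
have [i1 e1] : cintegrable m1 (fun x => r%:R * acontr n a r.-1 (fun s => f (rcons s x)) (sl z (fun s => v (x :: s))) t) /\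
    cint m1 (fun x => r%:R * acontr n a r.-1 (fun s => f (rcons s x)) (sl z (fun s => v (x :: s))) t) =
    - r%:R * acontr n a r f (sl z v) t.
  clear IH YE Y; case: r pE pE' nv nf' nvx => [|r] pE pE' nv nf' nvx.
    split; first by under eq_fun do rewrite mul0r; exact: cintegrable0.
    transitivity (0 : C); last by rewrite oppr0 mul0r.
    by rewrite -(cint0 m1); apply: eq_cint => x; rewrite mul0r.
  have nS : nice (r.+1 + b) (sl z v) by apply: nice_sl; case: nv.
  have [i e] := acontr_slice t nE nf' nS.
  have E x : r.+1%:R * acontr n a r.+1.-1 (fun s => f (rcons s x)) (sl z (fun s => v (x :: s))) t =
      - r.+1%:R * acontr n a r (fun s => f (rcons s x)) (fun s => sl z v (x :: s)) t.
    rewrite mulNr -mulrN; congr (_ * _); rewrite -mulN1r -(acontrZr _ _ nE).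
    - by apply: (eq_acontr nE) => // s ss; rewrite mulN1r; apply: (sl_cons x nz nv ss).
    - by apply: nice_rcons; rewrite -addnS.
    - exact: nice_cons.
  split; first by under eq_fun do rewrite E; exact: cintegrableZ.
  by rewrite (eq_cint _ E) cintZ// e.
have [i2 e2] : cintegrable m1 (fun x => (p.+1%:R - r%:R) * ((-1) ^+ (r + a.-1) *
      wedge n.-1 z (acontr n.-1 a.-1 r (fun s => f (rcons s x)) (fun s => v (x :: s))) t)) /\
    cint m1 (fun x => (p.+1%:R - r%:R) * ((-1) ^+ (r + a.-1) *
      wedge n.-1 z (acontr n.-1 a.-1 r (fun s => f (rcons s x)) (fun s => v (x :: s))) t)) =
    (p.+1%:R - r%:R) * ((-1) ^+ (r + a.-1) * wedge n.-1 z (acontr n.-1 a.-1 r.+1 f v) t).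
  clear IH YE Y i1 e1; case: a nE pE pE' nf' => [|a] nE pE pE' nf'.
    have -> : p.+1 = r by rewrite pE' add0n.
    rewrite subrr mul0r; split; first by under eq_fun do rewrite mul0r; exact: cintegrable0.
    by rewrite -[RHS](cint0 m1); apply: eq_cint => x; rewrite mul0r.
  have nE' : n.-1 = (a + b)%N by rewrite nE.
  have nf2 : nice (a + r.+1) f by rewrite addnS -addSn.
  have h s := acontr_slice s nE' nf2 nv.1.
  have [i e] := asym_ten_cint z t (n := n.-1) (fun s _ => (h s).1).
  split; first by do 2 apply: cintegrableZ.
  rewrite cintZ; last exact: cintegrableZ.
  rewrite cintZ//; congr (_ * (_ * _)); rewrite [LHS](esym e); apply: eq_asym => -[//|y s] /= _.
  by rewrite (h s).2.
by rewrite (eq_cint _ YE) cintD// e1 e2.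
Qed.

End creation_recursion.

(** * The Fock space *)

Section complex_series.
Variable R : realType.
Local Notation C := R[i].
Local Notation Re := complex.Re.
Local Notation Im := complex.Im.
Implicit Types (F G : nat -> C) (S T : C).

(** A relation rather than a value: it carries convergence, which the [limn] in [fock_ip] does
    not. *)
Definition csum F S : Prop :=
  (series (fun n => Re (F n)) n @[n --> \oo] --> Re S) /\
  (series (fun n => Im (F n)) n @[n --> \oo] --> Im S).

Lemma csum_unique F S T : csum F S -> csum F T -> S = T.
Proof. by move=> [r1 i1] [r2 i2]; apply: eqC; [exact: cvg_unique r1 r2 | exact: cvg_unique i1 i2]. Qed.

Lemma csum_lc a F G S T : csum F S -> csum G T -> csum (fun n => a * F n + G n) (a * S + T).
Proof.
move=> [r1 i1] [r2 i2]; split.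
  rewrite ReD ReM (_ : series _ = fun n => Re a * series (fun n => Re (F n)) n -
    Im a * series (fun n => Im (F n)) n + series (fun n => Re (G n)) n).
    by apply: cvgD => //; apply: cvgB; exact: cvgMr.
  apply/funext => n; rewrite /series /= !mulr_sumr -sumrB -big_split /=.
  by apply: eq_bigr => k _; rewrite ReD ReM.
rewrite ImD ImM (_ : series _ = fun n => Re a * series (fun n => Im (F n)) n +
    Im a * series (fun n => Re (F n)) n + series (fun n => Im (G n)) n).
  by apply: cvgD => //; apply: cvgD; exact: cvgMr.
apply/funext => n; rewrite /series /= !mulr_sumr -!big_split /=.
by apply: eq_bigr => k _; rewrite ImD ImM.
Qed.

Lemma csumJ F S : csum F S -> csum (fun n => (F n)^*%C) S^*%C.
Proof.
move=> [r i]; split; first by rewrite ReJ; under [fun n => Re _]eq_fun do rewrite ReJ.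
rewrite ImJ (_ : series _ = fun n => - series (fun n => Im (F n)) n); first exact: cvgN.
by apply/funext => n; rewrite /series /= -sumrN; apply: eq_bigr => k _; rewrite ImJ.
Qed.

Lemma csum_single F n : (forall k, k != n -> F k = 0) -> csum F (F n).
Proof.
move=> F0.
have h (u : nat -> R) : (forall k, k != n -> u k = 0) -> series u k @[k --> \oo] --> u n.
  move=> u0; apply: cvg_near_cst; exists n.+1 => // k /= nk.
  rewrite /series /= big_mkord (bigD1 (Ordinal nk)) //= big1 ?addr0// => i ni.
  by apply: u0; apply: contra ni => /eqP e; apply/eqP/val_inj.
by split; apply: h => k /F0 ->.
Qed.

Lemma nneseries_cvg (a : nat -> R) : (forall n, 0 <= a n) ->
  (\sum_(0 <= n <oo) (a n)%:E < +oo)%E ->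
  series a n @[n --> \oo] --> fine (\sum_(0 <= n <oo) (a n)%:E)%E.
Proof.
move=> a0 afin; have S0 : (0 <= \sum_(0 <= n <oo) (a n)%:E)%E by apply: nneseries_ge0 => n _ _; rewrite lee_fin.
have : (\sum_(0 <= i < n) (a i)%:E)%E @[n --> \oo] --> (fine (\sum_(0 <= n <oo) (a n)%:E))%:E.
  by rewrite fineK ?ge0_fin_numE//; apply: is_cvg_nneseries => n _ _; rewrite lee_fin.
by move=> /fine_cvg; apply: cvg_trans; apply: near_eq_cvg; apply: nearW => n /=; rewrite sumEFin.
Qed.

Lemma csum_dominated F (a : nat -> R) : (forall n, 0 <= a n) -> cvgn (series a) ->
  (forall n, `|Re (F n)| <= a n /\ `|Im (F n)| <= a n) ->
  csum F (Complex (limn (series (fun n => Re (F n)))) (limn (series (fun n => Im (F n))))).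
Proof.
move=> a0 ca Fa.
have h (u : nat -> R) : (forall n, `|u n| <= a n) -> cvgn (series u).
  move=> ua; apply: normed_cvg; apply: (series_le_cvg (v_ := a)) => [n|n|n|] //; [exact: normr_ge0 | exact: ua].
by split; apply: h => n; case: (Fa n).
Qed.

End complex_series.

(** * The Fock space is a Hilbert space *)

Section fock_hilbert.
Variable R : realType.
Local Notation C := R[i].
Local Notation Re := complex.Re.
Local Notation Im := complex.Im.
Local Notation mu n := (muplus R n).
Local Notation family := ({n : nat & n.-tuple R} -> C).
Implicit Types (x y : prefock R) (u v : fock R).
Local Notation cp x n := (@component R (prefock_val x) n).

Lemma prefockP x : in_fock x.
Proof. by apply/asboolP; exact: (valP x). Qed.

Lemma cp_sqint x n : sqint (mu n) (cp x n).
Proof. by have [/(_ n) [[m1 m2 fin] _] _] := prefockP x. Qed.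

Definition fterm (x y : family) n : C :=
  n`!%:R * cint (mu n) (fun t => (component x n t)^*%C * component y n t).

Definition fnorm x n : R := n`!%:R * fine (sqn (mu n) (cp x n)).

Lemma fnorm_ge0 x n : 0 <= fnorm x n.
Proof. by rewrite mulr_ge0// fine_ge0// sqn_ge0. Qed.

Lemma fnormE x n : (fnorm x n)%:E = ((n`!%:R)%:E * sqn (mu n) (cp x n))%E.
Proof. by rewrite EFinM fineK// sqint_fin//; exact: cp_sqint. Qed.

Lemma fnorm_fin x : (\sum_(0 <= n <oo) (fnorm x n)%:E < +oo)%E.
Proof.
have [_] := prefockP x; congr (_ < _)%E.
by apply: eq_eseriesr => n _; rewrite fnormE.
Qed.

Lemma fterm_diag x n : fterm x x n = (fnorm x n)%:C%C.
Proof.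
rewrite /fterm cint_sqn; last exact: cp_sqint.
by rewrite natrC -rmorphM.
Qed.

Lemma cint_abs n (f g : n.-tuple R -> C) : sqint (mu n) f -> sqint (mu n) g ->
  normsq (cint (mu n) (fun t => (f t)^*%C * g t)) <=
  (fine (sqn (mu n) f) + fine (sqn (mu n) g)) ^+ 2.
Proof.
move=> Lf Lg; have LJ := normsqJ_sqint Lf; have [mf _] := LJ; have [mg _] := Lg.
have := cint_cauchy_schwarz (mu n) mf mg.
have -> : sqn (mu n) (fun t => (f t)^*%C) = sqn (mu n) f.
  by apply: eq_integral => t _; rewrite normsqJ.
rewrite -(fineK (sqint_fin Lf)) -(fineK (sqint_fin Lg)) -EFinM lee_fin /= => /le_trans; apply.
have a0 := fine_ge0 (sqn_ge0 (mu n) f); have b0 := fine_ge0 (sqn_ge0 (mu n) g).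
by nra.
Qed.

Lemma fterm_abs x y n : `|Re (fterm x y n)| <= fnorm x n + fnorm y n /\
  `|Im (fterm x y n)| <= fnorm x n + fnorm y n.
Proof.
have := cint_abs (cp_sqint x n) (cp_sqint y n).
rewrite /fterm /fnorm -mulrDr natrC; set c := cint _ _; set s := _ + _ => h.
have s0 : 0 <= s by rewrite addr_ge0// fine_ge0// sqn_ge0.
have k (a : R) : a ^+ 2 <= normsq c -> `|n`!%:R * a| <= n`!%:R * s.
  move=> ac; rewrite normrM ger0_norm// ler_wpM2l//.
  by rewrite -(@ler_sqr _ `|_|) ?nnegrE// real_normK ?num_real// (le_trans ac).
rewrite ReMr ImM /= mul0r addr0; split; apply: k.
  by rewrite /normsq lerDl sqr_ge0.
by rewrite /normsq lerDr sqr_ge0.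
Qed.

Definition fip (x y : family) : C :=
  Complex (limn (series (fun n => Re (fterm x y n)))) (limn (series (fun n => Im (fterm x y n)))).

(** Each term is at most [fnorm x n + fnorm y n], so square summability of both families gives
    absolute convergence. *)
Lemma fip_csum x y : csum (fterm x y) (fip x y).
Proof.
apply: (csum_dominated (a := fun n => fnorm x n + fnorm y n)).
- by move=> n; rewrite addr_ge0 ?fnorm_ge0.
- have c (w : prefock R) : cvgn (series (fnorm w)).
    by apply/cvg_ex; eexists; apply: nneseries_cvg (fnorm_fin w); exact: fnorm_ge0.
  rewrite (_ : series _ = (fun n => series (fnorm x) n + series (fnorm y) n)).
    exact: is_cvgD.
  by apply/funext => n; rewrite /series /= big_split.
- exact: fterm_abs.
Qed.

Lemma fip_lc a x y z : fip x (a *: y + z : prefock R) = a * fip x y + fip x z.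
Proof.
apply: csum_unique (fip_csum _ _) _.
rewrite (_ : fterm _ _ = fun n => a * fterm x y n + fterm x z n).
  by apply: csum_lc; exact: fip_csum.
apply/funext => n; rewrite /fterm mulrCA -mulrDr; congr (_ * _).
have Ixy := sqint_ip (cp_sqint x n) (cp_sqint y n).
have Ixz := sqint_ip (cp_sqint x n) (cp_sqint z n).
rewrite -cintZ// -cintD//; last exact: cintegrableZ.
by apply: eq_cint => t; rewrite (_ : cp (a *: y + z) n t = a * cp y n t + cp z n t)//; ring.
Qed.

Lemma fip_sym x y : fip y x = (fip x y)^*%C.
Proof.
apply: csum_unique (fip_csum _ _) _.
rewrite (_ : fterm y x = fun n => (fterm x y n)^*%C); first exact/csumJ/fip_csum.
apply/funext => n; rewrite /fterm conjcM natrC.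
have -> : ((n`!%:R : R)%:C)^*%C = (n`!%:R : R)%:C%C by apply: eqC => //=; rewrite oppr0.
congr (_ * _); rewrite -cintJ; last exact: sqint_ip (cp_sqint x n) (cp_sqint y n).
by apply: eq_cint => t; rewrite conjcM conjcK mulrC.
Qed.

Lemma fip_diag x : (Re (fip x x))%:E = (\sum_(0 <= n <oo) (fnorm x n)%:E)%E.
Proof.
have h := nneseries_cvg (fnorm_ge0 x) (fnorm_fin x).
have [h1 _] := fip_csum x x.
have e : (fun n => Re (fterm x x n)) = fnorm x by apply/funext => n; rewrite fterm_diag.
rewrite e in h1; rewrite (cvg_unique _ h1 h)// fineK// ge0_fin_numE ?fnorm_fin//.
by apply: nneseries_ge0 => n _ _; rewrite lee_fin fnorm_ge0.
Qed.

Lemma fip_ae x x' y y' : (forall n, {ae mu n, forall t, cp x n t = cp x' n t}) ->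
  (forall n, {ae mu n, forall t, cp y n t = cp y' n t}) -> fip x y = fip x' y'.
Proof.
move=> xx yy; apply: csum_unique (fip_csum _ _) _.
rewrite (_ : fterm x y = fterm x' y'); first exact: fip_csum.
apply/funext => n; congr (_ * _); apply: cint_ae_eq.
- by apply: cmeasM; [apply: cmeasJ; case: (cp_sqint x n) | case: (cp_sqint y n)].
- by apply: cmeasM; [apply: cmeasJ; case: (cp_sqint x' n) | case: (cp_sqint y' n)].
- by move: (xx n) (yy n); apply: filterS2 => t -> ->.
Qed.

Lemma to_fock_eq x y : to_fock x = to_fock y <-> forall n, {ae mu n, forall t, cp x n t = cp y n t}.
Proof.
rewrite to_fockP; split.
  move=> /asboolP h n; move: (h n); apply: filterS => t.
  by move=> e; apply/eqP; rewrite -subr_eq0; apply/eqP.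
move=> h; apply/asboolP => n; move: (h n); apply: filterS => t e.
by rewrite -[LHS]/(cp x n t - cp y n t) e subrr.
Qed.

Lemma fock_ipE x y : fock_ip (to_fock x) (to_fock y) = fip x y.
Proof.
rewrite -[fock_ip _ _]/(fip (fock_rep (to_fock x)) (fock_rep (to_fock y))).
by apply: fip_ae; apply/to_fock_eq; rewrite fock_repK.
Qed.

Lemma fock_nsq x : (hnorm (@fock_ip R) (to_fock x) ^+ 2)%:E = (\sum_(0 <= n <oo) (fnorm x n)%:E)%E.
Proof.
rewrite /hnorm fock_ipE sqr_sqrtr ?fip_diag// -lee_fin fip_diag.
by apply: nneseries_ge0 => n _ _; rewrite lee_fin fnorm_ge0.
Qed.

Lemma fnorm_le_nsq x n : fnorm x n <= hnorm (@fock_ip R) (to_fock x) ^+ 2.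
Proof.
rewrite -lee_fin fock_nsq (nneseries_split 0 n.+1) ?add0n; last first.
  by move=> k _; rewrite lee_fin fnorm_ge0.
rewrite big_mkord big_ord_recr /= -[leLHS]add0e -[leLHS]adde0; apply: leeD.
  by apply: leeD => //; apply: sume_ge0 => k _; rewrite lee_fin fnorm_ge0.
by apply: nneseries_ge0 => k _ _; rewrite lee_fin fnorm_ge0.
Qed.

Lemma to_fock_rep u : exists x, u = to_fock x.
Proof. by exists (fock_rep u); rewrite fock_repK. Qed.

Lemma to_fockB x y : to_fock (x - y) = to_fock x - to_fock y.
Proof. by apply/eqP; rewrite eq_sym subr_eq -to_fockD subrK. Qed.

(** Permuting variables is isometric in L^2 and [f k] has no defect of antisymmetry, so the defect
    of [g] is controlled by the distance from [g] to [f k]. *)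
Lemma antisymmetric_limit n (g : n.-tuple R -> C) (f : nat -> n.-tuple R -> C) :
  cmeas g -> (forall k, cmeas (f k)) -> (forall k, Defs.antisymmetric (f k)) ->
  (forall e : R, 0 < e -> exists k, (sqn (mu n) (fun t => g t - f k t)%R <= e%:E)%E) ->
  Defs.antisymmetric g.
Proof.
move=> mg mf af fg s.
have mgs := cmeas_permute s mg; have msg := cmeasZ ((-1) ^+ s) mg.
suff : sqn (mu n) (fun t => g (permute_tuple s t) - (-1) ^+ s * g t) = 0%E.
  move/(sqn_eq0 (cmeasB mgs msg)); apply: filterS => t /eqP.
  by rewrite subr_eq0 => /eqP.
apply/eqP; rewrite eq_le sqn_ge0 andbT; apply/lee_addgt0Pr => e e0; rewrite add0e.
have [k hk] := fg (e / 4) ltac:(lra).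
have mfs := cmeas_permute s (mf k); have msf := cmeasZ ((-1) ^+ s) (mf k).
have n1 : normsq ((-1) ^+ s : C) = 1.
  by case: (odd_perm s); rewrite /= ?expr1 ?expr0 ?normsqN /normsq /=; ring.
have -> : sqn (mu n) (fun t => g (permute_tuple s t) - (-1) ^+ s * g t) =
    sqn (mu n) (fun t => (g (permute_tuple s t) - f k (permute_tuple s t)) -
      (-1) ^+ s * (g t - f k t)).
  apply: sqn_ae_eq; first exact: cmeasB.
    by apply: cmeasB; [exact: cmeasB | apply: cmeasZ; exact: cmeasB].
  move: (af k s); apply: filterS => t ->.
  by rewrite mulrBr opprB addrA subrK.
have mB := cmeasB mg (mf k).
have h := sqnB (mu n) (cmeas_permute s mB) (cmeasZ ((-1) ^+ s) mB); apply: (le_trans h) => {h}.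
rewrite (sqn_permute s mB) sqnZ// n1 mul1e.
have [x0|x0] : (2%:E * sqn (mu n) (fun t => g t - f k t)%R <= (e / 2)%:E)%E \/ False.
  left; rewrite (_ : e / 2 = 2 * (e / 4)); last by field.
  by rewrite EFinM; apply: lee_wpmul2l.
  by apply: le_trans (leeD x0 x0) _; rewrite -EFinD lee_fin; lra.
by [].
Qed.

(** The work is in completeness. Each degree converges by [sqint_complete]; the weighted sum of the
    distances to x k is estimated on finitely many degrees at a time, by comparison with a later x
    j. *)
Lemma hilbert_fock : hilbert (@fock_ip R).
Proof.
split.
- move=> u a v w; have [x ->] := to_fock_rep u; have [y ->] := to_fock_rep v; have [z ->] := to_fock_rep w.
  have -> : a *: to_fock y + to_fock z = to_fock (a *: y + z) by rewrite to_fockD -fock_scaleE.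
  by rewrite !fock_ipE fip_lc.
- move=> u v; have [x ->] := to_fock_rep u; have [y ->] := to_fock_rep v.
  by rewrite !fock_ipE fip_sym.
- move=> u; have [x ->] := to_fock_rep u; rewrite fock_ipE -lee_fin fip_diag.
  by apply: nneseries_ge0 => n _ _; rewrite lee_fin fnorm_ge0.
- move=> u; have [x ->] := to_fock_rep u; rewrite fock_ipE => h.
  have hn : hnorm (@fock_ip R) (to_fock x) = 0 by rewrite /hnorm fock_ipE h sqrtr0.
  have -> : (0 : fock R) = to_fock 0 by rewrite -[LHS](subrr (to_fock 0)) -to_fockB subrr.
  apply/to_fock_eq => n; apply: sqn_eq0; first by case: (cp_sqint x n).
  have := fnorm_le_nsq x n; rewrite hn expr0n /= => f0.
  have : fnorm x n = 0 by apply/eqP; rewrite eq_le f0 fnorm_ge0.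
  move/eqP; rewrite mulf_eq0 pnatr_eq0 gtn_eqF ?fact_gt0//= => /eqP e.
  by rewrite -(fineK (sqint_fin (cp_sqint x n))) e.
move=> u cu; pose x k := fock_rep (u k).
have ux k : u k = to_fock (x k) by rewrite fock_repK.
have cn n j k : (sqn (mu n) (fun t => cp (x j) n t - cp (x k) n t)%R <=
    (hnorm (@fock_ip R) (u j - u k) ^+ 2)%:E)%E.
  rewrite !ux -to_fockB -[X in (X <= _)%E]/(sqn (mu n) (cp (x j - x k) n)).
  rewrite -(fineK (sqint_fin (cp_sqint (x j - x k) n))) lee_fin.
  apply: le_trans (fnorm_le_nsq _ n); rewrite /fnorm ler_peMl ?ler1n ?fact_gt0//.
  by rewrite fine_ge0// sqn_ge0.
have ex n : exists g : n.-tuple R -> C, cmeas g /\ forall e : R, 0 < e ->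
    exists K, forall k, (K <= k)%N -> (sqn (mu n) (fun t => g t - cp (x k) n t)%R <= e%:E)%E.
  have [|g mg hg] := @sqint_complete _ _ _ (mu n) (fun k => cp (x k) n) (fun k => cp_sqint (x k) n).
    move=> e e0; have [K hK] := cu (Num.sqrt e) ltac:(by rewrite sqrtr_gt0).
    exists K => j k Kj Kk; apply: le_trans (cn n j k) _; rewrite lee_fin.
    have := hK j k Kj Kk; rewrite -(@ltr_sqr _ (hnorm _ _)) ?nnegrE ?nrm_ge0 ?sqrtr_ge0//.
    by rewrite [X in _ < X]sqr_sqrtr ?(ltW e0)// => /ltW.
  by exists g.
pose g n := projT1 (cid (ex n)).
have hg n : cmeas (g n) /\ _ := projT2 (cid (ex n)).
have mg n : cmeas (g n) by case: (hg n).
have mx k n : cmeas (cp (x k) n) by case: (cp_sqint (x k) n).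
have ag n : Defs.antisymmetric (g n).
  apply: (antisymmetric_limit (mg n) (fun k => mx k n)) => [k|e e0].
    by have [/(_ n) []] := prefockP (x k).
  by have [_ /(_ e e0)[K hK]] := hg n; exists K; exact: hK.
have dist (e : R) : 0 < e -> exists K, forall k, (K <= k)%N ->
    (\sum_(0 <= n <oo) (n`!%:R)%:E * sqn (mu n) (fun t => g n t - cp (x k) n t)%R <= (e ^+ 2)%:E)%E.
  move=> e0; have [K hK] := cu (e / 2) ltac:(lra); exists K => k Kk.
  have t0 n : (0 <= (n`!%:R)%:E * sqn (mu n) (fun t => g n t - cp (x k) n t)%R)%E.
    by rewrite mule_ge0// ?lee_fin// sqn_ge0.
  apply: lime_le; first by apply: is_cvg_nneseries => n _ _; exact: t0.
  apply: nearW => N; apply/lee_addgt0Pr => d d0.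
  (* The error allowed in each of the first N degrees: N terms 2 N! c add up to at most d. *)
  pose c := d / 2 / (N * N`!).+1%:R.
  have c0 : 0 < c by rewrite !divr_gt0.
  have /choice[L hL] n : exists L, forall j, (L <= j)%N -> (sqn (mu n) (fun t => g n t - cp (x j) n t)%R <= c%:E)%E.
    by have [_ /(_ c c0)] := hg n.
  pose j := maxn K (\max_(n < N) L n).
  have step n : (n < N)%N -> ((n`!%:R)%:E * sqn (mu n) (fun t => g n t - cp (x k) n t)%R <=
      (2 * (N`!%:R * c))%:E + 2%:E * (fnorm (x j - x k) n)%:E)%E.
    move=> nN; have -> : sqn (mu n) (fun t => g n t - cp (x k) n t) =
      sqn (mu n) (fun t => (g n t - cp (x j) n t) + cp (x j - x k) n t).
      by apply: eq_sqn => t; rewrite (_ : cp (x j - x k) n t = cp (x j) n t - cp (x k) n t)// subrKA.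
    have hs := sqnD (mu n) (cmeasB (mg n) (mx j n)) (proj1 (cp_sqint (x j - x k) n)).
    apply: (le_trans (lee_wpmul2l _ hs)); first by rewrite lee_fin.
    have m0 : (sqn (mu n) (fun t => g n t - cp (x j) n t)%R <= c%:E)%E.
      apply: hL; rewrite leq_max; apply/orP; right.
      exact: (@leq_bigmax _ (fun m : 'I_N => L m) (Ordinal nN)).
    have -> : sqn (mu n) (cp (x j - x k) n) = (fine (sqn (mu n) (cp (x j - x k) n)))%:E.
      by rewrite fineK// sqint_fin//; exact: cp_sqint.
    have m1 : ((n`!%:R)%:E * (2%:E * c%:E + 2%:E * (fine (sqn (mu n) (cp (x j - x k) n)))%:E) <=
       (2 * (N`!%:R * c))%:E + 2%:E * (fnorm (x j - x k) n)%:E)%E.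
      rewrite -[leLHS]/((n`!%:R * (2 * c + 2 * fine (sqn (mu n) (cp (x j - x k) n))))%:E).
      rewrite -[leRHS]/((2 * (N`!%:R * c) + 2 * fnorm (x j - x k) n)%:E) lee_fin mulrDr /fnorm.
      have nN' : n`!%:R <= N`!%:R :> R by rewrite ler_nat leq_fact// ltnW.
      apply: lerD; first by rewrite mulrCA ler_pM2l// ler_pM2r.
      by rewrite mulrCA.
    apply: le_trans m1; apply: lee_wpmul2l; first by rewrite lee_fin.
    by apply: leeD => //; apply: lee_wpmul2l.
  have jK : (K <= j)%N by rewrite leq_maxl.
  have fs : (\sum_(0 <= n < N) (fnorm (x j - x k) n)%:E <= ((e / 2) ^+ 2)%:E)%E.
    apply: (@le_trans _ _ (\sum_(0 <= n <oo) (fnorm (x j - x k) n)%:E)%E).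
      by apply: nneseries_lim_ge => n _ _; rewrite lee_fin fnorm_ge0.
    rewrite -fock_nsq to_fockB -!ux lee_fin ler_sqr ?nnegrE ?nrm_ge0//; last lra.
    by apply: ltW; exact: hK.
  apply: (@le_trans _ _ (\sum_(0 <= n < N) ((2 * (N`!%:R * c))%:E + 2%:E * (fnorm (x j - x k) n)%:E))%E).
    by rewrite !big_mkord; apply: lee_sum => n _; exact: step.
  move: fs; rewrite !sumEFin lee_fin => fs.
  rewrite -EFinD lee_fin big_split /= -mulr_sumr.
  rewrite sumr_const_nat subn0.
  have : (2 * (N`!%:R * c)) *+ N <= d.
    rewrite -mulr_natr -mulrA -mulrA (mulrC c) mulrA -natrM mulrA.
    rewrite /c mulrA ler_pdivrMr ?ltr0n//.
    have : (N`! * N)%:R <= (N * N`!).+1%:R :> R by rewrite ler_nat mulnC leqnSn.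
    by move: d0; nra.
  rewrite mulrnAr -mulr_sumr; move: fs; set S := \sum_(_ <= _ < _) _.
  have -> : (e / 2) ^+ 2 = e ^+ 2 / 4 by field.
  by have := sqr_ge0 e; lra.
have [K1 hK1] := dist 1 ltac:(lra).
pose y := fun w : {n : nat & n.-tuple R} => g (tag w) (tagged w).
have yin : in_fock y.
  have ysq n : (sqn (mu n) (g n) <= 2%:E * sqn (mu n) (fun t => g n t - cp (x K1) n t)%R +
      2%:E * sqn (mu n) (cp (x K1) n))%E.
    have := sqnD (mu n) (cmeasB (mg n) (mx K1 n)) (mx K1 n).
    by under eq_sqn do rewrite subrK.
  split=> [n|].
    split; last exact: ag.
    have [m1 m2] := mg n; split=> //; apply: le_lt_trans (ysq n) _.
    have [_ /(_ 1 ltac:(lra))[K hK]] := hg n.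
    have [_ f1] := cp_sqint (x K1) n.
    rewrite lte_add_pinfty ?lte_mul_pinfty//.
    have := hK1 K1 (leqnn _); rewrite expr1n.
    rewrite (nneseries_split 0 n.+1) ?add0n; last by move=> k _; rewrite mule_ge0// ?lee_fin// sqn_ge0.
    rewrite big_mkord big_ord_recr /= => h.
    have : ((n`!%:R)%:E * sqn (mu n) (fun t => g n t - cp (x K1) n t)%R <= 1%:E)%E.
      apply: le_trans h; rewrite -[leLHS]add0e -[leLHS]adde0; apply: leeD.
        by apply: leeD => //; apply: sume_ge0 => k _; rewrite mule_ge0// ?lee_fin// sqn_ge0.
      by apply: nneseries_ge0 => k _ _; rewrite mule_ge0// ?lee_fin// sqn_ge0.
    move=> h1; rewrite ltey; apply: contraTneq h1 => ->.
    by rewrite gt0_muley ?lte_fin ?ltr0n ?fact_gt0.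
  have t0 n : (0 <= (n`!%:R)%:E * sqn (mu n) (fun t => g n t - cp (x K1) n t)%R)%E.
    by rewrite mule_ge0// ?lee_fin// sqn_ge0.
  have f0 n : (0 <= (fnorm (x K1) n)%:E)%E by rewrite lee_fin fnorm_ge0.
  apply: (@le_lt_trans _ _ (\sum_(0 <= n <oo) (2%:E * ((n`!%:R)%:E * sqn (mu n) (fun t => g n t - cp (x K1) n t)%R) +
      2%:E * (fnorm (x K1) n)%:E))%E).
    apply: lee_nneseries => [n _ _|n _]; first by rewrite mule_ge0// ?lee_fin// sqn_ge0.
    apply: (le_trans (lee_wpmul2l _ (ysq n))); first by rewrite lee_fin.
    rewrite ge0_muleDr ?mule_ge0 ?sqn_ge0// fnormE.
    by rewrite !muleA !(muleC (n`!%:R)%:E 2%:E).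
  rewrite nneseriesD//; last 2 first.
  - by move=> n _ _; exact: mule_ge0.
  - by move=> n _ _; exact: mule_ge0.
  rewrite !nneseriesZl// lte_add_pinfty// lte_mul_pinfty ?lee_fin//; last exact: fnorm_fin.
  by have := hK1 K1 (leqnn _); rewrite expr1n => /le_lt_trans; apply; rewrite ltry.
pose Y : prefock R := Prefock (asboolT yin).
exists (to_fock Y); apply/tendsP => e e0; have [K hK] := dist (e / 2) ltac:(lra).
exists K => k Kk; rewrite ux -to_fockB -(@ltr_sqr _ (hnorm _ _)) ?nnegrE ?nrm_ge0 ?(ltW e0)//.
rewrite -lte_fin fock_nsq; apply: (@le_lt_trans _ _ ((e / 2) ^+ 2)%:E); last by rewrite lte_fin; nra.
apply: le_trans (hK k Kk); rewrite le_eqVlt; apply/orP; left; apply/eqP.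
apply: eq_eseriesr => n _; rewrite fnormE; congr (_ * _)%E; apply: eq_integral => t _.
by rewrite -normsqN opprB.
Qed.

End fock_hilbert.

Section embeddings.
Variable R : realType.
Local Notation C := R[i].
Local Notation mu n := (muplus R n).
Local Notation H := (fock R).
Local Notation ip := (@fock_ip R).
Local Notation nrm := (hnorm ip).
Local Notation nsq := (nsq ip).
Local Notation tf n F := (fun t : n.-tuple R => F (tval t) : C).
Local Notation cp x n := (@component R (prefock_val x) n).
Implicit Types (F G : seq R -> C) (u v : H) (x y : prefock R).

Let hH : hilbert ip := hilbert_fock R.

Definition emb n F : H := embed (tf n F).

Lemma single_same n (f : n.-tuple R -> C) t : component (single f) n t = f t.
Proof. by rewrite /component /single /= valK. Qed.

Lemma single_other n k (f : n.-tuple R -> C) t : k != n -> component (single f) k t = 0.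
Proof.
move=> kn; rewrite /component /single; case: insubP => // w _ e.
have kE : k = n by rewrite -(size_tuple w) -[tval w]/(val w) e size_tuple.
by move: kn; rewrite kE eqxx.
Qed.

Lemma single_in_fock n (f : n.-tuple R -> C) : Lambda f -> in_fock (single f).
Proof.
move=> [[m1 m2 fin] af].
have sE : component (single f) n = f by apply/funext => t; rewrite single_same.
have s0 k : k != n -> component (single f) k = fun=> 0.
  by move=> kn; apply/funext => t; rewrite single_other.
split=> [k|].
  have [->|kn] := eqVneq k n; first by rewrite sE.
  rewrite (s0 k kn); have [[z1 z2] z3] := @sqint0 _ _ _ (mu k); split=> //.
  by move=> s; apply: nearW => t; rewrite mulr0.
have e0 k : k != n -> ((k`!%:R)%:E * L2norm2 (component (single f) k) = 0)%E.
  move=> kn; rewrite (s0 k kn) -[L2norm2 _]/(sqn (mu k) (fun=> 0)) sqn_ae0 ?mule0//.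
  exact: nearW.
have t0 k : (0 <= (k`!%:R)%:E * L2norm2 (component (single f) k))%E.
  by rewrite mule_ge0// ?lee_fin//; exact: sqn_ge0.
rewrite (nneseries_split 0 n.+1) ?add0n => [|k _]; last exact: t0.
rewrite big_mkord big_ord_recr /= big1 => [|k _]; last first.
  by apply: e0; rewrite ltn_eqF// ltn_ord.
rewrite eseries0 => [|k nk _]; last by apply: e0; rewrite gtn_eqF.
by rewrite add0e adde0 sE lte_mul_pinfty// lee_fin.
Qed.

Lemma embedE n (f : n.-tuple R -> C) : Lambda f -> exists x, embed f = to_fock x /\
  forall k t, cp x k t = component (single f) k t.
Proof.
move=> Lf; have hx : single f \in @fock_pred R by apply/asboolP; exact: single_in_fock.
exists (Prefock hx); split=> //; congr to_fock; apply: val_inj.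
by rewrite val_insubd hx.
Qed.

Lemma to_fock_lc a x y : a *: to_fock x + to_fock y = to_fock (a *: x + y).
Proof. by rewrite to_fockD -fock_scaleE. Qed.

Lemma to_fock0 : to_fock 0 = 0 :> H.
Proof. by rewrite -[RHS](subrr (to_fock 0)) -to_fockB subrr. Qed.

Lemma embed_lc n a (f g h : n.-tuple R -> C) : Lambda f -> Lambda g -> Lambda h ->
  {ae mu n, forall t, h t = a * f t + g t} -> embed h = a *: embed f + embed g.
Proof.
move=> /embedE[x [-> xE]] /embedE[y [-> yE]] /embedE[z [-> zE]] hfg.
rewrite to_fock_lc; apply/to_fock_eq => k.
have E t : cp (a *: x + y) k t = a * cp x k t + cp y k t by [].
have [->|kn] := eqVneq k n.
  move: hfg; apply: filterS => t; rewrite -[cp (a *: x + y) n t]/(a * cp x n t + cp y n t) zE xE yE.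
  by rewrite !single_same.
apply: nearW => t; rewrite E zE xE yE !single_other// mulr0 addr0//.
Qed.

Lemma embed_ae n (f g : n.-tuple R -> C) : Lambda f -> Lambda g ->
  {ae mu n, forall t, f t = g t} -> embed f = embed g.
Proof.
move=> /embedE[x [-> xE]] /embedE[y [-> yE]] fg; apply/to_fock_eq => k.
have [->|kn] := eqVneq k n.
  by move: fg; apply: filterS => t; rewrite xE yE !single_same.
by apply: nearW => t; rewrite xE yE !single_other.
Qed.

Lemma ip_embed_l n (f : n.-tuple R -> C) x : Lambda f ->
  ip (embed f) (to_fock x) = n`!%:R * cint (mu n) (fun t => (f t)^*%C * cp x n t).
Proof.
move=> /embedE[y [-> yE]]; rewrite fock_ipE.
have -> : n`!%:R * cint (mu n) (fun t => (f t)^*%C * cp x n t) = fterm y x n.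
  by congr (_ * _); apply: eq_cint => t; rewrite yE single_same.
apply: csum_unique (fip_csum _ _) _; apply: csum_single => k kn.
rewrite /fterm (_ : cint _ _ = 0) ?mulr0// -(cint0 (mu k)).
by apply: eq_cint => t; rewrite yE single_other// conjc0 mul0r.
Qed.

Lemma ip_embed n (f g : n.-tuple R -> C) : Lambda f -> Lambda g ->
  ip (embed f) (embed g) = n`!%:R * cint (mu n) (fun t => (f t)^*%C * g t).
Proof.
move=> Lf /embedE[y [-> yE]]; rewrite ip_embed_l//; congr (_ * _).
by apply: eq_cint => t; rewrite yE single_same.
Qed.

Lemma ip_embed_neq n k (f : n.-tuple R -> C) (g : k.-tuple R -> C) : n != k ->
  Lambda f -> Lambda g -> ip (embed f) (embed g) = 0.
Proof.
move=> nk Lf /embedE[y [-> yE]]; rewrite ip_embed_l// (_ : cint _ _ = 0) ?mulr0// -(cint0 (mu n)).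
by apply: eq_cint => t; rewrite yE single_other// mulr0.
Qed.

Lemma nsq_embed n (f : n.-tuple R -> C) : Lambda f ->
  nsq (embed f) = n`!%:R * fine (sqn (mu n) f).
Proof.
move=> Lf; rewrite nsqE ip_embed// cint_sqn; last by case: Lf => [[m1 m2 fin] _].
by rewrite natrC -rmorphM.
Qed.

Lemma nalt_Lambda n F : nalt n F -> Lambda (tf n F).
Proof.
move=> [nF aF]; have [[m1 m2] fin] := nice_sqint nF; split; first by split.
by move=> s; apply: nearW => t; exact: aF.
Qed.

Lemma asym_antisymmetrize n F (t : n.-tuple R) : asym n F t = antisymmetrize (tf n F) t.
Proof. exact: asymE. Qed.

(** A crude constant, built up one permutation at a time; only continuity of antisymmetrization
    matters. *)
Lemma sqn_asym n : exists2 K : R, 0 <= K & forall F, cmeas (tf n F) ->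
  (sqn (mu n) (tf n (asym n F)) <= K%:E * sqn (mu n) (tf n F))%E.
Proof.
have n1 (s : 'S_n) : normsq ((-1) ^+ s : C) = 1.
  by case: (odd_perm s); rewrite /= ?expr1 ?expr0 ?normsqN /normsq /=; ring.
have mS F (r : seq 'S_n) : cmeas (tf n F) ->
    cmeas (fun t : n.-tuple R => \sum_(s <- r) (-1) ^+ s * F (permute_tuple s t)).
  by move=> mF; apply: cmeas_sum => s _; apply: cmeasZ; exact: (cmeas_permute s mF).
have [K K0 hK] : exists2 K : R, 0 <= K & forall F, cmeas (tf n F) ->
    (sqn (mu n) (fun t => \sum_(s : 'S_n) (-1) ^+ s * F (permute_tuple s t))%R <= K%:E * sqn (mu n) (tf n F))%E.
  elim: (index_enum _) => [|s r [K K0 hK]].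
    exists 0 => // F mF; rewrite mul0e sqn_ae0//; last by apply: nearW => t; rewrite big_nil.
    exact: mS.
  exists (2 + 2 * K) => [|F mF]; first lra.
  have ms : cmeas (fun t : n.-tuple R => (-1) ^+ s * F (permute_tuple s t)).
    by apply: cmeasZ; exact: (cmeas_permute s mF).
  have -> : sqn (mu n) (fun t => \sum_(s <- s :: r) (-1) ^+ s * F (permute_tuple s t)) =
      sqn (mu n) (fun t => (-1) ^+ s * F (permute_tuple s t) +
        \sum_(s <- r) (-1) ^+ s * F (permute_tuple s t)).
    by apply: eq_sqn => t; rewrite big_cons.
  apply: le_trans (sqnD (mu n) ms (mS F r mF)) _.
  rewrite sqnZ ?n1 ?mul1e; last exact: (cmeas_permute s mF).
  rewrite (sqn_permute s mF) (EFinD 2) (EFinM 2) ge0_muleDl ?mule_ge0 ?lee_fin//.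
  by apply: leeD => //; rewrite -muleA; apply: lee_wpmul2l => //; exact: hK.
exists (normsq (n`!%:R^-1 : C) * K) => [|F mF]; first by rewrite mulr_ge0 ?normsq_ge0.
rewrite (eq_sqn _ (fun t : n.-tuple R => asymE F t)) sqnZ ?EFinM -?muleA; last exact: mS.
by apply: lee_wpmul2l; [rewrite lee_fin normsq_ge0 | exact: hK].
Qed.

Lemma Lambda_asym n F : sqint (mu n) (tf n F) -> Lambda (tf n (asym n F)).
Proof.
move=> [mF fF]; have [K K0 hK] := sqn_asym n.
have mA : cmeas (tf n (asym n F)).
  rewrite (_ : tf n (asym n F) = fun t => (n`!%:R)^-1 * \sum_(s : 'S_n) (-1) ^+ s * F (permute_tuple s t)).
    by apply: cmeasZ; apply: cmeas_sum => s _; apply: cmeasZ; exact: (cmeas_permute s mF).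
  by apply/funext => t; rewrite asymE.
have [m1 m2] := mA; split; last by move=> s; apply: nearW => t; exact: asym_alt.
split=> //; apply: le_lt_trans (hK F mF) _.
by apply: lte_mul_pinfty; rewrite ?lee_fin.
Qed.

Lemma nsq_emb_asym n : exists2 K : R, 0 <= K & forall F, sqint (mu n) (tf n F) ->
  nsq (emb n (asym n F)) <= K * fine (sqn (mu n) (tf n F)).
Proof.
have [K K0 hK] := sqn_asym n; exists (n`!%:R * K) => [|F LF]; first by rewrite mulr_ge0.
have LA := Lambda_asym LF; rewrite nsq_embed// -mulrA ler_wpM2l//.
have [[m1 m2 fA] _] := LA; have [mF fF] := LF.
rewrite -lee_fin EFinM !fineK; [exact: hK | exact: sqint_fin |].
by apply: sqint_fin; split.
Qed.

Lemma asym_ae n F G : {ae mu n, forall t, F (tval t) = G (tval t)} ->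
  {ae mu n, forall t, asym n F (tval t) = asym n G (tval t)}.
Proof.
move=> FG; have : {ae mu n, forall t, forall s : 'S_n, F (permute_tuple s t) = G (permute_tuple s t)}.
  have h (r : seq 'S_n) : {ae mu n, forall t, forall s, s \in r -> F (permute_tuple s t) = G (permute_tuple s t)}.
    elim: r => [|s r IH]; first exact: nearW.
    have hs := ae_permute s FG; move: hs IH; apply: filterS2 => t e IH k.
    by rewrite inE => /predU1P[->|/IH].
  by move: (h (enum 'S_n)); apply: filterS => t e s; apply: e; rewrite mem_enum.
by apply: filterS => t e; rewrite !asymE; congr (_ * _); apply: eq_bigr => s _; rewrite e.
Qed.

Lemma emb_asym_lc n a F G E : sqint (mu n) (tf n F) -> sqint (mu n) (tf n G) -> sqint (mu n) (tf n E) ->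
  {ae mu n, forall t, E (tval t) = a * F (tval t) + G (tval t)} ->
  emb n (asym n E) = a *: emb n (asym n F) + emb n (asym n G).
Proof.
move=> LF LG LE e; apply: embed_lc; try exact: Lambda_asym.
have := asym_ae (G := fun t => a * F t + G t) e; apply: filterS => t ->.
by rewrite asymD asymZ.
Qed.

End embeddings.

(** * Wedge products of one-variable functions are total *)

Section totality.
Variable R : realType.
Local Notation C := R[i].
Local Notation mu n := (muplus R n).
Local Notation H := (fock R).
Local Notation ip := (@fock_ip R).
Local Notation nrm := (hnorm ip).
Local Notation nsq := (nsq ip).
Local Notation tf n F := (fun t : n.-tuple R => F (tval t) : C).
Local Notation cp x n := (@component R (prefock_val x) n).
Implicit Types (F G : seq R -> C) (u v : H) (x y : prefock R) (z : R -> C).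

Let hH : hilbert ip := hilbert_fock R.

Fixpoint wedges (zs : seq (R -> C)) : seq R -> C :=
  if zs is z :: zs' then wedge (size zs') z (wedges zs') else fun=> 1.

Definition all_nice1 zs : Prop := foldr (fun z P => nice1 z /\ P) True zs.

Lemma wedges_nalt zs : all_nice1 zs -> nalt (size zs) (wedges zs).
Proof.
elim: zs => [_|z zs IH /= [nz /IH [nW aW]]]; last exact: nalt_wedge.
split; last by move=> s t; rewrite mulr1; have -> : s = 1%g by [apply/permP => -[]]; rewrite odd_perm1.
by split; [exact: bmeas_cst | exists 0 => t; rewrite tuple0].
Qed.

Lemma asym0E F t : asym 0 F t = F [::].
Proof.
rewrite /asym (big_pred1 1%g) => [|s]; last by apply/esym/eqP/permP => -[].
by rewrite odd_perm1 expr0 !mul1r invr1 mul1r tuple0.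
Qed.

Lemma wedges_asym zs t : wedges zs t = asym (size zs) (tens zs) t.
Proof.
elim: zs t => [|z zs IH] t; first by rewrite asym0E.
rewrite /= /wedge (eq_asym (G := ten z (asym (size zs) (tens zs)))); last first.
  by case=> [//|x s] _ /=; rewrite IH.
by rewrite asym_ten_asym; apply: eq_asym => -[//|x s].
Qed.

Lemma nice1_ind (A : set R) : bounded_set1 A -> nice1 (ind A).
Proof.
move=> [mA [K hK]]; split.
- by split; [exact: measurable_indic | exact: measurable_cst].
- by exists 1 => x; rewrite /ind normsq_real indicE; case: (_ \in _); rewrite ?expr1n ?expr0n.
- exists K => x; rewrite /ind indicE; case: (boolP (x \in A)) => [|_]; first by rewrite inE => /hK.
  by move=> h; exfalso; apply: h.
Qed.

Lemma conjc_nat n : (n%:R : C)^*%C = n%:R.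
Proof. by rewrite natrC; apply: eqC => //=; rewrite oppr0. Qed.

Lemma conjc_sign (b : bool) : ((-1) ^+ b : C)^*%C = (-1) ^+ b.
Proof. by case: b; rewrite ?expr1 ?expr0 ?conjcN conjc1. Qed.

(** Antisymmetrization is symmetric and fixes [h]: each permutation is moved onto [h], where it
    reproduces its own sign. *)
Lemma cint_asym n F (h : n.-tuple R -> C) : sqint (mu n) (tf n F) -> Lambda h ->
  cint (mu n) (fun t => (asym n F t)^*%C * h t) = cint (mu n) (fun t => (F t)^*%C * h t).
Proof.
move=> LF [Lh ah]; have [mF _] := LF; have [m1 m2 _] := Lh.
have Lh' : sqint (mu n) h by case: Lh.
have mh : cmeas h by [].
have LFs (s : 'S_n) : sqint (mu n) (fun t => F (permute_tuple s t)).
  by have [_ fF] := LF; split; [exact: (cmeas_permute s mF) | rewrite (sqn_permute s mF)].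
have key (s : 'S_n) : cint (mu n) (fun t => (F (permute_tuple s t))^*%C * h t) =
    (-1) ^+ s * cint (mu n) (fun t => (F t)^*%C * h t).
  rewrite -(cint_permute s (cmeasM (cmeasJ mF) mh)) -cintZ; last first.
    exact: (cintegrable_permute s (sqint_ip LF Lh')).
  apply: cint_ae_eq.
  - exact: cmeasM (cmeasJ (cmeas_permute s mF)) mh.
  - by apply: cmeasZ; exact: (cmeas_permute s (cmeasM (cmeasJ mF) mh)).
  - move: (ah s); apply: filterS => t ->.
    by rewrite [RHS]mulrCA [(-1) ^+ s * ((-1) ^+ s * _)]mulrA sign_sq mul1r.
have E (t : n.-tuple R) : (asym n F t)^*%C * h t = (n`!%:R)^-1 * \sum_(s : 'S_n)
    (-1) ^+ s * ((F (permute_tuple s t))^*%C * h t).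
  rewrite asymE conjcM -mulrA.
  have -> : ((n`!%:R)^-1 : C)^*%C = (n`!%:R)^-1.
    by rewrite fmorphV; congr (_^-1); exact: conjc_nat.
  congr (_ * _); rewrite -[X in X * _](_ : \sum_(s : 'S_n) ((-1) ^+ s * F (permute_tuple s t))^*%C = _); last first.
    by elim/big_rec2: _ => [|s a b _ ->]; rewrite ?conjc0 ?conjcD.
  rewrite mulr_suml; apply: eq_bigr => s _.
  by rewrite conjcM conjc_sign mulrA.
have Is (s : 'S_n) : cintegrable (mu n) (fun t => (-1) ^+ s * ((F (permute_tuple s t))^*%C * h t)).
  by apply: cintegrableZ; exact: (sqint_ip (LFs s) Lh').
rewrite (eq_cint _ E) cintZ; last by apply: cintegrable_sum => s _; exact: Is.
rewrite cint_sum => [|s _]; last exact: Is.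
rewrite (eq_bigr (fun=> cint (mu n) (fun t => (F t)^*%C * h t))) => [|s _].
  by rewrite sumr_const card_Sn -[X in _ * X]mulr_natl mulKf// fact_neq0.
rewrite cintZ; last exact: (sqint_ip (LFs s) Lh').
by rewrite key mulrA sign_sq mul1r.
Qed.

(** A wedge of indicators pairs with an antisymmetric component as the indicator of the box does, so
    [box_integrals_ae0] applies. *)
Lemma degree_total n x : (forall zs, size zs = n -> all_nice1 zs -> ip (emb n (wedges zs)) (to_fock x) = 0) ->
  {ae mu n, forall t, cp x n t = 0}.
Proof.
move=> h; have Lx : Lambda (cp x n) by have [/(_ n)] := prefockP x.
apply: box_integrals_ae0; first by have [[m1 m2 fin] _] := Lx.
move=> A bA; pose zs := [seq ind (A i) | i <- iota 0 n].
have szs : size zs = n by rewrite size_map size_iota.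
have nzs : all_nice1 zs.
  by rewrite /zs; elim: (iota 0 n) => //= i s IH; split=> //; apply: nice1_ind.
have := h zs szs nzs; rewrite ip_embed_l; last first.
  by apply: nalt_Lambda; have := wedges_nalt nzs; rewrite szs.
move=> /eqP; rewrite mulf_eq0 (negbTE (fact_neq0 _ _)) /= => /eqP.
have -> : (fun t : n.-tuple R => (wedges zs t)^*%C * cp x n t) = (fun t => (asym n (tens zs) t)^*%C * cp x n t).
  by apply/funext => t; rewrite wedges_asym szs.
have tE (t : n.-tuple R) : tens zs t = (\1_(@box R n A) t)%:C%C by exact: tens_ind.
rewrite cint_asym//; last first.
  have LW : sqint (mu n) (fun t => (\1_(@box R n A) t)%:C%C).
    have mb : measurable (@box R n A) by apply: measurable_box => i; case: (bA i).
    split; first by split; [exact: measurable_indic | exact: measurable_cst].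
    rewrite /sqn (eq_integral (fun t => (\1_(@box R n A) t)%:E)); last first.
      by move=> t _; rewrite normsq_real indicE; case: (_ \in _); rewrite ?expr1n ?expr0n.
    by rewrite integral_indic// setIT finite_box.
  by rewrite (_ : tf n (tens zs) = fun t => (\1_(@box R n A) t)%:C%C)//; apply/funext.
move=> <-; apply: eq_cint => t; rewrite tE.
by congr (_ * _); apply: eqC => //=; rewrite oppr0.
Qed.

Lemma wedges_ip0 n u F : (forall zs, size zs = n -> all_nice1 zs -> ip (emb n (wedges zs)) u = 0) ->
  Lambda (tf n F) -> ip (emb n F) u = 0.
Proof.
have [x ->] := to_fock_rep u; move=> /degree_total x0 LF.
rewrite ip_embed_l// -[RHS](mulr0 n`!%:R) -(cint0 (mu n)); congr (_ * _).
have [[m1 m2 _] _] := LF; apply: cint_ae_eq.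
- by apply: cmeasM; [exact: cmeasJ | case: (cp_sqint x n)].
- exact: cmeas_cst.
- by move: x0; apply: filterS => t ->; rewrite mulr0.
Qed.

Lemma emb_separating u : (forall n F, nalt n F -> ip (emb n F) u = 0) -> u = 0.
Proof.
have [x ->] := to_fock_rep u; move=> h; rewrite -(to_fock0 R); apply/to_fock_eq => n.
apply: degree_total => zs zn nzs; apply: h; rewrite -zn; exact: wedges_nalt.
Qed.

End totality.

Section bounded_extension.
Variables (R : realType) (H : lmodType R[i]) (ip : H -> H -> R[i]).
Variable hH : hilbert ip.
Local Notation C := R[i].
Local Notation nrm := (hnorm ip).
Local Notation nsq := (nsq ip).

(** [G] is the graph of a bounded map on a dense subspace; giving it as a relation avoids proving
    that the map is well defined on sums of homogeneous vectors. *)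
Lemma bounded_extension (G : set (H * H)) (M : R) : 0 <= M ->
  (forall a x x' y y', G (x, y) -> G (x', y') -> G (a *: x + x', a *: y + y')) ->
  (forall x y, G (x, y) -> nsq y <= M * nsq x) ->
  (forall x (e : R), 0 < e -> exists p, G p /\ nrm (p.1 - x) < e) ->
  exists2 B, bounded_op ip B & forall x y, G (x, y) -> B x = y.
Proof.
move=> M0 Gl GM Gd.
pose Q x y := exists u v, [/\ forall k : nat, G (u k, v k), tends ip u x & tends ip v y].
have GB x x' y y' : G (x, y) -> G (x', y') -> nrm (y - y') <= Num.sqrt M * nrm (x - x').
  move=> g g'; have := GM _ _ (Gl (-1) _ _ _ _ g' g); rewrite !scaleN1r [- y' + y]addrC [- x' + x]addrC => h.
  have -> : Num.sqrt M * nrm (x - x') = Num.sqrt (M * nsq (x - x')) by rewrite sqrtrM.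
  by rewrite /hnorm ler_sqrt// mulr_ge0// nsq_ge0.
have Qex x : exists y, Q x y.
  have /choice[p hp] (k : nat) : exists p, G p /\ nrm (p.1 - x) < k.+1%:R^-1.
    by apply: Gd; rewrite invr_gt0.
  have px : tends ip (fun k => (p k).1) x.
    apply: (tends_squeeze (f := fun k : nat => k.+1%:R^-1)); first exact: cvg_harmonic.
    by move=> k; case: (hp k) => _ /ltW.
  have [y hy] : exists y, tends ip (fun k => (p k).2) y.
    apply: (hilbert_complete hH) => e e0.
    have M1 : 0 < Num.sqrt M + 1 by rewrite ltr_wpDl ?sqrtr_ge0.
    have [N hN] := tends_cauchy hH px (divr_gt0 e0 M1); exists N => m n Nm Nn.
    have gm : G ((p m).1, (p m).2) by rewrite -surjective_pairing; case: (hp m).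
    have gn : G ((p n).1, (p n).2) by rewrite -surjective_pairing; case: (hp n).
    apply: le_lt_trans (GB _ _ _ _ gm gn) _.
    have := hN m n Nm Nn; rewrite ltr_pdivlMr// => /(le_lt_trans _); apply.
    by rewrite mulrC ler_wpM2l ?nrm_ge0// lerDl.
  exists y, (fun k => (p k).1), (fun k => (p k).2); split=> // k.
  by rewrite -surjective_pairing; case: (hp k).
have Qu x y y' : Q x y -> Q x y' -> y = y'.
  move=> [u [v [g ux vy]]] [u' [v' [g' ux' vy']]].
  have h1 := tendsB hH ux ux'; rewrite subrr in h1.
  have h2 : tends ip (fun k => v k - v' k) 0.
    by apply: (tends_lip h1 (M := Num.sqrt M)) => k; rewrite !subr0; exact: GB.
  by apply/eqP; rewrite -subr_eq0; apply/eqP/(tends_unique hH (tendsB hH vy vy') h2).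
have /choice[B hB] := Qex.
have GQ x y : G (x, y) -> Q x y.
  by move=> g; exists (fun=> x), (fun=> y); split=> //; exact: tends_cst.
exists B => [|x y /GQ]; last exact: Qu.
split=> [a x y|].
  apply: (Qu (a *: x + y)); first exact: hB.
  have [u [v [g ux vy]]] := hB x; have [u' [v' [g' ux' vy']]] := hB y.
  exists (fun k => a *: u k + u' k), (fun k => a *: v k + v' k); split=> [k||].
  - exact: Gl.
  - by apply: tendsD => //; exact: tendsZ.
  - by apply: tendsD => //; exact: tendsZ.
exists (Num.sqrt M) => x; have [u [v [g ux vy]]] := hB x.
rewrite -(@ler_sqr _ (nrm _)) ?nnegrE ?mulr_ge0 ?nrm_ge0 ?sqrtr_ge0// exprMn [Num.sqrt M ^+ 2]sqr_sqrtr// !(nrmE hH).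
have h1 := cvg_nsq hH vy.
have h2 : M * nsq (u k) @[k --> \oo] --> M * nsq x by apply: cvgMr; exact: (cvg_nsq hH ux).
by apply: ler_cvg_to h1 h2 _; apply: nearW => k; exact: GM (g k).
Qed.

Lemma separating_dense (A : set H) : A 0 -> (forall a x y, A x -> A y -> A (a *: x + y)) ->
  (forall y, (forall x, A x -> ip x y = 0) -> y = 0) ->
  forall x (e : R), 0 < e -> exists2 a, A a & nrm (a - x) < e.
Proof.
move=> A0 Al sep; pose K : set H := [set x | forall e : R, 0 < e -> exists2 a, A a & nrm (a - x) < e].
have Ks : subspace K.
  split=> [e e0|a x y Kx Ky e e0]; first by exists 0; rewrite ?subrr ?(nrm0 hH).
  have a0 : 0 < Num.sqrt (normsq a) + 1 by rewrite ltr_wpDl ?sqrtr_ge0.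
  have [p Ap hp] := Kx (e / 2 / (Num.sqrt (normsq a) + 1)) ltac:(by rewrite !divr_gt0).
  have [q Aq hq] := Ky (e / 2) ltac:(by rewrite divr_gt0).
  exists (a *: p + q); first exact: Al.
  rewrite opprD addrACA -scalerBr; apply: le_lt_trans (ler_nrmD hH _ _) _.
  rewrite (nrmZ hH) [X in _ < X](splitr e); apply: ler_ltD => //.
  move: hp; rewrite ltr_pdivlMr// => /ltW; apply: le_trans.
  by rewrite mulrC ler_wpM2l ?nrm_ge0// lerDl.
have Kc : closed_under_limits ip K.
  move=> u v Ku /tendsP uv e e0; have [N hN] := uv (e / 2) ltac:(by rewrite divr_gt0).
  have [p Ap hp] := Ku N (e / 2) ltac:(by rewrite divr_gt0).
  exists p => //; apply: le_lt_trans (ler_nrmB hH _ (u N) _) _.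
  have hN' := hN N (leqnn N).
  by rewrite [X in _ < X](splitr e); exact: ltrD.
move=> x; suff: K x by [].
have [p Kp hp] := projection_exists hH Ks Kc x.
suff /eqP : x - p = 0 by rewrite subr_eq0 => /eqP ->.
by apply: sep => a Aa; apply: hp => e e0; exists a; rewrite ?subrr ?(nrm0 hH).
Qed.

Lemma nsq_orthogonal_sum (e : nat -> H) N : (forall m n, m != n -> ip (e m) (e n) = 0) ->
  nsq (\sum_(n < N) e n) = \sum_(n < N) nsq (e n).
Proof.
move=> oe; elim: N => [|N IH]; first by rewrite !big_ord0 (nsq0 hH).
have o k : (k <= N)%N -> ip (\sum_(n < k) e n) (e N) = 0.
  elim: k => [_|k IHk kN]; first by rewrite big_ord0 (ip0l hH).
  by rewrite big_ord_recr (ipDl hH) /= (IHk (ltnW kN)) add0r oe// ltn_eqF.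
by rewrite !big_ord_recr /= (nsqD hH) (o N (leqnn N)) IH mulr0 addr0.
Qed.

End bounded_extension.

(** * Creation and annihilation operators *)

Section creation_operators.
Variable R : realType.
Local Notation C := R[i].
Local Notation mu n := (muplus R n).
Local Notation m1 := (@mu1 R).
Local Notation tf n F := (fun t : n.-tuple R => F (tval t) : C).
Local Notation Re := complex.Re.
Implicit Types (F G : seq R -> C) (z w : R -> C).

(* What the operator theory uses of the Fock space H: emb n F is the vector of
   H given by F in degree n. Keeping H abstract prevents unification from
   unfolding the quotient that defines the Fock space. *)
Record fock_model (H : lmodType C) (ip : H -> H -> C) (emb : nat -> (seq R -> C) -> H) : Prop := {
  fm_hilbert : hilbert ip;
  fm_lc : forall n a F G, nalt n F -> nalt n G ->
    emb n (fun t => a * F t + G t) = a *: emb n F + emb n G;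
  fm_eq : forall n F G, (forall t, size t = n -> F t = G t) -> emb n F = emb n G;
  fm_ip : forall n F G, nalt n F -> nalt n G ->
    ip (emb n F) (emb n G) = n`!%:R * cint (mu n) (fun t : n.-tuple R => (F t)^*%C * G t);
  fm_neq : forall n k F G, n != k -> nalt n F -> nalt k G -> ip (emb n F) (emb k G) = 0;
  fm_wedges : forall n u F,
    (forall zs, size zs = n -> all_nice1 zs -> ip (emb n (wedges zs)) u = 0) ->
    nalt n F -> ip (emb n F) u = 0;
  fm_separating : forall u, (forall n F, nalt n F -> ip (emb n F) u = 0) -> u = 0 }.

Definition conjf (T : Type) (f : T -> C) : T -> C := fun x => (f x)^*%C.

Lemma conjfK T (f : T -> C) : conjf (conjf f) = f.
Proof. by apply/funext => x; rewrite /conjf conjcK. Qed.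

Lemma niceJ n F : nice n F -> nice n (conjf F).
Proof.
move=> [[mF [M hM]] [K hK]]; split; last first.
  by exists K => t h; apply: hK => F0; apply: h; rewrite /conjf F0 conjc0.
by split; [exact: cmeasJ | exists M => t; rewrite normsqJ].
Qed.

Lemma altJ n F : alt n F -> alt n (conjf F).
Proof. by move=> aF s t; rewrite /conjf aF conjcM conjc_sign. Qed.

Lemma naltJ n F : nalt n F -> nalt n (conjf F).
Proof. by move=> [nF aF]; split; [exact: niceJ | exact: altJ]. Qed.

Lemma nice1J z : nice1 z -> nice1 (conjf z).
Proof.
move=> [mz [M hM] [K hK]]; split; first exact: cmeasJ.
  by exists M => x; rewrite normsqJ.
by exists K => x h; apply: hK => z0; apply: h; rewrite /conjf z0 conjc0.
Qed.

Lemma nalt_lc n a F G : nalt n F -> nalt n G -> nalt n (fun t => a * F t + G t).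
Proof.
by move=> [nF aF] [nG aG]; split; [apply: niceD => //; exact: niceZ | apply: altD => //; exact: altZ].
Qed.

Lemma nalt0 n : nalt n (fun _ : seq R => 0 : C).
Proof. by split; [exact: nice0 | move=> s t; rewrite mulr0]. Qed.

Lemma fock_modelP : fock_model (@fock_ip R) (@emb R).
Proof.
split.
- exact: hilbert_fock.
- move=> n a F G nF nG; apply: embed_lc; try exact: nalt_Lambda.
    exact: (nalt_Lambda (nalt_lc a nF nG)).
  exact: nearW.
- by move=> n F G h; congr embed; apply/funext => t; rewrite h ?size_tuple.
- by move=> n F G nF nG; exact: (ip_embed (nalt_Lambda nF) (nalt_Lambda nG)).
- by move=> n k F G nk nF nG; exact: (ip_embed_neq nk (nalt_Lambda nF) (nalt_Lambda nG)).
- by move=> n u F h nF; exact: (wedges_ip0 h (nalt_Lambda nF)).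
- exact: emb_separating.
Qed.

Variables (H : lmodType C) (ip : H -> H -> C) (emb : nat -> (seq R -> C) -> H).
Hypothesis fm : fock_model ip emb.
Local Notation nrm := (hnorm ip).
Local Notation nsq := (nsq ip).
Implicit Types (u v : H).

Let hH := fm_hilbert fm.
Let emb_lc := fm_lc fm.
Let emb_eq := fm_eq fm.
Let ip_emb := fm_ip fm.
Let ip_emb_neq := fm_neq fm.
Let emb_separating := fm_separating fm.

Lemma emb_total (K : set H) : subspace K -> closed_under_limits ip K ->
  (forall n F, nalt n F -> K (emb n F)) -> forall u, K u.
Proof.
move=> Ks Kc hK u; have [p Kp hp] := projection_exists hH Ks Kc u.
have : u - p = 0 by apply: emb_separating => n F /hK; exact: hp.
by move=> /eqP; rewrite subr_eq0 => /eqP ->.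
Qed.

Lemma emb0 n : emb n (fun=> 0) = 0 :> H.
Proof.
have := emb_lc (-1) (nalt0 n) (nalt0 n); rewrite scaleN1r addNr => <-.
by apply: emb_eq => t _; rewrite mulr0 addr0.
Qed.

Lemma embZ n a F : nalt n F -> emb n (fun t => a * F t) = a *: emb n F.
Proof.
move=> nF; have := emb_lc a nF (nalt0 n); rewrite emb0 addr0 => <-.
by apply: emb_eq => t _; rewrite addr0.
Qed.

Lemma wedge_lc n z a F G t : wedge n z (fun s => a * F s + G s) t = a * wedge n z F t + wedge n z G t.
Proof.
rewrite /wedge -asymZ -asymD; apply: eq_asym => -[|x s] //= _; ring.
Qed.

(** The factor n + 1 is the quotient of the weights (n+1)! and n! in the two inner products. *)
Lemma ip_wedge n z F G : nice1 z -> nalt n F -> nalt n.+1 G ->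
  ip (emb n.+1 (wedge n z F)) (emb n.+1 G) = n.+1%:R * ip (emb n F) (emb n (sl (conjf z) G)).
Proof.
move=> nz nF nG; have nS := nalt_sl (nice1J nz) nG.
have nT := nice_ten nz nF.1.
rewrite (ip_emb (nalt_wedge nz nF.1) nG) (ip_emb nF nS).
rewrite /wedge (cint_asym (nice_sqint nT) (nalt_Lambda nG)).
rewrite factS natrM -mulrA; congr (_ * (_ * _)).
have [_ _ ->] := cint_cons (niceM (niceJ nT) nG.1.1).
apply: eq_cint => t; rewrite /sl -cintZ.
  by apply: eq_cint => x; rewrite /conjf /= conjcM; ring.
by apply: (sl_integrable (nice1J nz) nG.1.1); rewrite size_tuple.
Qed.

(** Canonical anticommutation relation between the creator of [z] and the annihilator of [conjf w],
    pointwise; n + 1 and n are the weights of annihilation in the two degrees. It is [asym_cons]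
    integrated against [w]. *)
Lemma car n z w F t : nice1 z -> nice1 w -> nalt n F -> size t = n ->
  n.+1%:R * sl w (wedge n z F) t + n%:R * wedge n.-1 z (sl w F) t =
  cint m1 (fun x => w x * z x) * F t.
Proof.
move=> nz nw nF st; have [nW aW] := nalt_wedge nz nF.1.
have iwz : cintegrable m1 (fun x => w x * z x).
  by have [mz hz _] := nz; exact: nice1_integrable.
rewrite {1}/sl -cintZ; last exact: (sl_integrable nw nW.1 st).
have E x : n.+1%:R * (w x * wedge n z F (x :: t)) =
    F t * (w x * z x) - n%:R * (w x * asym n (ten z (fun s => F (x :: s))) t).
  by rewrite mulrCA asym_cons//; [ring | case: nF].
rewrite (eq_cint _ E).
have iF : cintegrable m1 (fun x => F t * (w x * z x)) by exact: cintegrableZ.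
case: n nF st nW aW E => [|n] nF st nW aW E.
  rewrite mul0r addr0 mulrC -cintZ//; apply: eq_cint => x.
  by rewrite mul0r subr0.
have iS s : size s = n -> cintegrable m1 (fun x => w x * F (x :: s)).
  by move=> ss; apply: (sl_integrable nw nF.1.1 ss).
have [i e] := asym_ten_cint z t iS.
have E2 x : asym n.+1 (ten z (fun s => w x * F (x :: s))) t = w x * asym n.+1 (ten z (fun s => F (x :: s))) t.
  by rewrite -asymZ; apply: eq_asym => -[|y s] /= _; [rewrite mulr0 | ring].
rewrite (funext E2) in i e.
rewrite cintB//; last exact: cintegrableZ.
rewrite !cintZ// -e -[asym _ _ _]/(wedge n z (sl w F) t) subrK mulrC.
by [].
Qed.

(** By [car], |b^*(z) F|^2 = |z|^2 |F|^2 - |b(z) F|^2. *)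
Lemma nsq_wedge n z F : nice1 z -> nalt n F ->
  nsq (emb n.+1 (wedge n z F)) <= Re (cint m1 (fun x => conjf z x * z x)) * nsq (emb n F).
Proof.
move=> nz nF; have nW := nalt_wedge nz nF.1; have nz' := nice1J nz.
set c := cint _ _.
have nS := nalt_sl nz' nW.
have cE : c = (Re c)%:C%C.
  apply: eqC => //=; rewrite /Rintegral (eq_integral (fun=> 0%E)) ?integral0// => x _.
  by rewrite /conjf conjc_normsq.
rewrite nsqE (ip_wedge nz nF nW) -(ipZr hH) -(embZ _ nS).
case: n nF nW nS => [|n] nF nW nS.
  have -> : emb 0 (fun t => 1%:R * sl (conjf z) (wedge 0 z F) t) = emb 0 (fun t => c * F t).
    by apply: emb_eq => t st; have := car nz nz' nF st; rewrite mul0r addr0.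
  by rewrite (embZ _ nF) (ipZr hH) cE ReMr -cE nsqE.
have nF' := nalt_sl nz' nF; have nWS := nalt_wedge nz nF'.1.
have -> : emb n.+1 (fun t => n.+2%:R * sl (conjf z) (wedge n.+1 z F) t) =
    emb n.+1 (fun t => (- n.+1%:R) * wedge n z (sl (conjf z) F) t + c * F t).
  apply: emb_eq => t st; rewrite -(car nz nz' nF st) mulNr addrCA [- _ + _]addrC subrr addr0.
  by [].
have ncF : nalt n.+1 (fun t => c * F t).
  by have := nalt_lc c nF (nalt0 n.+1); under [X in nalt _ X]eq_fun do rewrite addr0.
rewrite (emb_lc _ nWS ncF) (embZ c nF) (ipDr hH) !(ipZr hH) ReD.
have -> : Re (c * ip (emb n.+1 F) (emb n.+1 F)) = Re c * nsq (emb n.+1 F) by rewrite {1}cE ReMr -nsqE.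
rewrite gerDr.
rewrite (hilbert_sym hH) (ip_wedge nz nF' nF) conjcM conjc_nat -(hilbert_sym hH) mulNr ReN oppr_le0.
by rewrite natrC !ReMr !mulr_ge0// -nsqE nsq_ge0.
Qed.

(** For b = true the sign turns z wedge F into F wedge z: creation on the right instead of the
    left. *)
Definition sg (b : bool) (n : nat) : C := if b then (-1) ^+ n else 1.

Lemma sg_conj b n : (sg b n)^*%C = sg b n.
Proof. by case: b; rewrite /sg ?conjc1// -signr_odd conjc_sign. Qed.

Lemma sg_sq b n : sg b n * sg b n = 1.
Proof. by case: b; rewrite /sg ?mul1r// -expr2 -exprM mulnC exprM sqrrN !expr1n. Qed.

(** On finite sums of homogeneous vectors the bound of [nsq_wedge] holds degree by degree, and
    different degrees stay orthogonal. The operator is extended by density and its adjoint is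
    identified through [ip_wedge]. *)
Lemma creation_exists b z : nice1 z -> exists B B', [/\ bounded_op ip B, bounded_op ip B',
  is_adjoint ip B B',
  forall n F, nalt n F -> B (emb n F) = sg b n *: emb n.+1 (wedge n z F) &
  (forall n G, nalt n.+1 G -> B' (emb n.+1 G) = (sg b n * n.+1%:R) *: emb n (sl (conjf z) G)) /\
  (forall G, nalt 0 G -> B' (emb 0 G) = 0)].
Proof.
move=> nz; pose c := Re (cint m1 (fun x => conjf z x * z x)).
have c0 : 0 <= c.
  rewrite /c /= /Rintegral fine_ge0//; apply: integral_ge0 => x _.
  by rewrite lee_fin /conjf conjc_normsq normsq_ge0.
pose W n F : H := sg b n *: emb n.+1 (wedge n z F).
pose G : set (H * H) := [set p | exists N (F : nat -> seq R -> C), (forall n, nalt n (F n)) /\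
  p = (\sum_(n < N) emb n (F n), \sum_(n < N) W n (F n))].
have Wlc n a F1 F2 : nalt n F1 -> nalt n F2 -> W n (fun t => a * F1 t + F2 t) = a *: W n F1 + W n F2.
  move=> n1 n2; rewrite /W scalerA mulrC -scalerA -scalerDr; congr (_ *: _).
  rewrite -emb_lc; try exact: (nalt_wedge nz (proj1 _)).
    by apply: emb_eq => t _; rewrite wedge_lc.
  by apply: nalt_wedge => //; case: n1.
  by apply: nalt_wedge => //; case: n2.
have W0 n : W n (fun=> 0) = 0.
  have := Wlc n (-1) _ _ (nalt0 n) (nalt0 n); rewrite scaleN1r addNr => <-.
  by congr W; apply/funext => t; rewrite mulr0 addr0.
(* Two sums of different lengths are brought to a common length by zero terms. *)
have pad N M (F : nat -> seq R -> C) (V : nat -> (seq R -> C) -> H) : (forall n, V n (fun=> 0) = 0) ->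
    (N <= M)%N -> \sum_(n < N) V n (F n) = \sum_(n < M) V n (if (n < N)%N then F n else fun=> 0).
  move=> V0 NM; rewrite (big_ord_widen _ (fun n => V n (F n)) NM) big_mkcond /=.
  by apply: eq_bigr => i _; case: ifP; rewrite ?V0.
have nif N (F : nat -> seq R -> C) : (forall n, nalt n (F n)) -> forall n, nalt n (if (n < N)%N then F n else fun=> 0).
  by move=> nF n; case: ifP => // _; exact: nalt0.
have [B bB GB] : exists2 B, bounded_op ip B & forall x y, G (x, y) -> B x = y.
  apply: (bounded_extension hH c0).
  - move=> a _ _ _ _ [N [F [nF [-> ->]]]] [N' [F' [nF' [-> ->]]]].
    pose M := maxn N N'; pose F1 n := if (n < N)%N then F n else fun=> 0.
    pose F2 n := if (n < N')%N then F' n else fun=> 0.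
    exists M, (fun n t => a * F1 n t + F2 n t); split=> [n|].
      by apply: nalt_lc; exact: nif.
    have h V V0 := pad N M F V V0 (leq_maxl _ _); have h' V V0 := pad N' M F' V V0 (leq_maxr _ _).
    rewrite (h _ emb0) (h' _ emb0) (h _ W0) (h' _ W0) !scaler_sumr -!big_split /=.
    congr pair; apply: eq_bigr => n _; first by rewrite emb_lc//; exact: nif.
    by rewrite Wlc//; exact: nif.
  - move=> x y [N [F [nF [-> ->]]]].
    rewrite (nsq_orthogonal_sum hH (e := fun n => W n (F n))) => [|m n mn]; last first.
      rewrite /W (ipZr hH) (ipZl hH) (ip_emb_neq _ (nalt_wedge nz (nF m).1) (nalt_wedge nz (nF n).1)) ?eqSS//.
      by rewrite !mulr0.
    rewrite (nsq_orthogonal_sum hH (e := fun n => emb n (F n))) => [|m n mn]; last first.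
      exact: ip_emb_neq.
    rewrite mulr_sumr; apply: ler_sum => n _; rewrite /W (nsqZ hH).
    rewrite (_ : normsq (sg b n) = 1) ?mul1r; first exact: nsq_wedge.
    by have := congr1 (@complex.Re R) (conjc_normsq (sg b n)); rewrite sg_conj sg_sq /= => <-.
  - pose A : set H := [set x | exists y, G (x, y)].
    suff dA x e : 0 < e -> exists2 a, A a & nrm (a - x) < e.
      by move=> x e /(dA x)[a [y Gy] ae]; exists (a, y).
    apply: (separating_dense hH (A := A)).
    + exists 0, 0%N, (fun=> fun=> 0); split=> [n|]; first exact: nalt0.
      by rewrite !big_ord0.
    + move=> a _ _ [_ [N [F [nF [-> _]]]]] [_ [N' [F' [nF' [-> _]]]]].
      pose M := maxn N N'; pose F1 n := if (n < N)%N then F n else fun=> 0.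
      pose F2 n := if (n < N')%N then F' n else fun=> 0.
      exists (\sum_(n < M) W n (fun t => a * F1 n t + F2 n t)), M, (fun n t => a * F1 n t + F2 n t).
      split=> [n|]; first by apply: nalt_lc; exact: nif.
      congr pair; rewrite (pad N M F _ emb0 (leq_maxl _ _)) (pad N' M F' _ emb0 (leq_maxr _ _)).
      rewrite scaler_sumr -big_split; apply: eq_bigr => n _; rewrite emb_lc//; exact: nif.
    + move=> y h; apply: emb_separating => n F nF; apply: h; pose F' k := if k == n then F else fun=> 0.
      exists (\sum_(k < n.+1) W k (F' k)), n.+1, F'; split=> [k|].
        by rewrite /F'; case: eqP => [->//|_]; exact: nalt0.
      congr pair; rewrite big_ord_recr /= /F' eqxx big1 ?add0r// => k _.
      by rewrite ltn_eqF// emb0.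
have BE n F : nalt n F -> B (emb n F) = W n F.
  move=> nF; apply: GB; pose F' k := if k == n then F else fun=> 0.
  exists n.+1, F'; split=> [k|].
    by rewrite /F'; case: eqP => [->//|_]; exact: nalt0.
  have s0 (V : nat -> (seq R -> C) -> H) : (forall n, V n (fun=> 0) = 0) -> \sum_(k < n.+1) V k (F' k) = V n F.
    move=> V0; rewrite big_ord_recr /= /F' eqxx big1 ?add0r// => k _.
    by rewrite ltn_eqF// V0.
  by rewrite !s0//; exact: emb0.
have [B' bB' aB] := adjoint_exists hH bB.
have aB' := adjoint_sym hH aB.
exists B, B'; split=> //; split=> [n F nF|F nF].
  have nz' := nice1J nz; have nS := nalt_sl nz' nF.
  apply/eqP; rewrite -subr_eq0; apply/eqP/emb_separating => m F' nF'.
  rewrite (ipBr hH) aB' BE// /W (ipZl hH) (ipZr hH) sg_conj.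
  have [mn|mn] := eqVneq m n.
    by move: nF'; rewrite mn => nF'; rewrite (ip_wedge nz nF' nF) mulrA subrr.
  by rewrite (ip_emb_neq _ (nalt_wedge nz nF'.1) nF) ?eqSS// (ip_emb_neq mn nF' nS) !mulr0 subrr.
apply: emb_separating => m F' nF'.
by rewrite aB' BE// /W (ipZl hH) (ip_emb_neq _ (nalt_wedge nz nF'.1) nF)// mulr0.
Qed.

(** Annihilation in degree 0 needs no clause of its own: there the factor [n%:R] is 0. *)
Definition creation_family (cr an : bool -> (R -> C) -> H -> H) : Prop :=
  forall b z, nice1 z -> [/\ bounded_op ip (cr b z), bounded_op ip (an b z),
  is_adjoint ip (cr b z) (an b z),
  forall n F, nalt n F -> cr b z (emb n F) = sg b n *: emb n.+1 (wedge n z F) &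
  forall n F, nalt n F -> an b z (emb n F) = (sg b n.-1 * n%:R) *: emb n.-1 (sl (conjf z) F)].

Lemma creation_family_exists : exists cr an, creation_family cr an.
Proof.
have ex (bz : bool * (R -> C)) : exists BB : (H -> H) * (H -> H), nice1 bz.2 ->
    [/\ bounded_op ip BB.1, bounded_op ip BB.2, is_adjoint ip BB.1 BB.2,
    forall n F, nalt n F -> BB.1 (emb n F) = sg bz.1 n *: emb n.+1 (wedge n bz.2 F) &
    forall n F, nalt n F -> BB.2 (emb n F) = (sg bz.1 n.-1 * n%:R) *: emb n.-1 (sl (conjf bz.2) F)].
  case: bz => b z /=; have [nz|nz] := pselect (nice1 z); last by exists (id, id).
  have [B [B' [h1 h2 h3 h4 [h5 h6]]]] := creation_exists b nz; exists (B, B') => _; split=> //.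
  by case=> [|n] F nF /=; [rewrite h6// mulr0 scale0r | rewrite h5].
have /choice[f hf] := ex.
by exists (fun b z => (f (b, z)).1), (fun b z => (f (b, z)).2) => b z nz; exact: hf (b, z) nz.
Qed.

End creation_operators.

(** * The Clifford algebra and its commutant *)

Section clifford_standard_form.
Variable R : realType.
Local Notation C := R[i].
Local Notation mu n := (muplus R n).
Local Notation m1 := (@mu1 R).
Variables (H : lmodType C) (ip : H -> H -> C) (emb : nat -> (seq R -> C) -> H).
Hypothesis fm : fock_model ip emb.
Variables cr an : bool -> (R -> C) -> H -> H.
Hypothesis ca : creation_family ip emb cr an.
Local Notation nrm := (hnorm ip).
Local Notation nsq := (nsq ip).
Implicit Types (F G : seq R -> C) (z w : R -> C) (u v x y : H) (b : bool).

Let hH := fm_hilbert fm.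

Lemma ten_ten_swap n z w F t : asym n.+2 (ten z (ten w F)) t = - asym n.+2 (ten w (ten z F)) t.
Proof.
rewrite -mulN1r -[in RHS](expr1 (-1)) -(@asym_insert _ n.+1 1 w (ten z F))//.
by apply: eq_asym => -[//|x [//|y s]] _ /=; rewrite drop0; ring.
Qed.

Lemma wedge_wedge n z w F t : wedge n.+1 z (wedge n w F) t = - wedge n.+1 w (wedge n z F) t.
Proof. by rewrite /wedge !asym_ten_asym ten_ten_swap. Qed.

Definition Om : H := emb 0 (fun=> 1).

(* op false z is the field operator Psi(z); the op true z generate the commutant *)
Definition op b z x : H := cr b z x + an b (conjf z) x.

Lemma op_emb b z n F : nice1 z -> nalt n F -> op b z (emb n F) =
  sg R b n *: emb n.+1 (wedge n z F) + (sg R b n.-1 * n%:R) *: emb n.-1 (sl z F).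
Proof.
move=> nz nF; have [_ _ _ h _] := ca b nz; have [_ _ _ _ h'] := ca b (nice1J nz).
by rewrite /op h// h'// conjfK.
Qed.

Lemma op_bounded b z : nice1 z -> bounded_op ip (op b z).
Proof.
move=> nz; have [h _ _ _ _] := ca b nz; have [_ h' _ _ _] := ca b (nice1J nz).
by have := bop_lc hH 1 h h'; congr (bounded_op _ _); apply/funext => x; rewrite scale1r.
Qed.

Lemma op_adjoint b z : nice1 z -> is_adjoint ip (op b z) (op b (conjf z)).
Proof.
move=> nz x y; have [_ _ h _ _] := ca b nz; have [_ _ /(adjoint_sym hH) h' _ _] := ca b (nice1J nz).
by rewrite /op conjfK (ipDr hH) (ipDl hH) h h' addrC.
Qed.

Lemma emb_ext A B : bounded_op ip A -> bounded_op ip B ->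
  (forall n F, nalt n F -> A (emb n F) = B (emb n F)) -> forall x, A x = B x.
Proof.
move=> bA bB h; apply: (emb_total fm (K := [set x | A x = B x])) => //.
- split=> [|a x y /= hx hy]; first by rewrite /= (lin0 (bop_lin bA)) (lin0 (bop_lin bB)).
  by rewrite (bop_lin bA) (bop_lin bB) hx hy.
- move=> u x hu ux /=; have h1 := bop_tends bA ux; have h2 := bop_tends bB ux.
  have e : A \o u = B \o u by apply/funext => k; exact: hu.
  by rewrite e in h1; exact: (tends_unique hH h1 h2).
Qed.

Lemma emb_scale n a F G : nalt n G -> (forall t, size t = n -> F t = a * G t) ->
  emb n F = a *: emb n G.
Proof. by move=> nG h; rewrite -(embZ fm a nG); exact: (fm_eq fm). Qed.

(** Exchanging the two factors costs -1, which is offset by the twist (-1)^(n + 1) against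
    (-1)^n. *)
Lemma cr_comm z w x : nice1 z -> nice1 w -> cr false z (cr true w x) = cr true w (cr false z x).
Proof.
move=> nz nw; have [b1 _ _ h1 _] := ca false nz; have [b2 _ _ h2 _] := ca true nw.
apply: (emb_ext (A := cr false z \o cr true w) (B := cr true w \o cr false z)).
- exact: bop_comp.
- exact: bop_comp.
- move=> n F nF /=; have nWz := nalt_wedge nz nF.1; have nWw := nalt_wedge nw nF.1.
  rewrite (h2 _ _ nF) (h1 _ _ nF) (linZ (bop_lin b1)) (linZ (bop_lin b2)) (h1 _ _ nWw) (h2 _ _ nWz).
  rewrite (emb_scale (a := -1) (nalt_wedge nw nWz.1)) => [|t _]; last by rewrite wedge_wedge mulN1r.
  rewrite /sg exprS !scalerA ?mul1r ?mulr1; congr (_ *: _).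
  by rewrite mulrN1 mulN1r.
Qed.

Lemma an_comm z w x : nice1 z -> nice1 w -> an false z (an true w x) = an true w (an false z x).
Proof.
move=> nz nw; have [_ _ a1 _ _] := ca false nz; have [_ _ a2 _ _] := ca true nw.
have a1' := adjoint_sym hH a1; have a2' := adjoint_sym hH a2.
by apply: (ip_ext hH) => y; rewrite a1' a2' a2' a1' cr_comm.
Qed.

(** Neither mixed commutator vanishes alone. By [car] each one is, up to (-1)^n, the integral of z
    w, and the two cancel because this integral is symmetric in z and w. *)
Lemma cr_an_comm z w x : nice1 z -> nice1 w ->
  cr false z (an true (conjf w) x) + an false (conjf z) (cr true w x) =
  cr true w (an false (conjf z) x) + an true (conjf w) (cr false z x).
Proof.
move=> nz nw; have nz' := nice1J nz; have nw' := nice1J nw.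
have [b1 _ _ h1 _] := ca false nz; have [b2 _ _ h2 _] := ca true nw.
have [_ b3 _ _ h3] := ca false nz'; have [_ b4 _ _ h4] := ca true nw'.
rewrite conjfK in h3; rewrite conjfK in h4.
have sum A B A' B' : bounded_op ip A -> bounded_op ip B -> bounded_op ip A' -> bounded_op ip B' ->
    bounded_op ip (fun x => A (B x) + A' (B' x)).
  move=> hA hB hA' hB'; have := bop_lc hH 1 (bop_comp hA hB) (bop_comp hA' hB').
  by congr (bounded_op _ _); apply/funext => y; rewrite scale1r.
apply: (emb_ext (sum _ _ _ _ b1 b4 b3 b2) (sum _ _ _ _ b2 b3 b4 b1)).
move=> n F nF; have nWz := nalt_wedge nz nF.1; have nWw := nalt_wedge nw nF.1.
rewrite (h1 _ _ nF) (h2 _ _ nF) (h3 _ _ nF) (h4 _ _ nF).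
rewrite (linZ (bop_lin b1)) (linZ (bop_lin b2)) (linZ (bop_lin b3)) (linZ (bop_lin b4)).
rewrite (h3 _ _ nWw) (h4 _ _ nWz).
have cE : cint m1 (fun s : R => z s * w s) = cint m1 (fun s : R => w s * z s).
  by apply: eq_cint => y; rewrite mulrC.
case: n F nF nWz nWw => [|n] F nF nWz nWw.
  rewrite /sg /= ?expr0 ?(mulr0, scale0r, add0r, scale1r, mulr1, mul1r).
  apply: (fm_eq fm) => t st; have := car nw nz nF st; have := car nz nw nF st.
  by rewrite !mul1r !mul0r !addr0 cE => -> ->.
have nSz := nalt_sl nz nF; have nSw := nalt_sl nw nF.
rewrite (h1 _ _ nSw) (h2 _ _ nSz) /sg /= !scalerA !mul1r !mulr1 ?mul1r.
have nX1 := nalt_wedge nz nSw.1; have nY1 := nalt_wedge nw nSz.1.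
have nX2 := nalt_sl nz nWw; have nY2 := nalt_sl nw nWz.
(* By [car] both sides are the integral of z w times F. *)
have e : n.+2%:R *: emb n.+1 (sl z (wedge n.+1 w F)) + n.+1%:R *: emb n.+1 (wedge n w (sl z F)) =
    n.+2%:R *: emb n.+1 (sl w (wedge n.+1 z F)) + n.+1%:R *: emb n.+1 (wedge n z (sl w F)).
  have na c G : nalt n.+1 G -> nalt n.+1 (fun t => c * G t).
    by move=> nG; have := nalt_lc c nG (nalt0 R n.+1); under [X in nalt _ X]eq_fun do rewrite addr0.
  rewrite -(embZ fm n.+1%:R nY1) -(fm_lc fm n.+2%:R nX2 (na n.+1%:R _ nY1)).
  rewrite -(embZ fm n.+1%:R nX1) -(fm_lc fm n.+2%:R nY2 (na n.+1%:R _ nX1)).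
  apply: (fm_eq fm) => t st; have := car nw nz nF st; have := car nz nw nF st.
  by rewrite /= cE => <- <-.
have {}e : n.+2%:R *: emb n.+1 (sl z (wedge n.+1 w F)) =
    n.+2%:R *: emb n.+1 (sl w (wedge n.+1 z F)) + n.+1%:R *: emb n.+1 (wedge n z (sl w F)) -
    n.+1%:R *: emb n.+1 (wedge n w (sl z F)).
  by rewrite -e addrK.
rewrite exprS mulN1r.
have sE (c : C) X : (- (-1) ^+ n * c) *: X = - (-1) ^+ n *: (c *: X) by rewrite scalerA.
rewrite !sE e [(n.+1%:R * _) *: _](_ : _ = (-1) ^+ n *: (n.+1%:R *: emb n.+1 (wedge n w (sl z F)))); last first.
  by rewrite scalerA mulrC.
rewrite -[((-1) ^+ n * _) *: _]scalerA.
set s := (-1) ^+ n; set X1 := n.+1%:R *: _; set Y1 := n.+1%:R *: _; set Y2 := n.+2%:R *: _.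
hring hH.
Qed.

Lemma op_comm z w x : nice1 z -> nice1 w -> op false z (op true w x) = op true w (op false z x).
Proof.
move=> nz nw; have nz' := nice1J nz; have nw' := nice1J nw.
have [b1 _ _ _ _] := ca false nz; have [_ b2 _ _ _] := ca false nz'.
have [b3 _ _ _ _] := ca true nw; have [_ b4 _ _ _] := ca true nw'.
rewrite /op (linD (bop_lin b1)) (linD (bop_lin b2)) (linD (bop_lin b3)) (linD (bop_lin b4)).
rewrite cr_comm// an_comm// !addrA; congr (_ + _).
by rewrite -!addrA; congr (_ + _); exact: cr_an_comm.
Qed.

Lemma nalt_Om : nalt 0 (fun _ : seq R => 1 : C).
Proof. exact: (@wedges_nalt R [::] I). Qed.

Lemma op_Om b z : nice1 z -> op b z Om = emb 1 (wedge 0 z (fun=> 1)).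
Proof.
by move=> nz; rewrite /Om (op_emb _ nz nalt_Om) mulr0 scale0r addr0; case: b; rewrite /sg ?expr0 scale1r.
Qed.

Lemma emb_wedge b n z F : nice1 z -> nalt n F ->
  emb n.+1 (wedge n z F) = sg R b n *: op b z (emb n F) + (- (sg R b n * sg R b n.-1) * n%:R) *: emb n.-1 (sl z F).
Proof.
move=> nz nF; rewrite (op_emb _ nz nF) scalerDr !scalerA sg_sq scale1r -addrA mulrA -scalerDl.
by rewrite mulNr subrr scale0r addr0.
Qed.

(** A wedge is [op] applied to a wedge with one factor fewer, up to a vector of degree lower by two.
    The field is moved onto [y]; stability of [A] shows that the new vector satisfies the hypothesis
    on [y], so the induction applies to it. *)
Lemma words_total b (A : set H) y : A Om -> (forall z x, nice1 z -> A x -> A (op b z x)) ->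
  (forall x, A x -> ip x y = 0) -> y = 0.
Proof.
move=> A1 Aop Ay; apply: (fm_separating fm) => n F; apply: (fm_wedges fm) => zs <- {n F}.
have [n] := ubnP (size zs).
elim: n => // n IH in zs y Ay *; case: zs => [_ _|z zs /= zn [nz nzs]]; first exact: Ay.
have nv := wedges_nalt nzs; rewrite ltnS in zn.
rewrite (emb_wedge b nz nv) (ipDl hH) !(ipZl hH).
have -> : ip (op b z (emb (size zs) (wedges zs))) y = 0.
  have := op_adjoint b (nice1J nz) (emb (size zs) (wedges zs)) y; rewrite conjfK => <-.
  apply: IH => // x Ax; have := op_adjoint b (nice1J nz) x y; rewrite conjfK => ->.
  by apply: Ay; exact: Aop.
case: zs nzs nv zn => [|w zs] nzs nv zn; first by rewrite mulr0 mulr0 conjc0 mul0r addr0.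
have -> : ip (emb (size (w :: zs)).-1 (sl z (wedges (w :: zs)))) y = 0; last by rewrite !mulr0 addr0.
apply: (fm_wedges fm) => [zs' szs' nzs'|]; last exact: nalt_sl.
rewrite -szs'; apply: IH => //; rewrite szs'; exact: ltnW zn.
Qed.

Variable J : H -> H.
Hypothesis J_lc : forall a x y, J (a *: x + y) = a^*%C *: J x + J y.
Hypothesis J_ip : forall x y, ip (J x) (J y) = ip y x.
Hypothesis J_K : forall x, J (J x) = x.
Hypothesis J_emb : forall n F, nalt n F -> J (emb n F) = (-1) ^+ 'C(n, 2) *: emb n (conjf F).

Lemma J_Om : J Om = Om.
Proof.
rewrite /Om (J_emb nalt_Om) expr0 scale1r; apply: (fm_eq fm) => t _; exact: conjc1.
Qed.

Lemma J_D x y : J (x + y) = J x + J y.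
Proof. by have := J_lc 1 x y; rewrite conjc1 !scale1r. Qed.

Lemma J_0 : J 0 = 0.
Proof. by apply: (ip_ext hH) => y; rewrite -[y]J_K J_ip (ip0l hH) (ip0r hH). Qed.

Lemma J_Z a x : J (a *: x) = a^*%C *: J x.
Proof. by have := J_lc a x 0; rewrite J_0 !addr0. Qed.

Lemma conjf_wedge n z F t : conjf (wedge n z F) t = wedge n (conjf z) (conjf F) t.
Proof.
rewrite /wedge /asym /conjf conjcM; congr (_ * _); first by rewrite fmorphV; congr (_^-1); exact: conjc_nat.
elim/big_rec2: _ => [|s a b _ <-]; rewrite ?conjc0// conjcD conjcM conjc_sign; congr (_ * _ + _).
have E (u : seq R) : (ten z F u)^*%C = ten (conjf z) (conjf F) u.
  by case: u => [|x u]; [exact: conjc0 | exact: conjcM].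
exact: E.
Qed.

Lemma conjf_sl n z F t : nice1 z -> nalt n.+1 F -> size t = n ->
  conjf (sl z F) t = sl (conjf z) (conjf F) t.
Proof.
move=> nz nF st; rewrite /conjf /sl -cintJ; last exact: (sl_integrable nz nF.1.1 st).
by apply: eq_cint => x; rewrite conjcM.
Qed.

(** The signs match because C(n + 1, 2) = C(n, 2) + n, and (-1)^n is exactly the twist of
    [op true]. *)
Lemma J_op z x : nice1 z -> J (op false z x) = op true (conjf z) (J x).
Proof.
move=> nz; have nz' := nice1J nz; have [lB [M hM]] := op_bounded true nz'.
(* Both sides are now linear in x, as [emb_ext] requires. *)
rewrite -[RHS]J_K; congr J; move: x.
apply: (emb_ext (op_bounded false nz) (B := fun x => J (op true (conjf z) (J x)))).
  split=> [a x y|]; first by rewrite J_lc lB J_lc conjcK.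
  by exists M => x; have nJ y : nrm (J y) = nrm y by [rewrite /hnorm J_ip]; rewrite nJ -(nJ x).
move=> n F nF; have nF' := naltJ nF; rewrite (op_emb _ nz nF) (J_emb nF) (linZ lB) (op_emb _ nz' nF').
rewrite J_Z J_D !J_Z (J_emb (nalt_wedge nz' nF'.1)) /sg scale1r mul1r.
have s_conj k : ((-1) ^+ k : C)^*%C = (-1) ^+ k by rewrite -signr_odd conjc_sign.
rewrite !conjcM !s_conj conjc_nat scalerDr !scalerA; congr (_ + _).
  rewrite binS bin1 -exprD (sg_sq R true) scale1r.
  by apply: (fm_eq fm) => t _; rewrite conjf_wedge !conjfK.
case: n nF nF' => [|n] nF nF'; first by rewrite mulr0 !(mul0r, mulr0) !scale0r.
rewrite (J_emb (nalt_sl nz' nF')) scalerA /= binS bin1; congr (_ *: _).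
  have := sg_sq R true n; have := sg_sq R true 'C(n, 2); rewrite /sg exprD.
  move: (_ ^+ 'C(n, 2)) (_ ^+ n) => a s h1 h2.
  by rewrite mulrA -[a * s * s]mulrA h2 mulr1 mulrAC h1 mul1r.
apply: (fm_eq fm) => t st; by rewrite (conjf_sl nz' nF' st) !conjfK.
Qed.

Variable S : set (H -> H).
Hypothesis S_bounded : forall A, S A -> bounded_op ip A.
Hypothesis S_adjoint : forall A, S A -> exists2 A', S A' & is_adjoint ip A A'.
Hypothesis S_commute : forall A w x, S A -> nice1 w -> A (op true w x) = op true w (A x).
Hypothesis S_op : forall z, nice1 z -> S (op false z).

Local Notation N' := (commutant ip S).
Local Notation N := (commutant ip N').

Lemma commutant3 : commutant ip N = N'.
Proof.
apply/seteqP; split=> [A [bA hA]|A [bA hA]]; split=> // B.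
  move=> SB; apply: hA; split; first exact: S_bounded.
  by move=> D [_ hD]; exact/esym/hD.
by move=> [_ hB]; apply/esym/hB; split.
Qed.

Lemma N'_adjoint A : N' A -> exists2 A', N' A' & is_adjoint ip A A'.
Proof.
move=> cA; have [A' bA' AA'] := adjoint_exists hH (proj1 cA).
by exists A' => //; exact: (commutant_adjoint hH S_adjoint bA' AA' cA).
Qed.

Lemma N_adjoint A : N A -> exists2 A', N A' & is_adjoint ip A A'.
Proof.
move=> cA; have [A' bA' AA'] := adjoint_exists hH (proj1 cA).
by exists A' => //; exact: (commutant_adjoint hH N'_adjoint bA' AA' cA).
Qed.

Lemma N'_op w : nice1 w -> N' (op true w).
Proof.
by move=> nw; split=> [|A SA]; [exact: op_bounded | apply/funext => x /=; exact: S_commute].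
Qed.

Lemma N_op z : nice1 z -> N (op false z).
Proof.
by move=> nz; split=> [|A [_ hA]]; [exact: op_bounded | exact/esym/hA/S_op].
Qed.

Lemma N'_total y : (forall w : H -> H, N' w -> ip (w Om) y = 0) -> y = 0.
Proof.
move=> h; apply: (words_total (b := true) (A := [set w Om | w in (N' : set (H -> H))])).
- by exists id => //; exact: commutant_id.
- move=> z _ nz [w Nw <-]; exists (op true z \o w) => //.
  by apply: commutant_comp => //; exact: N'_op.
- by move=> _ [w Nw <-]; exact: h.
Qed.

(** For words a in the left fields, J (a Om) = a^* Om is checked letter by letter with [J_op].
    Testing J (w Om) against these total vectors a Om, with which w commutes as an operator, gives
    w^* Om. *)
Lemma J_N' (w w' : H -> H) : N' w -> N' w' -> is_adjoint ip w w' -> J (w Om) = w' Om.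
Proof.
move=> Nw Nw' ww'; apply/eqP; rewrite -subr_eq0; apply/eqP.
apply: (words_total (b := false) (A := [set a Om | a in [set a | exists2 a', is_adjoint ip a a' &
  (forall (v : H -> H) x, N' v -> a' (v x) = v (a' x)) /\ J (a Om) = a' Om]])).
- exists id => //; exists id => //; split=> //; exact: J_Om.
- move=> z _ nz [a [a' aa' [ca' Ja]] <-]; have nz' := nice1J nz.
  exists (op false z \o a) => //; exists (a' \o op false (conjf z)).
    by move=> x y /=; rewrite op_adjoint// aa'.
  split=> [v x Nv|/=]; first by rewrite /= (commutantE Nv (S_op nz')) ca'.
  rewrite J_op// Ja -ca'; last exact: N'_op.
  by congr a'; rewrite !op_Om.
- move=> _ [a [a' aa' [ca' Ja]] <-]; rewrite (ipBr hH); apply/eqP; rewrite subr_eq0; apply/eqP.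
  rewrite -{1}[a Om]J_K J_ip Ja -(adjoint_sym hH ww') -ca'// (adjoint_sym hH aa').
  by [].
Qed.

(** The roles are exchanged: J (u Om) is tested against the total vectors w Om, for which [J_N'] is
    known. *)
Lemma J_N (u u' : H -> H) : N u -> N u' -> is_adjoint ip u u' -> J (u Om) = u' Om.
Proof.
move=> Nu Nu' uu'; apply/eqP; rewrite -subr_eq0; apply/eqP/N'_total => w Nw.
have [w' Nw' ww'] := N'_adjoint Nw.
rewrite (ipBr hH); apply/eqP; rewrite subr_eq0; apply/eqP.
rewrite -{1}[w Om]J_K J_ip (J_N' Nw Nw' ww') -(adjoint_sym hH uu') -(commutantE Nu' Nw').
by rewrite (adjoint_sym hH ww').
Qed.

Lemma clifford_standard_form : standard_form ip N N' Om J.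
Proof.
split=> //.
- exact: commutant3.
- exact: N_adjoint.
- exact: N'_adjoint.
- exact: N'_total.
- pose A : set H := [set u Om | u in (N : set (H -> H))].
  suff dA t (e : R) : 0 < e -> exists2 a, A a & nrm (a - t) < e.
    by move=> x e /(dA x)[_ [u Nu <-] h]; exists u.
  have N'b B : N' B -> bounded_op ip B by case.
  have A1 : A Om by exists id => //; exact: commutant_id.
  have Al a x y : A x -> A y -> A (a *: x + y).
    move=> [u Nu <-] [u' Nu' <-]; exists (fun x => a *: u x + u' x) => //.
    exact: commutant_lc.
  apply: (separating_dense hH) => // [|y h].
    by have := Al (-1) _ _ A1 A1; rewrite scaleN1r addNr.
  apply: (words_total (b := false) A1) h => z _ nz [u Nu <-].
  by exists (op false z \o u) => //; apply: commutant_comp => //; exact: N_op.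
(* <Om, a b Om> = <J a Om, b Om> = <J b Om, a Om> = <Om, b a Om>. *)
- move=> a b Na Nb; have [a' Na' aa'] := N_adjoint Na; have [b' Nb' bb'] := N_adjoint Nb.
  rewrite (aa' Om) (bb' Om) -(J_N Na Na' aa') -(J_N Nb Nb' bb').
  by rewrite -[b Om in LHS]J_K J_ip.
- by move=> w w' x Nw Nw' ww'; rewrite -(J_N' Nw Nw' ww') J_ip.
Qed.

End clifford_standard_form.

Section contraction_of_nice.
Variable R : realType.
Local Notation C := R[i].
Local Notation mu n := (muplus R n).
Implicit Types (F G : seq R -> C).

Lemma nice_contr a b r F G : nice (a + r) F -> nice (r + b) G -> nice (a + b) (contr a r F G).
Proof.
move=> [[mF [M hM]] [K hK]] [[mG [M' hM']] [K' hK']].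
have sE (t : (a + b).-tuple R) (u : r.-tuple R) : exists (s1 : (a + r).-tuple R) (s2 : (r + b).-tuple R),
    tval s1 = take a t ++ rev u /\ tval s2 = u ++ drop a t.
  have h1 : size (take a t ++ rev u) == (a + r)%N.
    by rewrite size_cat size_rev !size_takel ?size_tuple// leq_addr.
  have h2 : size (u ++ drop a t) == (r + b)%N.
    by rewrite size_cat size_drop !size_tuple addKn.
  by exists (Tuple h1), (Tuple h2).
have supp (t : (a + b).-tuple R) : contr a r F G t <> 0 ->
    exists u : r.-tuple R, F (take a t ++ rev u) <> 0 /\ G (u ++ drop a t) <> 0.
  apply: contra_notP => /forallNP h; rewrite /contr -[RHS](cint0 (mu r)).
  apply: eq_cint => u; have := h u.
  have [->|F0] := eqVneq (F (take a t ++ rev u)) 0; first by rewrite mul0r.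
  have [->|G0] := eqVneq (G (u ++ drop a t)) 0; first by rewrite mulr0.
  by case; split; exact/eqP.
split; last first.
  exists (Num.max K K') => t /supp[u [Fu Gu]] y; rewrite -(cat_take_drop a t) mem_cat le_max.
  have [s1 [s2 [e1 e2]]] := sE t u; rewrite -e1 in Fu; rewrite -e2 in Gu.
  case/orP => yt; apply/orP; [left|right].
    by apply: (hK _ Fu); rewrite e1 mem_cat yt.
  by apply: (hK' _ Gu); rewrite e2 mem_cat yt orbT.
split; first exact: contr_meas.
pose B := @box R r (fun=> [set x | `|x| <= K']).
exists (M * M' * fine (mu r B) * fine (mu r B)) => t; apply: cint_finite_support.
- by apply: cmeasM; have [] := sections_meas mF mG (size_tuple t).
- move=> u; have [s1 [s2 [e1 e2]]] := sE t u; rewrite -e1 -e2 normsqM.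
  by apply: ler_pM; rewrite ?normsq_ge0.
- by apply: measurable_box => _; exact: measurable_tuple_cst.
- by apply: finite_box => _; exact: bounded_set1_ball.
- move=> u FG i; have [s1 [s2 [e1 e2]]] := sE t u; rewrite -e2 in FG.
  apply: (hK' s2) => [G0|]; first by apply: FG; rewrite G0 mulr0.
  by rewrite e2 mem_cat mem_tnth.
Qed.

Lemma nalt_acontr n a b r F G : n = (a + b)%N -> nice (a + r) F -> nice (r + b) G ->
  nalt n (acontr n a r F G).
Proof.
by move=> -> nF nG; split; [apply: nice_asym; exact: nice_contr | exact: asym_alt].
Qed.

End contraction_of_nice.

(** * The product formula *)

Section product_expansion.
Variable R : realType.
Local Notation C := R[i].
Variables (H : lmodType C) (ip : H -> H -> C) (emb : nat -> (seq R -> C) -> H).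
Hypothesis fm : fock_model ip emb.
Implicit Types (F G v : seq R -> C) (z : R -> C).

(* Phi p q F G is the right-hand side of the product formula, as a vector *)
Definition coef p q r : C := (r`! * 'C(p, r) * 'C(q, r))%N%:R.

Lemma coefC p q r : coef p q r = coef q p r.
Proof. by rewrite /coef mulnAC. Qed.

Lemma coef0 p q r : (minn p q < r)%N -> coef p q r = 0.
Proof.
by rewrite /coef gtn_min => /orP[h|h]; rewrite (bin_small h) ?muln0// mul0n.
Qed.

Lemma coef_down p q r : (r <= q.+1)%N ->
  coef p q.+1 r * ((q.+1%:R - r%:R) / q.+1%:R) = coef p q r.
Proof.
move=> rq; rewrite mulrA -natrB// -natrM -mulnA [('C(q.+1, r) * _)%N]mulnC -mul_bin_down /=.
by rewrite mulnCA natrM mulrC mulKf ?pnatr_eq0.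
Qed.

(** Weight of the terms in which the new factor is contracted: one contraction is spent, and one of
    the p variables of the left factor is chosen for it. *)
Lemma coef_diag p q r : coef p q.+1 r.+1 * (r.+1%:R / q.+1%:R) = p%:R * coef p.-1 q r.
Proof.
rewrite mulrA -!natrM; apply/eqP; rewrite -(inj_eq (mulIf (_ : q.+1%:R != 0 :> C))) ?pnatr_eq0//.
rewrite divfK ?pnatr_eq0// -natrM; apply/eqP; congr (_%:R).
rewrite factS; have h1 := mul_bin_diag p r; have h2 := mul_bin_diag q.+1 r; rewrite /= in h2.
rewrite -mulnA [('C(q.+1, r.+1) * _)%N]mulnC -h2 [(r.+1 * _)%N]mulnC -!mulnA [(r.+1 * _)%N]mulnA -h1; lia.
Qed.

(** The coefficients vanish beyond [minn p q], so sums for different degrees can be compared over a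
    common range. *)
Lemma sum_coef p q B (V : nat -> H) : (minn p q < B)%N ->
  \sum_(r < (minn p q).+1) coef p q r *: V r = \sum_(0 <= r < B) coef p q r *: V r.
Proof.
move=> pB; rewrite (big_ord_widen _ (fun r => coef p q r *: V r) pB) big_mkcond /= big_mkord.
by apply: eq_bigr => r _; case: ifP => // /negbT; rewrite -leqNgt => h; rewrite coef0// scale0r.
Qed.

Definition Phi p q F G : H :=
  \sum_(r < (minn p q).+1) coef p q r *: emb (p + q - r.*2) (acontr (p + q - r.*2) (p - r) r F G).

(** The part of the product in which [z] stays free. It occurs with the same sign in [Phi_wedge_r]
    and [Phi_wedge_l] and cancels in [Phi_step]. *)
Definition wPhi p q z F G : H :=
  \sum_(r < (minn p q).+1) coef p q r *:
    emb (p + q - r.*2).+1 (wedge (p + q - r.*2) z (acontr (p + q - r.*2) (p - r) r F G)).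

(** The alternatives with a zero coefficient cover the boundary values of r, where a truncated
    degree makes the function meaningless. *)
Lemma emb_lc0 n a b F G : (a = 0 \/ nalt n F) -> (b = 0 \/ nalt n G) ->
  emb n (fun t => a * F t + b * G t) = a *: emb n F + b *: emb n G.
Proof.
move=> [->|nF] [->|nG].
- rewrite !scale0r addr0 -(emb0 fm n); apply: (fm_eq fm) => t _; rewrite !mul0r addr0//.
- rewrite scale0r add0r -(embZ fm b nG); apply: (fm_eq fm) => t _; rewrite mul0r add0r//.
- rewrite scale0r addr0 -(embZ fm a nF); apply: (fm_eq fm) => t _; rewrite mul0r addr0//.
- rewrite -(embZ fm b nG) -(fm_lc fm)//.
  by have := nalt_lc b nG (nalt0 R n); under [X in nalt _ X]eq_fun do rewrite addr0.
Qed.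

(** [acontr_wedge_r] for vectors; trading [slr] for [sl] costs (-1)^(p - 1). *)
Lemma emb_acontr_wedge_r n a b p q r z F v : n = (a + b)%N -> p = (a + r)%N -> q.+1 = (r + b)%N ->
  nice1 z -> nalt p F -> nalt q v ->
  emb n (acontr n a r F (wedge q z v)) =
  (r%:R / q.+1%:R * (-1) ^+ p.-1) *: emb n (acontr n a r.-1 (sl z F) v) +
  ((q.+1%:R - r%:R) / q.+1%:R * (-1) ^+ p) *: emb n (wedge n.-1 z (acontr n.-1 a r F v)).
Proof.
move=> nE pE qE nz nF nv; have q0 : q.+1%:R != 0 :> C by rewrite pnatr_eq0.
have Q (x y : C) : q.+1%:R * (x * (q.+1%:R^-1 * y)) = x * y by rewrite mulrCA mulVKf.
have nF' : nalt (a + r) F by rewrite -pE.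
rewrite -emb_lc0; first apply: (fm_eq fm) => t _.
- apply: (mulfI q0); rewrite (acontr_wedge_r t nE qE nz nF' nv) mulrDr -!mulrA !Q addnC -pE.
  congr (_ + _); case: r pE {qE nF'} nv nF {Q q0} (qE) => [|r] pE nv nF qE; first by rewrite !mul0r.
  have pE' : p.-1 = (a + r)%N by rewrite pE addnS.
  have qE' : q = (r + b)%N by case: qE.
  have nF2 : nalt (a + r).+1 F by rewrite -addnS -pE.
  have nv' : nice (r + b) v by rewrite -qE'; case: nv.
  have e := acontrZl ((-1) ^+ (a + r)) t nE (nice_sl nz nF2.1) nv'.
  rewrite pE' /= -[in RHS]e; congr (_ * _).
  apply: (eq_acontr nE) => // s ss; exact: (slr_sl nF2.2 nz nF2.1).
- case: r pE qE nF' => [|r] pE qE nF'; first by left; rewrite !mul0r.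
  have nF2 : nalt (a + r).+1 F by rewrite -addnS.
  right; apply: (nalt_acontr nE); first exact: (nice_sl nz nF2.1).
  by rewrite (_ : r + b = q)%N; [case: nv | case: qE].
- case: b nE qE => [|b] nE qE; first by left; rewrite qE addn0 subrr !mul0r.
  right; rewrite nE addnS /=; apply: nalt_wedge => //; apply: (proj1 (nalt_acontr erefl nF'.1 _)).
  by move: qE; rewrite addnS => -[<-]; case: nv.
Qed.

Lemma emb_acontr_wedge_l n a b p q r z F v : n = (a + b)%N -> p.+1 = (a + r)%N -> q = (r + b)%N ->
  nice1 z -> nalt p F -> nalt q v ->
  (-1) ^+ p *: emb n (acontr n a r (wedge p z F) v) =
  (r%:R / p.+1%:R) *: emb n (acontr n a r.-1 F (sl z v)) +
  ((p.+1%:R - r%:R) / p.+1%:R * (-1) ^+ p) *: emb n (wedge n.-1 z (acontr n.-1 a.-1 r F v)).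
Proof.
move=> nE pE qE nz nF nv; have p0 : p.+1%:R != 0 :> C by rewrite pnatr_eq0.
have Q (x y : C) : p.+1%:R * (x * (p.+1%:R^-1 * y)) = x * y by rewrite mulrCA mulVKf.
have nv' : nalt (r + b) v by rewrite -qE.
have nW : nice (a + r) (wedge p z F) by rewrite -pE; case: (nalt_wedge nz nF.1).
rewrite -(embZ fm _ (nalt_acontr nE nW nv'.1)) -emb_lc0; first apply: (fm_eq fm) => t _.
- apply: (mulfI p0); rewrite (acontr_wedge_l t nE pE nz nF nv') mulrDr -!mulrA !Q; congr (_ + _).
  case: a pE {nE nW} => [|a] pE; first by rewrite pE add0n subrr !mul0r.
  by rewrite /= addnC (_ : a + r = p)%N//; case: pE.
- case: r pE qE {nv' nW} => [|r] pE qE; first by left; rewrite !mul0r.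
  have nv2 : nalt (r + b).+1 v by rewrite -addSn -qE.
  right; apply: (nalt_acontr nE); last exact: (nice_sl nz nv2.1).
  by rewrite (_ : a + r = p)%N; [case: nF | move: pE; rewrite addnS => -[]].
- case: a nE pE {nW} => [|a] nE pE; first by left; rewrite pE add0n subrr !mul0r.
  right; rewrite nE addSn /=; apply: nalt_wedge => //; apply: (proj1 (nalt_acontr erefl _ nv'.1)).
  by move: pE => -[<-]; case: nF.
Qed.

(** The case distinction on r is a shift of the summation index: the contracted part of the term r +
    1 is the term r of the product in degrees p - 1 and q. *)
Lemma Phi_term_r p q r z F v : nice1 z -> nalt p F -> nalt q v ->
  coef p q.+1 r *: emb (p + q.+1 - r.*2) (acontr (p + q.+1 - r.*2) (p - r) r F (wedge q z v)) =
  (if r is r'.+1 then ((-1) ^+ p.-1 * p%:R) *: (coef p.-1 q r' *: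
     emb (p.-1 + q - r'.*2) (acontr (p.-1 + q - r'.*2) (p.-1 - r') r' (sl z F) v)) else 0) +
  (-1) ^+ p *: (coef p q r *:
     emb (p + q - r.*2).+1 (wedge (p + q - r.*2) z (acontr (p + q - r.*2) (p - r) r F v))).
Proof.
move=> nz nF nv; have [rm|rm] := leqP r (minn p q.+1); last first.
  rewrite coef0// scale0r coef0 ?scale0r ?scaler0 ?addr0; last first.
    by apply: leq_trans rm; rewrite ltnS leq_min geq_minl (leq_trans (geq_minr _ _)).
  case: r rm => // r rm; case: p {nF} rm => [|p] rm; first by rewrite mulr0 scale0r.
  by rewrite coef0 ?scale0r ?scaler0//; move: rm; rewrite minnSS ltnS.
move: rm; rewrite leq_min => /andP[rp rq].
rewrite (emb_acontr_wedge_r (b := q.+1 - r) _ _ _ nz nF nv); [|by rewrite -?addnn; lia..].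
rewrite scalerDr !scalerA; congr (_ + _); last first.
  rewrite mulrA coef_down// [coef p q r * _]mulrC.
  have [rq'|rq'] := leqP r q; last by rewrite coef0 ?mulr0 ?mul0r ?scale0r// gtn_min rq' orbT.
  by rewrite (_ : (p + q.+1 - r.*2 = (p + q - r.*2).+1)%N)//; rewrite -addnn; lia.
case: r rp rq => [|r] rp rq; first by rewrite !mul0r mulr0 scale0r.
rewrite mulrA coef_diag; case: p nF rp => // p nF rp /=.
rewrite subSS (_ : (p.+1 + q.+1 - r.+1.*2 = p + q - r.*2)%N); last by rewrite -addnn; lia.
by rewrite scalerA; congr (_ *: _); rewrite mulrC mulrA.
Qed.

Lemma Phi_term_l p q r z F v : nice1 z -> nalt p F -> nalt q v ->
  (-1) ^+ p *: (coef p.+1 q r *: emb (p.+1 + q - r.*2) (acontr (p.+1 + q - r.*2) (p.+1 - r) r (wedge p z F) v)) =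
  (if r is r'.+1 then q%:R *: (coef p q.-1 r' *:
     emb (p + q.-1 - r'.*2) (acontr (p + q.-1 - r'.*2) (p - r') r' F (sl z v))) else 0) +
  (-1) ^+ p *: (coef p q r *:
     emb (p + q - r.*2).+1 (wedge (p + q - r.*2) z (acontr (p + q - r.*2) (p - r) r F v))).
Proof.
move=> nz nF nv; have [rm|rm] := leqP r (minn p.+1 q); last first.
  rewrite coef0// scale0r scaler0 coef0 ?scale0r ?scaler0 ?addr0; last first.
    by apply: leq_trans rm; rewrite ltnS leq_min geq_minr (leq_trans (geq_minl _ _)).
  case: r rm => // r rm; case: q {nv} rm => [|q] rm; first by rewrite scale0r.
  by rewrite coef0 ?scale0r ?scaler0//; move: rm; rewrite minnSS ltnS.
move: rm; rewrite leq_min => /andP[rp rq].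
rewrite scalerA mulrC -scalerA.
rewrite (emb_acontr_wedge_l (b := q - r) _ _ _ nz nF nv); [|by rewrite -?addnn; lia..].
rewrite scalerDr !scalerA; congr (_ + _); last first.
  rewrite mulrA coefC coef_down// [coef q p r]coefC [coef p q r * _]mulrC.
  have [rp'|rp'] := leqP r p; last by rewrite coef0 ?mulr0 ?mul0r ?scale0r// gtn_min rp'.
  rewrite (_ : (p.+1 + q - r.*2 = (p + q - r.*2).+1)%N); last by rewrite -addnn; lia.
  by rewrite (_ : (p.+1 - r).-1 = p - r)%N//; lia.
case: r rp rq => [|r] rp rq; first by rewrite !mul0r mulr0 scale0r.
rewrite coefC coef_diag; case: q nv rq => // q nv rq /=; rewrite [coef q p r]coefC.
by rewrite subSS scalerA (_ : (p.+1 + q.+1 - r.+1.*2 = p + q - r.*2)%N)//; rewrite -addnn; lia.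
Qed.

Lemma PhiE p q B F G : (minn p q < B)%N -> Phi p q F G =
  \sum_(0 <= r < B) coef p q r *: emb (p + q - r.*2) (acontr (p + q - r.*2) (p - r) r F G).
Proof. exact: (sum_coef (fun r => emb (p + q - r.*2) (acontr (p + q - r.*2) (p - r) r F G))). Qed.

Lemma wPhiE p q B z F G : (minn p q < B)%N -> wPhi p q z F G = \sum_(0 <= r < B) coef p q r *:
  emb (p + q - r.*2).+1 (wedge (p + q - r.*2) z (acontr (p + q - r.*2) (p - r) r F G)).
Proof.
exact: (sum_coef (fun r => emb (p + q - r.*2).+1
  (wedge (p + q - r.*2) z (acontr (p + q - r.*2) (p - r) r F G)))).
Qed.

Lemma Phi_wedge_r p q z F v : nice1 z -> nalt p F -> nalt q v ->
  Phi p q.+1 F (wedge q z v) =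
  ((-1) ^+ p.-1 * p%:R) *: Phi p.-1 q (sl z F) v + (-1) ^+ p *: wPhi p q z F v.
Proof.
move=> nz nF nv; have B1 : (minn p q.+1 < (p + q).+3)%N by lia.
have B2 : (minn p.-1 q < (p + q).+2)%N by lia.
have B3 : (minn p q < (p + q).+3)%N by lia.
rewrite (PhiE _ _ B1) (PhiE _ _ B2) (wPhiE _ _ _ B3) !scaler_sumr.
rewrite (eq_bigr _ (fun r _ => Phi_term_r r nz nF nv)) big_split /=; congr (_ + _).
by rewrite big_nat_recl// add0r.
Qed.

Lemma Phi_wedge_l p q z F v : nice1 z -> nalt p F -> nalt q v ->
  (-1) ^+ p *: Phi p.+1 q (wedge p z F) v =
  q%:R *: Phi p q.-1 F (sl z v) + (-1) ^+ p *: wPhi p q z F v.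
Proof.
move=> nz nF nv; have B1 : (minn p.+1 q < (p + q).+3)%N by lia.
have B2 : (minn p q.-1 < (p + q).+2)%N by lia.
have B3 : (minn p q < (p + q).+3)%N by lia.
rewrite (PhiE _ _ B1) (PhiE _ _ B2) (wPhiE _ _ _ B3) !scaler_sumr.
rewrite (eq_bigr _ (fun r _ => Phi_term_l r nz nF nv)) big_split /=; congr (_ + _).
by rewrite big_nat_recl// add0r.
Qed.

End product_expansion.

(** * The expansion is a value of left multiplication *)

Section product_formula.
Variable R : realType.
Local Notation C := R[i].
Variables (H : lmodType C) (ip : H -> H -> C) (emb : nat -> (seq R -> C) -> H).
Hypothesis fm : fock_model ip emb.
Variables cr an : bool -> (R -> C) -> H -> H.
Hypothesis ca : creation_family ip emb cr an.
Variables (N N' : set (H -> H)) (J : H -> H).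
Local Notation Om := (Om emb).
Local Notation op := (op cr an).
Local Notation Phi := (Phi emb).
Hypothesis hN : standard_form ip N N' Om J.
Hypothesis J_lc : forall a x y, J (a *: x + y) = a^*%C *: J x + J y.
Hypothesis J_ip : forall x y, ip (J x) (J y) = ip y x.
Hypothesis J_emb : forall n F, nalt n F -> J (emb n F) = (-1) ^+ 'C(n, 2) *: emb n (conjf F).
Hypothesis N'_op : forall w z x, N' w -> nice1 z -> w (op false z x) = op false z (w x).
(** A bounded extension of [Phi] to all vectors; [prod_op] is the instance. *)
Variable P : nat -> nat -> H -> H -> H.
Hypothesis P_emb : forall p q F G, nalt p F -> nalt q G -> P p q (emb p F) (emb q G) = Phi p q F G.
Hypothesis P_bounded_l : forall p q y, bounded_op ip (P p q ^~ y).
Hypothesis P_bounded_r : forall p q x, bounded_op ip (P p q x).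
Implicit Types (F G v : seq R -> C) (z : R -> C) (x y : H).

Let hH := fm_hilbert fm.
Let J_K := sf_JK hN.

Lemma Phi_unit p F : nalt p F -> Phi p 0 F (fun=> 1) = emb p F.
Proof.
move=> [_ aF]; rewrite /Phi minn0 big_ord1 /coef !bin0 !muln1 scale1r addn0 !subn0.
apply: (fm_eq fm) => t st; rewrite -[RHS](alt_asym aF)//.
by apply: eq_asym => s ss; rewrite contr0 mulr1 take_oversize ?ss.
Qed.

Lemma J_op_true z x : nice1 z -> J (op true z x) = op false (conjf z) (J x).
Proof.
move=> nz; have := J_op fm ca J_lc J_ip J_K J_emb (J x) (nice1J nz).
by rewrite conjfK J_K => <-; rewrite J_K.
Qed.

(* the identity x (Psi(z) y) = (x Psi(z)) y for x in degree p and y in degree q *)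
Lemma Phi_step p q z F v : nice1 z -> nalt p F -> nalt q v ->
  Phi p q.+1 F (wedge q z v) = ((-1) ^+ p.-1 * p%:R) *: Phi p.-1 q (sl z F) v +
    ((-1) ^+ p *: Phi p.+1 q (wedge p z F) v - q%:R *: Phi p q.-1 F (sl z v)).
Proof.
move=> nz nF nv; rewrite (Phi_wedge_r fm nz nF nv) (Phi_wedge_l fm nz nF nv).
by rewrite [X in X - _]addrC addrK.
Qed.

Lemma conjc_signn n : ((-1) ^+ n : C)^*%C = (-1) ^+ n.
Proof. exact: (sg_conj R true). Qed.

Section commuting_operator.
Variable w : H -> H.
Hypothesis Nw : N' w.

Let bw : bounded_op ip w.
Proof. by move: Nw; rewrite -(sf_N' hN) => -[]. Qed.

(** For all w in the commutant, this says that the pair of [emb q v] and [Phi p q F v] lies in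
    [left_mul] of [emb p F]. *)
Let claim q : Prop := forall p F v, nalt p F -> nalt q v ->
  ip (Phi p q F v) (w Om) = ip (emb q v) (w (J (emb p F))).

(** Taking the adjoint of [P] makes both sides inner products with [emb q v], and wedges are total
    in degree q. *)
Lemma Phi_of_wedges q : (forall p F zs, size zs = q -> nalt p F -> all_nice1 zs ->
  ip (Phi p q F (wedges zs)) (w Om) = ip (emb q (wedges zs)) (w (J (emb p F)))) -> claim q.
Proof.
move=> h p F v nF nv; rewrite -(P_emb nF nv).
have [A _ PA] := adjoint_exists hH (P_bounded_r p q (emb p F)).
have PA' x y : ip (P p q (emb p F) x) y = ip x (A y) by rewrite (adjoint_sym hH PA).
rewrite PA'; apply/eqP; rewrite -subr_eq0 -(ipBr hH); apply/eqP.
apply: (fm_wedges fm) nv => zs szs nzs; have nz := wedges_nalt nzs; rewrite szs in nz.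
rewrite (ipBr hH) -PA' (P_emb nF nz); apply/eqP; rewrite subr_eq0; apply/eqP; exact: h.
Qed.

(** [w] commutes with [op false], and J turns [op true z] into [op false (conjf z)]; so a field in
    front of the second argument becomes a field behind the first one. [Phi_step] is the same
    exchange for [Phi]. *)
Lemma Phi_commute_step p q z F v : nice1 z -> nalt p F -> nalt q v ->
  claim q -> ((0 < q)%N -> claim q.-1) ->
  ip (Phi p q.+1 F (wedge q z v)) (w Om) = ip (emb q.+1 (wedge q z v)) (w (J (emb p F))).
Proof.
move=> nz nF nv cq cq'; have nz' := nice1J nz.
have lw := bop_lin bw.
have e1 : ip (op false z (emb q v)) (w (J (emb p F))) = ip (emb q v) (w (J (op true z (emb p F)))).
  rewrite (J_op_true _ nz) (N'_op _ Nw nz') (op_adjoint fm ca false nz') conjfK.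
  by [].
have e2 : ip (emb q v) (w (J (op true z (emb p F)))) =
    (-1) ^+ p * ip (Phi p.+1 q (wedge p z F) v) (w Om) +
    ((-1) ^+ p.-1 * p%:R) * ip (Phi p.-1 q (sl z F) v) (w Om).
  have J0 : J 0 = 0 by apply: (ip_ext hH) => y; rewrite -[y]J_K J_ip (ip0l hH) (ip0r hH).
  have JZ a x : J (a *: x) = a^*%C *: J x by have := J_lc a x 0; rewrite J0 !addr0.
  rewrite (op_emb ca _ nz nF) J_lc JZ lw (linZ lw) (ipDr hH) !(ipZr hH) /sg.
  rewrite conjcM !conjc_signn conjc_nat (cq _ _ _ (nalt_wedge nz nF.1) nv); congr (_ + _).
  case: p F nF {e1} => [|p] F nF; first by rewrite mulr0 !mul0r.
  by rewrite (cq _ _ _ (nalt_sl nz nF) nv).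
have e3 : ip (emb q.+1 (wedge q z v)) (w (J (emb p F))) =
    ip (op false z (emb q v)) (w (J (emb p F))) - q%:R * ip (emb q.-1 (sl z v)) (w (J (emb p F))).
  by rewrite (op_emb ca _ nz nv) /sg scale1r mul1r (ipDl hH) (ipZl hH) conjc_nat addrK.
rewrite e3 e1 e2 (Phi_step nz nF nv) !(ipDl hH) (ipNl hH) !(ipZl hH) conjcM !conjc_signn !conjc_nat.
have -> : q%:R * ip (Phi p q.-1 F (sl z v)) (w Om) = q%:R * ip (emb q.-1 (sl z v)) (w (J (emb p F))).
  case: q nv {cq e1 e2 e3} cq' => [|q] nv cq'; first by rewrite !mul0r.
  by rewrite (cq' isT _ _ _ nF (nalt_sl nz nv)).
by rewrite addrCA addrA.
Qed.

(** The step descends from q + 1 to q and q - 1, hence strong induction. For q = 0 the second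
    argument is the vacuum and the relation is [sf_J]. *)
Lemma Phi_commute q : claim q.
Proof.
elim/ltn_ind: q => q IH; apply: Phi_of_wedges => p F zs szs nF nzs.
have [w' Nw' ww'] := sf_adjN' hN Nw.
case: zs q szs nzs IH => [|z zs] q <- /=.
  move=> _ _; rewrite (Phi_unit nF) (ww' (emb 0 (fun=> 1))) (sf_J hN _ Nw' Nw (adjoint_sym hH ww')).
  by rewrite J_K.
move=> [nz nzs] IH; have nv := wedges_nalt nzs.
apply: Phi_commute_step => // [|s0]; apply: IH => //.
by rewrite ltnS leq_pred.
Qed.

(** Membership in the closed span of the vectors [emb n F], expressed by double orthogonality. *)
Definition in_degree n x : Prop := forall u, (forall F, nalt n F -> ip (emb n F) u = 0) -> ip x u = 0.

(** With the adjoints of [P] and [w] the identity becomes an equality of inner products with y and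
    then with x, so it extends from [nice] functions one argument at a time. *)
Lemma product_commute p q x y : in_degree p x -> in_degree q y ->
  ip (P p q x y) (w Om) = ip y (w (J x)).
Proof.
move=> px qy; have [w' _ ww'] := sf_adjN' hN Nw.
have key F : nalt p F -> ip (P p q (emb p F) y) (w Om) = ip y (w (J (emb p F))).
  move=> nF; have [A _ PA] := adjoint_exists hH (P_bounded_r p q (emb p F)).
  have PA' s t : ip (P p q (emb p F) s) t = ip s (A t) by rewrite (adjoint_sym hH PA).
  apply/eqP; rewrite PA' -subr_eq0 -(ipBr hH); apply/eqP/qy => G nG.
  by rewrite (ipBr hH) -PA' (P_emb nF nG) Phi_commute// subrr.
have [A _ PA] := adjoint_exists hH (P_bounded_l p q y).
have PA' s t : ip (P p q s y) t = ip s (A t) by rewrite -(adjoint_sym hH PA).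
have wJ s : ip y (w (J s)) = ip s (J (w' y)) by rewrite ww' -{1}[w' y]J_K J_ip.
apply/eqP; rewrite PA' wJ -subr_eq0 -(ipBr hH); apply/eqP/px => F nF.
by rewrite (ipBr hH) -PA' -wJ key// subrr.
Qed.

End commuting_operator.

Lemma product_left_mul p q x y : in_degree p x -> in_degree q y -> left_mul ip N' Om J x (y, P p q x y).
Proof. by move=> px qy w Nw /=; exact: product_commute. Qed.

End product_formula.

(** * Field operators of arbitrary square-integrable functions *)

Section field_operators.
Variable R : realType.
Local Notation C := R[i].
Variables (H : lmodType C) (ip : H -> H -> C) (emb : nat -> (seq R -> C) -> H).
Hypothesis fm : fock_model ip emb.
Variables cr an : bool -> (R -> C) -> H -> H.
Hypothesis ca : creation_family ip emb cr an.
Variable J : H -> H.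
Hypothesis J_ip : forall x y, ip (J x) (J y) = ip y x.
Hypothesis J_K : forall x, J (J x) = x.
Variables (Z : Type) (L : Z -> Prop) (conjZ : Z -> Z) (one : (R -> C) -> Z) (E : Z -> H).
Variable cre : Z -> (H -> H) -> Prop.
Hypothesis L_one : forall z, nice1 z -> L (one z).
Hypothesis L_conj : forall z, L z -> L (conjZ z).
Hypothesis one_conj : forall z, conjZ (one z) = one (conjf z).
Hypothesis E_conj : forall z, L z -> E (conjZ z) = J (E z).
Hypothesis E_total : forall u, (forall z, nice1 z -> ip u (E (one z)) = 0) -> forall z, L z -> ip u (E z) = 0.
Hypothesis cre_bounded : forall z B, cre z B -> bounded_op ip B.
Hypothesis cre_linear : forall n F, nalt n F -> exists2 T, bounded_op ip T &
  forall z B, L z -> cre z B -> B (emb n F) = T (E z).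
Hypothesis cre_exists : forall z, nice1 z -> cre (one z) (cr false z).
Local Notation op := (op cr an).
Implicit Types (F G : seq R -> C) (x y g : H).

Let hH := fm_hilbert fm.

Definition fieldop z B : Prop := exists B1 B2 B2', [/\ cre z B1, cre (conjZ z) B2,
  bounded_op ip B2', is_adjoint ip B2 B2' & B = (fun x => B1 x + B2' x)].

Lemma fieldop_one z : nice1 z -> fieldop (one z) (op false z).
Proof.
move=> nz; have nz' := nice1J nz; have [_ b _ _ _] := ca false nz'; have [_ _ a _ _] := ca false nz'.
exists (cr false z), (cr false (conjf z)), (an false (conjf z)); split=> //; first exact: cre_exists.
by rewrite one_conj; exact: cre_exists.
Qed.

(** The matrix coefficients of creators depend on z as an inner product with [E z]; through
    [E_total], identities known for [nice1] functions then extend to all z. *)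
Definition linear_in_z y : Prop := forall g, exists u, forall z B, L z -> cre z B -> ip g (B y) = ip u (E z).

Lemma linear_in_z_lc a x y : linear_in_z x -> linear_in_z y -> linear_in_z (a *: x + y).
Proof.
move=> hx hy g; have [u hu] := hx g; have [v hv] := hy g; exists (a^*%C *: u + v) => z B Lz cB.
by rewrite (bop_lin (cre_bounded cB)) (ipDr hH) (ipZr hH) (ipDl hH) (ipZl hH) conjcK (hu _ _ Lz cB) (hv _ _ Lz cB).
Qed.

Lemma linear_in_z_emb n F : nalt n F -> linear_in_z (emb n F).
Proof.
move=> nF g; have [T bT TE] := cre_linear nF; have [T' _ TT'] := adjoint_exists hH bT.
by exists (T' g) => z B Lz cB; rewrite (TE _ _ Lz cB) TT'.
Qed.

Lemma linear_in_z_op w n F : nice1 w -> nalt n F -> linear_in_z (op true w (emb n F)).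
Proof.
move=> nw nF; rewrite (op_emb ca _ nw nF); apply: linear_in_z_lc.
  by apply: linear_in_z_emb; apply: nalt_wedge => //; case: nF.
case: n F nF => [|n] F nF; first by rewrite mulr0 scale0r -(scale0r (emb 0 F)); have := linear_in_z_lc (-1) (linear_in_z_emb nF) (linear_in_z_emb nF); rewrite scaleN1r addNr scale0r.
rewrite -[X in linear_in_z X]addr0; apply: linear_in_z_lc; first exact/linear_in_z_emb/nalt_sl.
by have := linear_in_z_lc (-1) (linear_in_z_emb nF) (linear_in_z_emb nF); rewrite scaleN1r addNr.
Qed.

(** The annihilating part is antilinear in the conjugate of z, hence linear in z; [J] converts its
    coefficient vector. *)
Lemma fieldop_linear g y : linear_in_z g -> linear_in_z y ->
  exists u, forall z B, L z -> fieldop z B -> ip g (B y) = ip u (E z).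
Proof.
move=> lg ly; have [u hu] := ly g; have [v hv] := lg y; exists (u + J v) => z B Lz [B1 [B2 [B2' [c1 c2 _ a ->]]]].
rewrite (ipDr hH) (hu _ _ Lz c1) (ipDl hH) (adjoint_sym hH a); congr (_ + _).
by rewrite (hilbert_sym hH) (hv _ _ (L_conj Lz) c2) (E_conj Lz) -(hilbert_sym hH) -[v in LHS]J_K J_ip.
Qed.

Lemma fieldop_bounded z B : fieldop z B -> bounded_op ip B.
Proof.
move=> [B1 [B2 [B2' [c1 c2 b _ ->]]]]; have := bop_lc hH 1 (cre_bounded c1) b.
by congr (bounded_op _ _); apply/funext => x; rewrite scale1r.
Qed.

(** The coefficients of the commutator with [op true w] are linear in z and vanish for [nice1]
    functions by [op_comm]. *)
Lemma fieldop_commute z B w x : L z -> fieldop z B -> nice1 w -> B (op true w x) = op true w (B x).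
Proof.
move=> Lz fB nw; have bB := fieldop_bounded fB; have bw := op_bounded fm ca true nw.
apply: (emb_ext fm (bop_comp bB bw) (bop_comp bw bB)) => n F nF /=.
apply/eqP; rewrite -subr_eq0; apply/eqP/(fm_separating fm) => m G nG.
have nw' := nice1J nw.
have [u1 h1] := fieldop_linear (linear_in_z_emb nG) (linear_in_z_op nw nF).
have [u2 h2] := fieldop_linear (linear_in_z_op nw' nG) (linear_in_z_emb nF).
rewrite (ipBr hH) (op_adjoint fm ca) // (h1 _ _ Lz fB) (h2 _ _ Lz fB) -(ipBl hH).
apply: E_total Lz => z' nz'; have fz := fieldop_one nz'; have Lz' := L_one nz'.
rewrite (ipBl hH) -(h1 _ _ Lz' fz) -(h2 _ _ Lz' fz) -(op_adjoint fm ca)// (op_comm fm ca)//.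
by rewrite subrr.
Qed.

End field_operators.

(** * Contractions modulo null sets *)

Section contraction_linearity.
Variable R : realType.
Local Notation C := R[i].
Local Notation mu n := (muplus R n).
Local Notation tf n F := (fun t : n.-tuple R => F (tval t) : C).
Implicit Types (F G : seq R -> C).
Variables (a b r : nat).

Lemma sqint_contr F G : sqint (mu (a + r)) (tf (a + r) F) -> sqint (mu (r + b)) (tf (r + b) G) ->
  sqint (mu (a + b)) (tf (a + b) (contr a r F G)).
Proof.
move=> [mF fF] [mG fG]; split; first exact: contr_meas.
apply: le_lt_trans (contr_bound mF mG) _.
by apply: lte_mul_pinfty => //; [exact: sqn_ge0 | rewrite ge0_fin_numE ?sqn_ge0].
Qed.

Lemma contr_null F G : sqint (mu (a + r)) (tf (a + r) F) -> sqint (mu (r + b)) (tf (r + b) G) ->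
  {ae mu (a + r), forall t, F (tval t) = 0} \/ {ae mu (r + b), forall t, G (tval t) = 0} ->
  {ae mu (a + b), forall t, contr a r F G (tval t) = 0}.
Proof.
move=> [mF fF] [mG fG] h; apply: sqn_eq0; first exact: contr_meas.
apply/eqP; rewrite eq_le sqn_ge0 andbT; apply: le_trans (contr_bound mF mG) _.
by case: h => h; [rewrite (sqn_ae0 mF h) mul0e | rewrite (sqn_ae0 mG h) mule0].
Qed.

Lemma contr_lin_l c F F1 F2 G : sqint (mu (a + r)) (tf (a + r) F) ->
  sqint (mu (a + r)) (tf (a + r) F1) -> sqint (mu (a + r)) (tf (a + r) F2) ->
  sqint (mu (r + b)) (tf (r + b) G) ->
  {ae mu (a + r), forall t, F (tval t) = c * F1 (tval t) + F2 (tval t)} ->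
  {ae mu (a + b), forall t, contr a r F G (tval t) = c * contr a r F1 G (tval t) + contr a r F2 G (tval t)}.
Proof.
move=> LF LF1 LF2 LG FE; pose E s := c * F1 s + F2 s.
have LE : sqint (mu (a + r)) (tf (a + r) E) by apply: sqintD => //; exact: sqintZ.
have [mF1 _] := LF1; have [mF2 _] := LF2; have [mG _] := LG.
have h0 := contrB LF LE LG LG.
have h1 : {ae mu (a + b), forall t, contr a r (fun s => F s - E s) G (tval t) = 0}.
  apply: contr_null => //; first exact: (sqintB LF LE).
  by left; move: FE; apply: filterS => t ->; rewrite subrr.
have h2 := contr_integrable mF1 mG LF1 LG; have h3 := contr_integrable mF2 mG LF2 LG.
have h4 : {ae mu (a + b), forall t, contr a r E G (tval t) = c * contr a r F1 G (tval t) + contr a r F2 G (tval t)}.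
  move: h2 h3; apply: filterS2 => t i1 i2; rewrite /contr -cintZ// -cintD//; last exact: cintegrableZ.
  by apply: eq_cint => u; rewrite /E mulrDl mulrA.
move: h0 h1 h4; apply: filterS3 => t e0 e1 <-; apply/eqP; rewrite -subr_eq0 e0 e1 add0r; apply/eqP.
rewrite /contr -[RHS](cint0 (mu r)); apply: eq_cint => u; rewrite subrr mulr0//.
Qed.

Lemma contr_lin_r c F G G1 G2 : sqint (mu (a + r)) (tf (a + r) F) ->
  sqint (mu (r + b)) (tf (r + b) G) -> sqint (mu (r + b)) (tf (r + b) G1) ->
  sqint (mu (r + b)) (tf (r + b) G2) ->
  {ae mu (r + b), forall t, G (tval t) = c * G1 (tval t) + G2 (tval t)} ->
  {ae mu (a + b), forall t, contr a r F G (tval t) = c * contr a r F G1 (tval t) + contr a r F G2 (tval t)}.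
Proof.
move=> LF LG LG1 LG2 GE; pose E s := c * G1 s + G2 s.
have LE : sqint (mu (r + b)) (tf (r + b) E) by apply: sqintD => //; exact: sqintZ.
have [mG1 _] := LG1; have [mG2 _] := LG2; have [mF _] := LF.
have h0 := contrB LF LF LG LE.
have h1 : {ae mu (a + b), forall t, contr a r F (fun s => G s - E s) (tval t) = 0}.
  apply: contr_null => //; first exact: (sqintB LG LE).
  by right; move: GE; apply: filterS => t ->; rewrite subrr.
have h2 := contr_integrable mF mG1 LF LG1; have h3 := contr_integrable mF mG2 LF LG2.
have h4 : {ae mu (a + b), forall t, contr a r F E (tval t) = c * contr a r F G1 (tval t) + contr a r F G2 (tval t)}.
  move: h2 h3; apply: filterS2 => t i1 i2; rewrite /contr -cintZ// -cintD//; last exact: cintegrableZ.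
  by apply: eq_cint => u; rewrite /E mulrDr mulrCA.
move: h0 h1 h4; apply: filterS3 => t e0 e1 <-; apply/eqP; rewrite -subr_eq0 e0 e1 addr0; apply/eqP.
rewrite /contr -[RHS](cint0 (mu r)); apply: eq_cint => u; rewrite subrr mul0r//.
Qed.

Lemma contr_ae F F' G G' : sqint (mu (a + r)) (tf (a + r) F) -> sqint (mu (a + r)) (tf (a + r) F') ->
  sqint (mu (r + b)) (tf (r + b) G) -> sqint (mu (r + b)) (tf (r + b) G') ->
  {ae mu (a + r), forall t, F (tval t) = F' (tval t)} ->
  {ae mu (r + b), forall t, G (tval t) = G' (tval t)} ->
  {ae mu (a + b), forall t, contr a r F G (tval t) = contr a r F' G' (tval t)}.
Proof.
move=> LF LF' LG LG' FF GG.
have e1 : {ae mu (a + b), forall t, contr a r F G (tval t) = 0 * contr a r F' G (tval t) + contr a r F' G (tval t)}.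
  by apply: contr_lin_l => //; move: FF; apply: filterS => t ->; rewrite mul0r add0r.
have e2 : {ae mu (a + b), forall t, contr a r F' G (tval t) = 0 * contr a r F' G' (tval t) + contr a r F' G' (tval t)}.
  by apply: contr_lin_r => //; move: GG; apply: filterS => t ->; rewrite mul0r add0r.
by move: e1 e2; apply: filterS2 => t -> ->; rewrite !mul0r !add0r.
Qed.

End contraction_linearity.

(** * The modular conjugation *)

Section fock_conjugation.
Variable R : realType.
Local Notation C := R[i].
Local Notation mu n := (muplus R n).
Local Notation H := (fock R).
Local Notation ip := (@fock_ip R).
Local Notation family := ({n : nat & n.-tuple R} -> C).
Local Notation cp x n := (@component R (prefock_val x) n).
Implicit Types (u v : H) (x y : prefock R).

(** The sign is that of reversing n variables: the adjoint of a product reverses its factors. *)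
Definition conj_family (x : family) : family := fun t => (-1) ^+ 'C(tag t, 2) * (x t)^*%C.

Lemma normsq_sign n (c : C) : normsq ((-1) ^+ n * c) = normsq c.
Proof.
rewrite normsqM -signr_odd; case: (odd n); rewrite ?expr1 ?expr0 ?normsqN.
all: by rewrite (_ : normsq (1 : C) = 1) ?mul1r// /normsq /= expr1n expr0n addr0.
Qed.

Lemma Lambda_conj n c (f : n.-tuple R -> C) : Lambda f -> Lambda (fun t => (-1) ^+ c * (f t)^*%C).
Proof.
move=> [Lf af]; have [m1 m2 ff] := Lf.
have [m3 m4] : cmeas (fun t => (-1) ^+ c * (f t)^*%C) by apply/cmeasZ/cmeasJ.
split.
  split=> //; rewrite (_ : L2norm2 _ = L2norm2 f)//.
  by apply: eq_integral => t _; rewrite normsq_sign normsqJ.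
by move=> s; move: (af s); apply: filterS => t ->; rewrite conjcM conjc_sign mulrCA.
Qed.

Lemma conj_in_fock x : conj_family x \in @fock_pred R.
Proof.
have [Lx sx] := prefockP x; apply/asboolP; split=> [n|].
  exact: (Lambda_conj 'C(n, 2) (Lx n)).
move: sx; congr (_ < _)%E; apply: eq_eseriesr => n _; congr (_ * _)%E; apply: eq_integral => t _.
by rewrite /component normsq_sign normsqJ.
Qed.

Definition preJ x : prefock R := Prefock (conj_in_fock x).

Definition fock_J u : H := to_fock (preJ (fock_rep u)).

Lemma preJE x n t : cp (preJ x) n t = (-1) ^+ 'C(n, 2) * (cp x n t)^*%C.
Proof. by []. Qed.

Lemma fock_JE x : fock_J (to_fock x) = to_fock (preJ x).
Proof.
apply/to_fock_eq => n; have /to_fock_eq/(_ n) : to_fock (fock_rep (to_fock x)) = to_fock x by rewrite fock_repK.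
by apply: filterS => t; rewrite !preJE => ->.
Qed.

Lemma sign_mulK n (c : C) : (-1) ^+ n * ((-1) ^+ n * c) = c.
Proof. by rewrite mulrA (sg_sq R true) mul1r. Qed.

Lemma fock_JK u : fock_J (fock_J u) = u.
Proof.
have [x ->] := to_fock_rep u; rewrite !fock_JE; apply/to_fock_eq => n; apply: nearW => t.
by rewrite !preJE conjcM conjcK (sg_conj R true) sign_mulK.
Qed.

Lemma fock_J_lc a u v : fock_J (a *: u + v) = a^*%C *: fock_J u + fock_J v.
Proof.
have [x ->] := to_fock_rep u; have [y ->] := to_fock_rep v.
rewrite to_fock_lc !fock_JE to_fock_lc; apply/to_fock_eq => n; apply: nearW => t.
rewrite -[cp (a^*%C *: preJ x + preJ y) n t]/(a^*%C * cp (preJ x) n t + cp (preJ y) n t) !preJE.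
rewrite -[cp (a *: x + y) n t]/(a * cp x n t + cp y n t) conjcD conjcM mulrDr mulrCA//.
Qed.

Lemma fock_J_ip u v : ip (fock_J u) (fock_J v) = ip v u.
Proof.
have [x ->] := to_fock_rep u; have [y ->] := to_fock_rep v.
rewrite !fock_JE !fock_ipE; apply: csum_unique (fip_csum _ _) _.
rewrite (_ : fterm (preJ x) (preJ y) = fterm y x); first exact: fip_csum.
apply/funext => n; congr (_ * _); apply: eq_cint => t; rewrite !preJE conjcM conjcK (sg_conj R true).
by rewrite mulrACA (sg_sq R true) mul1r mulrC.
Qed.

Lemma fock_J_embed n (f : n.-tuple R -> C) : Lambda f ->
  fock_J (embed f) = (-1) ^+ 'C(n, 2) *: embed (fun t => (f t)^*%C).
Proof.
move=> Lf; have Lf' : Lambda (fun t => (f t)^*%C).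
  by have := Lambda_conj 0 Lf; under [X in Lambda X]eq_fun do rewrite expr0 mul1r.
have [x [-> xE]] := embedE Lf; have [y [-> yE]] := embedE Lf'.
have -> : (-1) ^+ 'C(n, 2) *: to_fock y = to_fock ((-1) ^+ 'C(n, 2) *: y + 0).
  by rewrite -to_fock_lc to_fock0 addr0.
rewrite fock_JE; apply/to_fock_eq => k; apply: nearW.
have E t : cp ((-1) ^+ 'C(n, 2) *: y + 0) k t = (-1) ^+ 'C(n, 2) * component (single (fun t => (f t)^*%C)) k t.
  by rewrite -yE -[LHS]/((-1) ^+ 'C(n, 2) * cp y k t + 0) addr0.
have [kn|kn] := eqVneq k n; last by move=> t; rewrite E preJE xE !single_other// conjc0 !mulr0.
by rewrite kn in E * => t; rewrite E preJE xE !single_same.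
Qed.

End fock_conjugation.

Section bounded_operator_criteria.
Variables (R : realType) (H : lmodType R[i]) (ip : H -> H -> R[i]).
Hypothesis hH : hilbert ip.
Implicit Types (u v : H).

Lemma bounded_of_nsq (A : H -> H) (K : R) : 0 <= K -> (forall u, nsq ip (A u) <= K * nsq ip u) ->
  (forall c u v, A (c *: u + v) = c *: A u + A v) -> bounded_op ip A.
Proof.
move=> K0 hK lA; split=> //; exists (Num.sqrt K) => u.
rewrite -(@ler_sqr _ (hnorm ip _)) ?nnegrE ?mulr_ge0 ?nrm_ge0 ?sqrtr_ge0// exprMn !(nrmE hH).
by rewrite [X in X * _]sqr_sqrtr.
Qed.

Lemma bounded_sum n (c : nat -> R[i]) (A : nat -> H -> H) :
  (forall k, (k < n)%N -> bounded_op ip (A k)) -> bounded_op ip (fun u => \sum_(k < n) c k *: A k u).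
Proof.
elim: n => [_|n IH bA].
  have := bop_lc hH (-1) (bop_id ip) (bop_id ip); congr (bounded_op _ _).
  by apply/funext => u; rewrite scaleN1r addNr big_ord0.
have := bop_lc hH (c n) (bA n (ltnSn n)) (IH (fun k kn => bA k (ltnW kn))); congr (bounded_op _ _).
by apply/funext => u; rewrite big_ord_recr addrC.
Qed.

Lemma bounded_agree (D : set H) (A B : H -> H) x : bounded_op ip A -> bounded_op ip B ->
  (forall u, (forall d, D d -> ip d u = 0) -> ip x u = 0) ->
  (forall d, D d -> A d = B d) -> A x = B x.
Proof.
move=> bA bB Dx AB; have [A' _ AA'] := adjoint_exists hH bA; have [B' _ BB'] := adjoint_exists hH bB.
apply: (ip_ext hH) => g; rewrite AA' BB' (hilbert_sym hH) [RHS](hilbert_sym hH); congr (_^*%C).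
apply/eqP; rewrite -subr_eq0 -(ipBr hH); apply/eqP/Dx => d Dd.
by rewrite (ipBr hH) (adjoint_sym hH AA') (adjoint_sym hH BB') AB// subrr.
Qed.

Lemma adjoint_commute (A A' B B' : H -> H) : is_adjoint ip A A' -> is_adjoint ip B B' ->
  (forall x, A (B x) = B (A x)) -> forall x, A' (B' x) = B' (A' x).
Proof.
move=> aA aB AB x; have aA' := adjoint_sym hH aA; have aB' := adjoint_sym hH aB.
by apply: (ip_ext hH) => g; rewrite aA' aB' aB' aA' AB.
Qed.

End bounded_operator_criteria.

(** * The product as a bounded bilinear operation on the Fock space *)

Section contraction_operators.
Variable R : realType.
Local Notation C := R[i].
Local Notation mu n := (muplus R n).
Local Notation H := (fock R).
Local Notation ip := (@fock_ip R).
Local Notation nrm := (hnorm ip).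
Local Notation nsq := (nsq ip).
Local Notation tf n F := (fun t : n.-tuple R => F (tval t) : C).
Local Notation cp x n := (@component R (prefock_val x) n).
Implicit Types (F G : seq R -> C) (u v : H) (x y : prefock R).

Let hH : hilbert ip := hilbert_fock R.

Definition on_seq n (f : n.-tuple R -> C) : seq R -> C := fun s => f (tuple_of_seq n s).

Lemma on_seqE n (f : n.-tuple R -> C) : tf n (on_seq f) = f.
Proof. by apply/funext => t; rewrite /on_seq tuple_of_seq_id. Qed.

(** Taken from a representative chosen once per vector, so it is linear in [u] only almost
    everywhere. *)
Definition cmp n u : seq R -> C := on_seq (cp (fock_rep u) n).

Lemma cmp_sqint n u : sqint (mu n) (tf n (cmp n u)).
Proof. by rewrite on_seqE; exact: cp_sqint. Qed.

Lemma cmp_lc n a u v :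
  {ae mu n, forall t, cmp n (a *: u + v) (tval t) = a * cmp n u (tval t) + cmp n v (tval t)}.
Proof.
have : to_fock (fock_rep (a *: u + v)) = to_fock (a *: fock_rep u + fock_rep v).
  by rewrite fock_repK -to_fock_lc !fock_repK.
by move=> /to_fock_eq/(_ n); apply: filterS => t; rewrite /cmp /on_seq !tuple_of_seq_id => ->.
Qed.

Lemma cmp_embed n (f : n.-tuple R -> C) : Lambda f ->
  {ae mu n, forall t, cmp n (embed f) (tval t) = f t}.
Proof.
move=> Lf; have [x [e xE]] := embedE Lf.
have : to_fock (fock_rep (embed f)) = to_fock x by rewrite fock_repK.
move=> /to_fock_eq/(_ n); apply: filterS => t; rewrite /cmp /on_seq tuple_of_seq_id => ->.
by rewrite xE single_same.
Qed.

Lemma sqn_cmp n u : fine (sqn (mu n) (tf n (cmp n u))) <= nsq u.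
Proof.
rewrite on_seqE -(nrmE hH) -{2}[u]fock_repK; apply: le_trans (fnorm_le_nsq _ n).
by rewrite /fnorm ler_peMl ?ler1n ?fact_gt0// fine_ge0// sqn_ge0.
Qed.

Definition cop n a r p q u v : H := emb n (acontr n a r (cmp p u) (cmp q v)).

Section fixed_degrees.
Variables (n a b r p q : nat).
Hypotheses (nE : n = (a + b)%N) (pE : p = (a + r)%N) (qE : q = (r + b)%N).
Local Notation cop := (cop n a r p q).

Let L u v : sqint (mu n) (tf n (contr a r (cmp p u) (cmp q v))).
Proof. by rewrite nE; apply: sqint_contr; rewrite -?pE -?qE; exact: cmp_sqint. Qed.

Lemma cop_nsq : exists2 K : R, 0 <= K & forall u v, nsq (cop u v) <= K * (nsq u * nsq v).
Proof.
have [K K0 hK] := nsq_emb_asym R n; exists K => // u v.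
have Lu := cmp_sqint p u; have Lv := cmp_sqint q v.
apply: le_trans (hK _ (L u v)) _; rewrite ler_wpM2l//.
apply: (@le_trans _ _ (fine (sqn (mu p) (tf p (cmp p u))) * fine (sqn (mu q) (tf q (cmp q v))))).
  rewrite -lee_fin EFinM !fineK; [|exact: sqint_fin..].
  move: (L u v) Lu Lv => _ []; move: (cmp p u) (cmp q v) => F G.
  by rewrite nE pE qE => mF _ [mG _]; exact: contr_bound.
by apply: ler_pM; rewrite ?fine_ge0 ?sqn_ge0// sqn_cmp.
Qed.

Lemma cop_lin_l c u u' v : cop (c *: u + u') v = c *: cop u v + cop u' v.
Proof.
apply: emb_asym_lc; try exact: L.
have := cmp_lc p c u u'; have := cmp_sqint p (c *: u + u').
move: (cmp_sqint p u) (cmp_sqint p u') (cmp_sqint q v).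
move: (cmp p u) (cmp p u') (cmp p _) (cmp q v) => F1 F2 F G.
by rewrite nE pE qE => *; exact: contr_lin_l.
Qed.

Lemma cop_lin_r c u v v' : cop u (c *: v + v') = c *: cop u v + cop u v'.
Proof.
apply: emb_asym_lc; try exact: L.
have := cmp_lc q c v v'; have := cmp_sqint q (c *: v + v').
move: (cmp_sqint q v) (cmp_sqint q v') (cmp_sqint p u).
move: (cmp q v) (cmp q v') (cmp q _) (cmp p u) => G1 G2 G F.
by rewrite nE pE qE => *; exact: contr_lin_r.
Qed.

Lemma cop_bounded_l v : bounded_op ip (cop^~ v).
Proof.
have [K K0 hK] := cop_nsq; apply: (bounded_of_nsq hH (K := K * nsq v)).
- by rewrite mulr_ge0// nsq_ge0.
- by move=> u; rewrite -mulrA [nsq v * _]mulrC; exact: hK.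
- by move=> c u u'; exact: cop_lin_l.
Qed.

Lemma cop_bounded_r u : bounded_op ip (cop u).
Proof.
have [K K0 hK] := cop_nsq; apply: (bounded_of_nsq hH (K := K * nsq u)).
- by rewrite mulr_ge0// nsq_ge0.
- by move=> v; rewrite -mulrA; exact: hK.
- by move=> c v v'; exact: cop_lin_r.
Qed.

Lemma cop_embed (f : p.-tuple R -> C) (g : q.-tuple R -> C) : Lambda f -> Lambda g ->
  Lambda (tf n (acontr n a r (on_seq f) (on_seq g))) /\
  cop (embed f) (embed g) = emb n (acontr n a r (on_seq f) (on_seq g)).
Proof.
move=> Lf Lg.
have Lf' : sqint (mu p) (tf p (on_seq f)) by rewrite on_seqE; case: Lf => -[].
have Lg' : sqint (mu q) (tf q (on_seq g)) by rewrite on_seqE; case: Lg => -[].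
have L' : sqint (mu n) (tf n (contr a r (on_seq f) (on_seq g))).
  by rewrite nE; apply: sqint_contr; rewrite -?pE -?qE.
split; first exact: Lambda_asym.
rewrite /cop /emb; refine (embed_ae (Lambda_asym (L _ _)) (Lambda_asym L') _); apply: asym_ae.
have ef : {ae mu p, forall t, cmp p (embed f) (tval t) = on_seq f (tval t)}.
  by move: (cmp_embed Lf); apply: filterS => t ->; rewrite /on_seq tuple_of_seq_id.
have eg : {ae mu q, forall t, cmp q (embed g) (tval t) = on_seq g (tval t)}.
  by move: (cmp_embed Lg); apply: filterS => t ->; rewrite /on_seq tuple_of_seq_id.
move: (cmp_sqint p (embed f)) (cmp_sqint q (embed g)) Lf' Lg' ef eg.
move: (cmp p _) (cmp q _) (on_seq f) (on_seq g) => F' G' F G.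
by rewrite nE pE qE => *; exact: contr_ae.
Qed.

End fixed_degrees.

Definition prod_op p q u v : H :=
  \sum_(r < (minn p q).+1) coef R p q r *: cop (p + q - r.*2) (p - r) r p q u v.

Lemma prod_op_bounded_l p q v : bounded_op ip (prod_op p q ^~ v).
Proof.
apply: (bounded_sum hH (fun r => coef R p q r) (A := fun r u => cop (p + q - r.*2) (p - r) r p q u v)) => r rm.
by apply: (cop_bounded_l (b := q - r)); rewrite -?addnn; lia.
Qed.

Lemma prod_op_bounded_r p q u : bounded_op ip (prod_op p q u).
Proof.
apply: (bounded_sum hH (fun r => coef R p q r) (A := fun r v => cop (p + q - r.*2) (p - r) r p q u v)) => r rm.
by apply: (cop_bounded_r (b := q - r)); rewrite -?addnn; lia.
Qed.

Lemma prod_op_emb p q F G : nalt p F -> nalt q G ->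
  prod_op p q (emb p F) (emb q G) = Phi (@emb R) p q F G.
Proof.
move=> nF nG.
have E r : (r < (minn p q).+1)%N -> cop (p + q - r.*2) (p - r) r p q (emb p F) (emb q G) =
    emb (p + q - r.*2) (acontr (p + q - r.*2) (p - r) r F G).
  move=> rm.
  have nE : (p + q - r.*2)%N = (p - r + (q - r))%N by rewrite -addnn; lia.
  have pE : p = (p - r + r)%N by lia.
  have qE : q = (r + (q - r))%N by lia.
  have [_ ->] := cop_embed nE pE qE (nalt_Lambda nF) (nalt_Lambda nG).
  apply: (fm_eq (fock_modelP R)) => t st; apply: (eq_acontr nE) => s.
    by rewrite -pE => ss; rewrite /on_seq tuple_of_seqK.
  by rewrite -qE => ss; rewrite /on_seq tuple_of_seqK.
rewrite /prod_op /Phi; apply: eq_bigr => r _; rewrite E//; exact: ltn_ord.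
Qed.

End contraction_operators.

Section clifford_algebra.
Variable R : realType.
Local Notation C := R[i].
Local Notation mu n := (muplus R n).
Local Notation H := (fock R).
Local Notation ip := (@fock_ip R).
Local Notation tf n F := (fun t : n.-tuple R => F (tval t) : C).
Implicit Types (F G : seq R -> C) (u v : H).

Let hH : hilbert ip := hilbert_fock R.
Let fm := fock_modelP R.

Definition one_particle (z : R -> C) : 1.-tuple R -> C := fun t => z (head 0 t).
Definition conj1 (z : 1.-tuple R -> C) : 1.-tuple R -> C := fun t => (z t)^*%C.

Lemma L2_one_particle z : nice1 z -> L2 (one_particle z).
Proof. by move=> /nice1_nice/nice_sqint[[m1 m2] f]; split. Qed.

Lemma L2_conj1 z : L2 z -> L2 (conj1 z).
Proof.
move=> [m1 m2 f]; have [[m3 m4] f'] : sqint (mu 1) (conj1 z) by exact: normsqJ_sqint.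
by split.
Qed.

Lemma Lambda1 (z : 1.-tuple R -> C) : L2 z -> Lambda z.
Proof.
move=> Lz; split=> // s; apply: nearW => t; have -> : s = 1%g by apply/permP => i; rewrite !ord1.
rewrite odd_perm1 mul1r; congr z; apply: eq_from_tnth => i.
by rewrite tnth_mktuple perm1.
Qed.

Lemma embed_conj1 z : L2 z -> embed (conj1 z) = fock_J (embed z).
Proof. by move=> /Lambda1/fock_J_embed ->; rewrite expr0 scale1r. Qed.

Lemma embed_in_degree n (f : n.-tuple R -> C) u : Lambda f ->
  (forall F, nalt n F -> ip (emb n F) u = 0) -> ip (embed f) u = 0.
Proof.
move=> Lf h; have -> : embed f = emb n (on_seq f) by rewrite /emb on_seqE.
apply: wedges_ip0; last by rewrite on_seqE.
by move=> zs zn nzs; have nw := wedges_nalt nzs; rewrite zn in nw; exact: (h _ nw).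
Qed.

Lemma emb_wedge1 z : emb 1 (wedge 0 z (fun=> 1)) = embed (one_particle z).
Proof.
congr embed; apply/funext => t; rewrite /wedge alt_asym ?size_tuple//.
  by rewrite /one_particle; case: (tval t) (size_tuple t) => [|x s] //= _; rewrite mulr1.
move=> s t'; have -> : s = 1%g by apply/permP => i; rewrite !ord1.
rewrite odd_perm1 mul1r; congr (ten _ _ (tval _)); apply: eq_from_tnth => i.
by rewrite tnth_mktuple perm1.
Qed.

(** In degree 1 a wedge has a single factor, so totality of wedges is density of [nice1]
    functions. *)
Lemma one_particle_total u : (forall z : R -> C, nice1 z -> ip u (embed (one_particle z)) = 0) ->
  forall z : 1.-tuple R -> C, L2 z -> ip u (embed z) = 0.
Proof.
move=> h z Lz; rewrite (hilbert_sym hH) (_ : ip (embed z) u = 0) ?conjc0//.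
have -> : embed z = emb 1 (on_seq z) by rewrite /emb on_seqE.
apply: wedges_ip0; last by rewrite on_seqE; exact: Lambda1.
move=> [|z' [|? ?]]// _ [nz' _].
by rewrite (hilbert_sym hH) [emb 1 _]emb_wedge1 h// conjc0.
Qed.

Lemma emb_tensor n (z : 1.-tuple R -> C) (w : n.-tuple R -> C) :
  embed (antisymmetrize (tensor z w)) = emb n.+1 (acontr n.+1 1 0 (on_seq z) (on_seq w)).
Proof.
congr embed; apply/funext => t; rewrite /acontr (asym_antisymmetrize (n := n.+1)).
by congr (antisymmetrize _ t); apply/funext => s; rewrite contr0.
Qed.

Lemma tensor_embed n (z : 1.-tuple R -> C) (w : n.-tuple R -> C) : L2 z -> Lambda w ->
  embed (antisymmetrize (tensor z w)) = cop n.+1 1 0 1 n (embed z) (embed w).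
Proof.
move=> Lz Lw; rewrite emb_tensor.
by have [_ ->] := cop_embed (b := n) (n := n.+1) (a := 1) (r := 0) erefl erefl erefl (Lambda1 Lz) Lw.
Qed.

Lemma emb_tensor_seq n z F : embed (antisymmetrize (tensor (one_particle z) (tf n F))) = emb n.+1 (wedge n z F).
Proof.
rewrite emb_tensor; apply: (fm_eq fm) => t _; apply: eq_asym => -[//|x s] /= [ss].
by rewrite contr0 /= drop0 take0 /on_seq /one_particle !tuple_of_seqK.
Qed.

(** Creation is a contraction of order 0, and this is bounded in its first argument too. *)
Lemma creation_linear n F : nalt n F -> exists2 T, bounded_op ip T &
  forall (z : 1.-tuple R -> C) B, L2 z -> creation z B -> B (emb n F) = T (embed z).
Proof.
move=> nF; exists (fun u => cop n.+1 1 0 1 n u (emb n F)).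
  exact: (@cop_bounded_l _ n.+1 1 n 0 1 n).
by move=> z B Lz [_ h]; rewrite /emb (h _ _ (nalt_Lambda nF)) tensor_embed//; exact: nalt_Lambda.
Qed.

Variables cr an : bool -> (R -> C) -> H -> H.
Hypothesis ca : creation_family ip (@emb R) cr an.

(** [cr] is specified on [nice] functions only; in degree n it agrees there with the bounded
    operator [T], hence on all of [Lambda]. *)
Lemma creation_cr z : nice1 z -> creation (one_particle z) (cr false z).
Proof.
move=> nz; have [bA _ _ crE _] := ca false nz; split=> // n f Lf.
have Lz := L2_one_particle nz; rewrite tensor_embed//.
set T := cop n.+1 1 0 1 n (embed (one_particle z)).
have bT : bounded_op ip T by exact: (@cop_bounded_r _ n.+1 1 n 0 1 n).
apply: (bounded_agree hH (D := [set d | exists2 F, nalt n F & d = emb n F]) bA bT) => [u h|_ [F nF ->]].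
  by apply: embed_in_degree => // F nF; apply: h; exists F.
rewrite (crE _ _ nF) scale1r /T; have e := tensor_embed Lz (nalt_Lambda nF).
rewrite -emb_tensor_seq; exact: e.
Qed.

Local Notation S0 := [set B | exists2 z : 1.-tuple R -> C, L2 z & field_op z B].
Local Notation S := (S0 `|` [set A' | bounded_op ip A' /\ exists2 A, S0 A & is_adjoint ip A A']).
Local Notation J := (@fock_J R).
Local Notation op := (op cr an).

Lemma J_emb n F : nalt n F -> J (emb n F) = (-1) ^+ 'C(n, 2) *: emb n (conjf F).
Proof. by move=> /nalt_Lambda; exact: fock_J_embed. Qed.

Lemma field_op_commute z B w x : L2 z -> field_op z B -> nice1 w -> B (op true w x) = op true w (B x).
Proof.
exact: (fieldop_commute fm ca (@fock_J_ip R) (@fock_JK R) (L := @L2 R 1) (conjZ := conj1) (one := one_particle)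
  (E := @embed R 1) (cre := @creation R) L2_one_particle L2_conj1 (fun=> erefl) embed_conj1 one_particle_total
  (fun z B => @proj1 _ _) creation_linear creation_cr).
Qed.

Lemma field_op_bounded z B : field_op z B -> bounded_op ip B.
Proof. exact: (fieldop_bounded fm (conjZ := conj1) (cre := @creation R) (fun z B => @proj1 _ _)). Qed.

Lemma S_op z : nice1 z -> S (op false z).
Proof.
move=> nz; left; exists (one_particle z); first exact: L2_one_particle.
exact: (fieldop_one ca (conjZ := conj1) (one := one_particle) (cre := @creation R) (fun=> erefl) creation_cr nz).
Qed.

Lemma S_bounded A : S A -> bounded_op ip A.
Proof. by case=> [[z _ /field_op_bounded]|[]]. Qed.

Lemma S_adjoint A : S A -> exists2 A', S A' & is_adjoint ip A A'.
Proof.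
case=> [SA|[bA [A' SA' aA]]]; last by exists A'; [left | exact: (adjoint_sym hH aA)].
have [A' bA' aA] := adjoint_exists hH (S_bounded (or_introl SA)).
by exists A' => //; right; split=> //; exists A.
Qed.

Lemma S_commute A w x : S A -> nice1 w -> A (op true w x) = op true w (A x).
Proof.
move=> SA nw; case: SA => [[z Lz fA]|[bA [A' [z Lz fA] aA]]]; first exact: field_op_commute fA nw.
have nw' := nice1J nw; have aw := op_adjoint fm ca true nw'; rewrite conjfK in aw.
exact: (adjoint_commute hH aA aw (fun x => field_op_commute x Lz fA nw')).
Qed.

Lemma clifford_standard : standard_form ip (@clifford R) (commutant ip S) (vacuum R) J.
Proof.
exact: (clifford_standard_form fm ca (@fock_J_lc R) (@fock_J_ip R) (@fock_JK R) J_emb S_bounded S_adjoint S_commute S_op).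
Qed.

Lemma clifford_product p q u v : in_degree ip (@emb R) p u -> in_degree ip (@emb R) q v ->
  left_mul ip (commutant ip S) (vacuum R) J u (v, prod_op p q u v).
Proof.
apply: (product_left_mul fm ca clifford_standard (@fock_J_lc R) (@fock_J_ip R) J_emb _
  (@prod_op_emb R) (@prod_op_bounded_l R) (@prod_op_bounded_r R)).
move=> w z x Nw nz; have := commutantE Nw (S_op nz) x; exact: esym.
Qed.

(** By [L2_imageP] exactly one operator has image [embed f], so the choice made by [xget] is
    forced. *)
Lemma chaosE n (f : n.-tuple R -> C) : chaos f = left_mul ip (commutant ip S) (vacuum R) J (embed f).
Proof.
have P T := L2_imageP hH clifford_standard T (embed f).
rewrite /chaos; apply: xget_unique => [|T /P //]; exact/P.
Qed.

Lemma hat_contraction_emb p q r (f : p.-tuple R -> C) (g : q.-tuple R -> C) : (r <= minn p q)%N ->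
  Lambda f -> Lambda g -> Lambda (hat_contraction r f g) /\
  cop (p + q - r.*2) (p - r) r p q (embed f) (embed g) = embed (hat_contraction r f g).
Proof.
move=> rm Lf Lg.
have nE : (p + q - r.*2)%N = (p - r + (q - r))%N by rewrite -addnn; lia.
have pE : p = (p - r + r)%N by lia.
have qE : q = (r + (q - r))%N by lia.
have [Lh e] := cop_embed nE pE qE Lf Lg.
have hE : hat_contraction r f g = tf (p + q - r.*2)%N (acontr (p + q - r.*2) (p - r) r (on_seq f) (on_seq g)).
  by apply/funext => t; rewrite /acontr asym_antisymmetrize.
split; first exact: (eq_ind_r (fun h => Lambda h) Lh hE).
exact: (etrans e (congr1 (@embed R _) (esym hE))).
Qed.

Lemma scaled_chaos_sum p q (f : p.-tuple R -> C) (g : q.-tuple R -> C) : Lambda f -> Lambda g ->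
  \big[@clifford_add R/@clifford_zero R]_(r < (minn p q).+1)
    graph_scale (r`! * 'C(p, r) * 'C(q, r))%N%:R (chaos (hat_contraction r f g)) =
  left_mul ip (commutant ip S) (vacuum R) J (prod_op p q (embed f) (embed g)).
Proof.
move=> Lf Lg; rewrite /prod_op; elim/big_rec2: _ => [|r T h _ ->].
  exact: (graph_zero_left_mul hH clifford_standard).
have rm : (r <= minn p q)%N by rewrite -ltnS.
have [_ ->] := hat_contraction_emb rm Lf Lg.
(* The coefficient is nonzero because r is at most p and q. *)
rewrite chaosE (graph_scale_left_mul hH clifford_standard); last first.
  by move: rm; rewrite leq_min pnatr_eq0 -lt0n !muln_gt0 fact_gt0 !bin_gt0.
exact: (strong_add_left_mul hH clifford_standard).
Qed.

Lemma in_degree_embed n (f : n.-tuple R -> C) : Lambda f -> in_degree ip (@emb R) n (embed f).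
Proof. by move=> Lf u; exact: embed_in_degree. Qed.

Lemma in_degree_J n (f : n.-tuple R -> C) : Lambda f -> in_degree ip (@emb R) n (J (embed f)).
Proof.
move=> Lf u h; rewrite fock_J_embed// (ipZl hH) embed_in_degree ?mulr0//.
by have := Lambda_conj 0 Lf; under [X in Lambda X]eq_fun do rewrite expr0 mul1r.
Qed.

(** The witness for the densely defined adjoint is the product of J g by J f, again given by
    [prod_op]. *)
Lemma chaos_product p q (f : p.-tuple R -> C) (g : q.-tuple R -> C) : Lambda f -> Lambda g ->
  clifford_mul (chaos f) (chaos g) =
  left_mul ip (commutant ip S) (vacuum R) J (prod_op p q (embed f) (embed g)).
Proof.
move=> Lf Lg; rewrite !chaosE.
have df := in_degree_embed Lf; have dg := in_degree_embed Lg.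
apply: (strong_mul_left_mul hH clifford_standard (clifford_product df dg)).
exact: clifford_product (in_degree_J Lg) (in_degree_J Lf).
Qed.

End clifford_algebra.

Theorem proposition4p1 (R : realType) (p q : nat)
    (f : p.-tuple R -> R[i]) (g : q.-tuple R -> R[i])
    (hf : Lambda f) (hg : Lambda g) :
  (forall r : nat, (r <= minn p q)%N -> Lambda (hat_contraction r f g)) /\
  clifford_mul (chaos f) (chaos g) =
  \big[@clifford_add R/@clifford_zero R]_(r < (minn p q).+1)
    graph_scale (r`! * 'C(p, r) * 'C(q, r))%N%:R
      (chaos (hat_contraction r f g)).
Proof.
have [cr [an ca]] := creation_family_exists (fock_modelP R); split.
  by move=> r rm; have [] := hat_contraction_emb rm hf hg.
by rewrite (chaos_product ca hf hg) (scaled_chaos_sum ca hf hg).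
Qed.
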